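(* $W_2^{\mathrm{in}}$ is a distance on $P_{n,d}$, and the metric space $(P_{n,d},W_2^{\mathrm{in}})$ is complete and geodesic: for any $p_0,p_1\in P_{n,d}$ there exists an admissible curve $\gamma$ from $p_0$ to $p_1$ with $W_2^{\mathrm{in}}(\gamma(s),\gamma(t))=|t-s|\,W_2^{\mathrm{in}}(p_0,p_1)$ for all $s,t\in[0,1]$.
   Context: $P_{n,d}$ is the projectivized space of complex homogeneous polynomials of degree $d$ in $n+1$ variables. $\mu:P_{n,d}\to\mathscr{P}(\mathbb{C}\mathrm{P}^n)$ is given by $\int f\,\mathrm{d}\mu(p)=\frac1d\int_{\mathbb{G}(1,n)}\sum_{z\in Z(p)\cap\ell}m_z(p|_\ell)f(z)\,\mathrm{vol}_{\mathbb{G}(1,n)}(\mathrm{d}\ell)$ ($\mathbb{G}(1,n)$ the Grassmannian of lines with $U(n+1)$-invariant probability measure, $m_z(p|_\ell)$ the multiplicity of $z$ as a zero of $p|_\ell$). $W_2$ is the quadratic Wasserstein distance on $\mathscr{P}(\mathbb{C}\mathrm{P}^n)$ with Fubini–Study cost. $AC^2$ curves: there is $m\in L^2$ with $W_2(\mu_s,\mu_t)\le\int_s^tm$; metric speed $|\dot\mu_t|=\lim_{h\to0}W_2(\mu_{t+h},\mu_t)/|h|$. A curve $\gamma:[0,1]\to P_{n,d}$ is admissible if $t\mapsto\mu(\gamma(t))$ is in $AC^2([0,1];(\mathscr{P}(\mathbb{C}\mathrm{P}^n),W_2))$, with energy $\mathcal{E}(\gamma)=\int_0^1|\dot\mu_t|^2\mathrm{d}t$;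 $W_2^{\mathrm{in}}(p_0,p_1)=\inf\{\mathcal E(\gamma)^{1/2}:\gamma \text{ admissible},\gamma(0)=p_0,\gamma(1)=p_1\}$. *)

(* Defs.v *)
From HB Require Import structures.
From mathcomp Require Import all_boot all_order all_algebra.
(* mpoly must be imported before mathcomp-analysis (notation levels) *)
From mathcomp Require Import mpoly.
From mathcomp Require Import all_classical all_reals all_analysis.
From mathcomp Require Import complex.
Set Implicit Arguments. Unset Strict Implicit. Unset Printing Implicit Defensive.
Import Order.TTheory GRing.Theory Num.Theory.
Import numFieldNormedType.Exports.
Local Open Scope classical_set_scope.
Local Open Scope ring_scope.

Definition Vec (R : realType) (n : nat) := 'cV[R[i]]_(n.+1).
Definition Mat (R : realType) (n : nat) := 'M[R[i]]_(n.+1).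

Definition adj (R : realType) (m k : nat) (A : 'M[R[i]]_(m, k)) : 'M[R[i]]_(k, m) :=
  (map_mx (@conjc R) A)^T.

(* Points of CP^n are modelled as rank-one orthogonal projectors
   (the line C u <-> u u^H / |u|^2); lines of CP^n (points of G(1,n))
   as rank-two orthogonal projectors. *)
Definition orth_proj (R : realType) (n : nat) (P : Mat R n) :=
  adj P = P /\ P *m P = P.
Definition rank1proj (R : realType) (n : nat) (P : Mat R n) :=
  orth_proj P /\ \tr P = 1.
Definition rank2proj (R : realType) (n : nat) (P : Mat R n) :=
  orth_proj P /\ \tr P = 2%:R.

Definition unitary (R : realType) (n : nat) (U : Mat R n) :=
  U *m adj U = 1%:M.

(* Borel sigma-algebra on the matrix space C^{(n+1)x(n+1)} ~ R^{2(n+1)^2}: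
   generated by the real and imaginary parts of the entries. *)
Definition coordG (R : realType) (n : nat) : set (set (Mat R n)) :=
  [set A | exists (i j : 'I_n.+1) (B : set R), measurable B /\
     (A = [set M : Mat R n | B (complex.Re (M i j))] \/ A = [set M : Mat R n | B (complex.Im (M i j))])].

(* C is pointed (by 0), so that matrices over C are pointed *)
HB.instance Definition _ (R : realType) := isPointed.Build R[i] 0.

Notation MT R n := (g_sigma_algebraType (@coordG R n)).

(* Fubini--Study distance between two points of CP^n:
   d([u],[v]) = arccos (|<u,v>| / (|u| |v|)) = arccos sqrt(tr(P Q)). *)
Definition dFS (R : realType) (n : nat) (P Q : Mat R n) : R :=
  acos (Num.sqrt (complex.Re (\tr (P *m Q)))).

Definition HPoly (R : realType) (n : nat) := mpoly.mpoly n.+1 R[i].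

Definition is_homog (R : realType) (n d : nat) (p : HPoly R n) : bool :=
  p \in @mpoly.ishomog1 n.+1 R[i] d (@mpoly.mdeg n.+1).

(* representatives of points of P_{n,d} *)
Definition inPnd (R : realType) (n d : nat) (p : HPoly R n) :=
  p != 0 /\ is_homog d p.

Definition proj_eq (R : realType) (n : nat) (p q : HPoly R n) :=
  exists c : R[i], c != 0 /\ q = c *: p.

Definition restr (R : realType) (n : nat) (p : HPoly R n) (u v : Vec R n)
  : {poly R[i]} :=
  mpoly.meval (fun i => (u i ord0)%:P + 'X * (v i ord0)%:P)
    (mpoly.map_mpoly (@polyC R[i]) p).

(* m_z(p|_l): multiplicity of the point Z (rank-one projector u u^H) as a
   zero of p restricted to the line L = u u^H + v v^H (v orthonormal to u):
   order of vanishing of t |-> p(u + t v) at t = 0.  (Independent of the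
   choice of u, v.)  Convention: 0 if Z is not on L, or if p vanishes on L. *)
Definition mult (R : realType) (n : nat) (p : HPoly R n) (L Z : Mat R n) : nat :=
  let P := fun uv : Vec R n * Vec R n =>
             Z = uv.1 *m adj uv.1 /\ L = Z + uv.2 *m adj uv.2 in
  let uv := xget (0 : Vec R n, 0 : Vec R n) P in
  let q := restr p uv.1 uv.2 in
  if `[< P uv >] && (q != 0) then mup 0 q else 0%N.

Definition muP (R : realType) (n d : nat) (vol : {measure set (MT R n) -> \bar R})
  (p : HPoly R n) : set (MT R n) -> \bar R :=
  fun A => (((d%:R : R)^-1)%:E *
    (\int[vol]_L (\esum_(Z in A `&` [set Z : MT R n | rank1proj Z])
                      ((mult p L Z)%:R : R)%:E)))%E.

Definition W2sq (R : realType) (n : nat) (mu nu : set (MT R n) -> \bar R) : \bar R :=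
  ereal_inf [set c | exists pi : probability (MT R n * MT R n)%type R,
     (forall A, measurable A -> pi (A `*` setT) = mu A) /\
     (forall B, measurable B -> pi (setT `*` B) = nu B) /\
     c = (\int[pi]_x ((dFS x.1 x.2) ^+ 2)%:E)%E].

Definition W2 (R : realType) (n : nat) (mu nu : set (MT R n) -> \bar R) : R :=
  Num.sqrt (fine (W2sq mu nu)).

Definition AC2 (R : realType) (n : nat) (c : R -> set (MT R n) -> \bar R) :=
  exists m : R -> R,
    measurable_fun `[(0%R : R), (1%R : R)] m /\
    (\int[lebesgue_measure]_(t in `[(0%R : R), (1%R : R)]) ((m t) ^+ 2)%:E < +oo)%E /\
    forall s t : R, 0 <= s -> s <= t -> t <= 1 ->
      ((W2 (c s) (c t))%:E <= \int[lebesgue_measure]_(x in `[s, t]) (m x)%:E)%E.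

Definition speed (R : realType) (n : nat) (c : R -> set (MT R n) -> \bar R) (t : R) : R :=
  lim ((fun h : R => W2 (c (t + h)) (c t) / `|h|) @ 0^').

Definition energy (R : realType) (n : nat) (c : R -> set (MT R n) -> \bar R) : \bar R :=
  (\int[lebesgue_measure]_(t in `[(0%R : R), (1%R : R)]) ((speed c t) ^+ 2)%:E)%E.

Definition admissible (R : realType) (n d : nat) (vol : {measure set (MT R n) -> \bar R})
  (g : R -> HPoly R n) :=
  (forall t, 0 <= t <= 1 -> inPnd d (g t)) /\
  AC2 (fun t => muP d vol (g t)).

Definition curve_energy (R : realType) (n d : nat) (vol : {measure set (MT R n) -> \bar R})
  (g : R -> HPoly R n) : \bar R :=
  energy (fun t => muP d vol (g t)).

Definition W2in_sq (R : realType) (n d : nat) (vol : {measure set (MT R n) -> \bar R})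
  (p0 p1 : HPoly R n) : \bar R :=
  ereal_inf [set e | exists g : R -> HPoly R n,
     admissible d vol g /\ proj_eq p0 (g 0) /\ proj_eq p1 (g 1) /\
     e = curve_energy d vol g].

Definition W2in (R : realType) (n d : nat) (vol : {measure set (MT R n) -> \bar R})
  (p0 p1 : HPoly R n) : R :=
  Num.sqrt (fine (W2in_sq d vol p0 p1)).

(* Main.v *)
(** Let D(p, q) be the W_2-distance of the measures mu(p) and mu(q). Matching the roots line by line bounds
    D(p, q)^2 by the mass of the points where |p| <= 2 |p - q|, and sublevel sets of polynomials are small: this
    makes D continuous, and it yields chains from p to q with arbitrarily short steps and bounded total D-length.
    Such a chain runs through the pencil p - r w q with |w| = 1 and r in geometric shells: the bad sets of the steps
    for different r and w have bounded overlap, so that some direction w is cheap. Next, D separates the points of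
    P_{n,d}. Near a generic zero, |p|^m' is bounded by a multiple of |q|^m, where m and m' are the multiplicities of
    p and q; if the measures agree but m' < m, then the mass of a ball, which is positive, grows without bound under
    arbitrarily small enlargements. So m = m', and p and q have the same roots on an open set of lines.
    Since P_{n,d} is compact, limits of chains along an ultrafilter are Lipschitz curves, and the infimal length of
    chains is a complete geodesic distance. It equals W_2^in: a Lipschitz curve with constant L has energy at most
    L^2, and conversely the functions t |-> D(c t, c r), for rational r, have densities whose supremum is almost
    everywhere the metric derivative of c, so that D(c s, c t) is at most the integral of the speed from s to t. *)

Require Import Defs.
From HB Require Import structures.
From mathcomp Require Import all_boot all_order all_algebra.
From mathcomp Require Import perm mpoly.
From mathcomp Require Import all_classical all_reals all_analysis.
From mathcomp Require Import measurable_realfun complex.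
From mathcomp Require Import ring lra.
Import Order.TTheory GRing.Theory Num.Theory.
Import numFieldNormedType.Exports HBNNSimple.
Local Open Scope classical_set_scope.
Local Open Scope ring_scope.
Set Implicit Arguments.
Unset Strict Implicit.
Unset Printing Implicit Defensive.

(** * Matching roots in a metric space *)

(** The obstacle is that roots are only Hölder continuous in the coefficients: [DD_bad] bounds the
    square of a distance by a mass, and along an arbitrary segment of forms this does not bound the
    sum of the steps as the segment is cut more finely. The pencil cures this. Each shell is cut
    into [N] steps and [N] directions [w] are tried. As the bad sets overlap boundedly often, their
    total mass over all [N * N] pairs is bounded independently of [N]; so one direction has total
    mass of order [1 / N], and by Cauchy--Schwarz its [N] steps have bounded total length. The shell
    [s] carries mass of order [4 ^- s], which leaves room for a weight [2 ^ s] making the lengths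
    summable over the shells. Invariance of [vol] enters through averaging: a line or a vector is
    moved by finitely many unitary matrices, and a polynomial of bounded degree is small for few of
    them. The integrands that define [muP] and the energy are not known to be measurable; their
    integrals are therefore compared by inequalities off null sets. *)

Lemma eq_ler (R : numDomainType) (x y : R) : x = y -> x <= y.
Proof. by move=> ->. Qed.

(** Pigeonhole: the shells []r0 * La ^+ k, r0 * La ^+ k.+1]] with [k <= size s] are disjoint and
    outnumber the entries of [s]. In the induction, an entry in the first shell is removed and the
    scale is raised by [La]. *)
Lemma scale_gap (R : realType) (La : R) (s : seq R) (r0 : R) : 1 <= La -> 0 < r0 ->
  exists k : nat, (k <= size s)%N /\
    forall r, r \in s -> r <= r0 * La ^+ k \/ r0 * La ^+ k.+1 < r.
Proof.
move=> La1; have La0 : 0 < La by exact: lt_le_trans La1.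
elim: {s}(size s) {-2}s (erefl (size s)) r0 => [|n IH] s.
  by move/size0nil=> -> r0 _; exists 0%N; split=> // r; rewrite in_nil.
move=> sn r0 r0p.
have [hall|] := boolP (all (fun r => (r <= r0) || (r0 * La < r)) s).
  exists 0%N; split=> // r /(allP hall) /orP; rewrite expr0 mulr1 expr1.
  by case=> h; [left|right].
move=> /allPn [r rs]; rewrite negb_or -!ltNge -leNgt => /andP[h1 h2].
have sz : size (rem r s) = n by rewrite size_rem // sn.
have [|k [kn hk]] := IH (rem r s) sz (r0 * La); first by rewrite mulr_gt0.
exists k.+1; split; first by rewrite sn ltnS -sz.
move=> r' r's.
have [->|ne] := eqVneq r' r.
  left; apply: le_trans h2 _; rewrite exprS mulrA -[X in X <= _]mulr1.
  by apply: ler_wpM2l; [apply: mulr_ge0; exact: ltW|exact: exprn_ege1].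
have /hk : r' \in rem r s.
  have := perm_to_rem rs; move/perm_mem/(_ r'); rewrite r's inE => h.
  by move: (esym h); rewrite (negbTE ne).
by rewrite -!mulrA -!exprS.
Qed.

Lemma prod_ratio (R : realType) (T : eqType) (d : T -> T -> R) (c : R) (s : seq T) x y :
  0 <= c -> (forall z u, 0 <= d z u) ->
  (forall z, z \in s -> d z x <= c * d z y) ->
  \prod_(z <- s) d z x <= c ^+ size s * \prod_(z <- s) d z y.
Proof.
move=> c0 d0; elim: s => [|z s IH] h; first by rewrite !big_nil expr0 mulr1.
rewrite !big_cons /= exprS mulrACA.
apply: ler_pM => //; first by apply: prodr_ge0.
- by apply: h; rewrite mem_head.
- by apply: IH => u us; apply: h; rewrite inE us orbT.
Qed.

(* If every [w] were far from [b], then between two suitably separated scales around [b]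
   that avoid all [z]'s the product over [zs] grows by a definite factor while the product
   over [ws] is nearly constant. *)
Lemma near_exists (R : realType) (T : eqType) (d : T -> T -> R) (n : nat) (Q kap r0 r1 : R)
    (S : set T) (b : T) (zs ws : seq T) :
  (forall x y, 0 <= d x y) -> (forall x y, d x y = d y x) ->
  (forall x y z, d x z <= d x y + d y z) ->
  1 <= Q -> 1 <= kap -> 0 < r0 ->
  forall La, La = 3 * kap * (3 * kap * Q * 4 ^+ n.+1 + 2) ->
  r0 * La ^+ n.+2 <= r1 ->
  (forall a rho, r0 <= rho -> rho <= r1 ->
     exists x, [/\ ~ S x, rho <= d a x & d a x <= kap * rho]) ->
  size zs = n -> size ws = n.+1 ->
  (forall x y, ~ S x -> ~ S y ->
     (\prod_(z <- b :: zs) d z x) * (\prod_(w <- ws) d w y) <=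
     Q * ((\prod_(z <- b :: zs) d z y) * (\prod_(w <- ws) d w x))) ->
  exists2 w, w \in ws & d b w <= r0 * La ^+ n.+2.
Proof.
move=> d0 dC dT Q1 kap1 r0p La LaE hr1 H szz szw HR.
(* [M] exceeds [Q * kap * 4 ^+ n.+1], the most that the remaining factors can compensate between the
   radii [2 * rho] and [M * rho]; [La = 3 * kap * M] keeps both test points in the inner third of
   the free shell. *)
have [M ME] : exists M, M = 3 * kap * Q * 4 ^+ n.+1 + 2 by eexists.
rewrite -ME in LaE.
have Q0 : 0 < Q by lra.
have k0 : 0 < kap by lra.
have e4 : 1 <= 4 ^+ n.+1 :> R by apply: exprn_ege1; lra.
have kQ : 1 <= kap * Q by rewrite -[1]mulr1; apply: ler_pM => //; lra.
have M5 : 3 * kap * Q * 4 ^+ n.+1 >= 3.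
  rewrite -!mulrA -[X in X <= _]mulr1 ler_pM2l ?ltr0n // mulrA.
  by apply: le_trans kQ _; rewrite ler_peMr // mulr_ge0 ?ltW.
have M2 : 5 <= M by rewrite ME; lra.
have M0 : 0 < M by lra.
have La1 : 9 <= La.
  by rewrite LaE; have := ler_pM (ler0n R 1) (ler0n R 5) kap1 M2; lra.
have [//|hno] := pselect (exists2 w, w \in ws & d b w <= r0 * La ^+ n.+2).
have far w : w \in ws -> r0 * La ^+ n.+2 < d b w.
  by move=> ww; rewrite ltNge; apply/negP=> h; apply: hno; exists w.
have [|k [kn hk]] := @scale_gap R La (map (d b) zs) r0 _ r0p; first by lra.
rewrite size_map szz in kn.
have [rho rhoE] : exists rho, rho = r0 * La ^+ k by eexists.
rewrite -rhoE in hk.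
have rho0 : 0 < rho by rewrite rhoE mulr_gt0 ?exprn_gt0 //; lra.
have rhoL m : (k <= m)%N -> rho <= r0 * La ^+ m.
  by move=> km; rewrite rhoE ler_pM2l // ler_weXn2l //; lra.
have r0rho : r0 <= rho.
  by rewrite rhoE -[X in X <= _]mulr1 ler_pM2l // exprn_ege1 //; lra.
have LaS m : r0 * La ^+ m.+1 = La * (r0 * La ^+ m) by rewrite exprS; ring.
have kM : M <= kap * M by rewrite ler_peMl // ltW.
have Lr : La * rho <= r1.
  rewrite rhoE -LaS; apply: le_trans hr1; rewrite ler_pM2l // ler_weXn2l ?ltnS //; first lra.
  by apply: leq_trans kn _.
have MLr : M * rho <= La * rho by rewrite LaE ler_pM2r //; nra.
have [||y [Sy y1 y2]] := H b (2 * rho); [by lra| |].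
  by apply: le_trans Lr; rewrite ler_pM2r //; lra.
have [||x [Sx x1 x2]] := H b (M * rho); [| exact: le_trans Lr|].
  by apply: le_trans r0rho _; rewrite ler_peMl ?ltW //; lra.
have krho : rho <= kap * rho by rewrite ler_peMl // ltW.
have x2' : d b x * 3 <= La * rho by rewrite LaE; lra.
have y2' : d b y * 3 <= La * rho.
  by rewrite LaE; have : kap * rho * 2 <= kap * rho * M; [rewrite ler_pM2l ?mulr_gt0 //; lra|lra].
have fr u v w : d b u * 3 <= La * rho -> d b v * 3 <= La * rho -> La * rho < d b w ->
    d w u <= 2 * d w v.
  move=> hu hv hw; have := dT b u w; have := dT b v w; have := dT w b u.
  by rewrite (dC w b) (dC w u) (dC u w) (dC w v) (dC v w); lra.
have frw w : w \in ws -> La * rho < d b w.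
  move=> /far; apply: le_lt_trans; rewrite rhoE -LaS ler_pM2l // ler_weXn2l ?ltnS //; first lra.
  exact: leq_trans kn _.
have Gxy : \prod_(w <- ws) d w x <= 2 ^+ n.+1 * \prod_(w <- ws) d w y.
  by rewrite -szw; apply: prod_ratio => // w /frw; apply: fr.
have nz z : z \in zs -> d b z <= rho \/ La * rho < d b z.
  by move=> zz; have /hk := map_f (d b) zz; rewrite LaS -rhoE.
have Fyx : \prod_(z <- zs) d z y <= 2 ^+ n * \prod_(z <- zs) d z x.
  rewrite -szz; apply: prod_ratio => // z /nz [hz|]; last by apply: fr.
  have := dT z b y; have := dT b z x; rewrite (dC z b).
  have : 3 * kap * 4 <= M.
    have : kap * 4 <= kap * (Q * 4 ^+ n.+1).
      rewrite ler_pM2l // exprS -[X in X <= _]mul1r; apply: ler_pM => //.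
      by rewrite ler_peMr // exprn_ege1 //; lra.
    by rewrite ME -!mulrA; lra.
  by nra.
have zy0 z : z \in zs -> 0 < d z y.
  move=> /nz [hz|hz].
    by have := dT b z y; lra.
  by have := dT b y z; rewrite (dC z y); lra.
have Fy0 : 0 < \prod_(z <- zs) d z y.
  by rewrite big_seq; apply: prodr_gt0 => z; apply: zy0.
have wy0 w : w \in ws -> 0 < d w y.
  by move=> /frw hz; have := dT b y w; rewrite (dC w y); lra.
have Gy0 : 0 < \prod_(w <- ws) d w y.
  by rewrite big_seq; apply: prodr_gt0 => w; apply: wy0.
have := HR x y Sx Sy; rewrite !big_cons.
set F := \prod_(z <- zs) d z x in Fyx *; set F' := \prod_(z <- zs) d z y in Fyx Fy0 *.
set G := \prod_(w <- ws) d w x in Gxy *; set G' := \prod_(w <- ws) d w y in Gxy Gy0 *.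
have h2 : 0 < 2 ^+ n :> R by rewrite exprn_gt0.
move=> hh.
have h1 : M * rho * F * G' <= Q * (kap * (2 * rho) * F' * (2 ^+ n.+1 * G')).
  apply: le_trans (_ : d b x * F * G' <= _).
    rewrite ler_pM2r //; apply: ler_wpM2r => //.
    by apply: prodr_ge0.
  apply: le_trans hh _; rewrite ler_pM2l //; apply: ler_pM => //.
  - by rewrite mulr_ge0 // ltW.
  - by apply: prodr_ge0.
  - by rewrite ler_pM2r.
have F0 : 0 < F by rewrite -(pmulr_rgt0 _ h2); apply: lt_le_trans Fyx.
have h3 : M * F <= Q * kap * 4 * 4 ^+ n * F.
  have h4 : M * F * (rho * G') <= Q * kap * 2 * (2 ^+ n.+1) * F' * (rho * G').
    by apply: le_trans (le_trans h1 _); apply: eq_ler; ring.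
  have rG : 0 < rho * G' by rewrite mulr_gt0.
  rewrite ler_pM2r // in h4.
  apply: le_trans h4 _.
  have -> : Q * kap * 4 * 4 ^+ n * F = Q * kap * 2 * (2 ^+ n.+1) * (2 ^+ n * F).
    have -> : 4 ^+ n = 2 ^+ n * 2 ^+ n :> R by rewrite -exprMn; congr (_ ^+ _); ring.
    by rewrite exprS; ring.
  by rewrite ler_pM2l // !mulr_gt0 // exprn_gt0.
rewrite ler_pM2r // ME in h3.
have hQk : 0 < Q * kap * 4 ^+ n by rewrite !mulr_gt0 // exprn_gt0.
exfalso; move: h3; rewrite exprS; lra.
Qed.

Lemma matching_exists (R : realType) (n : nat) (Q kap r1 : R) :
  1 <= Q -> 1 <= kap -> 0 < r1 ->
  exists2 C : R, 0 < C & forall (T : eqType) (d : T -> T -> R) (S : set T) (zs ws : seq T) (r0 : R),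
  (forall x y, 0 <= d x y) -> (forall x y, d x y <= 1) -> (forall x y, d x y = d y x) ->
  (forall x y z, d x z <= d x y + d y z) ->
  0 < r0 ->
  (forall a rho, r0 <= rho -> rho <= r1 ->
     exists x, [/\ ~ S x, rho <= d a x & d a x <= kap * rho]) ->
  size zs = n -> size ws = n ->
  (forall x y, ~ S x -> ~ S y ->
     (\prod_(z <- zs) d z x) * (\prod_(w <- ws) d w y) <=
     Q * ((\prod_(z <- zs) d z y) * (\prod_(w <- ws) d w x))) ->
  exists2 ws', perm_eq ws' ws & forall x0 i, (i < n)%N -> d (nth x0 zs i) (nth x0 ws' i) <= C * r0.
Proof.
elim: n Q kap r1 => [|n IH] Q kap r1 Q1 kap1 r1p.
  exists 1 => // T d S zs ws r0 _ _ _ _ _ _ _ szw _; exists [::] => //.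
  by rewrite (size0nil szw).
have [||| C' C'0 HC'] := IH (3 * Q) (kap * (kap + 1)) (r1 / (kap + 1)).
- by lra.
- by nra.
- by rewrite divr_gt0 //; lra.
have [La LaE] : exists La, La = 3 * kap * (3 * kap * Q * 4 ^+ n.+1 + 2) by eexists.
have [C0 C0E] : exists C0, C0 = La ^+ n.+2 by eexists.
have e4 : 0 < 4 ^+ n.+1 :> R by rewrite exprn_gt0.
have La1 : 1 <= La.
  have : 0 < kap * Q * 4 ^+ n.+1 by rewrite !mulr_gt0 //; lra.
  by rewrite LaE; nra.
have C01 : 1 <= C0 by rewrite C0E; exact: exprn_ege1.
have C00 : 0 < C0 by exact: lt_le_trans ltr01 C01.
(* The summands serve, in this order, the trivial case [r1 < r0 * C0] where [d <= 1] suffices, the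
   first pair, and the induction hypothesis at scale [4 * C0 * r0]. *)
exists (C0 / r1 + C0 + C' * (4 * C0)).
  have h1 : 0 < C0 / r1 by exact: divr_gt0.
  have h2 : 0 < C' * (4 * C0) by rewrite mulr_gt0 // mulr_gt0.
  by rewrite !addr_gt0.
move=> T d S zs ws r0 d0 d1 dC dT r0p H szz szw HR.
have [big|small] := ltP r1 (r0 * C0).
  exists ws => // x0 i _; apply: le_trans (d1 _ _) _.
  have : 1 <= C0 / r1 * r0 by rewrite mulrAC ler_pdivlMr // mul1r mulrC ltW.
  have : 0 <= C' * (4 * C0) * r0 by rewrite !mulr_ge0 // ltW.
  by nra.
case: zs szz HR => // b zs [szz] HR.
rewrite C0E in small.
have [w ww dbw] := near_exists d0 dC dT Q1 kap1 r0p LaE small H szz szw HR.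
rewrite -C0E in dbw.
pose S' := S `|` [set x | d b x < 2 * (C0 * r0)].
have C0r : 0 < C0 * r0 by rewrite mulr_gt0 //; lra.
have S'P x : ~ S' x -> ~ S x /\ 2 * (C0 * r0) <= d b x.
  move=> h; split; first by move=> Sx; apply: h; left.
  by rewrite leNgt; apply/negP=> hx; apply: h; right.
have [|||||ws' pws' Hws'] := HC' T d S' zs (rem w ws) (4 * (C0 * r0)) d0 d1 dC dT.
- by rewrite mulr_gt0.
- move=> a rho h1; rewrite ler_pdivlMr; last by lra.
  move=> h2.
  have [||x [Sx x1 x2]] := H a rho; [by nra|by nra|].
  have [bx|bx] := leP (2 * (C0 * r0)) (d b x).
    exists x; split=> //; last by nra.
    by case=> //=; rewrite ltNge bx.
  (* The point found at scale [rho] lies in the new ball, whose diameter is at most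
     [4 * (C0 * r0) <= rho]; a point at distance [(kap + 1) * rho] from [a] must then be outside
     it. *)
  have [||y [Sy y1 y2]] := H a ((kap + 1) * rho); [by nra|by nra|].
  exists y; split; [|by nra|by nra].
  case=> //= yb; have := dT a x y; have := dT x b y; rewrite (dC x b).
  by nra.
- exact: szz.
- by rewrite size_rem // szw.
- move=> x y /S'P [Sx bx] /S'P [Sy by_]; have := HR x y Sx Sy.
  rewrite !big_cons !(perm_big _ (perm_to_rem ww)) /= !big_cons.
  set F := \prod_(z <- zs) d z x; set F' := \prod_(z <- zs) d z y.
  set G := \prod_(w <- _) d w y; set G' := \prod_(w <- _) d w x.
  move=> h.
  have F0 : 0 <= F by apply: prodr_ge0.
  have F'0 : 0 <= F' by apply: prodr_ge0.
  have G0 : 0 <= G by apply: prodr_ge0.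
  have G'0 : 0 <= G' by apply: prodr_ge0.
  have t1 : d b y <= 2 * d w y by have := dT b w y; lra.
  have t2 : d w x <= 3 / 2 * d b x by have := dT w b x; rewrite (dC w b); lra.
  have t3 : 0 < d b x * d w y by rewrite mulr_gt0 //; [lra|have := d0 w y; lra].
  rewrite -(ler_pM2l t3).
  apply: le_trans (le_trans h _); first by apply: eq_ler; ring.
  have -> : d b x * d w y * (3 * Q * (F' * G')) = Q * (2 * d w y * F' * (3 / 2 * d b x * G')).
    by field.
  rewrite ler_pM2l; last by lra.
  by apply: ler_pM; rewrite ?mulr_ge0 // ler_wpM2r.
exists (w :: ws').
  by rewrite perm_sym (perm_trans (perm_to_rem ww)) // perm_cons perm_sym.
move=> x0 [_|i] /=.
  apply: le_trans dbw _; rewrite (mulrC r0) ler_pM2r //.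
  rewrite addrAC lerDr addr_ge0 ?divr_ge0 ?mulr_ge0 ?ltW //.
rewrite ltnS => /(Hws' x0) h; apply: le_trans h _.
rewrite !mulrA ler_pM2r // lerDr addr_ge0 ?divr_ge0 ?ltW //.
Qed.

(** * Complex moduli and the chordal distance on the projective line *)

(** The modulus as an element of [R]; the norm of [R[i]] takes its values in [R[i]]. *)
Definition cn (R : realType) (x : R[i]) : R := complex.Re `|x|.

Lemma cnE (R : realType) (x : R[i]) : `|x| = (cn x)%:C%C.
Proof. by rewrite /cn normc_def. Qed.

Lemma cn_def (R : realType) (x : R[i]) :
  cn x = Num.sqrt (complex.Re x ^+ 2 + complex.Im x ^+ 2).
Proof. by rewrite /cn normc_def. Qed.

Lemma cn_ge0 (R : realType) (x : R[i]) : 0 <= cn x.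
Proof. by rewrite cn_def sqrtr_ge0. Qed.
#[global] Hint Extern 0 (is_true (@Order.le _ _ _ (cn _))) => exact: cn_ge0 : core.

Lemma cn_sqr (R : realType) (x : R[i]) : cn x ^+ 2 = complex.Re x ^+ 2 + complex.Im x ^+ 2.
Proof. by rewrite cn_def sqr_sqrtr // addr_ge0 ?sqr_ge0. Qed.

Lemma cnJ (R : realType) (x : R[i]) : cn (x^*)%C = cn x.
Proof. by rewrite /cn normcJ. Qed.

Lemma mulcJ (R : realType) (x : R[i]) : x * (x^*)%C = (cn x ^+ 2)%:C%C.
Proof. by rewrite -sqr_normc cnE -rmorphXn. Qed.

Lemma cn_inj (R : realType) (x : R[i]) (r : R) : `|x| = r%:C%C -> cn x = r.
Proof. by rewrite /cn => ->. Qed.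

Lemma cnM (R : realType) (x y : R[i]) : cn (x * y) = cn x * cn y.
Proof. by apply: cn_inj; rewrite normrM !cnE -rmorphM. Qed.

Lemma cnN (R : realType) (x : R[i]) : cn (- x) = cn x.
Proof. by rewrite /cn normrN. Qed.

Lemma cnB (R : realType) (x y : R[i]) : cn (x - y) = cn (y - x).
Proof. by rewrite /cn distrC. Qed.

Lemma cnD (R : realType) (x y : R[i]) : cn (x + y) <= cn x + cn y.
Proof. by rewrite -lecR rmorphD /= -!cnE ler_normD. Qed.

Lemma cnD3 (R : realType) (x y z : R[i]) : cn (x - z) <= cn (x - y) + cn (y - z).
Proof. by apply: le_trans (cnD _ _); rewrite addrA subrK. Qed.

Lemma cnDB (R : realType) (x y : R[i]) : cn x - cn y <= cn (x - y).
Proof. by rewrite lerBlDr; apply: le_trans (cnD _ _); rewrite subrK. Qed.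

Lemma cn0 (R : realType) : cn (0 : R[i]) = 0.
Proof. by apply: cn_inj; rewrite normr0. Qed.

Lemma cn1 (R : realType) : cn (1 : R[i]) = 1.
Proof. by apply: cn_inj; rewrite normr1. Qed.

Lemma cn_eq0 (R : realType) (x : R[i]) : (cn x == 0) = (x == 0).
Proof. by rewrite -[RHS]normr_eq0 cnE -(inj_eq (@complexI R)). Qed.

Lemma cn_gt0 (R : realType) (x : R[i]) : (0 < cn x) = (x != 0).
Proof. by rewrite lt_def cn_ge0 andbT cn_eq0. Qed.

Lemma cnX (R : realType) (x : R[i]) n : cn (x ^+ n) = cn x ^+ n.
Proof. by apply: cn_inj; rewrite normrX cnE rmorphXn. Qed.

Lemma cnV (R : realType) (x : R[i]) : cn x^-1 = (cn x)^-1.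
Proof. by apply: cn_inj; rewrite normfV cnE fmorphV. Qed.

Lemma cn_real (R : realType) (r : R) : cn (r%:C%C) = `|r|.
Proof. by rewrite cn_def /= expr0n addr0 sqrtr_sqr. Qed.

Lemma cn_nat (R : realType) (k : nat) : cn (k%:R : R[i]) = k%:R.
Proof. by rewrite -(rmorph_nat (@real_complex R)) cn_real ger0_norm. Qed.

Lemma cn_prod (R : realType) (I : Type) (s : seq I) (F : I -> R[i]) :
  cn (\prod_(i <- s) F i) = \prod_(i <- s) cn (F i).
Proof.
elim: s => [|i s IH]; first by rewrite !big_nil cn1.
by rewrite !big_cons cnM IH.
Qed.

Lemma cn_sum (R : realType) (I : Type) (s : seq I) (P : pred I) (F : I -> R[i]) :
  cn (\sum_(i <- s | P i) F i) <= \sum_(i <- s | P i) cn (F i).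
Proof.
elim: s => [|i s IH]; first by rewrite !big_nil cn0.
rewrite !big_cons; case: ifP => // _.
by apply: le_trans (cnD _ _) _; rewrite lerD2l.
Qed.

Lemma cn_geRe (R : realType) (x : R[i]) : `|complex.Re x| <= cn x.
Proof.
by rewrite cn_def -sqrtr_sqr ler_sqrt ?lerDl ?addr_ge0 ?sqr_ge0.
Qed.

Lemma cn_geIm (R : realType) (x : R[i]) : `|complex.Im x| <= cn x.
Proof.
by rewrite cn_def -sqrtr_sqr ler_sqrt ?lerDr ?addr_ge0 ?sqr_ge0.
Qed.

Lemma cn_leD (R : realType) (x : R[i]) : cn x <= `|complex.Re x| + `|complex.Im x|.
Proof.
rewrite -(@ler_pXn2r _ 2) ?nnegrE ?addr_ge0 //.
rewrite cn_sqr -[complex.Re x ^+ 2]real_normK ?num_real // -[complex.Im x ^+ 2]real_normK ?num_real //.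
have : 0 <= `|complex.Re x| * `|complex.Im x| by rewrite mulr_ge0.
lra.
Qed.

Definition br (R : realType) (x y : R[i] * R[i]) : R[i] := x.1 * y.2 - x.2 * y.1.
Definition pn (R : realType) (x : R[i] * R[i]) : R := Num.sqrt (cn x.1 ^+ 2 + cn x.2 ^+ 2).

Lemma pn_ge0 (R : realType) (x : R[i] * R[i]) : 0 <= pn x.
Proof. exact: sqrtr_ge0. Qed.
#[global] Hint Extern 0 (is_true (@Order.le _ _ _ (pn _))) => exact: pn_ge0 : core.

Lemma pn_sqr (R : realType) (x : R[i] * R[i]) : pn x ^+ 2 = cn x.1 ^+ 2 + cn x.2 ^+ 2.
Proof. by rewrite sqr_sqrtr // addr_ge0 ?sqr_ge0. Qed.

Lemma pn_gt0 (R : realType) (x : R[i] * R[i]) : x != 0 -> 0 < pn x.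
Proof.
move=> x0; rewrite sqrtr_gt0 lt_def addr_ge0 ?sqr_ge0 // andbT.
rewrite paddr_eq0 ?sqr_ge0 // !sqrf_eq0 !cn_eq0.
by apply: contra x0; case: x => a b /=.
Qed.

Lemma pnZ (R : realType) (c : R[i]) (x : R[i] * R[i]) : pn (c * x.1, c * x.2) = cn c * pn x.
Proof.
by rewrite /pn /= !cnM !exprMn -mulrDr sqrtrM ?sqr_ge0 // sqrtr_sqr ger0_norm.
Qed.

Lemma pnD (R : realType) (x y : R[i] * R[i]) : pn (x.1 + y.1, x.2 + y.2) <= pn x + pn y.
Proof.
rewrite -(@ler_pXn2r _ 2) ?nnegrE ?addr_ge0 //.
rewrite sqrrD !pn_sqr /=.
have h1 : cn (x.1 + y.1) ^+ 2 <= (cn x.1 + cn y.1) ^+ 2.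
  by rewrite ler_pXn2r ?nnegrE ?addr_ge0 // cnD.
have h2 : cn (x.2 + y.2) ^+ 2 <= (cn x.2 + cn y.2) ^+ 2.
  by rewrite ler_pXn2r ?nnegrE ?addr_ge0 // cnD.
have h3 : cn x.1 * cn y.1 + cn x.2 * cn y.2 <= pn x * pn y.
  rewrite -(@ler_pXn2r _ 2) ?nnegrE ?addr_ge0 ?mulr_ge0 // exprMn !pn_sqr.
  have := sqr_ge0 (cn x.1 * cn y.2 - cn x.2 * cn y.1).
  rewrite !expr2; lra.
move: h1 h2; rewrite !sqrrD; lra.
Qed.

Lemma brC (R : realType) (x y : R[i] * R[i]) : cn (br x y) = cn (br y x).
Proof. by rewrite -cnN; congr cn; rewrite /br; ring. Qed.

Lemma br_ub (R : realType) (x y : R[i] * R[i]) : cn (br x y) <= pn x * pn y.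
Proof.
rewrite -(@ler_pXn2r _ 2) ?nnegrE ?addr_ge0 ?mulr_ge0 // exprMn !pn_sqr.
apply: le_trans (_ : (cn x.1 * cn y.2 + cn x.2 * cn y.1) ^+ 2 <= _).
  rewrite ler_pXn2r ?nnegrE ?addr_ge0 ?mulr_ge0 //.
  by apply: le_trans (cnD _ _) _; rewrite cnN !cnM.
have := sqr_ge0 (cn x.1 * cn y.1 - cn x.2 * cn y.2).
rewrite !expr2; lra.
Qed.

(** The norm applied to the identity [br x z * y = br x y * z + br y z * x] of vectors in the
    plane. *)
Lemma br_triangle (R : realType) (x y z : R[i] * R[i]) :
  cn (br x z) * pn y <= cn (br x y) * pn z + cn (br y z) * pn x.
Proof.
rewrite -!pnZ; apply: le_trans (pnD _ _).
by rewrite /=; apply: eq_ler; congr pn; rewrite /br; congr pair; ring.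
Qed.

(* The zero vector is sent to an arbitrary point, so that [chd] is a pseudometric on all of C^2. *)
Definition nz (R : realType) (x : R[i] * R[i]) : R[i] * R[i] := if x == 0 then (1, 0) else x.

Definition chd (R : realType) (x y : R[i] * R[i]) : R :=
  cn (br (nz x) (nz y)) / (pn (nz x) * pn (nz y)).

Lemma nz_neq0 (R : realType) (x : R[i] * R[i]) : nz x != 0.
Proof. by rewrite /nz; case: ifP => [_|->//]; apply/eqP => -[] /eqP; rewrite oner_eq0. Qed.

Lemma nz_id (R : realType) (x : R[i] * R[i]) : x != 0 -> nz x = x.
Proof. by rewrite /nz => /negbTE ->. Qed.

Lemma pn_nz (R : realType) (x : R[i] * R[i]) : 0 < pn (nz x).
Proof. by rewrite pn_gt0 // nz_neq0. Qed.
#[global] Hint Extern 0 (is_true (@Order.lt _ _ _ (pn (nz _)))) => exact: pn_nz : core.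

Lemma chd_ge0 (R : realType) (x y : R[i] * R[i]) : 0 <= chd x y.
Proof. by rewrite /chd divr_ge0 // mulr_ge0. Qed.

Lemma chd_le1 (R : realType) (x y : R[i] * R[i]) : chd x y <= 1.
Proof. by rewrite /chd ler_pdivrMr ?mulr_gt0 // mul1r br_ub. Qed.

Lemma chdC (R : realType) (x y : R[i] * R[i]) : chd x y = chd y x.
Proof. by rewrite /chd brC mulrC [pn _ * _]mulrC mulrC. Qed.

Lemma chdE (R : realType) (x y : R[i] * R[i]) :
  cn (br (nz x) (nz y)) = chd x y * (pn (nz x) * pn (nz y)).
Proof. by rewrite /chd divfK // gt_eqF // mulr_gt0. Qed.

Lemma chd_triangle (R : realType) (x y z : R[i] * R[i]) : chd x z <= chd x y + chd y z.
Proof.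
have h := br_triangle (nz x) (nz y) (nz z); rewrite !chdE in h.
rewrite -(@ler_pM2r _ (pn (nz x) * pn (nz y) * pn (nz z))) ?mulr_gt0 //.
by move: h; congr (_ <= _); ring.
Qed.

(** Off [S] the moduli of [f] and [g] agree up to the factors 2 and 3/2, whence [Q = 3]. Test points
    near a given point come from a square of side [a <= rho], shifted by [5 * rho] in both
    coordinates, in the chart where the given point has modulus at most 1: its points are at
    Euclidean distance between [5 * rho] and [20 * rho], and the chordal distance is smaller by a
    factor between 1 and 5, whence [kap = 20]. The bound [rho <= 1/10] keeps the square inside
    [[-2, 2]^2]. *)
Lemma match_squares (R : realType) (d : nat) : exists2 C : R, 0 < C &
  forall (a : R) (c c' : R[i]) (zs ws : seq (R[i] * R[i])) (S : set (R[i] * R[i])),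
  let f x := c * \prod_(z <- zs) br z x in let g x := c' * \prod_(w <- ws) br w x in
  0 < a -> c != 0 -> c' != 0 -> size zs = d -> size ws = d ->
  (forall z, z \in zs -> z != 0) -> (forall z, z \in ws -> z != 0) ->
  (forall x, cn (f x) <= 2 * cn (f x - g x) -> S x) ->
  (forall x0 y0 : R, -2 <= x0 -> x0 + a <= 2 -> -2 <= y0 -> y0 + a <= 2 ->
     (exists x y, [/\ x0 <= x <= x0 + a, y0 <= y <= y0 + a & ~ S (1, (x +i* y)%C)]) /\
     (exists x y, [/\ x0 <= x <= x0 + a, y0 <= y <= y0 + a & ~ S ((x +i* y)%C, 1)])) ->
  exists2 ws', perm_eq ws' ws &
    forall x0 i, (i < d)%N -> chd (nth x0 zs i) (nth x0 ws' i) <= C * a.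
Proof.
have [||| C C0 HC] := @matching_exists R d 3 20 10^-1; [by lra|by lra|by lra|].
exists C => // a c c' zs ws S f g a0 c0 c'0 szz szw z0 w0 HS HH.
pose S' := [set x | S x] `|` [set x | x = 0].
have S'P x : ~ S' x -> ~ S x /\ x <> 0.
  by move=> h; split=> h'; apply: h; [left|right].
apply: (HC _ (@chd R) S' zs ws a) => //.
- exact: chd_ge0.
- exact: chd_le1.
- exact: chdC.
- exact: chd_triangle.
- move=> p rho h1 h2.
  suff : forall (x : R[i] * R[i]) (mk : R[i] -> R[i] * R[i]), x = nz p ->
     (mk = (fun w => (1, w)) /\ cn x.2 <= cn x.1 \/ mk = (fun w => (w, 1)) /\ cn x.1 <= cn x.2) ->
      exists y, [/\ ~ S' y, rho <= chd p y & chd p y <= 20 * rho].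
    move=> H; have [l|l] := leP (cn (nz p).2) (cn (nz p).1).
      by apply: (H _ (fun w => (1, w)) erefl); left.
    by apply: (H _ (fun w => (w, 1)) erefl); right; split=> //; exact: ltW.
  move=> x mk xE Hmk.
  have x0 : x != 0 by rewrite xE nz_neq0.
  have [w [w1 [k k0 xk]]] : exists w, cn w <= 1 /\ exists2 k, k != 0 &
      x = (k * (mk w).1, k * (mk w).2).
    case: Hmk => -[-> hx].
      have x10 : x.1 != 0.
        rewrite -cn_gt0 lt_neqAle cn_ge0 andbT; apply/eqP => e.
        move: hx; rewrite -e => /(conj (cn_ge0 x.2)) /andP/le_anti/esym/eqP.
        rewrite cn_eq0 => /eqP e2; move/esym/eqP: e; rewrite cn_eq0 => /eqP e1.
        by move: x0; case: (x) e1 e2 => ? ? /= -> ->; rewrite eqxx.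
      exists (x.2 / x.1); split.
        by rewrite cnM cnV ler_pdivrMr ?mul1r // cn_gt0.
      by exists x.1 => //=; rewrite mulr1 mulrCA divff // mulr1; case: (x).
    have x20 : x.2 != 0.
      rewrite -cn_gt0 lt_neqAle cn_ge0 andbT; apply/eqP => e.
      move: hx; rewrite -e => /(conj (cn_ge0 x.1)) /andP/le_anti/esym/eqP.
      rewrite cn_eq0 => /eqP e2; move/esym/eqP: e; rewrite cn_eq0 => /eqP e1.
      by move: x0; case: (x) e1 e2 => ? ? /= -> ->; rewrite eqxx.
    exists (x.1 / x.2); split.
      by rewrite cnM cnV ler_pdivrMr ?mul1r // cn_gt0.
    by exists x.2 => //=; rewrite mulr1 mulrCA divff // mulr1; case: (x).
  have wr := cn_geRe w; have wi := cn_geIm w.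
  have [||||hA hB] := HH (complex.Re w + 5 * rho) (complex.Im w + 5 * rho).
  - by move: wr; rewrite ler_norml; lra.
  - by move: wr; rewrite ler_norml; lra.
  - by move: wi; rewrite ler_norml; lra.
  - by move: wi; rewrite ler_norml; lra.
  have [s [t [s1 t1 nS]]] : exists s t, [/\ complex.Re w + 5 * rho <= s <= complex.Re w + 5 * rho + a,
       complex.Im w + 5 * rho <= t <= complex.Im w + 5 * rho + a & ~ S (mk (s +i* t)%C)].
    by case: Hmk => -[-> _].
  set w' := (s +i* t)%C in nS.
  have d1 : 5 * rho <= cn (w' - w).
    apply: le_trans (cn_geRe _); rewrite raddfB /=.
    by apply: le_trans (ler_norm _); lra.
  have d2 : cn (w' - w) <= 20 * rho.
    apply: le_trans (cn_leD _) _; rewrite !raddfB /= !ger0_norm; lra.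
  have w'3 : cn w' <= 3.
    by have := cnD (w' - w) w; rewrite subrK; lra.
  have m0 u : mk u != 0.
    by case: Hmk => -[-> _]; apply/eqP => -[]; move/eqP; rewrite ?oner_eq0 // => _ /eqP; rewrite oner_eq0.
  have brm : cn (br (mk w) (mk w')) = cn (w' - w).
    case: Hmk => -[-> _]; first by congr cn; rewrite /br /=; ring.
    by rewrite cnB; congr cn; rewrite /br /=; ring.
  have pm u : pn (mk u) ^+ 2 = 1 + cn u ^+ 2.
    by rewrite pn_sqr; case: Hmk => -[-> _] /=; rewrite cn1 expr1n // addrC.
  have chE : chd p (mk w') = cn (w' - w) / (pn (mk w) * pn (mk w')).
    rewrite /chd -xE (nz_id (m0 _)) xk pnZ -brm.
    rewrite (_ : br _ (mk w') = k * br (mk w) (mk w')); last by rewrite /br /=; ring.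
    by rewrite cnM -[cn k * pn _ * _]mulrA -mulf_div divff ?mul1r // cn_eq0.
  have P0 : 0 < pn (mk w) * pn (mk w') by rewrite mulr_gt0 // pn_gt0.
  have P1 : 1 <= pn (mk w) * pn (mk w').
    rewrite -(@ler_pXn2r _ 2) ?nnegrE ?mulr_ge0 // exprMn !pm expr1n -[X in X <= _]mulr1.
    by apply: ler_pM => //; rewrite lerDl sqr_ge0.
  have P5 : pn (mk w) * pn (mk w') <= 5.
    rewrite -(@ler_pXn2r _ 2) ?nnegrE ?mulr_ge0 // exprMn !pm.
    have u1 : cn w ^+ 2 <= 1 by rewrite -(expr1n _ 2) ler_pXn2r ?nnegrE.
    have u2 : cn w' ^+ 2 <= 9.
      by rewrite (_ : 9 = 3 ^+ 2); [rewrite ler_pXn2r ?nnegrE|rewrite expr2; ring].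
    apply: le_trans (_ : 2 * 10 <= _); last by rewrite expr2; lra.
    by apply: ler_pM; rewrite ?addr_ge0 ?sqr_ge0 //; lra.
  exists (mk w'); split.
  - by case=> //= /eqP; rewrite (negbTE (m0 _)).
  - rewrite chE ler_pdivlMr //; apply: le_trans d1.
    by rewrite mulrC ler_pM2r //; lra.
  - rewrite chE ler_pdivrMr //; apply: le_trans d2 _.
    by rewrite ler_peMr //; lra.
- move=> x y /S'P [Sx /eqP nx] /S'P [Sy /eqP ny].
  have prodE (s : seq (R[i] * R[i])) v : v != 0 -> (forall z, z \in s -> z != 0) ->
      \prod_(z <- s) cn (br z v) = (\prod_(z <- s) chd z v) * ((\prod_(z <- s) pn z) * pn v ^+ size s).
    move=> v0; elim: s => [|z s IH] hz; first by rewrite !big_nil expr0 !mulr1.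
    rewrite !big_cons IH => [|u us]; last by rewrite hz // inE us orbT.
    have zz : z != 0 by rewrite hz // mem_head.
    have := chdE z v; rewrite !nz_id // => ->.
    by rewrite /= exprS; ring.
  have fx v : cn (f v) = cn c * \prod_(z <- zs) cn (br z v) by rewrite cnM cn_prod.
  have gx v : cn (g v) = cn c' * \prod_(z <- ws) cn (br z v) by rewrite cnM cn_prod.
  have key v : ~ S v -> cn (g v) <= 3 / 2 * cn (f v) /\ cn (f v) <= 2 * cn (g v).
    move=> Sv; have : 2 * cn (f v - g v) < cn (f v).
      by rewrite ltNge; apply/negP => /HS.
    have := cnDB (f v) (g v); have := cnDB (g v) (f v); rewrite (cnB (g v)).
    by lra.
  have [k1 k2] := key _ Sx; have [k3 k4] := key _ Sy.
  have h : cn (f x) * cn (g y) <= 3 * (cn (f y) * cn (g x)).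
    apply: le_trans (ler_pM (cn_ge0 _) (cn_ge0 _) k2 k3) _.
    by apply: eq_ler; field.
  rewrite !fx !gx !prodE // szz szw in h.
  have K0 : 0 < cn c * cn c' * (\prod_(z <- zs) pn z) * (\prod_(z <- ws) pn z) * pn x ^+ d * pn y ^+ d.
    have pz (s : seq (R[i] * R[i])) : (forall z, z \in s -> z != 0) -> 0 < \prod_(z <- s) pn z.
      by move=> hz; rewrite big_seq; apply: prodr_gt0 => z zs'; rewrite pn_gt0 // hz.
    by rewrite !mulr_gt0 ?pz ?cn_gt0 ?exprn_gt0 ?pn_gt0.
  rewrite -(ler_pM2l K0).
  move: h; congr (_ <= _); ring.
Qed.

(** * Hermitian vectors, projectors and unitary matrices *)

Lemma adjE (R : realType) m k (A : 'M[R[i]]_(m, k)) i j : adj A i j = ((A j i)^*)%C.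
Proof. by rewrite /adj !mxE. Qed.

Lemma adjK (R : realType) m k (A : 'M[R[i]]_(m, k)) : adj (adj A) = A.
Proof. by apply/matrixP => i j; rewrite !adjE conjcK. Qed.

Lemma adjM (R : realType) m k l (A : 'M[R[i]]_(m, k)) (B : 'M[R[i]]_(k, l)) :
  adj (A *m B) = adj B *m adj A.
Proof. by rewrite /adj map_mxM trmx_mul. Qed.

Lemma adjD (R : realType) m k (A B : 'M[R[i]]_(m, k)) : adj (A + B) = adj A + adj B.
Proof. by rewrite /adj map_mxD linearD. Qed.

Lemma adjN (R : realType) m k (A : 'M[R[i]]_(m, k)) : adj (- A) = - adj A.
Proof. by rewrite /adj map_mxN linearN. Qed.

Lemma adjB (R : realType) m k (A B : 'M[R[i]]_(m, k)) : adj (A - B) = adj A - adj B.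
Proof. by rewrite adjD adjN. Qed.

Lemma adjZ (R : realType) m k (c : R[i]) (A : 'M[R[i]]_(m, k)) : adj (c *: A) = (c^*)%C *: adj A.
Proof. by rewrite /adj map_mxZ linearZ. Qed.

Lemma adj1 (R : realType) m : adj (1%:M : 'M[R[i]]_m) = 1%:M.
Proof. by rewrite /adj map_mx1 trmx1. Qed.

Definition ip (R : realType) m (x y : 'cV[R[i]]_m) : R[i] := (adj x *m y) 0 0.
Definition vn (R : realType) m (x : 'cV[R[i]]_m) : R := Num.sqrt (\sum_i cn (x i 0) ^+ 2).

Lemma ipE (R : realType) m (x y : 'cV[R[i]]_m) : ip x y = \sum_i ((x i 0)^*)%C * y i 0.
Proof. by rewrite /ip mxE; apply: eq_bigr => i _; rewrite adjE. Qed.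

Lemma vn_ge0 (R : realType) m (x : 'cV[R[i]]_m) : 0 <= vn x.
Proof. exact: sqrtr_ge0. Qed.
#[global] Hint Extern 0 (is_true (@Order.le _ _ _ (vn _))) => exact: vn_ge0 : core.

Lemma vn_sqr (R : realType) m (x : 'cV[R[i]]_m) : vn x ^+ 2 = \sum_i cn (x i 0) ^+ 2.
Proof. by rewrite sqr_sqrtr // sumr_ge0 // => i _; rewrite sqr_ge0. Qed.

Lemma ipxx (R : realType) m (x : 'cV[R[i]]_m) : ip x x = (vn x ^+ 2)%:C%C.
Proof.
rewrite ipE vn_sqr rmorph_sum; apply: eq_bigr => i _.
by rewrite mulrC mulcJ.
Qed.

Lemma ipJ (R : realType) m (x y : 'cV[R[i]]_m) : ip y x = ((ip x y)^*)%C.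
Proof.
rewrite !ipE rmorph_sum; apply: eq_bigr => i _.
by rewrite rmorphM /= conjcK mulrC.
Qed.

Lemma ipDr (R : realType) m (x y z : 'cV[R[i]]_m) : ip x (y + z) = ip x y + ip x z.
Proof. by rewrite /ip mulmxDr mxE. Qed.
Lemma ipNr (R : realType) m (x y : 'cV[R[i]]_m) : ip x (- y) = - ip x y.
Proof. by rewrite /ip mulmxN mxE. Qed.
Lemma ipBr (R : realType) m (x y z : 'cV[R[i]]_m) : ip x (y - z) = ip x y - ip x z.
Proof. by rewrite ipDr ipNr. Qed.
Lemma ipZr (R : realType) m c (x y : 'cV[R[i]]_m) : ip x (c *: y) = c * ip x y.
Proof. by rewrite /ip -scalemxAr mxE. Qed.
Lemma ipDl (R : realType) m (x y z : 'cV[R[i]]_m) : ip (y + z) x = ip y x + ip z x.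
Proof. by rewrite /ip adjD mulmxDl mxE. Qed.
Lemma ipNl (R : realType) m (x y : 'cV[R[i]]_m) : ip (- y) x = - ip y x.
Proof. by rewrite /ip adjN mulNmx mxE. Qed.
Lemma ipBl (R : realType) m (x y z : 'cV[R[i]]_m) : ip (y - z) x = ip y x - ip z x.
Proof. by rewrite ipDl ipNl. Qed.
Lemma ipZl (R : realType) m c (x y : 'cV[R[i]]_m) : ip (c *: y) x = (c^*)%C * ip y x.
Proof. by rewrite /ip adjZ -scalemxAl mxE. Qed.
Lemma ip0r (R : realType) m (x : 'cV[R[i]]_m) : ip x 0 = 0.
Proof. by rewrite /ip mulmx0 mxE. Qed.

Lemma ip_adj (R : realType) m k (A : 'M[R[i]]_(k, m)) x y : ip (A *m x) y = ip x (adj A *m y).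
Proof. by rewrite /ip adjM mulmxA. Qed.

Lemma outerE (R : realType) m k (u : 'cV[R[i]]_m) (v x : 'cV[R[i]]_k) :
  u *m adj v *m x = ip v x *: u.
Proof.
rewrite -mulmxA; apply/matrixP => i j.
by rewrite !mxE big_ord1 mulrC (ord1 j) /ip.
Qed.

Lemma tr_outer (R : realType) m (u v : 'cV[R[i]]_m) : \tr (u *m adj v) = ip v u.
Proof. by rewrite mxtrace_mulC /mxtrace big_ord1. Qed.

Lemma vn_eq0 (R : realType) m (x : 'cV[R[i]]_m) : (vn x == 0) = (x == 0).
Proof.
apply/eqP/eqP => [x0|->]; last first.
  by apply/eqP; rewrite -sqrf_eq0 vn_sqr big1 // => i _; rewrite mxE cn0 expr0n.
have : \sum_i cn (x i 0) ^+ 2 = 0 by rewrite -vn_sqr x0 expr0n.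
move/psumr_eq0P => h; apply/matrixP => i j; rewrite (ord1 j) mxE.
by apply/eqP; rewrite -cn_eq0 -sqrf_eq0 h // => k _; rewrite sqr_ge0.
Qed.

Lemma vn_gt0 (R : realType) m (x : 'cV[R[i]]_m) : (0 < vn x) = (x != 0).
Proof. by rewrite lt_def vn_ge0 andbT vn_eq0. Qed.

Lemma vnZ (R : realType) m c (x : 'cV[R[i]]_m) : vn (c *: x) = cn c * vn x.
Proof.
rewrite /vn (eq_bigr (fun i => cn c ^+ 2 * cn (x i 0) ^+ 2)); last first.
  by move=> i _; rewrite mxE cnM exprMn.
by rewrite -mulr_sumr sqrtrM ?sqr_ge0 // sqrtr_sqr ger0_norm.
Qed.

Lemma vnN (R : realType) m (x : 'cV[R[i]]_m) : vn (- x) = vn x.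
Proof. by rewrite -scaleN1r vnZ cnN cn1 mul1r. Qed.

Lemma vn_unitP (R : realType) m (x : 'cV[R[i]]_m) : vn x = 1 <-> ip x x = 1.
Proof.
rewrite ipxx; split=> [->|h]; first by rewrite expr1n.
have h2 : vn x ^+ 2 = 1 by exact: (@complexI R).
by apply/eqP; rewrite -(@eqrXn2 _ 2) ?expr1n ?h2.
Qed.

Lemma addcJ (R : realType) (z : R[i]) : z + (z^*)%C = (2 * complex.Re z)%:C%C.
Proof. by case: z => a b; apply/eqP; rewrite eq_complex /= subrr eqxx andbT mulr2n mulrDl mul1r. Qed.

Lemma vnB_sqr (R : realType) m (x y : 'cV[R[i]]_m) :
  vn (x - y) ^+ 2 = vn x ^+ 2 + vn y ^+ 2 - 2 * complex.Re (ip x y).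
Proof.
apply: (@complexI R); rewrite -ipxx ipBl !ipBr (ipJ x y) !ipxx.
by rewrite (rmorphB (real_complex R)) (rmorphD (real_complex R)) /= -addcJ; ring.
Qed.

Lemma CS (R : realType) m (x y : 'cV[R[i]]_m) : cn (ip x y) <= vn x * vn y.
Proof.
have [y0|y0] := eqVneq y 0.
  by rewrite y0 ip0r cn0 mulr_ge0.
have vy : 0 < vn y by rewrite vn_gt0.
rewrite -(@ler_pXn2r _ 2) ?nnegrE ?mulr_ge0 // exprMn.
have := sqr_ge0 (vn (x - (ip y x / (vn y ^+ 2)%:C%C) *: y)).
rewrite vnB_sqr vnZ ipZr cnM cnV cn_real (ger0_norm (sqr_ge0 _)).
have -> : ip y x / (vn y ^+ 2)%:C%C * ip x y = (cn (ip x y) ^+ 2 / vn y ^+ 2)%:C%C.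
  by rewrite (fmorph_div (real_complex R)) /= -mulcJ -ipJ; ring.
rewrite /= (ipJ x y) cnJ.
have -> : (cn (ip x y) / vn y ^+ 2 * vn y) ^+ 2 = cn (ip x y) ^+ 2 / vn y ^+ 2.
  by field; rewrite gt_eqF.
move=> h; have : cn (ip x y) ^+ 2 / vn y ^+ 2 <= vn x ^+ 2 by lra.
by rewrite ler_pdivrMr // exprn_gt0.
Qed.

Lemma vnD (R : realType) m (x y : 'cV[R[i]]_m) : vn (x + y) <= vn x + vn y.
Proof.
rewrite -(@ler_pXn2r _ 2) ?nnegrE ?addr_ge0 // sqrrD.
rewrite -[y in vn (x + y)]opprK vnB_sqr vnN ipNr raddfN /=.
have := le_trans (cn_geRe _) (CS x y); rewrite ler_norml; lra.
Qed.

Lemma le_coord_vn (R : realType) m (x : 'cV[R[i]]_m) i : cn (x i 0) <= vn x.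
Proof.
rewrite -(@ler_pXn2r _ 2) ?nnegrE // vn_sqr (bigD1 i) //= lerDl.
by apply: sumr_ge0 => j _; rewrite sqr_ge0.
Qed.


Lemma orth_ip (R : realType) n (P : Mat R n) x y : orth_proj P -> ip (P *m x) y = ip x (P *m y).
Proof. by case=> h _; rewrite ip_adj h. Qed.

Lemma orth_outer (R : realType) n (u : Vec R n) : ip u u = 1 -> orth_proj (u *m adj u).
Proof.
move=> u1; split; first by rewrite adjM adjK.
by rewrite mulmxA outerE u1 scale1r.
Qed.

Lemma rank1_outer (R : realType) n (u : Vec R n) : ip u u = 1 -> rank1proj (u *m adj u).
Proof. by move=> u1; split; [exact: orth_outer|rewrite tr_outer]. Qed.

Lemma rank2_outer (R : realType) n (u v : Vec R n) : ip u u = 1 -> ip v v = 1 -> ip u v = 0 ->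
  rank2proj (u *m adj u + v *m adj v).
Proof.
move=> u1 v1 uv; have vu : ip v u = 0 by rewrite ipJ uv conjc0.
split; last by rewrite raddfD /= !tr_outer u1 v1.
split; first by rewrite adjD !adjM !adjK.
rewrite mulmxDl !mulmxDr !mulmxA !outerE u1 v1 uv vu !scale1r !scale0r !mul0mx.
by rewrite addr0 add0r.
Qed.

Lemma tr_proj (R : realType) n (P : Mat R n) : orth_proj P ->
  \tr P = (\sum_i \sum_j cn (P i j) ^+ 2)%:C%C.
Proof.
case=> h1 h2; rewrite -{1}h2 -{2}h1 /mxtrace rmorph_sum; apply: eq_bigr => i _.
by rewrite mxE rmorph_sum; apply: eq_bigr => j _; rewrite adjE mulcJ.
Qed.

Lemma tr_proj0 (R : realType) n (P : Mat R n) : orth_proj P -> \tr P = 0 -> P = 0.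
Proof.
move=> h; rewrite (tr_proj h) => /(@complexI R)/psumr_eq0P h0; apply/matrixP => i j; rewrite mxE.
have /psumr_eq0P h1 : \sum_j cn (P i j) ^+ 2 = 0.
  by apply: h0 => // k _; apply: sumr_ge0 => l _; rewrite sqr_ge0.
by apply/eqP; rewrite -cn_eq0 -sqrf_eq0 h1 // => k _; rewrite sqr_ge0.
Qed.

Lemma proj_split (R : realType) n (P : Mat R n) u : orth_proj P -> P *m u = u -> ip u u = 1 ->
  orth_proj (P - u *m adj u) /\ \tr (P - u *m adj u) = \tr P - 1.
Proof.
case=> h1 h2 Pu u1; split; last by rewrite raddfB /= tr_outer u1.
have uP : adj u *m P = adj u by rewrite -[in RHS]Pu adjM h1.
split; first by rewrite adjB h1 adjM adjK.
rewrite mulmxBl !mulmxBr h2 (mulmxA P) Pu -(mulmxA u) uP mulmxA outerE u1 scale1r.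
by rewrite subrr subr0.
Qed.

Definition nrm (R : realType) m (x : 'cV[R[i]]_m) : 'cV[R[i]]_m := ((vn x)^-1)%:C%C *: x.

Lemma nrm_unit (R : realType) m (x : 'cV[R[i]]_m) : x != 0 -> ip (nrm x) (nrm x) = 1.
Proof.
move=> x0; apply/vn_unitP; rewrite vnZ cn_real ger0_norm ?invr_ge0 //.
by rewrite mulVf // vn_eq0.
Qed.

(** A unit vector in the range of a nonzero projector: its first nonzero column, normalized. This
    explicit choice is measurable in [P]. *)
Definition fr (R : realType) n (P : Mat R n) : Vec R n :=
  foldr (fun j acc => if col j P == 0 then acc else nrm (col j P)) 0 (enum 'I_n.+1).

Lemma fr_spec (R : realType) n (P : Mat R n) : orth_proj P -> P != 0 ->
  ip (fr P) (fr P) = 1 /\ P *m fr P = fr P.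
Proof.
move=> [_ h2] P0.
have [j jc] : exists j, col j P != 0.
  apply: contrapT => h; case/eqP: P0; apply/matrixP => i j.
  have [/eqP e|e] := boolP (col j P == 0); last by case: h; exists j.
  by have /matrixP/(_ i 0) := e; rewrite !mxE.
have Pc k : P *m col k P = col k P by rewrite -[in RHS]h2 colE mulmxA -colE.
rewrite /fr; have : j \in enum 'I_n.+1 by rewrite mem_enum.
elim: (enum _) => // k s IH; rewrite inE /=; case: ifPn => [/eqP e|e _].
  by case/orP => [/eqP jk|//]; rewrite jk e eqxx in jc.
by split; [exact: nrm_unit|rewrite /nrm -scalemxAr Pc].
Qed.

Lemma rank1_fr (R : realType) n (Z : Mat R n) : rank1proj Z ->
  Z = fr Z *m adj (fr Z) /\ ip (fr Z) (fr Z) = 1.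
Proof.
case=> oZ tZ; have Z0 : Z != 0.
  by apply/eqP => e; move/eqP: tZ; rewrite e raddf0 eq_sym oner_eq0.
have [u1 Zu] := fr_spec oZ Z0; split=> //.
have [ho ht] := proj_split oZ Zu u1.
by apply/eqP; rewrite -subr_eq0; apply/eqP/tr_proj0 => //; rewrite ht tZ subrr.
Qed.

(** [fu L] and [fv L] form an orthonormal frame of the line [L], measurable in [L]; all coordinates
    on lines refer to it. *)
Definition fu (R : realType) n (L : Mat R n) : Vec R n := fr L.
Definition fv (R : realType) n (L : Mat R n) : Vec R n := fr (L - fr L *m adj (fr L)).

Lemma proj_orth (R : realType) n (P : Mat R n) u w : orth_proj P -> P *m u = u -> ip u u = 1 ->
  (P - u *m adj u) *m w = w -> P *m w = w /\ ip u w = 0.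
Proof.
move=> oP Pu u1 hw.
have uw : ip u w = 0.
  by rewrite -hw mulmxBl outerE ipBr ipZr u1 mulr1 -orth_ip // Pu subrr.
by split=> //; move: hw; rewrite mulmxBl outerE uw scale0r subr0.
Qed.

Lemma rank2_frame (R : realType) n (L : Mat R n) : rank2proj L ->
  [/\ L = fu L *m adj (fu L) + fv L *m adj (fv L), ip (fu L) (fu L) = 1, ip (fv L) (fv L) = 1,
      ip (fu L) (fv L) = 0 & L *m fu L = fu L /\ L *m fv L = fv L].
Proof.
case=> oL tL; have L0 : L != 0.
  by apply/eqP => e; move/eqP: tL; rewrite e raddf0 eq_sym pnatr_eq0.
have [u1 Lu] := fr_spec oL L0.
have [ho ht] := proj_split oL Lu u1.
have r1 : rank1proj (L - fr L *m adj (fr L)).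
  by split=> //; rewrite ht tL; ring.
have [e v1] := rank1_fr r1.
have P0 : L - fr L *m adj (fr L) != 0.
  by apply/eqP => e0; case: r1 => _ /eqP; rewrite e0 raddf0 eq_sym oner_eq0.
have [_ Lv] := fr_spec ho P0.
have [Lv' uv] := proj_orth oL Lu u1 Lv.
by split=> //; rewrite /fv -e addrC subrK.
Qed.

Lemma unitaryM (R : realType) n (U V : Mat R n) : unitary U -> unitary V -> unitary (U *m V).
Proof. by rewrite /unitary adjM => u v; rewrite mulmxA -(mulmxA U) v mulmx1. Qed.

Lemma unitaryC (R : realType) n (U : Mat R n) : unitary U -> adj U *m U = 1%:M.
Proof. exact: mulmx1C. Qed.

Lemma unitary_adj (R : realType) n (U : Mat R n) : unitary U -> unitary (adj U).
Proof. by move=> h; rewrite /unitary adjK unitaryC. Qed.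

Lemma unitary_ip (R : realType) n (U : Mat R n) x y : unitary U -> ip (U *m x) (U *m y) = ip x y.
Proof. by move=> h; rewrite ip_adj mulmxA unitaryC // mul1mx. Qed.

Lemma unitary_rank2 (R : realType) n (U L : Mat R n) : unitary U -> rank2proj L ->
  rank2proj (U *m L *m adj U).
Proof.
move=> hU /rank2_frame [e u1 v1 uv _]; rewrite e mulmxDr mulmxDl !mulmxA.
rewrite -!(mulmxA (U *m _)) -!adjM.
by apply: rank2_outer; rewrite unitary_ip.
Qed.

(** For a unit vector [w] and [cn t = 1] this is the complex reflection that multiplies [w] by [t]
    and fixes its orthogonal complement. *)
Definition twist (R : realType) n (t : R[i]) (w : Vec R n) : Mat R n :=
  1%:M + (t - 1) *: (w *m adj w).

Lemma twistE (R : realType) n t (w x : Vec R n) : twist t w *m x = x + ((t - 1) * ip w x) *: w.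
Proof. by rewrite mulmxDl mul1mx -scalemxAl outerE scalerA. Qed.

Lemma twist_unitary (R : realType) n t (w : Vec R n) : ip w w = 1 -> cn t = 1 -> unitary (twist t w).
Proof.
move=> w1 t1; rewrite /unitary /twist adjD adj1 adjZ adjM adjK.
rewrite mulmxDl mul1mx mulmxDr mulmx1 -scalemxAl -scalemxAr mulmxA outerE w1 scale1r.
rewrite -addrA scalerA -!scalerDl.
have tJ : t * (t^*)%C = 1 by rewrite mulcJ t1 expr1n.
have -> : ((t - 1)^*)%C + (t - 1 + (t - 1) * ((t - 1)^*)%C) = 0.
  have -> : ((t - 1)^*)%C = (t^*)%C - 1 by rewrite rmorphB rmorph1.
  by rewrite mulrBr mulrBl tJ; ring.
by rewrite scale0r addr0.
Qed.

(** Householder's construction: [b] is first multiplied by a phase that makes its product with [a]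
    real; the reflection in the difference then sends [a] to the new vector, and a second twist
    removes the phase. Both factors fix what is orthogonal to [a] and [b]. *)
Lemma unitary_move (R : realType) n (a b : Vec R n) : ip a a = 1 -> ip b b = 1 ->
  exists U, [/\ unitary U, U *m a = b & forall x, ip a x = 0 -> ip b x = 0 -> U *m x = x].
Proof.
move=> a1 b1.
have [t t1 tr] : exists2 t, cn t = 1 & exists r : R, ip a (t *: b) = r%:C%C.
  have [e|e] := eqVneq (ip a b) 0.
    by exists 1; [rewrite cn1|exists 0; rewrite ipZr e mulr0].
  exists (((ip a b)^*)%C / (cn (ip a b))%:C%C).
    by rewrite cnM cnV cnJ cn_real ger0_norm // divff // cn_eq0.
  exists (cn (ip a b)); rewrite ipZr mulrAC [_^*%C * _]mulrC mulcJ -fmorphV -rmorphM /=.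
  by congr (_%:C)%C; field; rewrite cn_eq0.
have tJ : t * (t^*)%C = 1 by rewrite mulcJ t1 expr1n.
have t0 : t != 0 by rewrite -cn_eq0 t1 oner_eq0.
set b' := t *: b in tr.
have b'1 : ip b' b' = 1 by rewrite ipZr ipZl b1 mulr1.
have hT : unitary (twist t^-1 b) by apply: twist_unitary => //; rewrite cnV t1 invr1.
have hTb : twist t^-1 b *m b' = b.
  rewrite twistE ipZr b1 mulr1 mulrBl mulVf // mul1r -scalerDl.
  by rewrite addrCA subrr addr0 scale1r.
have hTx x : ip b x = 0 -> twist t^-1 b *m x = x.
  by move=> h; rewrite twistE h mulr0 scale0r addr0.
have [ab|ab] := eqVneq a b'.
  exists (twist t^-1 b); split=> //; first by rewrite ab.
  by move=> x _; exact: hTx.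
have d0 : a - b' != 0 by rewrite subr_eq0.
pose w := nrm (a - b').
have w1 : ip w w = 1 by exact: nrm_unit.
exists (twist t^-1 b *m twist (-1) w); split.
- by apply: (unitaryM hT); apply: (twist_unitary w1); rewrite cnN cn1.
- rewrite -mulmxA -[RHS]hTb; congr (_ *m _); rewrite twistE.
  have [r rE] := tr.
  have b'a : ip b' a = r%:C%C by rewrite ipJ rE conjc_real.
  have vs : (vn (a - b') ^+ 2)%:C%C = 2 * (1 - r%:C%C).
    by rewrite -ipxx ipBl !ipBr a1 b'1 rE b'a; ring.
  have vv : vn (a - b') != 0 by rewrite vn_eq0.
  have v0 : (vn (a - b') ^+ 2)%:C%C != 0 by rewrite fmorph_eq0 expf_neq0.
  rewrite /w /nrm ipZl scalerA ipBl a1 b'a conjc_real.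
  have -> : (-1 - 1) * ((vn (a - b'))^-1%:C%C * (1 - r%:C%C)) * (vn (a - b'))^-1%:C%C = -1 :> R[i].
    rewrite (_ : _ * _ = - (2 * (1 - r%:C%C)) * ((vn (a - b'))^-1 * (vn (a - b'))^-1)%:C%C).
      rewrite -vs -invfM -expr2 mulNr fmorphV divff //.
    by rewrite rmorphM /=; ring.
  by rewrite scaleN1r opprB addrC subrK.
- move=> x xa xb; rewrite -mulmxA.
  have -> : twist (-1) w *m x = x; last exact: hTx.
  by rewrite twistE /w /nrm ipZl ipBl xa ipZl xb !mulr0 subrr !mulr0 scale0r addr0.
Qed.

(** Transitivity on lines. The matrix that corrects the second frame vector fixes the first one,
    which is orthogonal to both vectors involved. *)
Lemma unitary_move2 (R : realType) n (L L' : Mat R n) : rank2proj L -> rank2proj L' ->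
  exists2 U, unitary U & L' = U *m L *m adj U.
Proof.
move=> /rank2_frame [eL u1 v1 uv _] /rank2_frame [eL' u1' v1' uv' _].
have [U1 [hU1 U1u _]] := unitary_move u1 u1'.
have w1 : ip (U1 *m fv L) (U1 *m fv L) = 1 by rewrite unitary_ip.
have wu : ip (U1 *m fv L) (fu L') = 0 by rewrite -U1u unitary_ip // ipJ uv conjc0.
have [U2 [hU2 U2v U2x]] := unitary_move w1 v1'.
exists (U2 *m U1); first exact: unitaryM.
have e1 : U2 *m U1 *m fu L = fu L' by rewrite -mulmxA U1u U2x // ipJ uv' conjc0.
have e2 : U2 *m U1 *m fv L = fv L' by rewrite -mulmxA.
rewrite [in RHS]eL mulmxDr mulmxDl !mulmxA -!(mulmxA (_ *m _)) -!adjM.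
by rewrite e1 e2 !mulmxA e1 e2 -eL'.
Qed.

(** * Measurable complex functions and measurable choice of roots *)

Lemma measurable_setb (dT : measure_display) (T : measurableType dT) (f : T -> bool) :
  measurable_fun setT f -> measurable [set x | f x].
Proof.
move=> mf; have := mf measurableT [set true] I; rewrite setTI.
by congr measurable; apply/seteqP; split=> x /=.
Qed.

Lemma measurable_boolset (dT : measure_display) (T : measurableType dT) (f : T -> bool) :
  measurable [set x | f x] -> measurable_fun setT f.
Proof.
move=> mf; apply: (@measurable_fun_bool _ _ _ _ true); rewrite setTI.
by move: mf; congr measurable; apply/seteqP; split=> x /=.
Qed.

Lemma measurable_funT_le (dT : measure_display) (T : measurableType dT) (R : realType) (f : T -> R) :
  (forall a, measurable [set x | f x <= a]) -> measurable_fun setT f.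
Proof.
move=> H; apply: (measurability (@RGenOInfty.G R)).
  exact: RGenOInfty.measurableE.
move=> _ [_ [a ->] <-]; rewrite setTI.
rewrite (_ : _ @^-1` _ = ~` [set x | f x <= a]); first exact: measurableC.
by apply/seteqP; split=> x /=; rewrite in_itv /= andbT ltNge => /negP.
Qed.

Lemma measurable_sqrt (dT : measure_display) (T : measurableType dT) (R : realType) (f : T -> R) :
  measurable_fun setT f -> measurable_fun setT (fun x => Num.sqrt (f x)).
Proof.
move=> mf; apply: (@measurableT_comp _ _ _ _ _ _ (fun x : R => Num.sqrt x)) => //.
by apply: continuous_measurable_fun; exact: sqrt_continuous.
Qed.

Lemma measurable_inv_ge0 (dT : measure_display) (T : measurableType dT) (R : realType) (f : T -> R) :
  (forall x, 0 <= f x) -> measurable_fun setT f -> measurable_fun setT (fun x => (f x)^-1).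
Proof.
move=> f0 mf; rewrite (_ : (fun _ => _) = (fun x => (f x) `^ (-1))).
  by apply: (@measurableT_comp _ _ _ _ _ _ (fun x : R => x `^ (-1))) => //; exact: measurable_powR.
by apply/funext => x; rewrite powR_inv1.
Qed.

Definition cmeas (dT : measure_display) (T : measurableType dT) (R : realType) (f : T -> R[i]) :=
  measurable_fun setT (fun x => complex.Re (f x)) /\ measurable_fun setT (fun x => complex.Im (f x)).

Section cmeas_closure.
Context (dT : measure_display) (T : measurableType dT) (R : realType).
Implicit Types f g : T -> R[i].

Lemma cmeas_cst c : cmeas (fun _ : T => c : R[i]).
Proof. by split; exact: measurable_cst. Qed.

Lemma cmeas_real (h : T -> R) : measurable_fun setT h -> cmeas (fun x => (h x)%:C%C).
Proof. by move=> mh; split=> //=; exact: measurable_cst. Qed.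

Lemma cmeasD f g : cmeas f -> cmeas g -> cmeas (fun x => f x + g x).
Proof.
move=> [f1 f2] [g1 g2]; split.
  have := measurable_funD f1 g1; congr measurable_fun; apply/funext => x /=.
  by rewrite -raddfD.
have := measurable_funD f2 g2; congr measurable_fun; apply/funext => x /=.
by rewrite -raddfD.
Qed.

Lemma cmeasN f : cmeas f -> cmeas (fun x => - f x).
Proof.
move=> [f1 f2]; split.
  have := measurable_funN f1; congr measurable_fun; apply/funext => x /=.
  by rewrite -raddfN.
have := measurable_funN f2; congr measurable_fun; apply/funext => x /=.
by rewrite -raddfN.
Qed.

Lemma cmeasB f g : cmeas f -> cmeas g -> cmeas (fun x => f x - g x).
Proof. by move=> hf hg; apply: cmeasD => //; exact: cmeasN. Qed.

Lemma cmeasM f g : cmeas f -> cmeas g -> cmeas (fun x => f x * g x).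
Proof.
move=> [f1 f2] [g1 g2]; split.
  have := measurable_funB (measurable_funM f1 g1) (measurable_funM f2 g2).
  by congr measurable_fun; apply/funext => x /=; case: (f x) (g x) => a b [].
have := measurable_funD (measurable_funM f1 g2) (measurable_funM f2 g1).
by congr measurable_fun; apply/funext => x /=; case: (f x) (g x) => a b [].
Qed.

Lemma cmeasJ f : cmeas f -> cmeas (fun x => ((f x)^*)%C).
Proof.
move=> [f1 f2]; split.
  by move: f1; congr measurable_fun; apply/funext => x; case: (f x).
have := measurable_funN f2; congr measurable_fun; apply/funext => x /=.
by case: (f x).
Qed.

Lemma measurable_cn f : cmeas f -> measurable_fun setT (fun x => cn (f x)).
Proof.
move=> [f1 f2]; rewrite (_ : (fun _ => _) = (fun x => Num.sqrt (complex.Re (f x) ^+ 2 + complex.Im (f x) ^+ 2))).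
  by apply: measurable_sqrt; apply: measurable_funD; exact: measurable_funX.
by apply/funext => x; rewrite cn_def.
Qed.

Lemma cmeas_sum (I : Type) (s : seq I) (P : pred I) (F : I -> T -> R[i]) :
  (forall i, cmeas (F i)) -> cmeas (fun x => \sum_(i <- s | P i) F i x).
Proof.
move=> h; elim: s => [|i s IH].
  by rewrite (_ : (fun _ => _) = fun=> 0); [exact: cmeas_cst|apply/funext => x; rewrite big_nil].
case Pi: (P i); last by move: IH; congr cmeas; apply/funext => x; rewrite big_cons Pi.
by have := cmeasD (h i) IH; congr cmeas; apply/funext => x; rewrite big_cons Pi.
Qed.

Lemma cmeasX f k : cmeas f -> cmeas (fun x => f x ^+ k).
Proof.
move=> h; elim: k => [|k IH]; first exact: cmeas_cst.
by have := cmeasM h IH; congr cmeas; apply/funext => x; rewrite exprS.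
Qed.

Lemma cmeas_prod (I : Type) (s : seq I) (P : pred I) (F : I -> T -> R[i]) :
  (forall i, cmeas (F i)) -> cmeas (fun x => \prod_(i <- s | P i) F i x).
Proof.
move=> h; elim: s => [|i s IH].
  by rewrite (_ : (fun _ => _) = fun=> 1); [exact: cmeas_cst|apply/funext => x; rewrite big_nil].
case Pi: (P i); last by move: IH; congr cmeas; apply/funext => x; rewrite big_cons Pi.
by have := cmeasM (h i) IH; congr cmeas; apply/funext => x; rewrite big_cons Pi.
Qed.

Lemma cmeas_neq0 f : cmeas f -> measurable_fun setT (fun x => f x != 0).
Proof.
move=> h; rewrite (_ : (fun _ => _) = (fun x => 0 < cn (f x))).
  by apply: measurable_fun_ltr; [exact: measurable_cst|exact: measurable_cn].
by apply/funext => x; rewrite cn_gt0.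
Qed.

Lemma cmeas_if (b : T -> bool) f g : measurable_fun setT b -> cmeas f -> cmeas g ->
  cmeas (fun x => if b x then f x else g x).
Proof.
move=> mb [f1 f2] [g1 g2]; split.
  by have := measurable_fun_ifT mb f1 g1; congr measurable_fun; apply/funext => x; case: (b x).
by have := measurable_fun_ifT mb f2 g2; congr measurable_fun; apply/funext => x; case: (b x).
Qed.

Lemma cmeas_cplx (f g : T -> R) : measurable_fun setT f -> measurable_fun setT g ->
  cmeas (fun x => (f x +i* g x)%C).
Proof. by []. Qed.

End cmeas_closure.

Lemma rat_approx (R : realType) (x e : R) : 0 < e -> exists q : rat, `|ratr q - x| < e.
Proof.
move=> e0; have [|q] := @rat_in_itvoo R (x - e) (x + e); first by lra.
by rewrite in_itv /= => /andP[h1 h2]; exists q; rewrite ltr_norml; apply/andP; split; lra.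
Qed.

Lemma crat_approx (R : realType) (z : R[i]) (e : R) : 0 < e ->
  exists a b : rat, cn ((ratr a +i* ratr b)%C - z) < e.
Proof.
move=> e0; have [|a ha] := @rat_approx R (complex.Re z) (e / 2); first by lra.
have [|b hb] := @rat_approx R (complex.Im z) (e / 2); first by lra.
exists a, b; apply: le_lt_trans (cn_leD _) _; rewrite !raddfB /=.
by lra.
Qed.

Lemma horner_bound (R : realType) (p : {poly R[i]}) (M : R) (z : R[i]) : 0 <= M -> cn z <= M ->
  cn p.[z] <= \sum_(k < size p) cn p`_k * M ^+ k.
Proof.
move=> M0 zM; rewrite horner_coef; apply: le_trans (cn_sum _ _ _) _.
apply: ler_sum => k _; rewrite cnM cnX ler_wpM2l //.
by apply: lerXn2r; rewrite ?nnegrE.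
Qed.

Lemma root_approx (R : realType) (p : {poly R[i]}) (z : R[i]) (e : R) : root p z -> 0 < e ->
  exists2 dl, 0 < dl & forall q, cn (q - z) < dl -> cn p.[q] < e.
Proof.
move=> /factor_theorem [g ->] e0.
pose B := \sum_(k < size g) cn g`_k * (cn z + 1) ^+ k.
have B0 : 0 <= B by apply: sumr_ge0 => k _; rewrite mulr_ge0 // exprn_ge0 // addr_ge0.
exists (Num.min 1 (e / (B + 1))).
  by rewrite lt_min ltr01 divr_gt0 //; lra.
move=> q; rewrite lt_min => /andP[q1 q2].
rewrite hornerM hornerXsubC cnM.
have gB : cn g.[q] <= B.
  apply: horner_bound; first by rewrite addr_ge0.
  by have := cnD (q - z) z; rewrite subrK; lra.
apply: le_lt_trans (_ : B * cn (q - z) < e); first by rewrite ler_wpM2r.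
move: q2; rewrite ltr_pdivlMr; last by lra.
by have := cn_ge0 (q - z); nra.
Qed.

Lemma prodr_ge_exp (R : realType) (T : eqType) (f : T -> R) (e : R) (s : seq T) : 0 <= e ->
  (forall z, z \in s -> e <= f z) -> e ^+ size s <= \prod_(z <- s) f z.
Proof.
move=> e0; elim: s => [|x s IH] h; first by rewrite big_nil.
rewrite big_cons /= exprS; apply: ler_pM => //; first exact: exprn_ge0.
  by apply: h; rewrite mem_head.
by apply: IH => z zs; apply: h; rewrite inE zs orbT.
Qed.

Lemma list_min (R : realType) (T : eqType) (f : T -> R) (s : seq T) : s != [::] ->
  exists2 z, z \in s & forall w, w \in s -> f z <= f w.
Proof.
elim: s => // x [|y s] IH _.
  by exists x; rewrite ?mem_head // => w; rewrite inE => /eqP ->.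
have [//|z zs hz] := IH; have [h|h] := leP (f x) (f z).
  exists x; rewrite ?mem_head // => w; rewrite inE => /orP[/eqP-> //|/hz].
  exact: le_trans.
exists z; first by rewrite inE zs orbT.
by move=> w; rewrite inE => /orP[/eqP->|/hz //]; exact: ltW.
Qed.

Definition clroots (R : realType) (p : {poly R[i]}) : seq R[i] := sval (closed_field_poly_normal p).

Lemma clrootsE (R : realType) (p : {poly R[i]}) :
  p = lead_coef p *: \prod_(z <- clroots p) ('X - z%:P).
Proof. exact: (svalP (closed_field_poly_normal p)). Qed.

Lemma clroots_root (R : realType) (p : {poly R[i]}) z : p != 0 -> (z \in clroots p) = root p z.
Proof.
move=> p0; rewrite [in RHS](clrootsE p) rootZ ?lead_coef_eq0 //.
by rewrite root_prod_XsubC.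
Qed.

Lemma clroots_size (R : realType) (p : {poly R[i]}) : p != 0 -> size p = (size (clroots p)).+1.
Proof.
by move=> p0; rewrite {1}(clrootsE p) size_scale ?lead_coef_eq0 // size_prod_XsubC.
Qed.

Definition pmeas (dT : measure_display) (T : measurableType dT) (R : realType) (F : T -> {poly R[i]}) :=
  forall k, cmeas (fun x => (F x)`_k).

Lemma pmeas_horner (dT : measure_display) (T : measurableType dT) (R : realType)
    (F : T -> {poly R[i]}) N (z : T -> R[i]) :
  (forall x, (size (F x) <= N)%N) -> pmeas F -> cmeas z -> cmeas (fun x => (F x).[z x]).
Proof.
move=> sF mF mz; rewrite (_ : (fun _ => _) = fun x => \sum_(k < N) (F x)`_k * z x ^+ k).
  by apply: cmeas_sum => k; apply: cmeasM => //; exact: cmeasX.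
by apply/funext => x; apply: horner_coef_wide.
Qed.

Lemma pmeas_size (dT : measure_display) (T : measurableType dT) (R : realType)
    (F : T -> {poly R[i]}) N : (forall x, (size (F x) <= N)%N) -> pmeas F ->
  measurable_fun setT (fun x => (1 < size (F x))%N).
Proof.
move=> sF mF; apply: measurable_boolset.
rewrite (_ : [set x | _] = \bigcup_(k : nat) [set x | (F x)`_k.+1 != 0]).
  apply: bigcupT_measurable => k; apply: measurable_setb.
  exact: cmeas_neq0.
apply/seteqP; split=> x /=.
  move=> h; exists (size (F x)).-2 => //=.
  have -> : (size (F x)).-2.+1 = (size (F x)).-1 by case: (size (F x)) h => [|[]].
  by rewrite -lead_coefE lead_coef_eq0 -size_poly_gt0 ltnW.
move=> [k _ /=]; apply: contraNT; rewrite -leqNgt => h; apply/eqP.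
by rewrite nth_default //; apply: leq_trans h _.
Qed.

(* [g x <= 0] stands for membership in a closed set depending measurably on [x]. *)
Lemma root_set_measurable (dT : measure_display) (T : measurableType dT) (R : realType)
    (F : T -> {poly R[i]}) N (g : T -> R[i] -> R) :
  (forall x, (size (F x) <= N)%N) -> pmeas F ->
  (forall x z w, g x z - g x w <= cn (z - w)) ->
  (forall q, measurable_fun setT (g^~ q)) ->
  measurable [set x | (1 < size (F x))%N /\ exists2 z, root (F x) z & g x z <= 0].
Proof.
move=> sF mF gL mg.
pose A k (a b : rat) := [set x | g x (ratr a +i* ratr b)%C < k.+1%:R^-1] `&`
   [set x | cn (F x).[(ratr a +i* ratr b)%C] < k.+1%:R^-1].
rewrite (_ : [set x | _] = [set x | (1 < size (F x))%N] `&` \bigcap_(k : nat) \bigcup_a \bigcup_b A k a b).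
  apply: measurableI; first by apply: measurable_setb; exact: pmeas_size sF mF.
  apply: bigcapT_measurable => k; apply: bigcupT_measurable_rat => a; apply: bigcupT_measurable_rat => b.
  apply: measurableI; apply: measurable_setb.
    by apply: measurable_fun_ltr => //; exact: measurable_cst.
  apply: measurable_fun_ltr; last exact: measurable_cst.
  by apply: measurable_cn; apply: (pmeas_horner sF) => //; exact: cmeas_cst.
apply/seteqP; split=> x /= [s1 h]; split=> //.
  case: h => z rz gz k _.
  have k0 : 0 < k.+1%:R^-1 :> R by rewrite invr_gt0 ltr0n.
  have [dl dl0 hdl] := root_approx rz k0.
  have [|a [b hab]] := @crat_approx R z (Num.min dl (k.+1%:R^-1)).
    by rewrite lt_min dl0.
  move: hab; rewrite lt_min => /andP[h1 h2].
  exists a => //; exists b => //; split=> /=; last exact: hdl.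
  apply: le_lt_trans (le_trans _ (gL x _ z)) h2.
  by rewrite lerDl oppr_ge0.
have F0 : F x != 0 by rewrite -size_poly_gt0 ltnW.
apply: contrapT => hno.
have rs0 : clroots (F x) != [::].
  by apply: contraTneq s1 => e; rewrite (clroots_size F0) e.
have [z zr hz] := list_min (g x) rs0.
have gz : 0 < g x z.
  by rewrite ltNge; apply/negP => h'; apply: hno; exists z; rewrite // -clroots_root.
(* As [g x] is 1-Lipschitz and at least [2 * et] on the roots, a point with [g x q < et] is at
   distance at least [et] from every root, so [F x] has modulus at least [m] there. *)
pose et := g x z / 2.
have et0 : 0 < et by rewrite /et divr_gt0.
pose m := cn (lead_coef (F x)) * et ^+ size (clroots (F x)).
have m0 : 0 < m by rewrite mulr_gt0 ?cn_gt0 ?lead_coef_eq0 ?exprn_gt0.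
have [k hk] : exists k : nat, k.+1%:R^-1 < Num.min et m.
  have mm : 0 < Num.min et m by rewrite lt_min et0.
  exists (Num.bound (Num.min et m)^-1); rewrite -[X in _ < X]invrK ltf_pV2 ?posrE ?invr_gt0 ?ltr0n //.
  have := archi_boundP (ltW (_ : 0 < (Num.min et m)^-1)); rewrite invr_gt0 => /(_ mm) h2.
  by apply: lt_le_trans h2 _; rewrite ler_nat.
have [a _ [b _ [/= h1 h2]]] := h k I.
set q := (_ +i* _)%C in h1 h2.
move: hk; rewrite lt_min => /andP[k1 k2].
have : m <= cn (F x).[q].
  rewrite [in X in _ <= X](clrootsE (F x)) hornerZ cnM ler_pM2l ?cn_gt0 ?lead_coef_eq0 //.
  rewrite horner_prod cn_prod; apply: prodr_ge_exp => [|w ws]; first exact: ltW.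
  rewrite hornerXsubC cnB; apply: le_trans (gL x w q).
  by move: (hz w ws) (lt_trans h1 k1); rewrite /et; clear; lra.
by move=> h3; have := lt_trans (le_lt_trans h3 h2) k2; rewrite ltxx.
Qed.

Lemma cnB_lipRe (R : realType) (z w : R[i]) : complex.Re z - complex.Re w <= cn (z - w).
Proof. by rewrite -raddfB; apply: le_trans (cn_geRe _); exact: ler_norm. Qed.

Lemma cnB_lipIm (R : realType) (z w : R[i]) : complex.Im z - complex.Im w <= cn (z - w).
Proof. by rewrite -raddfB; apply: le_trans (cn_geIm _); exact: ler_norm. Qed.

(* The selected root has least real part and, among those, least imaginary part. *)
Lemma measurable_root (dT : measure_display) (T : measurableType dT) (R : realType)
    (F : T -> {poly R[i]}) N :
  (forall x, (size (F x) <= N)%N) -> pmeas F ->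
  exists2 z : T -> R[i], cmeas z & forall x, (1 < size (F x))%N -> root (F x) (z x).
Proof.
move=> sF mF.
have mA := pmeas_size sF mF.
pose A := [set x | (1 < size (F x))%N].
have rsP x : A x -> [/\ clroots (F x) != [::] & forall z, (z \in clroots (F x)) = root (F x) z].
  move=> s1; have F0 : F x != 0 by rewrite -size_poly_gt0 ltnW.
  split; last by move=> z; exact: clroots_root.
  by apply: contraTneq s1 => e; rewrite (clroots_size F0) e.
have /choice [rho hrho] : forall x, exists r : R, if (1 < size (F x))%N then
    (exists2 z, root (F x) z & complex.Re z = r) /\ (forall z, root (F x) z -> r <= complex.Re z) else r = 0.
  move=> x; case s1: (1 < size (F x))%N; last by exists 0.
  have [n0 hr] := rsP x s1; have [z zs hz] := list_min (fun z => complex.Re z) n0.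
  exists (complex.Re z); split; first by exists z; rewrite -?hr.
  by move=> w; rewrite -hr => /hz.
have mrho : measurable_fun setT rho.
  apply: measurable_funT_le => a.
  rewrite (_ : [set x | _] = [set x | (1 < size (F x))%N /\ exists2 z, root (F x) z & complex.Re z - a <= 0]
     `|` (~` A `&` [set x | 0 <= a])).
    apply: measurableU; last first.
      apply: measurableI; first by apply: measurableC; exact: measurable_setb.
      have [h|h] := leP 0 a; first by rewrite (_ : [set x | _] = setT) //; apply/seteqP; split.
      by rewrite (_ : [set x | _] = set0) //; apply/seteqP; split.
    apply: (root_set_measurable sF mF (g := fun _ z => complex.Re z - a)).
      by move=> x z w; have := cnB_lipRe z w; lra.
    by move=> q; exact: measurable_cst.
  apply/seteqP; split=> x /=.
    move=> h; have := hrho x; case: ifPn => s1.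
      by case=> -[z rz zr] _; left; split=> //; exists z; rewrite ?zr ?subr_le0.
    by move=> r0; right; split=> //; [apply/negP|rewrite -r0].
  case=> [[s1 [z rz hz]]|[/negP s1 a0]]; have := hrho x.
    by rewrite s1 => -[_ /(_ z rz)]; move: hz; rewrite subr_le0 => h1 h2; exact: le_trans h1.
  by rewrite (negbTE s1) => ->.
have /choice [sig hsig] : forall x, exists r : R, if (1 < size (F x))%N then
    (exists2 z, root (F x) z & complex.Re z = rho x /\ complex.Im z = r) /\
    (forall z, root (F x) z -> complex.Re z = rho x -> r <= complex.Im z) else r = 0.
  move=> x; case s1: (1 < size (F x))%N; last by exists 0.
  have := hrho x; rewrite s1 => -[[z0 rz0 z0r] _].
  have [n0 hr] := rsP x s1.
  have [|z] := list_min (fun z => complex.Im z) (s := [seq z <- clroots (F x) | complex.Re z == rho x]).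
    have : z0 \in [seq z <- clroots (F x) | complex.Re z == rho x] by rewrite mem_filter z0r eqxx hr.
    by case: [seq z <- clroots (F x) | complex.Re z == rho x].
  rewrite mem_filter hr => /andP[/eqP h1 h2] h3.
  exists (complex.Im z); split; first by exists z.
  by move=> w rw wr; apply: h3; rewrite mem_filter wr eqxx hr.
have msig : measurable_fun setT sig.
  apply: measurable_funT_le => a.
  rewrite (_ : [set x | _] = [set x | (1 < size (F x))%N /\ exists2 z, root (F x) z &
       Num.max (complex.Re z - rho x) (complex.Im z - a) <= 0]
     `|` (~` A `&` [set x | 0 <= a])).
    apply: measurableU; last first.
      apply: measurableI; first by apply: measurableC; exact: measurable_setb.
      have [h|h] := leP 0 a; first by rewrite (_ : [set x | _] = setT) //; apply/seteqP; split.
      by rewrite (_ : [set x | _] = set0) //; apply/seteqP; split.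
    apply: (root_set_measurable sF mF (g := fun x z => Num.max (complex.Re z - rho x) (complex.Im z - a))).
      move=> x z w; rewrite lerBlDr ge_max; apply/andP; split.
        have := cnB_lipRe z w; have : complex.Re w - rho x <= Num.max (complex.Re w - rho x) (complex.Im w - a).
          by rewrite le_max lexx.
        by lra.
      have := cnB_lipIm z w; have : complex.Im w - a <= Num.max (complex.Re w - rho x) (complex.Im w - a).
        by rewrite le_max lexx orbT.
      by lra.
    move=> q; apply: measurable_maxr; last exact: measurable_cst.
    by apply: measurable_funB => //; exact: measurable_cst.
  apply/seteqP; split=> x /=.
    move=> h; have := hsig x; case: ifPn => s1.
      case=> -[z rz [zr zi]] _; left; split=> //; exists z => //.
      by rewrite ge_max zr zi subrr lexx subr_le0.
    by move=> r0; right; split=> //; [apply/negP|rewrite -r0].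
  case=> [[s1 [z rz]]|[/negP s1 a0]]; have := hsig x.
    rewrite s1 ge_max !subr_le0 => -[_ h1] /andP[h2 h3].
    have := hrho x; rewrite s1 => -[_ /(_ z rz) h4].
    by apply: le_trans h3; apply: h1 => //; apply/eqP; rewrite eq_le h2 h4.
  by rewrite (negbTE s1) => ->.
exists (fun x => (rho x +i* sig x)%C) => [|x s1]; first exact: cmeas_cplx.
have := hsig x; rewrite s1 => -[[z rz [<- <-]] _].
by case: z rz.
Qed.

(** Linear factors are split off one by one. If the last coefficient vanishes, the factor [a] comes
    off, with the zero [(0, -1)] at infinity; otherwise a measurable root [z] gives the factor
    [b - z * a], and [h] lists the coefficients of the quotient by Horner's scheme. *)
Lemma binary_roots (dT : measure_display) (T : measurableType dT) (R : realType) (d : nat)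
    (c : nat -> T -> R[i]) : (forall k, cmeas (c k)) ->
  exists (kap : T -> R[i]) (ze1 ze2 : nat -> T -> R[i]),
    [/\ forall i, cmeas (ze1 i), forall i, cmeas (ze2 i) &
     forall x, (exists2 k, (k <= d)%N & c k x != 0) ->
       [/\ kap x != 0, forall i, (i < d)%N -> (ze1 i x, ze2 i x) != 0 & forall a b,
         \sum_(k < d.+1) c k x * a ^+ (d - k) * b ^+ k =
         kap x * \prod_(i < d) br (ze1 i x, ze2 i x) (a, b)]].
Proof.
elim: d c => [|d IH] c mc.
  exists (c 0%N), (fun _ _ => 0), (fun _ _ => 0); split; [by move=> i; exact: cmeas_cst..|].
  move=> x [k]; rewrite leqn0 => /eqP -> c0; split=> // a b.
  by rewrite big_ord_recr big_ord0 /= big_ord0 subnn !expr0 !mulr1 add0r.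
pose F x : {poly R[i]} := \poly_(k < d.+2) c k x.
have sF x : (size (F x) <= d.+2)%N by exact: size_poly.
have mF : pmeas F.
  move=> k; rewrite (_ : (fun _ => _) = fun x => if (k < d.+2)%N then c k x else 0); last first.
    by apply/funext => x; rewrite coef_poly.
  by case: (k < d.+2)%N => //; exact: cmeas_cst.
have [z mz hz] := measurable_root sF mF.
pose b x := c d.+1 x != 0.
have mb : measurable_fun setT b by exact: cmeas_neq0.
pose h k x := \sum_(k <= j < d.+2) c j x * z x ^+ (j - k).
pose c' k x := if b x then h k.+1 x else c k x.
have mc' k : cmeas (c' k).
  apply: cmeas_if => //; apply: cmeas_sum => j; apply: cmeasM => //; exact: cmeasX.
have [kap [e1 [e2 [me1 me2 he]]]] := IH c' mc'.
exists kap, (fun i x => if i is i'.+1 then e1 i' x else if b x then 1 else 0),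
  (fun i x => if i is i'.+1 then e2 i' x else if b x then z x else -1).
split.
- by case=> // ; apply: cmeas_if => //; exact: cmeas_cst.
- by case=> // ; apply: cmeas_if => //; exact: cmeas_cst.
- move=> x [k kd ck].
  have [|k1 k2 k3] := he x.
    rewrite /c'; case: (boolP (b x)) => bx.
      by exists d => //; rewrite /h big_nat1 subnn expr0 mulr1.
    exists k => //; move: kd; rewrite leq_eqVlt => /orP[/eqP e|//].
    by move: bx; rewrite /b -e ck.
  split=> //.
    case=> [|i] id; last exact: k2.
    case: ifPn => _; apply/eqP => -[]; first by move/eqP; rewrite oner_eq0.
    by move/eqP; rewrite oppr_eq0 oner_eq0.
  move=> a y; rewrite big_ord_recl /= mulrCA -k3.
  have [bx|bx] := boolP (b x); last first.
    have -> : br (0, -1) (a, y) = a by rewrite /br /=; ring.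
    rewrite big_ord_recr /= /c' (negbTE bx).
    move: bx; rewrite negbK => /eqP ->; rewrite !mul0r addr0 mulr_sumr.
    apply: eq_bigr => i _; rewrite subSn; last by rewrite -ltnS.
    by rewrite exprS; ring.
  have hS j : (j < d.+2)%N -> h j x = c j x + z x * h j.+1 x.
    move=> jd; rewrite /h big_ltn // subnn expr0 mulr1 mulr_sumr; congr (_ + _).
    rewrite big_nat_cond [in RHS]big_nat_cond; apply: eq_bigr => i /andP[/andP[i1 i2] _].
    by rewrite mulrCA -exprS -subSn.
  have h0 : h 0%N x = 0.
    have : root (F x) (z x).
      apply: hz; suff -> : size (F x) = d.+2 by [].
      exact: size_poly_eq.
    rewrite /root horner_poly => /eqP <-; rewrite /h big_mkord.
    by apply: eq_bigr => i _; rewrite subn0.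
  have hd : h d.+2 x = 0 by rewrite /h big_geq.
  rewrite /c' bx.
  have -> : br (1, z x) (a, y) = y - z x * a by rewrite /br /=; ring.
  rewrite mulrBl big_ord_recl /= subn0 expr0 mulr1.
  have -> : c 0%N x = - (z x * h 1%N x).
    by apply/eqP; rewrite -addr_eq0 -hS // h0.
  have -> : y * (\sum_(i < d.+1) h i.+1 x * a ^+ (d - i) * y ^+ i) =
     \sum_(i < d.+1) h i.+1 x * a ^+ (d - i) * y ^+ i.+1.
    by rewrite mulr_sumr; apply: eq_bigr => i _; rewrite exprS; ring.
  have -> : z x * a * (\sum_(i < d.+1) h i.+1 x * a ^+ (d - i) * y ^+ i) =
     z x * h 1%N x * a ^+ d.+1 + \sum_(i < d.+1) z x * h i.+2 x * a ^+ (d - i) * y ^+ i.+1.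
    rewrite [in RHS]big_ord_recr /= hd mulr0 !mul0r addr0 big_ord_recl /= mulrDr mulr_sumr.
    rewrite subn0 expr0 mulr1 exprS; congr (_ + _); first by ring.
    apply: eq_bigr => i _; rewrite /bump /= add1n.
    by rewrite -[in RHS](subnSK (ltn_ord i)) [in RHS]exprS; ring.
  have -> : \sum_(i < d.+1) c (bump 0 i) x * a ^+ (d.+1 - bump 0 i) * y ^+ bump 0 i =
      \sum_(i < d.+1) h i.+1 x * a ^+ (d - i) * y ^+ i.+1 -
      \sum_(i < d.+1) z x * h i.+2 x * a ^+ (d - i) * y ^+ i.+1.
    rewrite -sumrB; apply: eq_bigr => i _.
    have -> : bump 0 i = i.+1 by [].
    by rewrite subSS (hS i.+1 (ltn_ord i)) !mulrDl addrK.
  by ring.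
Qed.

(** * Homogeneous polynomials on lines *)

Definition pe (R : realType) (n : nat) (p : HPoly R n) (x : Vec R n) : R[i] :=
  p.@[fun i => x i 0].

Lemma restr_sum (R : realType) n (p : HPoly R n) (u v : Vec R n) :
  restr p u v = \sum_(m <- msupp p) (p@_m)%:P * \prod_i ((u i 0)%:P + 'X * (v i 0)%:P) ^+ m i.
Proof.
rewrite /restr {1}(mpolyE p) (raddf_sum (@mpoly.map_mpoly n.+1 R[i] {poly R[i]} (@polyC R[i]))) raddf_sum; apply: eq_bigr => m _.
pose f : {rmorphism R[i] -> {poly R[i]}} := @polyC R[i].
transitivity (meval (fun i => (u i ord0)%:P + 'X * (v i ord0)%:P) (map_mpoly f (p@_m *: 'X_[m]))).
  by [].
by rewrite map_mpolyZ map_mpolyX /= mevalZ mevalX.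
Qed.

Lemma horner_restr (R : realType) n (p : HPoly R n) (u v : Vec R n) t :
  (restr p u v).[t] = pe p (u + t *: v).
Proof.
rewrite restr_sum horner_sum /pe mevalE; apply: eq_bigr => m _.
rewrite hornerM hornerC horner_prod; congr (_ * _); apply: eq_bigr => i _.
by rewrite horner_exp hornerD hornerM !hornerC hornerX !mxE.
Qed.

Lemma homog_mdeg (R : realType) n d (p : HPoly R n) m : is_homog d p -> m \in msupp p -> mdeg m = d.
Proof. by move=> /dhomogP h /h. Qed.

Lemma pe_homog (R : realType) n d (p : HPoly R n) c x : is_homog d p ->
  pe p (c *: x) = c ^+ d * pe p x.
Proof.
move=> hp; rewrite /pe !mevalE mulr_sumr; apply: eq_big_seq => m mp.
rewrite mulrCA; congr (_ * _); rewrite -(homog_mdeg hp mp) mdegE -prodrXr -big_split /=.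
by apply: eq_bigr => i _; rewrite mxE exprMn.
Qed.

Lemma size_restr (R : realType) n d (p : HPoly R n) u v : is_homog d p ->
  (size (restr p u v) <= d.+1)%N.
Proof.
move=> hp; rewrite restr_sum; apply: leq_trans (size_sum _ _ _) _.
apply/bigmax_leqP_seq => m mp _; rewrite mul_polyC; apply: leq_trans (size_scale_leq _ _) _.
apply: leq_trans (size_poly_prod_leq _ _) _.
rewrite -(homog_mdeg hp mp) mdegE leq_subLR addnS ltnS cardT size_enum_ord.
rewrite (_ : (n.+1 + _ = \sum_(i < n.+1) (1 + m i))%N); last first.
  by rewrite big_split /= sum_nat_const card_ord muln1.
apply: leq_sum => i _; rewrite add1n; apply: leq_trans (size_poly_exp_leq _ _) _.
rewrite ltnS -[X in (_ <= X)%N]mul1n leq_mul2r; apply/orP; right.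
have : (size ((u i 0)%:P + 'X * (v i 0)%:P)%R <= 2)%N.
  apply: leq_trans (size_polyD _ _) _; rewrite geq_max.
  rewrite (leq_trans (size_polyC_leq1 _)) // mulrC mul_polyC.
  by apply: leq_trans (size_scale_leq _ _) _; rewrite size_polyX.
by case: (size _) => [|[|[|]]].
Qed.

Lemma poly_eq_horner (R : realType) (p q : {poly R[i]}) :
  (forall a, a != 0 -> p.[a] = q.[a]) -> p = q.
Proof.
move=> h; apply/eqP; rewrite -subr_eq0; apply/eqP.
apply: (@roots_geq_poly_eq0 _ _ [seq k.+1%:R | k <- iota 0 (size (p - q))]).
- apply/allP => x /mapP [k _ ->]; rewrite /root hornerD hornerN h ?subrr //.
- rewrite map_inj_in_uniq ?iota_uniq // => i j _ _ /eqP.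
  by rewrite eqr_nat => /eqP [].
- by rewrite size_map size_iota.
Qed.

(** For [a != 0] this is homogeneity; both sides are polynomials in [a], so the identity extends to
    [a = 0]. *)
Lemma pe_line (R : realType) n d (p : HPoly R n) u v a b : is_homog d p ->
  pe p (a *: u + b *: v) = \sum_(k < d.+1) (restr p u v)`_k * a ^+ (d - k) * b ^+ k.
Proof.
move=> hp.
have H a' b' : a' != 0 ->
    pe p (a' *: u + b' *: v) = \sum_(k < d.+1) (restr p u v)`_k * a' ^+ (d - k) * b' ^+ k.
  move=> a0; rewrite (_ : a' *: u + b' *: v = a' *: (u + (b' / a') *: v)); last first.
    by rewrite scalerDr scalerA mulrCA divff // mulr1.
  rewrite (pe_homog _ _ hp) -horner_restr (horner_coef_wide _ (size_restr u v hp)) mulr_sumr.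
  apply: eq_bigr => k _; have kd : (k <= d)%N by rewrite -ltnS.
  rewrite -{1}(subnK kd) exprD exprMn exprVn.
  by move: (a' ^+ k) (expf_neq0 k a0) => A A0; field.
have [a0|] := eqVneq a 0; last exact: H.
pose G : {poly R[i]} := \sum_(k < d.+1) ((restr p u v)`_k * b ^+ k) *: 'X^(d - k).
have GE x : G.[x] = \sum_(k < d.+1) (restr p u v)`_k * x ^+ (d - k) * b ^+ k.
  rewrite horner_sum; apply: eq_bigr => k _.
  by rewrite hornerZ hornerXn mulrAC.
rewrite -GE (_ : G = restr p (b *: v) u) ?horner_restr 1?addrC //.
by apply: poly_eq_horner => x x0; rewrite GE -H // horner_restr addrC.
Qed.

Lemma base_inj (n N : nat) (m m' : 'I_n -> nat) : (forall i, (m i < N)%N) -> (forall i, (m' i < N)%N) ->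
  (\sum_i m i * N ^ i = \sum_i m' i * N ^ i)%N -> m =1 m'.
Proof.
elim: n m m' => [|n IH] m m' h h'; first by move=> _ [].
rewrite !big_ord_recl !expn0 !muln1.
have E (f : 'I_n.+1 -> nat) : (\sum_(i < n) f (lift ord0 i) * N ^ lift ord0 i =
    (\sum_(i < n) f (lift ord0 i) * N ^ i) * N)%N.
  by rewrite big_distrl /=; apply: eq_bigr => i _; rewrite /bump /= add1n expnSr mulnA.
rewrite !E => e.
have N0 : (0 < N)%N by apply: leq_ltn_trans (h ord0).
have e0 : m ord0 = m' ord0.
  have := congr1 (modn^~ N) e; rewrite ![(_ + _ * N)%N]addnC !modnMDl !modn_small //.
move/eqP: e; rewrite e0 eqn_add2l eqn_pmul2r // => /eqP /(IH _ _ (fun i => h _) (fun i => h' _)) h2.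
by move=> i; case: (unliftP ord0 i) => [j ->|->]; [exact: h2|].
Qed.

(* Kronecker substitution [x_i = t ^ (d + 1) ^ i] separates the monomials of degree [d]. *)
Lemma homog_nat_neq0 (R : realType) n d (p : HPoly R n) : inPnd d p ->
  exists t : nat, pe p (\col_i (t%:R ^+ (d.+1 ^ i))) != 0.
Proof.
move=> [p0 hp].
pose e (m : 'X_{1.. n.+1}) := (\sum_(i < n.+1) m i * d.+1 ^ i)%N.
pose K : {poly R[i]} := \sum_(m <- msupp p) p@_m *: 'X^(e m).
have KE t : K.[t] = pe p (\col_i (t ^+ (d.+1 ^ i))).
  rewrite horner_sum /pe mevalE; apply: eq_bigr => m _.
  rewrite hornerZ hornerXn /e -prodrXr; congr (_ * _); apply: eq_bigr => i _.
  by rewrite mxE -exprM mulnC.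
have md m : m \in msupp p -> forall i, (m i < d.+1)%N.
  move=> mp i; rewrite ltnS -(homog_mdeg hp mp) mdegE (bigD1 i) //=.
  exact: leq_addr.
have K0 : K != 0.
  have : (0 < size (msupp p))%N by rewrite lt0n size_eq0 msupp_eq0.
  case E: (msupp p) => [//|m0 s] _.
  have m0p : m0 \in msupp p by rewrite E mem_head.
  apply/eqP => /(congr1 (fun q : {poly R[i]} => q`_(e m0))); rewrite coef0 /K coef_sum.
  rewrite (bigD1_seq m0) ?msupp_uniq //= coefZ coefXn eqxx mulr1 big_seq_cond big1 ?addr0.
    by move/eqP; rewrite mcoeff_eq0 m0p.
  move=> m /andP[mp mm0]; rewrite coefZ coefXn; case: eqP => [/esym em|]; last by rewrite mulr0.
  case/eqP: mm0; apply/mnmP => i; apply: (base_inj (md _ mp) (md _ m0p) em).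
apply: contrapT => h; case/eqP: K0.
apply: (@roots_geq_poly_eq0 _ _ [seq k%:R | k <- iota 0 (size K)]).
- apply/allP => x /mapP [k _ ->]; rewrite /root KE.
  by apply: contrapT => h'; apply: h; exists k; apply/negP.
- rewrite map_inj_in_uniq ?iota_uniq // => i j _ _ /eqP.
  by rewrite eqr_nat => /eqP.
- by rewrite size_map size_iota.
Qed.

Lemma pe_neq0 (R : realType) n d (p : HPoly R n) : inPnd d p -> exists x, pe p x != 0.
Proof. by move=> /homog_nat_neq0 [t h]; eexists; exact: h. Qed.

(** The point of projective space represented by [x]. *)
Definition pj (R : realType) n (x : Vec R n) : Mat R n := nrm x *m adj (nrm x).

Lemma pj_rank1 (R : realType) n (x : Vec R n) : x != 0 -> rank1proj (pj x).
Proof. by move=> x0; apply: rank1_outer; exact: nrm_unit. Qed.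

Lemma pjE (R : realType) n (x : Vec R n) : pj x = ((vn x ^+ 2)^-1)%:C%C *: (x *m adj x).
Proof.
rewrite /pj /nrm adjZ conjc_real -scalemxAl -scalemxAr scalerA -rmorphM /=.
by rewrite -invfM -expr2.
Qed.

Lemma pj_unit (R : realType) n (x : Vec R n) : ip x x = 1 -> pj x = x *m adj x.
Proof. by move=> /vn_unitP h; rewrite pjE h expr1n invr1 scale1r. Qed.

Lemma pjZ (R : realType) n c (x : Vec R n) : c != 0 -> pj (c *: x) = pj x.
Proof.
move=> c0; rewrite !pjE vnZ adjZ -scalemxAl -scalemxAr !scalerA; congr (_ *: _).
rewrite -mulrA mulcJ -rmorphM /=; congr (_%:C)%C; rewrite exprMn invfM mulrAC mulVf ?mul1r //.
by rewrite expf_neq0 // cn_eq0.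
Qed.

Lemma pj_mul (R : realType) n (x : Vec R n) : x != 0 -> pj x *m x = x.
Proof.
move=> x0; rewrite pjE -scalemxAl outerE scalerA ipxx -rmorphM /= mulVf ?scale1r //.
by rewrite expf_neq0 // vn_eq0.
Qed.

Lemma br0_par (R : realType) (x y : R[i] * R[i]) : x != 0 -> y != 0 -> br x y = 0 ->
  exists2 k, k != 0 & x = (k * y.1, k * y.2).
Proof.
case: x y => [a b] [c e] x0 y0; rewrite /br /= => /eqP; rewrite subr_eq0 => /eqP h.
have [c0|c0] := eqVneq c 0.
  have e0 : e != 0 by apply: contraNneq y0 => ->; rewrite c0.
  have a0 : a = 0 by apply/eqP; move/eqP: h; rewrite c0 mulr0 mulf_eq0 (negbTE e0) orbF.
  exists (b / e); last by rewrite c0 a0 mulr0 divfK.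
  rewrite mulf_neq0 ?invr_eq0 //; apply: contraNneq x0 => ->; by rewrite a0.
exists (a / c); last by rewrite divfK // mulrAC h mulfK.
rewrite mulf_neq0 ?invr_eq0 //; apply: contraNneq x0 => a0.
by move/eqP: h; rewrite a0 mul0r eq_sym mulf_eq0 (negbTE c0) orbF => /eqP ->.
Qed.

Definition onln (R : realType) n (u v : Vec R n) (z : R[i] * R[i]) : Vec R n := z.1 *: u + z.2 *: v.

Lemma ip_onln (R : realType) n (u v : Vec R n) z w : ip u u = 1 -> ip v v = 1 -> ip u v = 0 ->
  ip (onln u v z) (onln u v w) = (z.1^*)%C * w.1 + (z.2^*)%C * w.2.
Proof.
move=> u1 v1 uv; have vu : ip v u = 0 by rewrite ipJ uv conjc0.
by rewrite ipDr !ipDl !ipZr !ipZl u1 v1 uv vu; ring.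
Qed.

Lemma vn_onln (R : realType) n (u v : Vec R n) z : ip u u = 1 -> ip v v = 1 -> ip u v = 0 ->
  vn (onln u v z) = pn z.
Proof.
move=> u1 v1 uv; apply/eqP; rewrite -(@eqrXn2 _ 2) //; apply/eqP.
apply: (@complexI R); rewrite -ipxx ip_onln // pn_sqr rmorphD /= -!mulcJ.
by congr (_ + _); exact: mulrC.
Qed.

Lemma onln_neq0 (R : realType) n (u v : Vec R n) z : ip u u = 1 -> ip v v = 1 -> ip u v = 0 ->
  z != 0 -> onln u v z != 0.
Proof. by move=> u1 v1 uv z0; rewrite -vn_gt0 vn_onln // pn_gt0. Qed.

Lemma mup_affine (R : realType) (a b : R[i]) : (a, b) != 0 ->
  a%:P + 'X * b%:P != 0 :> {poly R[i]} /\ mup 0 (a%:P + 'X * b%:P) = (a == 0) :> nat.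
Proof.
move=> ab; have H : a%:P + 'X * b%:P != 0 :> {poly R[i]}.
  apply: contra_neq ab => e; have := congr1 (fun q : {poly R[i]} => (q`_0, q`_1)) e.
  by rewrite !coefD !coefXM !coefC /= addr0 add0r => -[-> ->].
split=> //; have [a0|a0] := eqVneq a 0; last first.
  by rewrite mupNroot // /root hornerD hornerM hornerX mul0r addr0 hornerC.
have b0 : b != 0 by apply: contraNneq ab => ->; rewrite a0.
rewrite a0 add0r mupMl ?rootC //.
have -> : 'X = ('X - 0%:P) ^+ 1 :> {poly R[i]} by rewrite expr1 subr0.
by rewrite mup_XsubCX !eqxx.
Qed.

Lemma mup_prod (R : realType) (I : Type) (s : seq I) (F : I -> {poly R[i]}) :
  (forall i, F i != 0) -> mup 0 (\prod_(i <- s) F i) = (\sum_(i <- s) mup 0 (F i))%N.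
Proof.
move=> F0; elim: s => [|i s IH].
  by rewrite !big_nil mupNroot // root1.
rewrite !big_cons mupM ?IH //.
by elim: {IH} s => [|j s IH]; rewrite ?big_nil ?oner_eq0 // big_cons mulf_neq0.
Qed.

(* The multiplicity does not depend on the frame chosen by [xget]: on the line it counts
   the linear factors vanishing at the given point. *)
Lemma multE (R : realType) n d (p : HPoly R n) (L Z : Mat R n) u v kap (ze : nat -> R[i] * R[i]) :
  ip u u = 1 -> ip v v = 1 -> ip u v = 0 -> L = u *m adj u + v *m adj v ->
  kap != 0 -> (forall i, (i < d)%N -> ze i != 0) ->
  (forall a b, pe p (a *: u + b *: v) = kap * \prod_(i < d) br (ze i) (a, b)) ->
  rank1proj Z ->
  mult p L Z = (\sum_(i < d) (Z == pj (onln u v (ze i))))%N.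
Proof.
move=> u1 v1 uv LE k0 z0 pE rZ.
have vu : ip v u = 0 by rewrite ipJ uv conjc0.
have rL : rank2proj L by rewrite LE; exact: rank2_outer.
rewrite /mult; set P := fun _ => _ /\ _; case: asboolP => hP /=; last first.
  (* The default branch of [xget]: if a linear factor vanished at [Z], the unit vector of that zero
     and its complement in [L] would form a frame. *)
  rewrite big1 // => i _; apply/eqP; rewrite eqb0; apply/negP => /eqP ZE.
  suff [w hw] : exists w, P w by apply: hP; exact: (@xgetPex _ (0, 0) P (ex_intro _ w hw)).
  pose w := onln u v (ze i); have w0 : w != 0 by apply: onln_neq0 => //; exact: z0.
  have w1 : ip (nrm w) (nrm w) = 1 by exact: nrm_unit.
  have Lw : L *m nrm w = nrm w.
    rewrite /nrm -scalemxAr; congr (_ *: _).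
    by rewrite /w /onln LE mulmxDl !mulmxDr -!scalemxAr !outerE u1 v1 uv vu !scale0r !scale1r !scaler0 addr0 add0r.
  have [ho ht] := proj_split (proj1 rL) Lw w1.
  have r1 : rank1proj (L - nrm w *m adj (nrm w)).
    by split=> //; rewrite ht (proj2 rL); ring.
  have [e _] := rank1_fr r1.
  by exists (nrm w, fr (L - nrm w *m adj (nrm w))); split=> //=; rewrite -e ZE addrC subrK.
move: hP; move: (xget _ _) => [x y] [/= ZE LE'].
have x1 : ip x x = 1 by rewrite -tr_outer -ZE; case: rZ.
have y1 : ip y y = 1.
  have := proj2 rL; rewrite LE' raddfD /= ZE !tr_outer x1 => e.
  by apply: (@addrI _ 1); rewrite e; ring.
have xy : ip x y = 0.
  have e2 : \tr (L *m L) = 2%:R by rewrite (proj2 (proj1 rL)) (proj2 rL).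
  rewrite LE' ZE mulmxDl !mulmxDr !mulmxA !outerE x1 y1 !scale1r !raddfD /= -!scalemxAl !linearZ /= !tr_outer x1 y1 in e2.
  have : ip x y * ip y x = 0.
    have h2 : ip x y * ip y x + ip y x * ip x y = 0.
      by apply: (@addrI _ 2%:R); rewrite addr0 -[in RHS]e2; ring.
    apply/eqP; move/eqP: h2; rewrite [ip y x * _]mulrC -mulr2n mulrn_eq0 /=.
    by [].
  by rewrite (ipJ x y) mulcJ => /eqP; rewrite fmorph_eq0 sqrf_eq0 cn_eq0 => /eqP.
have onL w : L *m w = w -> w = onln u v (ip u w, ip v w).
  by move=> {1}<-; rewrite LE mulmxDl !outerE.
have yx : ip y x = 0 by rewrite ipJ xy conjc0.
have Lx : L *m x = x by rewrite LE' ZE mulmxDl !outerE x1 yx scale1r scale0r addr0.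
have Ly : L *m y = y by rewrite LE' ZE mulmxDl !outerE y1 xy scale1r scale0r add0r.
set a := ip u x; set b := ip v x; set c := ip u y; set e := ip v y.
have xE : x = onln u v (a, b) by exact: onL.
have yE : y = onln u v (c, e) by exact: onL.
pose F (i : 'I_d) := (br (ze i) (a, b))%:P + 'X * (br (ze i) (c, e))%:P : {poly R[i]}.
have rE : restr p x y = kap *: \prod_(i < d) F i.
  apply: poly_eq_horner => t _; rewrite horner_restr hornerZ horner_prod.
  rewrite (_ : x + t *: y = (a + t * c) *: u + (b + t * e) *: v); last first.
    by rewrite {1}xE {1}yE /onln /= scalerDr !scalerA !scalerDl addrACA.
  rewrite pE; congr (_ * _); apply: eq_bigr => i _.
  by rewrite /F hornerD hornerM hornerX !hornerC /br /=; ring.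
(* A linear factor vanishing at both [x] and [y] would make these orthonormal vectors parallel. *)
have F0 (i : 'I_d) : (br (ze i) (a, b), br (ze i) (c, e)) != 0.
  apply/eqP => -[h1 h2].
  have ab0 : (a, b) != 0.
    by apply/eqP => -[a0 b0]; move: x1; rewrite xE a0 b0 /onln /= !scale0r addr0 ip0r => /eqP; rewrite eq_sym oner_eq0.
  have ce0 : (c, e) != 0.
    by apply/eqP => -[a0 b0]; move: y1; rewrite yE a0 b0 /onln /= !scale0r addr0 ip0r => /eqP; rewrite eq_sym oner_eq0.
  have [k kk k1] := br0_par (z0 i (ltn_ord i)) ab0 h1.
  have [l ll l1] := br0_par (z0 i (ltn_ord i)) ce0 h2.
  have : k *: x = l *: y.
    rewrite xE yE /onln /= !scalerDr !scalerA.
    by move: k1; rewrite l1 => -[-> ->].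
  move/(congr1 (ip x)); rewrite !ipZr x1 xy mulr0 mulr1 => k2.
  by move: kk; rewrite k2 eqxx.
have G0 i : F i != 0 by case: (mup_affine (F0 i)).
have q0 : restr p x y != 0.
  by rewrite rE scaler_eq0 negb_or k0 /=; apply/prodf_neq0 => i _.
rewrite q0 rE -mul_polyC mupMr ?rootC // mup_prod //.
apply: eq_bigr => i _; case: (mup_affine (F0 i)) => _ ->; congr nat_of_bool.
have ab0 : (a, b) != 0.
  by apply/eqP => -[a0 b0]; move: x1; rewrite xE a0 b0 /onln /= !scale0r addr0 ip0r => /eqP; rewrite eq_sym oner_eq0.
apply/eqP/eqP => [h|h].
  have [k kk k1] := br0_par (z0 i (ltn_ord i)) ab0 h.
  rewrite k1 (_ : onln u v _ = k *: x); last by rewrite xE /onln /= scalerDr !scalerA.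
  by rewrite pjZ // pj_unit.
have w0 : onln u v (ze i) != 0 by apply: onln_neq0 => //; exact: z0.
have := pj_mul w0; rewrite -h ZE outerE => /esym wE.
have : (ze i) = (ip x (onln u v (ze i)) * a, ip x (onln u v (ze i)) * b).
  have h1 : ip u (onln u v (ze i)) = (ze i).1 by rewrite ipDr !ipZr u1 uv mulr1 mulr0 addr0.
  have h2 : ip v (onln u v (ze i)) = (ze i).2 by rewrite ipDr !ipZr v1 vu mulr1 mulr0 add0r.
  rewrite [LHS]surjective_pairing -h1 -h2 [in X in (X, _)]wE [in X in (_, X)]wE !ipZr.
  by [].
by move=> ->; rewrite /br /=; ring.
Qed.

(** * The Fubini--Study distance *)

Lemma trmul_pj (R : realType) n (x y : Vec R n) :
  \tr ((x *m adj x) *m (y *m adj y)) = (cn (ip x y) ^+ 2)%:C%C.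
Proof.
by rewrite mulmxA outerE -scalemxAl linearZ /= tr_outer (ipJ x y) mulcJ.
Qed.

Lemma dFS_unit (R : realType) n (x y : Vec R n) :
  dFS (x *m adj x) (y *m adj y) = acos (cn (ip x y)).
Proof. by rewrite /dFS trmul_pj /= sqrtr_sqr ger0_norm. Qed.

Lemma sin_ge_cos (R : realType) (t : R) : 0 <= t -> t <= pi / 2 -> t * cos t <= sin t.
Proof.
move=> t0 tp.
have tpi : t <= pi by have := pi_ge0 R; lra.
have [|c cI] := @MVT_segment R (@sin R) (@cos R) 0 t t0 (fun x _ => is_derive_sin x).
  by apply: continuous_subspaceT => x; exact: continuous_sin.
rewrite sin0 !subr0 => ->; rewrite mulrC ler_wpM2r //.
move: cI; rewrite in_itv /= => /andP[c0 ct].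
by rewrite leNgt ltr_cos ?in_itv /= -?leNgt ?t0 ?c0 //; apply: le_trans tpi.
Qed.

Lemma acos_le (R : realType) (x a : R) : -1 <= x <= 1 -> 0 <= a <= pi -> (acos x <= a) = (cos a <= x).
Proof.
move=> xI aI; have [aa aE] := acos_def xI.
by rewrite leNgt -[X in cos a <= X]aE [RHS]leNgt ltr_cos // in_itv.
Qed.

(** The default value: no angle has such a cosine. *)
Lemma acos_out (R : realType) (x : R) : ~~ (-1 <= x <= 1) -> acos x = 0.
Proof.
move=> h; rewrite acos.unlock xgetPN // => y [_ yx].
by move/negP: h; apply; rewrite -yx cos_geN1 cos_le1.
Qed.

Lemma acos_bounds (R : realType) (x : R) : 0 <= acos x <= pi.
Proof.
case: (boolP (-1 <= x <= 1)) => [/acos_def[]//|/acos_out ->].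
by rewrite lexx pi_ge0.
Qed.

(** [1 - c ^+ 2] is the squared sine of the angle. For [c >= 1 / 2] the inequality
    [t * cos t <= sin t] suffices; otherwise the squared sine is at least 3/4 while the angle is at
    most 2. *)
Lemma acos_sqr_ub (R : realType) (c : R) : 0 <= c <= 1 -> acos c ^+ 2 <= 8 * (1 - c ^+ 2).
Proof.
move=> /andP[c0 c1].
have cI : -1 <= c <= 1 by rewrite c1 andbT; lra.
have a0 := acos_ge0 cI; have ap : acos c <= pi / 2.
  by rewrite acos_le ?cos_pihalf //; have := pi_ge0 R; lra.
have s2 : sin (acos c) ^+ 2 = 1 - c ^+ 2.
  by rewrite sin_acos // sqr_sqrtr // subr_ge0 expr_le1.
rewrite -s2; have [h|h] := leP (1 / 2) c.
  have := sin_ge_cos a0 ap; rewrite acosK ?in_itv //= => h2.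
  have h3 : acos c / 2 <= sin (acos c).
    by apply: le_trans h2; rewrite ler_wpM2l //; lra.
  have h4 : (acos c / 2) ^+ 2 <= sin (acos c) ^+ 2.
    by apply: lerXn2r; rewrite ?nnegrE //; [apply: divr_ge0|apply: le_trans h3; apply: divr_ge0].
  by have := sqr_ge0 (sin (acos c)); move: h4; rewrite exprMn; lra.
have h3 : 3 / 4 <= sin (acos c) ^+ 2.
  have : c ^+ 2 <= (1 / 2) ^+ 2 by apply: lerXn2r; rewrite ?nnegrE //; lra.
  by rewrite s2; lra.
have pi4 := pihalf_lt2 R.
have : acos c ^+ 2 <= 2 ^+ 2 by apply: lerXn2r; rewrite ?nnegrE //; lra.
by lra.
Qed.

Lemma acos_triangle (R : realType) (a b c : R) : 0 <= a <= 1 -> 0 <= b <= 1 -> 0 <= c <= 1 ->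
  a * b - Num.sqrt (1 - a ^+ 2) * Num.sqrt (1 - b ^+ 2) <= c -> acos c <= acos a + acos b.
Proof.
move=> ha hb hc h.
have I1 (x : R) : 0 <= x <= 1 -> -1 <= x <= 1 by lra.
have I2 (x : R) : 0 <= x <= 1 -> 0 <= acos x <= pi / 2.
  move=> hx; have /andP[-> _] := acos_bounds x.
  by rewrite acos_le ?cos_pihalf ?I1 //; have := pi_ge0 R; lra.
have := I2 _ ha; have := I2 _ hb => hB hA.
rewrite acos_le ?I1 //; last by lra.
by rewrite cosD !sin_acos ?I1 // !acosK // in_itv /= I1.
Qed.

Lemma cn_ip_le1 (R : realType) n (x y : Vec R n) : ip x x = 1 -> ip y y = 1 -> 0 <= cn (ip x y) <= 1.
Proof.
move=> /vn_unitP x1 /vn_unitP y1; rewrite cn_ge0 /=.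
by apply: le_trans (CS x y) _; rewrite x1 y1 mulr1.
Qed.

Lemma rank1_ex (R : realType) n (Z : Mat R n) : rank1proj Z ->
  exists2 u : Vec R n, ip u u = 1 & Z = u *m adj u.
Proof. by move=> /rank1_fr [e u1]; exists (fr Z). Qed.

(** The components [x'] and [z'] orthogonal to [y] have as norms the sines of the two angles, and
    [ip x z = ip x' z' + ip x y * ip y z]. Cauchy--Schwarz for the first term yields the addition
    formula for the cosine as a lower bound. *)
Lemma dFS_triangle (R : realType) n (P Q S : Mat R n) : rank1proj P -> rank1proj Q -> rank1proj S ->
  dFS P S <= dFS P Q + dFS Q S.
Proof.
move=> /rank1_ex [x x1 ->] /rank1_ex [y y1 ->] /rank1_ex [z z1 ->]; rewrite !dFS_unit.
apply: acos_triangle; rewrite ?cn_ip_le1 //.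
pose x' := x - ip y x *: y; pose z' := z - ip y z *: y.
have E : ip x z = ip x' z' + ip x y * ip y z.
  rewrite /x' /z' ipBr !ipBl !ipZl !ipZr y1 (ipJ y x) (ipJ x y) conjcK; ring.
have nx : vn x' = Num.sqrt (1 - cn (ip x y) ^+ 2).
  rewrite -[LHS](@ger0_norm) // -sqrtr_sqr; congr Num.sqrt; apply: (@complexI R).
  rewrite -ipxx /x' ipBr !ipBl !ipZl !ipZr x1 y1 rmorphB /= -mulcJ -(ipJ x y) rmorph1; ring.
have nz : vn z' = Num.sqrt (1 - cn (ip y z) ^+ 2).
  rewrite -[LHS](@ger0_norm) // -sqrtr_sqr; congr Num.sqrt; apply: (@complexI R).
  rewrite -ipxx /z' ipBr !ipBl !ipZl !ipZr z1 y1 rmorphB /= -mulcJ (ipJ y z) rmorph1; ring.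
rewrite -nx -nz -cnM lerBlDr addrC -lerBlDr.
rewrite (_ : ip x y * ip y z = ip x z - ip x' z'); last by rewrite E addrC addKr.
rewrite lerBlDl; apply: le_trans (cnD _ _) _; rewrite cnN lerD2l.
exact: CS.
Qed.

Lemma dFS_ge0 (R : realType) n (P Q : Mat R n) : 0 <= dFS P Q.
Proof. by have /andP[] := acos_bounds (Num.sqrt (complex.Re (\tr (P *m Q)))). Qed.
#[global] Hint Extern 0 (is_true (@Order.le _ _ _ (dFS _ _))) => exact: dFS_ge0 : core.

Lemma dFS_lepi (R : realType) n (P Q : Mat R n) : dFS P Q <= pi.
Proof. by have /andP[] := acos_bounds (Num.sqrt (complex.Re (\tr (P *m Q)))). Qed.

Lemma dFSC (R : realType) n (P Q : Mat R n) : dFS P Q = dFS Q P.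
Proof. by rewrite /dFS mxtrace_mulC. Qed.

Lemma rank1_trmul (R : realType) n (P Q : Mat R n) : rank1proj P -> rank1proj Q ->
  exists2 c : R, 0 <= c <= 1 & \tr (P *m Q) = (c ^+ 2)%:C%C /\ dFS P Q = acos c.
Proof.
move=> /rank1_ex [x x1 ->] /rank1_ex [y y1 ->]; exists (cn (ip x y)); first exact: cn_ip_le1.
by rewrite trmul_pj dFS_unit.
Qed.

Lemma dFS_sqr_ub (R : realType) n (P Q : Mat R n) : rank1proj P -> rank1proj Q ->
  dFS P Q ^+ 2 <= 8 * (1 - complex.Re (\tr (P *m Q))).
Proof. by move=> rP rQ; have [c hc [-> ->]] := rank1_trmul rP rQ; exact: acos_sqr_ub. Qed.

Lemma dFS_refl (R : realType) n (P : Mat R n) : rank1proj P -> dFS P P = 0.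
Proof.
move=> rP; have := dFS_sqr_ub rP rP; case: (rP) => -[_ ->] -> /=.
rewrite subrr mulr0 => h; apply/eqP; rewrite -sqrf_eq0 eq_le h sqr_ge0.
by [].
Qed.

(** The squared Frobenius distance of two rank-one projectors is [2 - 2 * tr (P Q)]. *)
Lemma dFS_dist (R : realType) n (P Q : Mat R n) : rank1proj P -> rank1proj Q ->
  dFS P Q ^+ 2 <= 4 * \sum_i \sum_j cn (P i j - Q i j) ^+ 2.
Proof.
move=> rP rQ; apply: le_trans (dFS_sqr_ub rP rQ) _.
have [[aP PP] tP] := rP; have [[aQ QQ] tQ] := rQ.
suff : (\sum_i \sum_j cn (P i j - Q i j) ^+ 2)%:C%C = (2 - 2 * complex.Re (\tr (P *m Q)))%:C%C.
  by move=> /(@complexI R) ->; lra.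
have [c _ [tc _]] := rank1_trmul rP rQ.
have -> : (\sum_i \sum_j cn (P i j - Q i j) ^+ 2)%:C%C = \tr ((P - Q) *m (P - Q)).
  have aD : adj (P - Q) = P - Q by rewrite adjB aP aQ.
  rewrite -{2}aD /mxtrace rmorph_sum; apply: eq_bigr => i _.
  rewrite mxE rmorph_sum; apply: eq_bigr => j _.
  by rewrite adjE mulcJ !mxE.
rewrite mulmxBl !mulmxBr PP QQ !raddfB /= tP tQ (mxtrace_mulC Q) tc /=.
by rewrite (rmorphM (real_complex R)) /= (rmorph_nat (real_complex R)); ring.
Qed.

(** By Lagrange's identity [chd z w] is the sine of the angle between the two points. *)
Lemma dFS_chd (R : realType) n (u v : Vec R n) z w : ip u u = 1 -> ip v v = 1 -> ip u v = 0 ->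
  z != 0 -> w != 0 -> dFS (pj (onln u v z)) (pj (onln u v w)) ^+ 2 <= 8 * chd z w ^+ 2.
Proof.
move=> u1 v1 uv z0 w0.
have zz : onln u v z != 0 by exact: onln_neq0.
have ww : onln u v w != 0 by exact: onln_neq0.
rewrite /pj dFS_unit; apply: le_trans (acos_sqr_ub (cn_ip_le1 (nrm_unit zz) (nrm_unit ww))) _.
rewrite ler_pM2l ?ltr0n // lerBlDr -lerBlDl.
rewrite /chd !nz_id // /nrm ipZl ipZr conjc_real !cnM !cn_real !vn_onln //.
have pz := pn_gt0 z0; have pw := pn_gt0 w0.
rewrite !ger0_norm ?invr_ge0 // ip_onln //.
apply: eq_ler; apply/eqP; rewrite subr_eq; apply/eqP.
apply: (@mulIf _ (pn z ^+ 2 * pn w ^+ 2)); first by rewrite mulf_neq0 // expf_neq0 // gt_eqF.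
rewrite mul1r mulrDl.
have -> : ((pn z)^-1 * ((pn w)^-1 * cn (z.1^*%C * w.1 + z.2^*%C * w.2))) ^+ 2 * (pn z ^+ 2 * pn w ^+ 2) =
   cn (z.1^*%C * w.1 + z.2^*%C * w.2) ^+ 2 by field; rewrite !gt_eqF.
have -> : (cn (br z w) / (pn z * pn w)) ^+ 2 * (pn z ^+ 2 * pn w ^+ 2) = cn (br z w) ^+ 2.
  by field; rewrite !gt_eqF.
rewrite !pn_sqr; apply: (@complexI R).
rewrite !(rmorphM (real_complex R)) !(rmorphD (real_complex R)) /= -!mulcJ /br.
by rewrite !rmorphD rmorphN !rmorphM /= !conjcK; ring.
Qed.

Lemma measurable_acos (R : realType) : measurable_fun setT (@acos R).
Proof.
apply: measurable_funT_le => a.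
have [a0|a0] := ltP a 0.
  rewrite (_ : [set x | _] = set0) //; apply/seteqP; split=> x //=.
  by have /andP[h _] := acos_bounds x; rewrite leNgt (lt_le_trans a0).
have [ap|ap] := leP pi a.
  rewrite (_ : [set x | _] = setT) //; apply/seteqP; split=> x //= _.
  by have /andP[_ h] := acos_bounds x; exact: le_trans ap.
rewrite (_ : [set x | _] = ~` `[(-1)%R, 1%R]%classic `|` `[cos a, 1]%classic).
  by apply: measurableU; [apply: measurableC|]; exact: measurable_itv.
apply/seteqP; split=> x /=; rewrite !in_itv /=.
  case: (boolP (-1 <= x <= 1)) => xI; last by move=> _; left.
  rewrite acos_le ?a0 ?(ltW ap) // => ->; right.
  by case/andP: xI.
case=> [/negP/acos_out ->//|/andP[h1 h2]].
have xI : -1 <= x <= 1 by rewrite h2 andbT; apply: le_trans h1; exact: cos_geN1.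
by rewrite acos_le ?a0 ?(ltW ap).
Qed.

Definition mmeas (dT : measure_display) (T : measurableType dT) (R : realType) m k
  (F : T -> 'M[R[i]]_(m, k)) := forall i j, cmeas (fun x => F x i j).

Section mmeas_closure.
Context (dT : measure_display) (T : measurableType dT) (R : realType).

Lemma mmeas_cst m k (A : 'M[R[i]]_(m, k)) : mmeas (fun _ : T => A).
Proof. by move=> i j; exact: cmeas_cst. Qed.

Lemma mmeasD m k (F G : T -> 'M[R[i]]_(m, k)) : mmeas F -> mmeas G -> mmeas (fun x => F x + G x).
Proof.
by move=> h1 h2 i j; have := cmeasD (h1 i j) (h2 i j); congr cmeas; apply/funext => x; rewrite mxE.
Qed.

Lemma mmeasB m k (F G : T -> 'M[R[i]]_(m, k)) : mmeas F -> mmeas G -> mmeas (fun x => F x - G x).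
Proof.
by move=> h1 h2 i j; have := cmeasB (h1 i j) (h2 i j); congr cmeas; apply/funext => x; rewrite !mxE.
Qed.

Lemma mmeasM m k l (F : T -> 'M[R[i]]_(m, k)) (G : T -> 'M[R[i]]_(k, l)) :
  mmeas F -> mmeas G -> mmeas (fun x => F x *m G x).
Proof.
move=> h1 h2 i j.
have := cmeas_sum (index_enum 'I_k) predT (fun a => cmeasM (h1 i a) (h2 a j)).
by congr cmeas; apply/funext => x; rewrite mxE.
Qed.

Lemma mmeasZ m k (c : T -> R[i]) (F : T -> 'M[R[i]]_(m, k)) : cmeas c -> mmeas F ->
  mmeas (fun x => c x *: F x).
Proof.
by move=> h1 h2 i j; have := cmeasM h1 (h2 i j); congr cmeas; apply/funext => x; rewrite mxE.
Qed.

Lemma mmeas_adj m k (F : T -> 'M[R[i]]_(m, k)) : mmeas F -> mmeas (fun x => adj (F x)).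
Proof.
by move=> h i j; have := cmeasJ (h j i); congr cmeas; apply/funext => x; rewrite adjE.
Qed.

Lemma mmeas_col m k (F : T -> 'M[R[i]]_(m, k)) j : mmeas F -> mmeas (fun x => col j (F x)).
Proof.
by move=> h i a; have := h i j; congr cmeas; apply/funext => x; rewrite mxE.
Qed.

Lemma mmeas_if m k (b : T -> bool) (F G : T -> 'M[R[i]]_(m, k)) : measurable_fun setT b ->
  mmeas F -> mmeas G -> mmeas (fun x => if b x then F x else G x).
Proof.
move=> mb h1 h2 i j; have := cmeas_if mb (h1 i j) (h2 i j); congr cmeas; apply/funext => x.
by case: (b x).
Qed.

Lemma cmeas_tr m (F : T -> 'M[R[i]]_m) : mmeas F -> cmeas (fun x => \tr (F x)).
Proof. by move=> h; rewrite /mxtrace; apply: cmeas_sum. Qed.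

Lemma measurable_vn m (F : T -> 'cV[R[i]]_m) : mmeas F -> measurable_fun setT (fun x => vn (F x)).
Proof.
move=> h; apply: measurable_sqrt.
apply: (@measurable_sum _ _ _ setT _ _ (fun i x => cn (F x i 0) ^+ 2)) => i.
by apply: measurable_funX; exact: measurable_cn.
Qed.

Lemma mmeas_nrm m (F : T -> 'cV[R[i]]_m) : mmeas F -> mmeas (fun x => nrm (F x)).
Proof.
move=> h; apply: mmeasZ => //; apply: cmeas_real; apply: measurable_inv_ge0 => //.
exact: measurable_vn.
Qed.

Lemma mmeas_fr n (F : T -> Mat R n) : mmeas F -> mmeas (fun x => fr (F x)).
Proof.
move=> h; rewrite /fr; elim: (enum _) => [|j s IH] /=; first exact: mmeas_cst.
apply: mmeas_if => //; last by apply: mmeas_nrm; exact: mmeas_col.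
rewrite (_ : (fun _ => _) = (fun x => vn (col j (F x)) == 0)).
  by apply: measurable_fun_eqr; [apply: measurable_vn; exact: mmeas_col|exact: measurable_cst].
by apply/funext => x; rewrite vn_eq0.
Qed.

Lemma mmeas_fu n (F : T -> Mat R n) : mmeas F -> mmeas (fun x => fu (F x)).
Proof. exact: mmeas_fr. Qed.

Lemma mmeas_fv n (F : T -> Mat R n) : mmeas F -> mmeas (fun x => fv (F x)).
Proof.
move=> h; apply: mmeas_fr; apply: mmeasB => //; apply: mmeasM; first exact: mmeas_fr.
by apply: mmeas_adj; exact: mmeas_fr.
Qed.

Lemma mmeasP n (F : T -> MT R n) : mmeas (F : T -> Mat R n) -> measurable_fun setT F.
Proof.
move=> h; apply: (@measurability _ _ T (MT R n) setT F (@coordG R n)) => //.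
move=> _ [_ [i [j [B [mB [->|->]]]]] <-]; rewrite setTI.
  by have := (h i j).1 measurableT B mB; rewrite setTI.
by have := (h i j).2 measurableT B mB; rewrite setTI.
Qed.

Lemma measurable_mmeas n (F : T -> MT R n) : measurable_fun setT F -> mmeas (F : T -> Mat R n).
Proof.
move=> h i j; split=> _ B mB; rewrite setTI.
  have := h measurableT [set M : MT R n | B (complex.Re (M i j))]; rewrite setTI; apply.
  by apply: sub_sigma_algebra; exists i, j, B; split=> //; left.
have := h measurableT [set M : MT R n | B (complex.Im (M i j))]; rewrite setTI; apply.
by apply: sub_sigma_algebra; exists i, j, B; split=> //; right.
Qed.

Lemma measurable_dFS n (F G : T -> MT R n) : measurable_fun setT F -> measurable_fun setT G ->
  measurable_fun setT (fun x => dFS (F x) (G x)).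
Proof.
move=> /measurable_mmeas hF /measurable_mmeas hG.
apply: (@measurableT_comp _ _ _ _ _ _ (@acos R)); first exact: measurable_acos.
by apply: measurable_sqrt; case: (cmeas_tr (mmeasM hF hG)).
Qed.

End mmeas_closure.

Lemma mmeas_id (R : realType) n : mmeas (fun M : MT R n => (M : Mat R n)).
Proof. by apply: measurable_mmeas; exact: measurable_id. Qed.

Lemma pmeas_restr (dT : measure_display) (T : measurableType dT) (R : realType) n (p : HPoly R n)
    (u v : T -> Vec R n) : mmeas u -> mmeas v -> pmeas (fun x => restr p (u x) (v x)).
Proof.
have pM (F G : T -> {poly R[i]}) : pmeas F -> pmeas G -> pmeas (fun x => F x * G x).
  move=> hF hG k; have := cmeas_sum (index_enum 'I_k.+1) predT (fun j => cmeasM (hF j) (hG (k - j)%N)).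
  by congr cmeas; apply/funext => x; rewrite coefM.
have pC (c : T -> R[i]) : cmeas c -> pmeas (fun x => (c x)%:P).
  move=> hc [|k]; first by move: hc; congr cmeas; apply/funext => x; rewrite coefC.
  by rewrite (_ : (fun _ => _) = fun=> 0); [exact: cmeas_cst|apply/funext => x; rewrite coefC].
move=> hu hv.
rewrite (_ : (fun x => _) = fun x => \sum_(m <- msupp p) (p@_m)%:P * \prod_i ((u x i 0)%:P + 'X * (v x i 0)%:P) ^+ m i);
  last by apply/funext => x; rewrite restr_sum.
elim: (msupp p) => [|m s IH].
  by rewrite (_ : (fun _ => _) = fun=> 0%:P); [apply: (pC); exact: cmeas_cst|apply/funext => x; rewrite big_nil].
rewrite (_ : (fun x => _) = fun x => (p@_m)%:P * (\prod_i ((u x i 0)%:P + 'X * (v x i 0)%:P) ^+ m i) +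
  \sum_(m <- s) (p@_m)%:P * \prod_i ((u x i 0)%:P + 'X * (v x i 0)%:P) ^+ m i); last first.
  by apply/funext => x; rewrite big_cons.
suff hA : pmeas (fun x => (p@_m)%:P * (\prod_i ((u x i 0)%:P + 'X * (v x i 0)%:P) ^+ m i)).
  by move=> k; have := cmeasD (hA k) (IH k); congr cmeas; apply/funext => x; rewrite coefD.
apply: (pM); first by apply: (pC); exact: cmeas_cst.
elim: (index_enum _) => [|i t IHt].
  by rewrite (_ : (fun _ => _) = fun=> 1%:P); [apply: (pC); exact: cmeas_cst|apply/funext => x; rewrite big_nil].
rewrite (_ : (fun x => _) = fun x => ((u x i 0)%:P + 'X * (v x i 0)%:P) ^+ m i *
   \prod_(i <- t) ((u x i 0)%:P + 'X * (v x i 0)%:P) ^+ m i); last by apply/funext => x; rewrite big_cons.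
apply: (pM) => //.
elim: (m i) => [|a IHa].
  by rewrite (_ : (fun _ => _) = fun=> 1%:P); [apply: (pC); exact: cmeas_cst|apply/funext => x; rewrite expr0].
rewrite (_ : (fun x => _) = fun x => ((u x i 0)%:P + 'X * (v x i 0)%:P) * ((u x i 0)%:P + 'X * (v x i 0)%:P) ^+ a);
  last by apply/funext => x; rewrite exprS.
have hX : pmeas (fun _ : T => 'X : {poly R[i]}) by move=> l; exact: cmeas_cst.
apply: (pM) => // l; have := cmeasD (pC _ (hu i 0) l) (pM _ _ hX (pC _ (hv i 0)) l).
by congr cmeas; apply/funext => x; rewrite coefD.
Qed.

(** * Root measures and couplings *)

Lemma measurable_select (dT dY : measure_display) (T : measurableType dT) (Y : measurableType dY)
    (I : finType) (s : T -> I) (G : I -> T -> Y) :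
  (forall k, measurable [set x | s x = k]) -> (forall k, measurable_fun setT (G k)) ->
  measurable_fun setT (fun x => G (s x) x).
Proof.
move=> ms mG _ B mB; rewrite setTI.
rewrite (_ : _ @^-1` B = \bigcup_(k in [set: I]) ([set x | s x = k] `&` (G k @^-1` B))).
  apply: fin_bigcup_measurable; first exact: finite_finset.
  by move=> k _; apply: measurableI => //; have := mG k measurableT B mB; rewrite setTI.
apply/seteqP; split=> x /=; first by move=> h; exists (s x).
by move=> [k _ [/= <-]].
Qed.

(** Comparing one index at a time keeps the choice measurable. It selects optimal permutations of
    roots and nearest points of a net. *)
Lemma measurable_argmin (dT : measure_display) (T : measurableType dT) (R : realType)
    (I : finType) (i0 : I) (h : I -> T -> R) : (forall i, measurable_fun setT (h i)) ->
  exists2 s : T -> I, (forall k, measurable [set x | s x = k]) & forall x i, h (s x) x <= h i x.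
Proof.
move=> mh.
suff [s ms hs] : exists2 s : T -> I, (forall k, measurable [set x | s x = k]) &
    forall x i, i \in enum I -> h (s x) x <= h i x.
  by exists s => // x i; apply: hs; rewrite mem_enum.
elim: (enum I) => [|i l [s ms hs]].
  exists (fun=> i0) => // k.
  have [->|ne] := eqVneq i0 k; first by rewrite (_ : [set x | _] = setT) //; apply/seteqP; split.
  by rewrite (_ : [set x | _] = set0) //; apply/seteqP; split=> // x /= e; move/eqP: ne.
pose b x := h i x < h (s x) x.
have mb : measurable_fun setT b.
  by apply: measurable_fun_ltr => //; exact: measurable_select.
exists (fun x => if b x then i else s x).
  move=> k; rewrite (_ : [set x | _] = ([set x | b x] `&` [set x | i = k]) `|` (~` [set x | b x] `&` [set x | s x = k])).
    apply: measurableU; apply: measurableI => //; [exact: measurable_setb| |by apply: measurableC; exact: measurable_setb].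
    have [->|ne] := eqVneq i k; first by rewrite (_ : [set x | _] = setT) //; apply/seteqP; split.
    by rewrite (_ : [set x | _] = set0) //; apply/seteqP; split=> // x /= e; move/eqP: ne.
  apply/seteqP; split=> x /=; first by case: ifPn => bx e; [left|right; split=> //; apply/negP].
  by case=> -[]; [move=> -> |move=> /negP/negbTE ->].
move=> x j; rewrite inE /b => /orP[/eqP->|jl].
  by case: ltP => // _; exact: lexx.
by case: ltP => [hl|_]; [apply: le_trans (ltW hl) _|]; exact: hs.
Qed.

(** The average of the [d] image measures. Its mass is already 1, so [mnormalize] changes no value
    and only supplies the structure of a probability. *)
Lemma mixture_exists (dT dY : measure_display) (T : measurableType dT) (Y : measurableType dY)
    (R : realType) (vol : probability T R) (d : nat) (F : nat -> T -> Y) :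
  (0 < d)%N -> (forall i, measurable_fun setT (F i)) ->
  exists P : probability Y R,
    (forall A, measurable A -> P A = ((d%:R^-1)%:E * \sum_(i < d) vol (F i @^-1` A))%E) /\
    (forall f : Y -> \bar R, measurable_fun setT f -> (forall y, 0 <= f y)%E ->
      (\int[P]_y f y = (d%:R^-1)%:E * \sum_(i < d) \int[vol]_x f (F i x))%E).
Proof.
move=> d0 mF.
pose X i : {mfun T >-> Y} := mfun_Sub (mem_set (mF i)).
have c0 : 0 <= d%:R^-1 :> R by rewrite invr_ge0.
pose m : {measure set Y -> \bar R} := msum (fun i => mscale (NngNum c0) (distribution vol (X i))) d.
have mE A : m A = ((d%:R^-1)%:E * \sum_(i < d) vol (F i @^-1` A))%E.
  rewrite /m /msum /mscale /= ge0_sume_distrr //.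
have m1 : m setT = 1%E.
  rewrite mE (eq_bigr (fun=> 1%E)); last by move=> i _; rewrite preimage_setT probability_setT.
  rewrite sumEFin sumr_const card_ord -EFinM mulVf //.
  by rewrite pnatr_eq0 -lt0n.
pose P : probability Y R := mnormalize m (distribution vol (X 0%N)).
have PE A : P A = m A.
  rewrite /P /= /mnormalize m1 ifF ?invr1 ?mule1 //.
  by rewrite onee_eq0.
exists P; split=> [A _|f mf f0]; first by rewrite PE mE.
rewrite (@eq_measure_integral _ _ _ setT m) => [|A mA _]; last exact: PE.
rewrite /m ge0_integral_measure_sum // ge0_sume_distrr //.
  apply: eq_bigr => i _; rewrite ge0_integral_mscale //=; congr (_ * _)%E.
  by rewrite ge0_integral_distribution.
by move=> i _; exact: integral_ge0.
Qed.

(* No measurability: the integral of a nonnegative function is a supremum over simple functions. *)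
Lemma le_integral_offnull (dT : measure_display) (T : measurableType dT) (R : realType)
    (mu : {measure set T -> \bar R}) (N : set T) (f g : T -> \bar R) :
  measurable N -> mu N = 0%E -> (forall x, 0 <= f x)%E -> (forall x, 0 <= g x)%E ->
  (forall x, ~ N x -> (f x <= g x)%E) -> (\int[mu]_x f x <= \int[mu]_x g x)%E.
Proof.
move=> mN N0 f0 g0 fg; rewrite !ge0_integralTE //; apply: ub_ereal_sup => _ [h hf <-].
apply: ereal_sup_ge.
have mC : measurable (~` N) by exact: measurableC.
have pE x : proj_nnsfun h mC x = h x * \1_(~` N) x by [].
exists (sintegral mu (proj_nnsfun h mC)).
  exists (proj_nnsfun h mC) => // x; rewrite pE indicE.
  have [xN|xN] := pselect (N x).
    by rewrite memNset //= ?mulr0 //; apply/negP => //.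
  by rewrite mem_set //= mulr1; apply: le_trans (hf x) (fg x xN).
rewrite -!integralT_nnsfun.
rewrite [leLHS](_ : _ = \int[mu]_x (proj_nnsfun h mC x)%:E)%E //.
apply: ge0_ae_eq_integral => //.
- by apply/measurable_EFinP; exact: measurable_funP.
- by apply/measurable_EFinP; exact: measurable_funP.
- by move=> x _; rewrite lee_fin.
- by move=> x _; rewrite lee_fin.
- exists N; split=> // x /= hx; apply: contrapT => xN; apply: hx => _.
  by rewrite -[mindic R mC x]/(\1_(~` N) x) indicE mem_set //= mulr1.
Qed.

Lemma esum_pred1 (R : realType) (T : choiceType) (S : set T) (a : T) :
  (\esum_(z in S) (((z == a)%:R : R)%:E) = ((a \in S)%:R : R)%:E)%E.
Proof.
rewrite (esumID [set a]) => [|z _]; last by rewrite lee_fin.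
rewrite [X in (_ + X)%E]esum1 ?adde0; last first.
  by move=> z [_ /= /eqP/negbTE ->].
case: (boolP (a \in S)) => aS.
  rewrite (_ : S `&` [set a] = [set a]) ?esum_set1 ?eqxx // ?lee_fin //.
  by apply/seteqP; split=> z /=; [case|move=> ->; split=> //; rewrite inE in aS].
rewrite (_ : S `&` [set a] = set0) ?esum_set0 //.
apply/seteqP; split=> z //= [Sz za]; move/negP: aS; apply; rewrite inE -za.
exact: Sz.
Qed.

Lemma eq_in_set (T T' : Type) (A : set T) (B : set T') x y : (A x <-> B y) -> (x \in A) = (y \in B).
Proof.
move=> [h1 h2]; case: (boolP (y \in B)) => h.
  by rewrite mem_set //; apply: h2; rewrite inE in h.
by rewrite memNset // => /h1 /mem_set; exact/negP.
Qed.

Section root_maps.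
Context (R : realType) (n d : nat).

Definition lcoef (p : HPoly R n) (k : nat) (L : MT R n) : R[i] := (restr p (fu L) (fv L))`_k.

Lemma cmeas_lcoef p k : cmeas (lcoef p k).
Proof.
by apply: pmeas_restr; [apply: mmeas_fu|apply: mmeas_fv]; exact: mmeas_id.
Qed.

(** For [p] homogeneous of degree [d]: the lines that are not contained in the zero set of [p]. *)
Definition lgood (p : HPoly R n) (L : MT R n) :=
  rank2proj L /\ exists2 k, (k <= d)%N & lcoef p k L != 0.

Lemma measurable_meq m k (F G : MT R n -> 'M[R[i]]_(m, k)) : mmeas F -> mmeas G ->
  measurable [set L | F L = G L].
Proof.
move=> hF hG.
rewrite (_ : [set L | _] = \bigcap_(i in [set: 'I_m]) \bigcap_(j in [set: 'I_k]) ~` [set L | F L i j - G L i j != 0]).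
  apply: fin_bigcap_measurable; first exact: finite_finset.
  move=> i _; apply: fin_bigcap_measurable; first exact: finite_finset.
  by move=> j _; apply: measurableC; apply: measurable_setb; apply: cmeas_neq0; exact: cmeasB.
apply/seteqP; split=> L /=.
  by move=> e i _ j _ /=; rewrite e subrr eqxx.
move=> h; apply/matrixP => i j; apply/eqP; rewrite -subr_eq0.
by have := h i I j I; move/negP; rewrite negbK.
Qed.

Lemma measurable_rank2 : measurable [set L : MT R n | rank2proj L].
Proof.
have mI := @mmeas_id R n.
rewrite (_ : [set L | _] = [set L : MT R n | adj (L : Mat R n) = L] `&` [set L | (L : Mat R n) *m L = L] `&`
   ~` [set L : MT R n | \tr (L : Mat R n) - 2%:R != 0]).
  apply: measurableI; first apply: measurableI.
  - by apply: measurable_meq => //; exact: mmeas_adj.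
  - by apply: measurable_meq => //; exact: mmeasM.
  - apply: measurableC; apply: measurable_setb; apply: cmeas_neq0; apply: cmeasB; first exact: cmeas_tr.
    exact: cmeas_cst.
apply/seteqP; split=> L /=.
  by move=> [[h1 h2] h3]; split=> //; rewrite h3 subrr eqxx.
by move=> [[h1 h2] /negP]; rewrite negbK subr_eq0 => /eqP h3.
Qed.

Lemma measurable_lgood p : measurable [set L | lgood p L].
Proof.
rewrite (_ : [set L | _] = [set L | rank2proj L] `&` \bigcup_(k in [set k | (k <= d)%N]) [set L | lcoef p k L != 0]).
  apply: measurableI; first exact: measurable_rank2.
  by apply: bigcup_measurable => k _; apply: measurable_setb; apply: cmeas_neq0; exact: cmeas_lcoef.
by apply/seteqP; split=> L /= [h1 [k h2 h3]]; split=> //; exists k.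
Qed.

Definition is_roots (p : HPoly R n) (kap : MT R n -> R[i]) (ze : nat -> MT R n -> R[i] * R[i]) :=
  [/\ forall i, cmeas (fun L => (ze i L).1), forall i, cmeas (fun L => (ze i L).2) &
   forall L, lgood p L -> [/\ kap L != 0, forall i, (i < d)%N -> ze i L != 0 &
     forall a b, pe p (a *: fu L + b *: fv L) = kap L * \prod_(i < d) br (ze i L) (a, b)]].

Lemma roots_exist p : is_homog d p -> exists kap ze, is_roots p kap ze.
Proof.
move=> hp; have [kap [e1 [e2 [m1 m2 h]]]] := binary_roots d (cmeas_lcoef p).
exists kap, (fun i L => (e1 i L, e2 i L)); split=> // L [_ /h [h1 h2 h3]]; split=> //.
by move=> a b; rewrite (pe_line _ _ _ _ hp) -h3.
Qed.

Definition rootpt (ze : nat -> MT R n -> R[i] * R[i]) (i : nat) (L : MT R n) : MT R n :=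
  pj (onln (fu L) (fv L) (ze i L)).

Lemma measurable_rootpt p kap ze i : is_roots p kap ze -> measurable_fun setT (rootpt ze i).
Proof.
move=> [m1 m2 _]; apply: mmeasP; have mI := @mmeas_id R n.
have hn : mmeas (fun L : MT R n => nrm (onln (fu L) (fv L) (ze i L))).
  by apply: mmeas_nrm; apply: mmeasD; apply: mmeasZ => //; [exact: mmeas_fu|exact: mmeas_fv].
by apply: mmeasM => //; exact: mmeas_adj.
Qed.

Lemma rootpt_rank1 p kap ze i L : is_roots p kap ze -> lgood p L -> (i < d)%N ->
  rank1proj (rootpt ze i L).
Proof.
move=> [_ _ h] gL id; have [_ h2 _] := h L gL.
have [_ u1 v1 uv _] := rank2_frame gL.1.
by apply: pj_rank1; apply: onln_neq0 => //; exact: h2.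
Qed.

(** On a good line the multiplicities in [A] add up to the number of indices [i] whose root point
    lies in [A]. The integrand of [muP] is not known to be measurable, so equality is obtained from
    two inequalities off the null set of bad lines. *)
Lemma muPE (vol : probability (MT R n) R) p kap ze A : (0 < d)%N -> is_roots p kap ze ->
  vol [set L | ~ lgood p L] = 0%E -> measurable A ->
  muP d vol p A = ((d%:R^-1)%:E * \sum_(i < d) vol (rootpt ze i @^-1` A))%E.
Proof.
move=> d0 hz N0 mA; rewrite /muP; congr (_ * _)%E.
have mN : measurable [set L | ~ lgood p L] by apply: measurableC; exact: measurable_lgood.
have mR i : measurable (rootpt ze i @^-1` A).
  by have := measurable_rootpt i hz measurableT mA; rewrite setTI.
have -> : (\sum_(i < d) vol (rootpt ze i @^-1` A) =
    \int[vol]_L (\sum_(i < d) (\1_(rootpt ze i @^-1` A) L)%:E))%E.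
  rewrite ge0_integral_sum //.
  - by apply: eq_bigr => i _; rewrite integral_indic // setIT.
  - by move=> i; apply/measurable_EFinP; exact: measurable_indic.
have E L : lgood p L -> (\esum_(Z in A `&` [set Z : MT R n | rank1proj Z]) ((mult p L Z)%:R : R)%:E =
    \sum_(i < d) (\1_(rootpt ze i @^-1` A) L)%:E)%E.
  move=> gL; have [_ _ h] := hz; have [k0 z0 pE] := h L gL.
  have [LE u1 v1 uv _] := rank2_frame gL.1.
  rewrite (eq_esum (b := fun Z => (\sum_(i < d) (((Z == rootpt ze i L)%:R : R)%:E))%E)); last first.
    move=> Z [_ rZ]; rewrite (multE u1 v1 uv LE k0 z0 pE rZ) natr_sum -sumEFin.
    by [].
  rewrite esum_sum; last by move=> Z i _ _; rewrite lee_fin.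
  apply: eq_bigr => i _; rewrite esum_pred1 indicE; congr (_%:R%:E).
  case: (boolP (L \in rootpt ze i @^-1` A)) => h'.
    rewrite inE in h'; rewrite mem_set //; split=> //=.
    exact: rootpt_rank1 hz gL (ltn_ord i).
  rewrite memNset // => -[h2 _]; move/negP: h'; apply; rewrite inE.
  exact: h2.
have e0 L : (0 <= \esum_(Z in A `&` [set Z : MT R n | rank1proj Z]) ((mult p L Z)%:R : R)%:E)%E.
  by apply: esum_ge0 => Z _; rewrite lee_fin.
have s0 L : (0 <= \sum_(i < d) (\1_(rootpt ze i @^-1` A) L : R)%:E)%E.
  by apply: sume_ge0 => i _; rewrite lee_fin.
apply/eqP; rewrite eq_le; apply/andP; split; apply: (@le_integral_offnull _ _ _ _ _ _ _ mN N0) => //.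
  by move=> L /= /contrapT /E ->.
by move=> L /= /contrapT /E ->.
Qed.

(** The coupling pairs the roots on each line by the cheapest permutation, chosen measurably.
    Reindexing by that permutation shows that the second marginal is unchanged. *)
Lemma W2sq_roots (vol : probability (MT R n) R) p q kap kap' ze ze' (bnd : MT R n -> \bar R) :
  (0 < d)%N -> is_roots p kap ze -> is_roots q kap' ze' ->
  vol [set L | ~ lgood p L] = 0%E -> vol [set L | ~ lgood q L] = 0%E ->
  measurable_fun setT bnd -> (forall L, 0 <= bnd L)%E ->
  (forall L, lgood p L -> lgood q L -> exists s : 'S_d,
    ((\sum_(i < d) dFS (rootpt ze i L) (rootpt ze' (s i) L) ^+ 2)%:E <= bnd L)%E) ->
  (W2sq (muP d vol p) (muP d vol q) <= (d%:R^-1)%:E * \int[vol]_L bnd L)%E.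
Proof.
move=> d0 hz hz' Np Nq mb b0 hs.
have mz i := measurable_rootpt i hz; have mz' i := measurable_rootpt i hz'.
pose h (s : 'S_d) L := \sum_(i < d) dFS (rootpt ze i L) (rootpt ze' (s i) L) ^+ 2.
have mh s : measurable_fun setT (h s).
  rewrite /h; apply: (@measurable_sum _ _ _ setT _ _ (fun (i : 'I_d) (L : MT R n) => dFS (rootpt ze i L) (rootpt ze' (s i) L) ^+ 2)) => i.
  by apply: measurable_funX; exact: measurable_dFS.
have [s ms hmin] := measurable_argmin (perm (@inj_id 'I_d)) mh.
pose o0 : 'I_d := Ordinal d0.
(* [mixture_exists] takes a family indexed by [nat], so the permutation is extended beyond [d]
   through a default index. *)
pose sx i L := nat_of_ord (s L (insubd o0 i)).
pose F i L := (rootpt ze i L, rootpt ze' (sx i L) L).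
have mF i : measurable_fun setT (F i).
  apply: measurable_fun_pair => //.
  exact: (@measurable_select _ _ _ _ _ s (fun t : 'S_d => rootpt ze' (t (insubd o0 i)))).
have FE (i : 'I_d) L : F i L = (rootpt ze i L, rootpt ze' (s L i) L).
  by rewrite /F /sx valKd.
have dE (i : 'I_d) L : dFS (F i L).1 (F i L).2 = dFS (rootpt ze i L) (rootpt ze' (s L i) L).
  by rewrite FE.
have sE L : (\sum_(i < d) (dFS (F i L).1 (F i L).2 ^+ 2)%:E)%E = (h (s L) L)%:E.
  have e : \sum_(i < d) dFS (F i L).1 (F i L).2 ^+ 2 = h (s L) L.
    by apply: eq_bigr => i _; exact: (congr1 (fun x => x ^+ 2) (dE i L)).
  by rewrite -e sumEFin.
have [P [PE PI]] := mixture_exists vol d0 mF.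
apply: (@le_trans _ _ (\int[P]_x (dFS x.1 x.2 ^+ 2)%:E)%E).
  apply: ereal_inf_lbound; exists P; split; last split=> //.
    move=> A mA; rewrite (muPE d0 hz Np mA) (PE _ (measurableX mA measurableT)).
    congr (_ * _)%E; apply: eq_bigr => i _; congr (vol _).
    by apply/seteqP; split=> L //= [].
  move=> B mB; rewrite (muPE d0 hz' Nq mB) (PE _ (measurableX measurableT mB)).
  congr (_ * _)%E.
  have mF2 i : measurable (F i @^-1` (setT `*` B)).
    by have := mF i measurableT (setT `*` B); rewrite setTI; apply; exact: measurableX.
  have mR i : measurable (rootpt ze' i @^-1` B).
    by have := mz' i measurableT B mB; rewrite setTI.
  have -> : (\sum_(i < d) vol (F i @^-1` (setT `*` B)) =
    \int[vol]_L (\sum_(i < d) (\1_(F i @^-1` (setT `*` B)) L)%:E))%E.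
    rewrite ge0_integral_sum //.
    - by apply: eq_bigr => i _; rewrite integral_indic // setIT.
    - by move=> i; apply/measurable_EFinP; exact: measurable_indic.
  have -> : (\sum_(i < d) vol (rootpt ze' i @^-1` B) =
    \int[vol]_L (\sum_(i < d) (\1_(rootpt ze' i @^-1` B) L)%:E))%E.
    rewrite ge0_integral_sum //.
    - by apply: eq_bigr => i _; rewrite integral_indic // setIT.
    - by move=> i; apply/measurable_EFinP; exact: measurable_indic.
  apply: eq_integral => L _; rewrite [RHS](reindex_inj (@perm_inj _ (s L))) /=.
  apply: eq_bigr => i _; rewrite !indicE; congr (_%:R%:E).
  congr nat_of_bool; apply: eq_in_set; split=> [[_ h2]|h2].
    by have : B (F i L).2 by []; rewrite FE.
  have h3 : B (F i L).2 by rewrite FE.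
  exact: (conj I h3).
rewrite PI; last by move=> y; rewrite lee_fin sqr_ge0.
  rewrite lee_pmul2l // ?lte_fin ?invr_gt0 ?ltr0n //.
  have -> : (\sum_(i < d) \int[vol]_L (dFS (F i L).1 (F i L).2 ^+ 2)%:E =
     \int[vol]_L (h (s L) L)%:E)%E.
    rewrite -ge0_integral_sum //.
    - by apply: eq_integral => L _; exact: sE.
    - move=> i; apply/measurable_EFinP; apply: measurable_funX; apply: measurable_dFS.
        exact: measurableT_comp measurable_fst (mF i).
      exact: measurableT_comp measurable_snd (mF i).
    - by move=> i L _; rewrite lee_fin sqr_ge0.
  have mN : measurable ([set L | ~ lgood p L] `|` [set L | ~ lgood q L]).
    by apply: measurableU; apply: measurableC; exact: measurable_lgood.
  apply: (le_integral_offnull mN).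
  - apply/eqP; rewrite -measure_le0; apply: le_trans (measureU2 _ _ _) _.
    + by apply: measurableC; exact: measurable_lgood.
    + by apply: measurableC; exact: measurable_lgood.
    + by rewrite [X in (X + _)%E]Np [X in (_ + X)%E]Nq adde0.
  - by move=> L; rewrite lee_fin sumr_ge0 // => i _; rewrite sqr_ge0.
  - by [].
  - move=> L hL; have [||t ht] := hs L.
    + by apply: contrapT => h'; apply: hL; left.
    + by apply: contrapT => h'; apply: hL; right.
    + by apply: le_trans ht; rewrite lee_fin; exact: hmin.
by apply/measurable_EFinP; apply: measurable_funX; apply: measurable_dFS.
Qed.

End root_maps.

(** * The transport cost of a perturbation *)

Definition itvR (R : realType) (x a : R) : set (measurableTypeR R) := `[x, x + a]%classic.

Lemma itvRE (R : realType) (x a y : R) : itvR x a y <-> x <= y <= x + a.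
Proof. by rewrite /itvR /= in_itv. Qed.

Lemma measurable_itvR (R : realType) (x a : R) : measurable (itvR x a).
Proof. exact: measurable_itv. Qed.

Lemma lebesgue_itvR (R : realType) (x a : R) : 0 <= a -> lebesgue_measure (itvR x a) = a%:E.
Proof.
move=> a0; rewrite /itvR lebesgue_measure_itv /= lte_fin; case: ltP => h.
  by rewrite -EFinB; congr (_%:E); ring.
by congr (_%:E); lra.
Qed.

Definition uM (R : realType) : {measure set (measurableTypeR R) -> \bar R} :=
  mrestr (@lebesgue_measure R) (measurable_itvR (-2) 4).

(** The uniform distribution on [[-2, 2]]; the Dirac mass is the fallback argument of
    [mnormalize]. *)
Definition uR (R : realType) : probability (measurableTypeR R) R :=
  mnormalize (uM R) (dirac (0 : measurableTypeR R)).

Lemma uRE (R : realType) (A : set (measurableTypeR R)) :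
  uR R A = (lebesgue_measure (A `&` itvR (-2)%R 4%R) * ((4^-1 : R)%:E))%E.
Proof.
have e : uM R setT = (4 : R)%:E.
  transitivity (lebesgue_measure (setT `&` itvR (-2 : R) 4)); first by [].
  by rewrite setTI lebesgue_itvR.
rewrite /uR /= /mnormalize e ifF //.
by apply/negbTE; rewrite orbF eqe; apply/eqP; lra.
Qed.

Lemma uR_itv (R : realType) (x a : R) : 0 <= a -> -2 <= x -> x + a <= 2 ->
  uR R (itvR x a) = (a / 4)%:E.
Proof.
move=> a0 x2 xa; rewrite uRE.
have -> : itvR x a `&` itvR (-2) 4 = itvR x a.
  apply/seteqP; split=> y; first by case.
  by move=> h; split=> //; move/itvRE/andP: h => [h1 h2]; apply/itvRE/andP; split; lra.
by rewrite lebesgue_itvR.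
Qed.

Lemma uR_ub (R : realType) (x a : R) : 0 <= a -> (uR R (itvR x a) <= (a / 4)%:E)%E.
Proof.
move=> a0; rewrite uRE EFinM lee_pmul2r ?lte_fin ?invr_gt0 ?ltr0n // -(lebesgue_itvR x a0).
by apply: le_measure; rewrite ?inE; [apply: measurableI| |exact: subIsetl]; exact: measurable_itvR.
Qed.

Notation RR R := (measurableTypeR R * measurableTypeR R)%type.

Definition u2 (R : realType) : probability (RR R) R := (uR R \x uR R)%E.

Definition cpt (R : realType) n (c : bool) (t : MT R n * RR R) : Vec R n :=
  if c then fu t.1 + (t.2.1 +i* t.2.2)%C *: fv t.1 else (t.2.1 +i* t.2.2)%C *: fu t.1 + fv t.1.

Definition lset (R : realType) n (c : bool) (Phi : Vec R n -> bool) : set (MT R n * RR R) :=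
  [set t | Phi (cpt c t)].

Definition vu2 (R : realType) n (vol : probability (MT R n) R) : probability (MT R n * RR R)%type R :=
  (vol \x u2 R)%E.

(* Up to scaling, the charts [u + w v] and [w u + v] with [w] in the square [-2, 2]^2 cover the
   whole line; [PP] is the mass of a condition in both charts, for [w] uniform in the square. *)
Definition PP (R : realType) n (vol : probability (MT R n) R) (Phi : Vec R n -> bool) : \bar R :=
  (vu2 vol (lset true Phi) + vu2 vol (lset false Phi))%E.

Definition vmeas (R : realType) n (Phi : Vec R n -> bool) :=
  forall c, measurable (lset c Phi).

Section cpt_measurable.
Context (R : realType) (n : nat).

Lemma mmeas_cpt c : mmeas (@cpt R n c).
Proof.
have m1 : mmeas (fun t : MT R n * RR R => (t.1 : Mat R n)).
  by apply: measurable_mmeas; exact: measurable_fst.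
have mc : cmeas (fun t : MT R n * RR R => (t.2.1 +i* t.2.2)%C).
  split=> /=; first exact: measurableT_comp measurable_fst measurable_snd.
  exact: measurableT_comp measurable_snd measurable_snd.
have mu' := mmeas_fu m1; have mv := mmeas_fv m1.
by case: c; rewrite /cpt; apply: mmeasD => //; exact: mmeasZ.
Qed.

Lemma cmeas_pe (dT : measure_display) (T : measurableType dT) (p : HPoly R n) (F : T -> Vec R n) :
  mmeas F -> cmeas (fun x => pe p (F x)).
Proof.
move=> hF; rewrite /pe (_ : (fun x => _) = fun x => \sum_(m <- msupp p) p@_m * \prod_i F x i 0 ^+ m i).
  apply: cmeas_sum => m; apply: cmeasM; first exact: cmeas_cst.
  by apply: cmeas_prod => i; apply: cmeasX; exact: hF.
by apply/funext => x; rewrite mevalE.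
Qed.

Lemma vmeas_le (p q : HPoly R n) (r : R) : vmeas (fun x => cn (pe p x) <= r * cn (pe q x)).
Proof.
move=> c; apply: measurable_setb; apply: measurable_fun_ler.
  by apply: measurable_cn; apply: cmeas_pe; exact: mmeas_cpt.
apply: measurable_funM; first exact: measurable_cst.
by apply: measurable_cn; apply: cmeas_pe; exact: mmeas_cpt.
Qed.

Lemma vmeas_le_cst (p : HPoly R n) (r : R) : vmeas (fun x => cn (pe p x) <= r).
Proof.
move=> c; apply: measurable_setb; apply: measurable_fun_ler; last exact: measurable_cst.
by apply: measurable_cn; apply: cmeas_pe; exact: mmeas_cpt.
Qed.

End cpt_measurable.

Lemma peB (R : realType) n (p q : HPoly R n) x : pe (p - q) x = pe p x - pe q x.
Proof. by rewrite /pe mevalB. Qed.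

Lemma peZ (R : realType) n c (p : HPoly R n) x : pe (c *: p) x = c * pe p x.
Proof. by rewrite /pe mevalZ. Qed.

Lemma u2_setX (R : realType) (A B : set (measurableTypeR R)) : measurable A -> measurable B ->
  u2 R (A `*` B) = (uR R A * uR R B)%E.
Proof. by move=> mA mB; exact: product_measure1E. Qed.

Lemma u2_square (R : realType) (x y a : R) : 0 <= a -> -2 <= x -> x + a <= 2 -> -2 <= y -> y + a <= 2 ->
  u2 R (itvR x a `*` itvR y a) = ((a / 4) ^+ 2)%:E.
Proof.
move=> a0 hx hxa hy hya; rewrite u2_setX; [|exact: measurable_itvR|exact: measurable_itvR].
by rewrite !uR_itv.
Qed.

(** A square of side [a] inside [[-2, 2]^2] has mass [(a / 4) ^+ 2], so a bad set of smaller mass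
    contains no such square and [match_squares] applies. *)
Lemma root_match_bound (R : realType) n (d : nat) : exists2 K : R, 0 < K &
  forall (p q : HPoly R n) kap kap' (ze ze' : nat -> MT R n -> R[i] * R[i]) (L : MT R n) (a : R),
  is_roots d p kap ze -> is_roots d q kap' ze' -> lgood d p L -> lgood d q L -> 0 < a ->
  let Phi x := cn (pe p x) <= 2 * cn (pe (p - q) x) in
  (u2 R (xsection (lset true Phi) L) + u2 R (xsection (lset false Phi) L) < ((a / 4) ^+ 2)%:E)%E ->
  exists s : 'S_d, \sum_(i < d) dFS (rootpt ze i L) (rootpt ze' (s i) L) ^+ 2 <= K * a ^+ 2.
Proof.
have [C C0 HC] := match_squares R d.
exists (d%:R * (8 * C ^+ 2) + 1).
  by rewrite ltr_wpDl // mulr_ge0 // mulr_ge0 // sqr_ge0.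
move=> p q kap kap' ze ze' L a [m1 m2 hz] [m1' m2' hz'] gp gq a0 Phi hPhi.
have [k0 z0 pE] := hz L gp; have [k0' z0' qE] := hz' L gq.
have [_ u1 v1 uv _] := rank2_frame gp.1.
pose zs := [seq ze i L | i <- iota 0 d]; pose ws := [seq ze' i L | i <- iota 0 d].
have prodE (e : nat -> MT R n -> R[i] * R[i]) x : \prod_(z <- [seq e i L | i <- iota 0 d]) br z x = \prod_(i < d) br (e i L) x.
  by rewrite big_map -(big_mkord predT (fun i => br (e i L) x)) /index_iota subn0.
pose S := [set x : R[i] * R[i] | Phi (x.1 *: fu L + x.2 *: fv L)].
have [||||||ws' pws' hws'] := HC a (kap L) (kap' L) zs ws S a0 k0 k0'.
- by rewrite size_map size_iota.
- by rewrite size_map size_iota.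
- by apply/allP; rewrite all_map; apply/allP => i; rewrite mem_iota => /andP[_ id]; exact: z0.
- by apply/allP; rewrite all_map; apply/allP => i; rewrite mem_iota => /andP[_ id]; exact: z0'.
- move=> x; rewrite !prodE; case: x => x y /= h.
  by rewrite /S /= /Phi peB pE qE.
- move=> x0 y0 h1 h2 h3 h4.
  have mP (c : bool) : measurable (xsection (lset c Phi) L).
    by apply: measurable_xsection; exact: vmeas_le.
  have key (c : bool) : exists x y, [/\ x0 <= x <= x0 + a, y0 <= y <= y0 + a & ~~ Phi (cpt c (L, (x, y)))].
    apply: contrapT => hn; move: hPhi; apply/negP; rewrite -leNgt.
    apply: (@le_trans _ _ (u2 R (xsection (lset c Phi) L))); last first.
      by case: (c); [apply: leeDl|apply: leeDr]; exact: measure_ge0.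
    rewrite -(u2_square (ltW a0) h1 h2 h3 h4); apply: le_measure; rewrite ?inE.
    - by apply: measurableX; exact: measurable_itvR.
    - exact: mP.
    - move=> [x y] /= [/itvRE hx /itvRE hy].
      rewrite /xsection /= inE /lset /=; apply: contrapT => /negP h.
      by apply: hn; exists x, y.
  split.
    have [x [y [hx hy h]]] := key true; exists x, y; split=> //.
    by rewrite /S /= scale1r; apply/negP.
  have [x [y [hx hy h]]] := key false; exists x, y; split=> //.
  by rewrite /S /= scale1r; apply/negP.
have szw : size ws = d by rewrite size_map size_iota.
have szw' : size ws' = d by rewrite (perm_size pws').
pose tw : d.-tuple (R[i] * R[i]) := Tuple (introT eqP szw).
have /tuple_permP [s ws'E] : perm_eq ws' tw by [].
exists s.
have nE (i : 'I_d) : nth 0 ws' i = ze' (s i) L.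
  rewrite ws'E -tnth_nth tnth_mktuple (tnth_nth 0) /=.
  by rewrite (nth_map 0%N) ?size_iota // nth_iota.
have zE (i : 'I_d) : nth 0 zs i = ze i L.
  by rewrite (nth_map 0%N) ?size_iota // nth_iota.
apply: (@le_trans _ _ (\sum_(i < d) 8 * (C * a) ^+ 2)).
  apply: ler_sum => i _; have := hws' 0 i (ltn_ord i); rewrite nE zE => h.
  apply: le_trans (dFS_chd u1 v1 uv (z0 i (ltn_ord i)) (z0' (s i) (ltn_ord _))) _.
  rewrite ler_pM2l ?ltr0n //; apply: lerXn2r; rewrite ?nnegrE ?chd_ge0 //.
  by rewrite mulr_ge0 // ltW.
rewrite sumr_const card_ord -[X in X <= _]mulr_natl.
have -> : (d%:R * (8 * C ^+ 2) + 1) * a ^+ 2 = d%:R * (8 * (C * a) ^+ 2) + a ^+ 2 by ring.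
by rewrite lerDl sqr_ge0.
Qed.

(** On each line the side [a] is adapted to the mass of the bad set there. The cost [a ^+ 2] is
    linear in that mass, so integrating over the lines produces [PP]. *)
Lemma W2_bad_bound (R : realType) n (d : nat) : (0 < d)%N -> exists2 K : R, 0 < K &
  forall (vol : probability (MT R n) R) (p q : HPoly R n), is_homog d p -> is_homog d q ->
  vol [set L | ~ lgood d p L] = 0%E -> vol [set L | ~ lgood d q L] = 0%E ->
  (W2sq (muP d vol p) (muP d vol q) <= K%:E * PP vol (fun x => cn (pe p x) <= 2 * cn (pe (p - q) x))%R)%E.
Proof.
move=> d0; have [K K0 HK] := root_match_bound R n d.
exists (16 * 2 * K); first by rewrite mulr_gt0.
move=> vol p q hp hq Np Nq.
have [kap [ze hz]] := roots_exist hp; have [kap' [ze' hz']] := roots_exist hq.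
set Phi := fun x => _.
have mPhi : vmeas Phi by exact: vmeas_le.
pose s c L : \bar R := u2 R (xsection (lset c Phi) L).
have ms c : measurable_fun setT (s c) by exact: (measurable_fun_xsection (u2 R) (mPhi c)).
have s0 c L : (0 <= s c L)%E by exact: measure_ge0.
have PPE : PP vol Phi = (\int[vol]_L (s true L + s false L))%E by rewrite ge0_integralD.
apply/lee_addgt0Pr => e e0.
pose bnd L := ((16 * 2 * K)%:E * ((s true L + s false L) + (e / (16 * 2 * K))%:E))%E.
have KK : 0 < 16 * 2 * K by rewrite mulr_gt0.
have ss0 L : (0 <= s true L + s false L)%E by rewrite adde_ge0.
have mss : measurable_fun setT (fun L => s true L + s false L)%E by exact: emeasurable_funD.
have e0' : (0 < (e / (16 * 2 * K))%:E)%E by rewrite lte_fin divr_gt0.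
have mse : measurable_fun setT (fun L => (s true L + s false L) + (e / (16 * 2 * K))%:E)%E.
  by apply: emeasurable_funD => //; exact: measurable_cst.
have b0 L : (0 <= bnd L)%E.
  by rewrite /bnd; apply: mule_ge0; [rewrite lee_fin ltW|apply: adde_ge0; [exact: ss0|exact: ltW]].
have sf c L : s c L \is a fin_num.
  by apply: fin_num_measure; apply: measurable_xsection; exact: mPhi.
have PP0 : (0 <= PP vol Phi)%E by rewrite PPE integral_ge0.
apply: (@le_trans _ _ ((d%:R^-1)%:E * \int[vol]_L bnd L)%E).
  apply: (W2sq_roots d0 hz hz' Np Nq).
  - by apply: emeasurable_funM => //; exact: measurable_cst.
  - exact: b0.
  - move=> L gp gq.
    have fs : (s true L + s false L)%E \is a fin_num.
      by rewrite fin_numD; apply/andP; split; exact: sf.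
    pose r := fine (s true L + s false L); have rE : (s true L + s false L)%E = r%:E by rewrite fineK.
    have r0 : 0 <= r by rewrite -lee_fin -rE.
    (* This makes [(a / 4) ^+ 2] twice the mass [r] plus a positive term, so the strict hypothesis
       of [root_match_bound] holds even when [r = 0]. *)
    pose a := Num.sqrt (16 * 2 * (r + e / (16 * 2 * K))).
    have re : 0 < r + e / (16 * 2 * K) by rewrite ltr_wpDl // divr_gt0.
    have a0 : 0 < a by rewrite sqrtr_gt0 mulr_gt0.
    have a2 : a ^+ 2 = 16 * 2 * (r + e / (16 * 2 * K)) by rewrite sqr_sqrtr // ltW // mulr_gt0.
    have [|t ht] := HK p q kap kap' ze ze' L a hz hz' gp gq a0.
      rewrite -/(s true L) -/(s false L) rE lte_fin exprMn a2 exprVn.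
      have -> : 16 * 2 * (r + e / (16 * 2 * K)) / 4 ^+ 2 = 2 * (r + e / (16 * 2 * K)).
        by move: (r + e / (16 * 2 * K)) => X; rewrite expr2; field.
      have : 0 < e / (16 * 2 * K) by rewrite divr_gt0.
      by lra.
    exists t; rewrite /bnd rE -EFinD -EFinM lee_fin; apply: le_trans ht _.
    by rewrite a2; apply: eq_ler; ring.
apply: (@le_trans _ _ (\int[vol]_L bnd L)%E).
  rewrite gee_pMl //.
  - by apply: integral_ge0 => L _; exact: b0.
  - by rewrite lee_fin invf_le1 ?ler1n // ltr0n.
rewrite /bnd ge0_integralZl //; last 2 first.
- by move=> L _; rewrite adde_ge0 // ltW.
- by rewrite lee_fin ltW.
rewrite ge0_integralD //; last first.
  by move=> L _; rewrite ltW.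
rewrite integral_cst // -PPE.
rewrite [X in (_ + _ * X)%E](_ : _ = 1%E); last exact: probability_setT.
rewrite mule1 ge0_muleDr ?PP0 ?(ltW e0') //.
by rewrite -EFinM mulrCA divff ?mulr1 // gt_eqF.
Qed.

(** * The Wasserstein distance *)

Lemma truncn_close (R : realType) (x y M : R) : 0 < M -> 0 <= x -> 0 <= y ->
  Num.truncn (x * M) = Num.truncn (y * M) -> `|x - y| <= M^-1.
Proof.
move=> M0 x0 y0 e.
have /andP[h1 h2] := truncn_itv (mulr_ge0 x0 (ltW M0)).
have /andP[h3 h4] := truncn_itv (mulr_ge0 y0 (ltW M0)).
rewrite e in h1 h2; rewrite -natr1 in h2 h4.
rewrite -(@ler_pM2r _ M) // mulVf ?gt_eqF // -{1}(ger0_norm (ltW M0)) -normrM mulrBl.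
by rewrite ler_norml; apply/andP; split; lra.
Qed.

(** One point of [A] is kept for every occupied cell of a grid in the real and imaginary parts of
    the entries; empty cells receive the default point [P0]. *)
Lemma finite_net (R : realType) n (A : set (Mat R n)) (e : R) : 0 < e -> A !=set0 ->
  (forall P, A P -> forall i j, cn (P i j) <= 2) ->
  exists (N : nat) (y : nat -> Mat R n), [/\ (0 < N)%N, forall k, A (y k) &
    forall P, A P -> exists k : 'I_N, forall i j, cn (P i j - y k i j) <= e].
Proof.
move=> e0 [P0 AP0] hA.
pose M := Num.bound (4 / e).
have M0 : 0 < M%:R :> R.
  by rewrite ltr0n lt0n; apply/eqP => M0; have := archi_boundP (ltW (divr_gt0 (ltr0n R 4) e0)); rewrite -/M M0 ltNge divr_ge0 // ltW.
have Me : M%:R^-1 <= e / 4.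
  rewrite -[e / 4]invrK lef_pV2 ?posrE ?invr_gt0 ?divr_gt0 // invf_div.
  by apply: ltW; apply: archi_boundP; rewrite divr_ge0 // ltW.
pose I := {ffun ('I_n.+1 * 'I_n.+1) -> ('I_(4 * M).+1 * 'I_(4 * M).+1)}.
pose gr (x : R) : 'I_(4 * M).+1 := inord (Num.truncn ((x + 2) * M%:R)).
pose J (P : Mat R n) : I := [ffun ij => (gr (complex.Re (P ij.1 ij.2)), gr (complex.Im (P ij.1 ij.2)))].
have hgr x y : `|x| <= 2 -> `|y| <= 2 -> gr x = gr y -> `|x - y| <= e / 4.
  rewrite !ler_norml => /andP[x1 x2] /andP[y1 y2] /(congr1 val) /= .
  have b (z : R) : -2 <= z -> z <= 2 -> (Num.truncn ((z + 2) * M%:R) < (4 * M).+1)%N.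
    move=> z1 z2; rewrite ltnS -(ler_nat R); apply: le_trans (_ : (z + 2) * M%:R <= _).
      by rewrite truncn_le // mulr_ge0 ?ler0n //; lra.
    by rewrite natrM ler_pM2r //; lra.
  rewrite !inordK ?b // => /truncn_close h.
  have hh : `|(x + 2) - (y + 2)| <= M%:R^-1 by apply: h => //; lra.
  rewrite -ler_norml; apply: le_trans Me; move: hh.
  by congr (`|_| <= _); ring.
have /choice [z hz] : forall k : I, exists P, A P /\ ((exists Q, A Q /\ J Q = k) -> J P = k).
  move=> k; have [[Q [AQ JQ]]|h] := pselect (exists Q, A Q /\ J Q = k); first by exists Q.
  by exists P0.
exists #|I|, (fun k => z (nth (J P0) (enum I) k)); split.
- by apply/card_gt0P; exists (J P0).
- by move=> k; case: (hz (nth (J P0) (enum I) k)).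
- move=> P AP; exists (enum_rank (J P)) => i j.
  have -> : nth (J P0) (enum I) (enum_rank (J P)) = J P.
    by have := enum_rankK (J P); rewrite /enum_val (set_nth_default (J P0)) // -cardE ltn_ord.
  have [Az Jz] := hz (J P); have {}Jz := Jz (ex_intro _ P (conj AP erefl)).
  have /ffunP /(_ (i, j)) := Jz; rewrite !ffunE /= => -[h1 h2].
  apply: le_trans (cn_leD _) _; rewrite !raddfB /=.
  have b1 Q : A Q -> `|complex.Re (Q i j)| <= 2 by move=> AQ; apply: le_trans (cn_geRe _) (hA _ AQ i j).
  have b2 Q : A Q -> `|complex.Im (Q i j)| <= 2 by move=> AQ; apply: le_trans (cn_geIm _) (hA _ AQ i j).
  have := hgr _ _ (b1 _ AP) (b1 _ Az) (esym h1).
  have := hgr _ _ (b2 _ AP) (b2 _ Az) (esym h2).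
  by move=> t1 t2; apply: le_trans (lerD t2 t1) _; lra.
Qed.

Lemma rank1_entry (R : realType) n (P : Mat R n) i j : rank1proj P -> cn (P i j) <= 2.
Proof.
move=> /rank1_ex [u u1 ->]; rewrite mxE big_ord1 adjE cnM cnJ.
have h k : cn (u k 0) <= 1 by rewrite -((vn_unitP u).2 u1); exact: le_coord_vn.
by apply: le_trans (ler_pM _ _ (h i) (h j)) _ => //; lra.
Qed.

Lemma dFS_net (R : realType) n (e : R) : 0 < e ->
  exists (N : nat) (y : nat -> Mat R n), [/\ (0 < N)%N, forall k, rank1proj (y k) &
    forall P, rank1proj P -> exists k : 'I_N, dFS P (y k) <= e].
Proof.
move=> e0; have e1 : 0 < e / (2 * n.+1%:R) by rewrite divr_gt0 // mulr_gt0 // ltr0n.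
have [||N [y [N0 hy hP]]] := @finite_net R n [set P | rank1proj P] _ e1.
- exists (pj (const_mx 1)); apply: pj_rank1.
  by apply/eqP => /matrixP/(_ 0 0)/eqP; rewrite !mxE oner_eq0.
- by move=> P rP i j; exact: rank1_entry.
exists N, y; split=> // P rP; have [k hk] := hP P rP; exists k.
rewrite -(@ler_pXn2r _ 2) ?nnegrE ?(ltW e0) //; apply: le_trans (dFS_dist rP (hy k)) _.
apply: le_trans (_ : 4 * \sum_(i < n.+1) \sum_(j < n.+1) (e / (2 * n.+1%:R)) ^+ 2 <= _).
  rewrite ler_pM2l ?ltr0n //; apply: ler_sum => i _; apply: ler_sum => j _.
  by apply: lerXn2r; rewrite ?nnegrE // ltW.
rewrite !sumr_const !card_ord -mulrnA -[X in 4 * X]mulr_natl natrM.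
have : n.+1%:R != 0 :> R by rewrite pnatr_eq0.
by move: n.+1%:R => m m0; apply: eq_ler; field.
Qed.

(** Young's inequality with a free weight. Choosing [l] only after integration replaces Minkowski's
    inequality in [W2_triangle]. *)
Lemma sqrD_weighted (R : realType) (a b l : R) : 0 < l -> (a + b) ^+ 2 <= (1 + l) * a ^+ 2 + (1 + l^-1) * b ^+ 2.
Proof.
move=> l0; have : 0 <= l * (a - b / l) ^+ 2 by rewrite mulr_ge0 ?sqr_ge0 // ltW.
have -> : l * (a - b / l) ^+ 2 = l * a ^+ 2 - 2 * a * b + l^-1 * b ^+ 2.
  by field; rewrite gt_eqF.
rewrite !expr2; lra.
Qed.

Lemma sqr_near (R : realFieldType) (x s b e : R) : 0 <= x -> x <= s + e -> 0 <= s -> s <= b + b ->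
  0 <= e -> e <= 1 -> x ^+ 2 <= e * (4 * b + 1) + s ^+ 2.
Proof.
move=> x0 xs s0 sb e0 e1; apply: le_trans (_ : (s + e) ^+ 2 <= _).
  by apply: lerXn2r; rewrite ?nnegrE // addr_ge0.
have := ler_wpM2r e0 sb; have := ler_wpM2r e0 e1.
by rewrite sqrrD [e ^+ 2]expr2; lra.
Qed.

Lemma norm_prob (dT : measure_display) (T : measurableType dT) (R : realType)
    (m : {measure set T -> \bar R}) (P0 : probability T R) : m setT = 1%E ->
  exists P : probability T R, forall A, P A = m A.
Proof.
move=> m1; exists (mnormalize m P0) => A.
by rewrite /= /mnormalize m1 ifF ?invr1 ?mule1 // onee_eq0.
Qed.

(** * Gluing couplings along a common marginal *)

Section gluing.
Context (R : realType) (n : nat).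
Local Notation X := (MT R n).
Implicit Types P Q S : probability X R.

Definition r1supp P := P [set x : X | ~ rank1proj x] = 0%E.

Definition coupling P Q (pi : probability (X * X)%type R) :=
  (forall A, measurable A -> pi (A `*` setT) = P A) /\
  (forall B, measurable B -> pi (setT `*` B) = Q B).

Definition cost (pi : probability (X * X)%type R) : \bar R := (\int[pi]_x ((dFS x.1 x.2) ^+ 2)%:E)%E.

Lemma measurable_rank1 : measurable [set L : X | rank1proj L].
Proof.
have mI := @mmeas_id R n.
rewrite (_ : [set L | _] = [set L : MT R n | adj (L : Mat R n) = L] `&` [set L | (L : Mat R n) *m L = L] `&`
   ~` [set L : MT R n | \tr (L : Mat R n) - 1 != 0]).
  apply: measurableI; first apply: measurableI.
  - by apply: measurable_meq => //; exact: mmeas_adj.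
  - by apply: measurable_meq => //; exact: mmeasM.
  - apply: measurableC; apply: measurable_setb; apply: cmeas_neq0; apply: cmeasB; first exact: cmeas_tr.
    exact: cmeas_cst.
apply/seteqP; split=> L /=.
  by move=> [[h1 h2] h3]; split=> //; rewrite h3 subrr eqxx.
by move=> [[h1 h2] /negP]; rewrite negbK subr_eq0 => /eqP h3.
Qed.

Lemma measurable_dFS2 : measurable_fun setT (fun x : X * X => (dFS x.1 x.2 ^+ 2)%:E).
Proof.
apply/measurable_EFinP; apply: measurable_funX.
by apply: measurable_dFS; [exact: measurable_fst|exact: measurable_snd].
Qed.

(* The couplings are glued over a partition of the middle space into small cells, which
   replaces the disintegration by conditioning on finitely many events of positive mass. *)
Lemma glue_exists P Q S pi12 pi23 (e : R) : 0 < e -> r1supp Q -> coupling P Q pi12 -> coupling Q S pi23 ->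
  exists m4 : probability ((X * X) * (X * X))%type R,
  [/\ forall E, measurable E -> m4 (E `*` setT) = pi12 E,
      forall E, measurable E -> m4 (setT `*` E) = pi23 E &
      exists2 D, measurable D & m4 (~` D) = 0%E /\
        forall t, D t -> rank1proj t.1.2 -> rank1proj t.2.1 -> dFS t.1.2 t.2.1 <= e].
Proof.
move=> e0 sQ [h12 h12'] [h23 h23'].
have e2 : 0 < e / 2 by rewrite divr_gt0.
have [N [y [N0 ry hy]]] := dFS_net n e2.
have mh (k : 'I_N) : measurable_fun setT (fun x : X => dFS x (y k)).
  by apply: measurable_dFS => //; exact: measurable_cst.
have [J mJ hJ] := measurable_argmin (Ordinal N0) mh.
pose C i : set X := [set x | J x = i :> nat].
have mC i : measurable (C i).
  have [iN|iN] := ltnP i N.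
    rewrite (_ : C i = [set x | J x = Ordinal iN]); first exact: mJ.
    by apply/seteqP; split=> x /= h; [apply: val_inj|rewrite /C /= h].
  rewrite (_ : C i = set0) //; apply/seteqP; split=> x //= h.
  by move: iN; rewrite -h leqNgt ltn_ord.
(* The weight that turns restriction to a cell into conditioning. It is 0 on a null cell, where the
   couplings have no mass either. *)
pose w i : R := (fine (Q (C i)))^-1.
have w0 i : 0 <= w i by rewrite invr_ge0 fine_ge0.
pose D i : set ((X * X) * (X * X))%type := (setT `*` C i) `*` (C i `*` setT).
have mD i : measurable (D i) by do 2 apply: measurableX => //.
pose Pi : {measure set ((X * X) * (X * X))%type -> \bar R} := (pi12 \x pi23)%E.
pose m4 : {measure set ((X * X) * (X * X))%type -> \bar R} := msum (fun i => mscale (NngNum (w0 i)) (mrestr Pi (mD i))) N.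
have m4E E : m4 E = (\sum_(i < N) (w i)%:E * Pi (E `&` D i))%E by [].
have PiX A B : measurable A -> measurable B -> Pi (A `*` B) = (pi12 A * pi23 B)%E.
  by move=> mA mB; exact: product_measure1E.
have cov (pi : probability (X * X)%type R) (F : nat -> set (X * X)%type) :
    (forall i, measurable (F i)) -> trivIset setT F -> (\bigcup_(i in [set k | (k < N)%N]) F i = setT) ->
    forall E, measurable E -> (\sum_(i < N) pi (E `&` F i) = pi E)%E.
  move=> mF tF cF E mE; rewrite -{2}(setIT E) -cF setI_bigcupr bigcup_mkord.
  have tI : trivIset setT (fun i => E `&` F i) by exact: trivIset_setIl.
  have mI i : measurable (E `&` F i) by exact: measurableI.
  by rewrite (measure_bigsetU pi mI tI).
have wq (a : \bar R) i : (a <= Q (C i))%E -> (0 <= a)%E -> ((w i)%:E * (a * Q (C i)) = a)%E.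
  move=> h a0; have qf : Q (C i) \is a fin_num by exact: fin_num_measure.
  have [q0|q0] := eqVneq (Q (C i)) 0%E.
    have -> : a = 0%E by apply/eqP; rewrite eq_le a0 -q0 h.
    by rewrite mul0e mule0.
  rewrite muleCA (_ : (w i)%:E * Q (C i) = 1)%E ?mule1 //.
  by rewrite /w -[X in (_ * X)%E](fineK qf) -EFinM mulVf // fine_eq0.
have ltC x : exists2 i, (i < N)%N & C i x by exists (J x) => //; exact: ltn_ord.
have tC : trivIset setT C by move=> i j _ _ [x [<- <-]].
suff [h1 h2 h3] : [/\ forall E, measurable E -> m4 (E `*` setT) = pi12 E,
      forall E, measurable E -> m4 (setT `*` E) = pi23 E &
      exists2 D, measurable D & m4 (~` D) = 0%E /\
        forall t, D t -> rank1proj t.1.2 -> rank1proj t.2.1 -> dFS t.1.2 t.2.1 <= e].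
  have m41 : m4 setT = 1%E by rewrite -setXTT h1 // probability_setT.
  have [P4 P4E] := norm_prob (pi12 \x pi23)%E m41.
  exists P4; split=> [E mE|E mE|]; [by rewrite P4E h1|by rewrite P4E h2|].
  by have [D' mD' [D0 hD]] := h3; exists D' => //; split=> //; rewrite P4E.
split.
- move=> E mE; rewrite m4E -(cov pi12 (fun i => setT `*` C i)) //.
  + apply: eq_bigr => i _.
    have -> : (E `*` setT) `&` D i = (E `&` (setT `*` C i)) `*` (C i `*` setT).
      by apply/seteqP; split=> [[p q]|[p q]] /= [h1 h2]; [case: h1 h2 => ? _ [] ? ?|case: h1].
    rewrite PiX; [|apply: measurableI => //; exact: measurableX|exact: measurableX].
    rewrite (h23 _ (mC i)) wq //.
    rewrite -(h12' _ (mC i)); apply: le_measure; rewrite ?inE; last exact: subIsetr.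
    * by apply: measurableI => //; exact: measurableX.
    * exact: measurableX.
  + by move=> i; exact: measurableX.
  + by move=> i j _ _ [p [[_ h1] [_ h2]]]; rewrite -h1 -h2.
  + by apply/seteqP; split=> // -[p q] _; have [i iN Ci] := ltC q; exists i.
- move=> E mE; rewrite m4E -(cov pi23 (fun i => C i `*` setT)) //.
  + apply: eq_bigr => i _.
    have -> : (setT `*` E) `&` D i = (setT `*` C i) `*` (E `&` (C i `*` setT)).
      by apply/seteqP; split=> [[p q]|[p q]] /= [h1 h2]; [case: h1 h2 => _ ? [] ? ?|case: h2].
    rewrite PiX; [|exact: measurableX|apply: measurableI => //; exact: measurableX].
    rewrite (h12' _ (mC i)) [(Q _ * _)%E]muleC wq //.
    rewrite -(h23 _ (mC i)); apply: le_measure; rewrite ?inE; last exact: subIsetr.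
    * by apply: measurableI => //; exact: measurableX.
    * exact: measurableX.
  + by move=> i; exact: measurableX.
  + by move=> i j _ _ [p [[h1 _] [h2 _]]]; rewrite -h1 -h2.
  + by apply/seteqP; split=> // -[p q] _; have [i iN Ci] := ltC p; exists i.
- exists (\bigcup_(i in [set k | (k < N)%N]) D i); first by apply: bigcup_measurable.
  split.
    rewrite m4E big1 // => i _.
    rewrite (_ : _ `&` D i = set0) ?measure0 ?mule0 //.
    by apply/seteqP; split=> // t [h1 h2]; apply: h1; exists i => //=; exact: ltn_ord.
  move=> [[x p] [q z]] [i _ [[_ /= h1] [/= h2 _]]] rp rq.
  have dJ v : rank1proj v -> dFS v (y (J v)) <= e / 2.
    by move=> rv; have [k hk] := hy v rv; apply: le_trans (hJ v k) hk.
  apply: le_trans (dFS_triangle rp (ry (J p)) rq) _.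
  have := dJ _ rp; have := dJ _ rq; rewrite (dFSC (y _)) h1 -h2; lra.
Qed.

Lemma r1supp_coupling1 P Q pi : r1supp P -> coupling P Q pi -> pi [set x | ~ rank1proj x.1] = 0%E.
Proof.
move=> sP [h _]; rewrite (_ : [set x | _] = [set x : X | ~ rank1proj x] `*` setT).
  by rewrite h //; apply: measurableC; exact: measurable_rank1.
by apply/seteqP; split=> [[x y]|[x y] []].
Qed.

Lemma r1supp_coupling2 P Q pi : r1supp Q -> coupling P Q pi -> pi [set x | ~ rank1proj x.2] = 0%E.
Proof.
move=> sQ [_ h]; rewrite (_ : [set x | _] = setT `*` [set x : X | ~ rank1proj x]).
  by rewrite h //; apply: measurableC; exact: measurable_rank1.
by apply/seteqP; split=> [[x y]|[x y] []].
Qed.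

Lemma W2sq_le P Q pi : coupling P Q pi -> (W2sq P Q <= cost pi)%E.
Proof. by move=> [h1 h2]; apply: ereal_inf_lbound; exists pi. Qed.

Lemma cost_push (dT : measure_display) (T : measurableType dT) (m : probability T R)
    (u v : T -> X) (pi : probability (X * X)%type R) :
  measurable_fun setT u -> measurable_fun setT v ->
  (forall A, measurable A -> pi A = m [set t | A (u t, v t)]) ->
  cost pi = (\int[m]_t (dFS (u t) (v t) ^+ 2)%:E)%E.
Proof.
move=> mu mv hpi.
have mf : measurable_fun setT (fun t => (u t, v t)) by exact: measurable_fun_pair.
pose f : {mfun T >-> (X * X)%type} := mfun_Sub (mem_set mf).
transitivity (cost (distribution m f)).
  by apply: eq_measure_integral => A mA _; exact: hpi.
rewrite /cost ge0_integral_distribution //; first exact: measurable_dFS2.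
by move=> x; rewrite lee_fin sqr_ge0.
Qed.

Lemma not_rank1_fst : measurable [set x : X * X | ~ rank1proj x.1].
Proof.
rewrite (_ : [set x | _] = (~` [set x : X | rank1proj x]) `*` setT).
  by apply: measurableX => //; apply: measurableC; exact: measurable_rank1.
by apply/seteqP; split=> [[x y]|[x y] []].
Qed.

Lemma not_rank1_snd : measurable [set x : X * X | ~ rank1proj x.2].
Proof.
rewrite (_ : [set x | _] = setT `*` (~` [set x : X | rank1proj x])).
  by apply: measurableX => //; apply: measurableC; exact: measurable_rank1.
by apply/seteqP; split=> [[x y]|[x y] []].
Qed.

Lemma integral_lin3 (dT : measure_display) (T : measurableType dT) (m : probability T R)
    (f g : T -> R) (a b e : R) :
  measurable_fun setT (fun t => (f t)%:E) -> measurable_fun setT (fun t => (g t)%:E) ->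
  (forall t, 0 <= f t) -> (forall t, 0 <= g t) -> 0 <= a -> 0 <= b -> 0 <= e ->
  (\int[m]_t (a * f t + b * g t + e)%:E = a%:E * \int[m]_t (f t)%:E + b%:E * \int[m]_t (g t)%:E + e%:E)%E.
Proof.
move=> mf mg f0 g0 a0 b0 e0.
have e1 : (\int[m]_t (cst e%:E t) = e%:E)%E.
  by rewrite integral_cst // [X in (_ * X)%E]probability_setT mule1.
have maf : measurable_fun setT (fun t => (a%:E * (f t)%:E)%E).
  by apply: emeasurable_funM => //; exact: measurable_cst.
have mbg : measurable_fun setT (fun t => (b%:E * (g t)%:E)%E).
  by apply: emeasurable_funM => //; exact: measurable_cst.
have af0 t : (0 <= a%:E * (f t)%:E)%E by rewrite mule_ge0 ?lee_fin.
have bg0 t : (0 <= b%:E * (g t)%:E)%E by rewrite mule_ge0 ?lee_fin.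
rewrite -(@ge0_integralZl _ _ _ m setT measurableT (fun t => (f t)%:E)) //.
rewrite -(@ge0_integralZl _ _ _ m setT measurableT (fun t => (g t)%:E)) //.
rewrite -[X in (_ + X)%E]e1 -ge0_integralD // -ge0_integralD //.
- by move=> t _; rewrite adde_ge0.
- exact: emeasurable_funD.
- by move=> t _; rewrite lee_fin.
- by move=> t _; rewrite lee_fin.
Qed.

Lemma glue_cost P Q S pi12 pi23 (l e : R) : 0 < l -> 0 < e -> r1supp P -> r1supp Q -> r1supp S ->
  coupling P Q pi12 -> coupling Q S pi23 ->
  (W2sq P S <= (1 + l)%:E * cost pi12 + (1 + l^-1)%:E * cost pi23 + e%:E)%E.
Proof.
move=> l0 e0 sP sQ sS c12 c23.
have pi0 : 0 < pi :> R by exact: pi_gt0.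
(* All distances are at most [pi], so an error [e'] at the middle point changes the squared distance
   by at most [e' * (4 * pi + 1)]; see [sqr_near]. *)
pose e' := Num.min 1 (e / (4 * pi + 1)).
have e'0 : 0 < e' by rewrite lt_min ltr01 divr_gt0 //; lra.
have e'1 : e' <= 1 by rewrite ge_min lexx.
have e'e : e' * (4 * pi + 1) <= e.
  by rewrite -ler_pdivlMr; [rewrite ge_min lexx orbT|lra].
have [m4 [E1 E2 [D mD [D0 hD]]]] := glue_exists e'0 sQ c12 c23.
have mf : measurable_fun setT (fun t : (X * X) * (X * X) => (t.1.1, t.2.2)).
  apply: measurable_fun_pair; first exact: measurableT_comp measurable_fst measurable_fst.
  exact: measurableT_comp measurable_snd measurable_snd.
have mp1 : measurable_fun setT (fun t : (X * X) * (X * X) => t.1) by exact: measurable_fst.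
have mp2 : measurable_fun setT (fun t : (X * X) * (X * X) => t.2) by exact: measurable_snd.
pose f : {mfun ((X * X) * (X * X))%type >-> (X * X)%type} := mfun_Sub (mem_set mf).
pose pi13 : probability (X * X)%type R := distribution m4 f.
have piE A : pi13 A = m4 [set t | A (t.1.1, t.2.2)] by [].
have c13 : coupling P S pi13.
  split=> A mA; rewrite piE.
    rewrite -(c12.1 _ mA) -E1; last exact: measurableX.
    by congr (m4 _); apply/seteqP; split=> [[[a b'] [c d]]|[[a b'] [c d]]] //= [[]].
  rewrite -(c23.2 _ mA) -E2; last exact: measurableX.
  by congr (m4 _); apply/seteqP; split=> [[[a b'] [c d]]|[[a b'] [c d]]] //= [_ []].
apply: le_trans (W2sq_le c13) _.
have g0 (t : X * X) : (0 <= (dFS t.1 t.2 ^+ 2)%:E :> \bar R)%E by rewrite lee_fin sqr_ge0.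
have I13 : cost pi13 = (\int[m4]_t (dFS t.1.1 t.2.2 ^+ 2)%:E)%E.
  by apply: cost_push => //; [exact: measurableT_comp measurable_fst measurable_fst|exact: measurableT_comp measurable_snd measurable_snd].
have I12 : cost pi12 = (\int[m4]_t (dFS t.1.1 t.1.2 ^+ 2)%:E)%E.
  apply: cost_push => [||A mA]; [exact: measurableT_comp measurable_fst measurable_fst|exact: measurableT_comp measurable_snd measurable_fst|].
  by apply: etrans (esym (E1 A mA)) _; congr (m4 _); apply/seteqP; split=> [[[a b'] c] []|[[a b'] c]].
have I23 : cost pi23 = (\int[m4]_t (dFS t.2.1 t.2.2 ^+ 2)%:E)%E.
  apply: cost_push => [||A mA]; [exact: measurableT_comp measurable_fst measurable_snd|exact: measurableT_comp measurable_snd measurable_snd|].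
  by apply: etrans (esym (E2 A mA)) _; congr (m4 _); apply/seteqP; split=> [[c [a b']] []|[c [a b']]].
have M12 : measurable_fun setT (fun t : (X * X) * (X * X) => (dFS t.1.1 t.1.2 ^+ 2)%:E).
  exact: measurableT_comp measurable_dFS2 mp1.
have M23 : measurable_fun setT (fun t : (X * X) * (X * X) => (dFS t.2.1 t.2.2 ^+ 2)%:E).
  exact: measurableT_comp measurable_dFS2 mp2.
have M13 : measurable_fun setT (fun t : (X * X) * (X * X) => (dFS t.1.1 t.2.2 ^+ 2)%:E).
  exact: measurableT_comp measurable_dFS2 mf.
have l1 : 0 <= 1 + l by rewrite addr_ge0 // ltW.
have l2 : 0 <= 1 + l^-1 by rewrite addr_ge0 // invr_ge0 ltW.
have mN : measurable ([set t : (X * X) * (X * X) | ~ rank1proj t.1.1] `|` [set t | ~ rank1proj t.1.2] `|`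
    [set t | ~ rank1proj t.2.1] `|` [set t | ~ rank1proj t.2.2] `|` ~` D).
  have mG : measurable [set x : X | ~ rank1proj x] by apply: measurableC; exact: measurable_rank1.
  have mpr (g : (X * X) * (X * X) -> X) : measurable_fun setT g -> measurable [set t | ~ rank1proj (g t)].
    by move=> mg; have := mg measurableT _ mG; rewrite setTI.
  repeat apply: measurableU; last exact: measurableC.
  - by apply: mpr; exact: measurableT_comp measurable_fst measurable_fst.
  - by apply: mpr; exact: measurableT_comp measurable_snd measurable_fst.
  - by apply: mpr; exact: measurableT_comp measurable_fst measurable_snd.
  - by apply: mpr; exact: measurableT_comp measurable_snd measurable_snd.
set N := (X in measurable X) in mN.
have N0 : m4 N = 0%E.
  apply/eqP; rewrite -measure_le0.
  have mG : measurable [set x : X | ~ rank1proj x] by apply: measurableC; exact: measurable_rank1.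
  have z1 : m4 [set t | ~ rank1proj t.1.1] = 0%E.
    rewrite -(r1supp_coupling1 sP c12) -E1; last exact: not_rank1_fst.
    by congr (m4 _); apply/seteqP; split=> [[[? ?] ?]|[[? ?] ?] []].
  have z2 : m4 [set t | ~ rank1proj t.1.2] = 0%E.
    rewrite -(r1supp_coupling2 sQ c12) -E1; last exact: not_rank1_snd.
    by congr (m4 _); apply/seteqP; split=> [[[? ?] ?]|[[? ?] ?] []].
  have z3 : m4 [set t | ~ rank1proj t.2.1] = 0%E.
    rewrite -(r1supp_coupling1 sQ c23) -E2; last exact: not_rank1_fst.
    by congr (m4 _); apply/seteqP; split=> [[? [? ?]]|[? [? ?]] []].
  have z4 : m4 [set t | ~ rank1proj t.2.2] = 0%E.
    rewrite -(r1supp_coupling2 sS c23) -E2; last exact: not_rank1_snd.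
    by congr (m4 _); apply/seteqP; split=> [[? [? ?]]|[? [? ?]] []].
  have mpr (g : (X * X) * (X * X) -> X) : measurable_fun setT g -> measurable [set t | ~ rank1proj (g t)].
    by move=> mg; have := mg measurableT _ mG; rewrite setTI.
  have m1 : measurable [set t : (X * X) * (X * X) | ~ rank1proj t.1.1].
    by apply: mpr; exact: measurableT_comp measurable_fst measurable_fst.
  have m2 : measurable [set t : (X * X) * (X * X) | ~ rank1proj t.1.2].
    by apply: mpr; exact: measurableT_comp measurable_snd measurable_fst.
  have m3 : measurable [set t : (X * X) * (X * X) | ~ rank1proj t.2.1].
    by apply: mpr; exact: measurableT_comp measurable_fst measurable_snd.
  have m4' : measurable [set t : (X * X) * (X * X) | ~ rank1proj t.2.2].
    by apply: mpr; exact: measurableT_comp measurable_snd measurable_snd.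
  have U2 A B : measurable A -> measurable B -> m4 A = 0%E -> m4 B = 0%E -> m4 (A `|` B) = 0%E.
    move=> mA mB a0 b0; apply/eqP; rewrite -measure_le0; apply: le_trans (measureU2 _ _ _) _ => //.
    by rewrite [X in (X + _)%E]a0 [X in (_ + X)%E]b0 adde0.
  rewrite measure_le0; apply/eqP.
  have m12 := measurableU _ _ m1 m2; have n12 := U2 _ _ m1 m2 z1 z2.
  have m13 := measurableU _ _ m12 m3; have n13 := U2 _ _ m12 m3 n12 z3.
  have m14 := measurableU _ _ m13 m4'; have n14 := U2 _ _ m13 m4' n13 z4.
  exact: U2 m14 (measurableC mD) n14 D0.
pose h (t : (X * X) * (X * X)) : R := ((1 + l) * dFS t.1.1 t.1.2 ^+ 2 + (1 + l^-1) * dFS t.2.1 t.2.2 ^+ 2 + e).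
have hE : (\int[m4]_t (h t)%:E = (1 + l)%:E * cost pi12 + (1 + l^-1)%:E * cost pi23 + e%:E)%E.
  have f0 (t : (X * X) * (X * X)) : 0 <= dFS t.1.1 t.1.2 ^+ 2 by exact: sqr_ge0.
  have g1 (t : (X * X) * (X * X)) : 0 <= dFS t.2.1 t.2.2 ^+ 2 by exact: sqr_ge0.
  by rewrite I12 I23; exact: (integral_lin3 m4 M12 M23 f0 g1 l1 l2 (ltW e0)).
rewrite -hE I13; apply: (le_integral_offnull mN N0).
- by move=> t; rewrite lee_fin sqr_ge0.
- by move=> t; rewrite /h lee_fin !addr_ge0 ?mulr_ge0 ?sqr_ge0 // ltW.
move=> [[x p] [q z]] hN /=.
have rx : rank1proj x by apply: contrapT => hx; apply: hN; do 4 left.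
have rp : rank1proj p by apply: contrapT => hx; apply: hN; do 3 left; right.
have rq : rank1proj q by apply: contrapT => hx; apply: hN; do 2 left; right.
have rz : rank1proj z by apply: contrapT => hx; apply: hN; left; right.
have Dt : D ((x, p), (q, z)) by apply: contrapT => hx; apply: hN; right.
have hpq := hD _ Dt rp rq.
rewrite lee_fin /h /=.
have t1 : dFS x z <= dFS x p + dFS q z + e'.
  apply: le_trans (dFS_triangle rx rp rz) _; rewrite -addrA lerD2l.
  apply: le_trans (dFS_triangle rp rq rz) _; rewrite [leRHS]addrC.
  exact: lerD hpq (lexx _).
apply: le_trans (lerD (sqrD_weighted (dFS x p) (dFS q z) l0) e'e); rewrite addrC.
by apply: sqr_near; rewrite ?addr_ge0 ?dFS_ge0 ?lerD ?dFS_lepi // ltW.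
Qed.

End gluing.

Lemma lee_pdiv (R : realType) (c e : R) (x : \bar R) : 0 < c -> (c%:E * x < (e * c)%:E)%E -> (x <= e%:E)%E.
Proof.
move=> c0; case: x => [x||].
- by rewrite -EFinM lte_fin lee_fin mulrC ltr_pM2r // => /ltW.
- by rewrite gt0_muley ?lte_fin.
- by rewrite leNye.
Qed.

Section wasserstein.
Context (R : realType) (n : nat).
Local Notation X := (MT R n).
Implicit Types P Q S : probability X R.

Lemma W2sq_ext (mu nu mu' nu' : set X -> \bar R) :
  (forall A, measurable A -> mu A = mu' A) -> (forall A, measurable A -> nu A = nu' A) ->
  W2sq mu nu = W2sq mu' nu'.
Proof.
move=> h1 h2; rewrite /W2sq; congr ereal_inf; apply/seteqP; split=> c [r [a [b ->]]]; exists r.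
  by split=> [A mA|]; [rewrite a ?h1|split=> // B mB; rewrite b ?h2].
by split=> [A mA|]; [rewrite a ?h1|split=> // B mB; rewrite b ?h2].
Qed.

Lemma W2sq_ge0 (mu nu : set X -> \bar R) : (0 <= W2sq mu nu)%E.
Proof.
apply: le_ereal_inf_tmp => c [r [_ [_ ->]]]; apply: integral_ge0 => x _.
by rewrite lee_fin sqr_ge0.
Qed.

Lemma W2sq_lt P Q (a : R) : (W2sq P Q < a%:E)%E -> exists2 r, coupling P Q r & (cost r < a%:E)%E.
Proof. by move=> /ereal_inf_lt [c [r [h1 [h2 ->]]] h]; exists r. Qed.

Lemma W2sq_swap (mu nu : set X -> \bar R) : (W2sq mu nu <= W2sq nu mu)%E.
Proof.
apply: le_ereal_inf_tmp => c [r [h1 [h2 ->]]].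
have ms : measurable_fun setT (fun x : X * X => (x.2, x.1)).
  by apply: measurable_fun_pair; [exact: measurable_snd|exact: measurable_fst].
pose s : {mfun (X * X)%type >-> (X * X)%type} := mfun_Sub (mem_set ms).
apply: ereal_inf_lbound; exists (distribution r s); split=> [A mA|].
  by rewrite -h2 //=; congr (r _); apply/seteqP; split=> [[x y] []|[x y] []].
split=> [A mA|].
  by rewrite -h1 //=; congr (r _); apply/seteqP; split=> [[x y] []|[x y] []].
transitivity (\int[r]_x ((dFS x.2 x.1) ^+ 2)%:E)%E.
  by apply: eq_integral => x _; rewrite dFSC.
have hp A : measurable A -> distribution r s A = r [set x | A (x.2, x.1)] by [].
exact: (esym (@cost_push R n _ _ r snd fst (distribution r s) measurable_snd measurable_fst hp)).
Qed.

Lemma W2sq_sym (mu nu : set X -> \bar R) : W2sq mu nu = W2sq nu mu.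
Proof. by apply: le_anti; rewrite !W2sq_swap. Qed.

Lemma W2sq_ub P Q : (W2sq P Q <= (pi ^+ 2)%:E)%E.
Proof.
pose r : probability (X * X)%type R := (P \x Q)%E.
have c : coupling P Q r.
  have rX A B : measurable A -> measurable B -> r (A `*` B) = (P A * Q B)%E.
    by move=> mA mB; exact: product_measure1E.
  by split=> A mA; rewrite rX //; rewrite ?[X in (_ * X)%E]probability_setT ?[X in (X * _)%E]probability_setT ?mule1 ?mul1e.
apply: le_trans (W2sq_le c) _.
apply: le_trans (_ : (\int[r]_x (cst (pi ^+ 2)%:E x) <= _)%E).
  apply: ge0_le_integral => //.
  - by move=> x _; rewrite lee_fin sqr_ge0.
  - exact: measurable_dFS2.
  - by move=> x _; rewrite lee_fin; apply: lerXn2r; rewrite ?nnegrE ?pi_ge0 // dFS_lepi.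
by rewrite integral_cst // [X in (_ * X)%E]probability_setT mule1.
Qed.

Lemma W2sq_fin P Q : W2sq P Q \is a fin_num.
Proof.
rewrite ge0_fin_numE ?W2sq_ge0 //; apply: le_lt_trans (W2sq_ub P Q) _; exact: ltry.
Qed.

Lemma W2E P Q : W2sq P Q = (W2 P Q ^+ 2)%:E.
Proof.
rewrite /W2 sqr_sqrtr ?fineK //; first exact: W2sq_fin.
by rewrite fine_ge0 // W2sq_ge0.
Qed.

Lemma W2_ge0 (mu nu : set X -> \bar R) : 0 <= W2 mu nu. Proof. exact: sqrtr_ge0. Qed.

Lemma W2sq_refl P : r1supp P -> W2sq P P = 0%E.
Proof.
move=> sP; apply/eqP; rewrite eq_le W2sq_ge0 andbT.
have md : measurable_fun setT (fun x : X => (x, x)) by exact: measurable_fun_pair.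
pose s : {mfun X >-> (X * X)%type} := mfun_Sub (mem_set md).
have c : coupling P P (distribution P s).
  by split=> A mA; rewrite /=; congr (P _); apply/seteqP; split=> [x []|x].
apply: le_trans (W2sq_le c) _.
rewrite (@cost_push _ _ _ _ P id id) //.
apply: le_trans (_ : (\int[P]_x (cst 0%E x) <= _)%E); last by rewrite integral0.
have mN : measurable [set x : X | ~ rank1proj x] by apply: measurableC; exact: measurable_rank1.
apply: (le_integral_offnull mN sP) => // [x|x /contrapT rx]; first by rewrite lee_fin sqr_ge0.
by rewrite lee_fin dFS_refl // expr0n.
Qed.

Lemma W2_triangle P Q S : r1supp P -> r1supp Q -> r1supp S -> W2 P S <= W2 P Q + W2 Q S.
Proof.
move=> sP sQ sS; apply/ler_addgt0Pr => e e0.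
have e2 : 0 < e / 2 by rewrite divr_gt0.
have x0 := W2_ge0 P Q; have y0 := W2_ge0 Q S; have z0 := W2_ge0 P S.
have EPQ := W2E P Q; have EQS := W2E Q S; have EPS := W2E P S.
set x := W2 P Q in x0 EPQ *; set y := W2 Q S in y0 EQS *; set z := W2 P S in z0 EPS *.
have [a [aE a0 xa]] : exists a, [/\ a = x + e / 2, 0 < a & x < a].
  by exists (x + e / 2); split=> //; [rewrite ltr_wpDl|rewrite ltrDl].
have [b [bE b0 yb]] : exists b, [/\ b = y + e / 2, 0 < b & y < b].
  by exists (y + e / 2); split=> //; [rewrite ltr_wpDl|rewrite ltrDl].
have -> : x + y + e = a + b by rewrite aE bE; field.
have [r1 c1 h1] : exists2 r, coupling P Q r & (cost r < (a ^+ 2)%:E)%E.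
  by apply: W2sq_lt; rewrite EPQ lte_fin ltrXn2r // nnegrE ltW.
have [r2 c2 h2] : exists2 r, coupling Q S r & (cost r < (b ^+ 2)%:E)%E.
  by apply: W2sq_lt; rewrite EQS lte_fin ltrXn2r // nnegrE ltW.
(* With the weight [b / a] the bound of [glue_cost] becomes [(a + b) ^+ 2] plus its error term. *)
have l0 : 0 < b / a by rewrite divr_gt0.
rewrite -(@ler_pXn2r _ 2) ?nnegrE ?addr_ge0 ?(ltW a0) ?(ltW b0) //.
apply/ler_addgt0Pr => t t0; rewrite -lee_fin -EPS.
apply: le_trans (glue_cost l0 t0 sP sQ sS c1 c2) _.
apply: le_trans (_ : ((1 + b / a)%:E * (a ^+ 2)%:E + (1 + (b / a)^-1)%:E * (b ^+ 2)%:E + t%:E <= _)%E).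
  apply: leeD => //; apply: leeD; apply: lee_wpmul2l; rewrite ?lee_fin ?addr_ge0 ?invr_ge0 ?ltW //.
rewrite -!EFinM -!EFinD lee_fin; apply: eq_ler.
by field; rewrite !gt_eqF.
Qed.

Lemma W2_sym (mu nu : set X -> \bar R) : W2 mu nu = W2 nu mu.
Proof. by rewrite /W2 W2sq_sym. Qed.

(** Markov's inequality: a coupling of cost below [e * r ^+ 2] gives mass at most [e] to pairs at
    distance at least [r], and a pair from [A] that misses [B] is such a pair. *)
Lemma W2sq0_nbhd P Q (A B : set X) (r : R) : r1supp P -> r1supp Q -> W2sq P Q = 0%E ->
  measurable A -> measurable B -> 0 < r ->
  (forall x y, A x -> rank1proj x -> rank1proj y -> dFS x y < r -> B y) ->
  (P A <= Q B)%E.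
Proof.
move=> sP sQ PQ0 mA mB r0 hAB; apply/lee_addgt0Pr => e e0.
have r20 : 0 < r ^+ 2 by rewrite exprn_gt0.
have [p c h] : exists2 p, coupling P Q p & (cost p < (e * r ^+ 2)%:E)%E.
  by apply: W2sq_lt; rewrite PQ0 lte_fin mulr_gt0.
rewrite -(c.1 _ mA) -(c.2 _ mB).
have m1 : measurable (setT `*` B : set (X * X)) by exact: measurableX.
have m2 : measurable (A `*` ~` B : set (X * X)) by apply: measurableX => //; exact: measurableC.
apply: le_trans (_ : p ((setT `*` B) `|` (A `*` ~` B)) <= _)%E.
  apply: le_measure; rewrite ?inE; [exact: measurableX|exact: measurableU|].
  by move=> [x y] [/= Ax _]; have [By|By] := pselect (B y); [left|right].
apply: le_trans (measureU2 _ m1 m2) _; apply: leeD2l.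
have mN : measurable ([set x : X * X | ~ rank1proj x.1] `|` [set x | ~ rank1proj x.2]).
  by apply: measurableU; [exact: not_rank1_fst|exact: not_rank1_snd].
have N0 : p ([set x : X * X | ~ rank1proj x.1] `|` [set x | ~ rank1proj x.2]) = 0%E.
  apply/eqP; rewrite -measure_le0.
  apply: le_trans (measureU2 _ (@not_rank1_fst R n) (@not_rank1_snd R n)) _.
  by rewrite [X in (X + _)%E](r1supp_coupling1 sP c) [X in (_ + X)%E](r1supp_coupling2 sQ c) adde0.
have : (\int[p]_x ((r ^+ 2)%:E * (\1_(A `*` ~` B) x)%:E) <= cost p)%E.
  apply: (le_integral_offnull mN N0) => [x|x|[x y] hN].
  - by rewrite -EFinM lee_fin mulr_ge0 // ltW.
  - by rewrite lee_fin sqr_ge0.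
  rewrite -EFinM lee_fin indicE.
  have [/set_mem [/= Ax By]|_] := boolP ((x, y) \in _); last by rewrite mulr0 sqr_ge0.
  rewrite mulr1; apply: lerXn2r; rewrite ?nnegrE ?(ltW r0) //.
  have rx : rank1proj x by apply: contrapT => hx; apply: hN; left.
  have ry : rank1proj y by apply: contrapT => hx; apply: hN; right.
  by rewrite leNgt; apply/negP => hr; apply: By; exact: hAB hr.
have mi : measurable_fun setT (fun x : X * X => (\1_(A `*` ~` B) x)%:E : \bar R).
  by apply/measurable_EFinP; exact: measurable_indic.
rewrite ge0_integralZl // ?lee_fin ?(ltW r20) //.
rewrite integral_indic // setIT => h'.
exact: lee_pdiv r20 (le_lt_trans h' h).
Qed.

End wasserstein.

(** * Sublevel sets of polynomials *)

Lemma cn_leB (R : realType) (x y : R[i]) : cn (x - y) <= cn x + cn y.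
Proof. by rewrite -(cnN y); exact: cnD. Qed.

(** Newton interpolation, node by node. The divided difference [f1] is at most [2 * eta / sg] at the
    other nodes; multiplying back by ['X - x] with [cn x <= 3] costs a factor 4, and the constant
    term accounts for the step from 8 to 9. *)
Lemma interp_bound (R : realType) (d : nat) (s : seq R[i]) (f : {poly R[i]}) (sg eta : R) :
  0 < sg -> sg <= 1 -> size s = d.+1 -> (size f <= d.+1)%N ->
  pairwise (fun x y => sg <= cn (x - y)) s -> all (fun x => cn x <= 3) s ->
  all (fun x => cn f.[x] <= eta) s -> forall k, cn f`_k <= (9 / sg) ^+ d * eta.
Proof.
move=> sg0 sg1; elim: d s f eta => [|d IH] s f eta ss sf.
  case: s ss => [|x [|y s]] // _ _ _ /= /andP[h _] k.
  rewrite expr0 mul1r; move: h; rewrite (size1_polyC sf) hornerC coefC => h.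
  by case: ifP => // _; rewrite cn0; apply: le_trans h; exact: cn_ge0.
case: s ss => [|x s] // [ss] /= /andP[hx hp] /andP[x3 s3] /andP[fx fs] k.
have e0 : 0 <= eta by apply: le_trans fx; exact: cn_ge0.
have : root (f - (f.[x])%:P) x by rewrite rootE !hornerE subrr.
move/factor_theorem => [f1 fE].
have {}fE : f = (f.[x])%:P + f1 * ('X - x%:P) by rewrite -fE addrC subrK.
have sf1 : (size f1 <= d.+1)%N.
  have [->|f10] := eqVneq f1 0; first by rewrite size_poly0.
  have : (size (f1 * ('X - x%:P))%R <= d.+2)%N.
    have -> : f1 * ('X - x%:P) = f - (f.[x])%:P.
      by apply/eqP; rewrite eq_sym subr_eq addrC -fE.
    rewrite (leq_trans (size_polyD _ _)) // geq_max sf size_polyN.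
    by rewrite (leq_trans (size_polyC_leq1 _)).
  by rewrite size_Mmonic ?monicXsubC // size_XsubC addn2.
have hf1 : all (fun y => cn f1.[y] <= 2 * eta / sg) s.
  apply/allP => y ys; have hy := allP hx y ys.
  have : f1.[y] * (y - x) = f.[y] - f.[x] by rewrite {1}fE !hornerE; ring.
  move/(congr1 (@cn R)); rewrite cnM => h.
  rewrite ler_pdivlMr //; apply: le_trans (_ : cn f1.[y] * cn (y - x) <= _).
    by apply: ler_wpM2l; rewrite ?cn_ge0 // cnB.
  rewrite h; apply: le_trans (cn_leB f.[y] f.[x]) _.
  have := allP fs y ys; move: fx; lra.
have {IH} IH := IH s f1 _ ss sf1 hp s3 hf1.
have c0 : 0 <= (9 / sg) ^+ d * (2 * eta / sg).
  by rewrite mulr_ge0 // ?exprn_ge0 // ?divr_ge0 ?mulr_ge0 // ltW.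
rewrite fE coefD coefC mulrBr coefB coefMX coefMC.
apply: le_trans (cnD _ _) _; apply: le_trans (lerD (_ : _ <= eta) (cn_leB _ _)) _.
  by case: ifP => // _; rewrite cn0.
have h1 : cn (if k == 0%N then 0 else f1`_k.-1) <= (9 / sg) ^+ d * (2 * eta / sg).
  by case: ifP => // _; rewrite ?cn0 // IH.
have h2 : cn (f1`_k * x) <= (9 / sg) ^+ d * (2 * eta / sg) * 3.
  by rewrite cnM; apply: ler_pM; rewrite ?cn_ge0 // IH.
apply: le_trans (lerD (lexx _) (lerD h1 h2)) _.
have h3 : 1 * (1 * eta) <= sg^-1 * ((9 / sg) ^+ d * eta).
  apply: ler_pM; rewrite ?mul1r ?invf_ge1 //.
  rewrite -[leLHS]mul1r; apply: ler_wpM2r => //; apply: exprn_ege1.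
  rewrite ler_pdivlMr // mul1r; move: sg1; lra.
rewrite exprS; move: h3; rewrite !mul1r; set a := (9 / sg) ^+ d.
have -> : a * (2 * eta / sg) = 2 * (sg^-1 * (a * eta)) by ring.
have -> : 9 / sg * a * eta = 9 * (sg^-1 * (a * eta)) by ring.
lra.
Qed.

Lemma few_small (R : realType) (d : nat) (I : finType) (x : I -> R[i]) (f : {poly R[i]}) (sg eta : R) k :
  0 < sg -> sg <= 1 -> (size f <= d.+1)%N -> (forall i j, i != j -> sg <= cn (x i - x j)) ->
  (forall i, cn (x i) <= 3) -> (9 / sg) ^+ d * eta < cn f`_k ->
  (#|[pred i | (cn f.[x i] <= eta)%R]| <= d)%N.
Proof.
move=> sg0 sg1 sf hx x3; apply: contraTT; rewrite -ltnNge -leNgt => hd.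
set A := [pred i | _] in hd.
pose s := map x (take d.+1 (enum A)).
apply: (@interp_bound _ _ s) => //.
- by rewrite size_map size_takel // -cardE.
- rewrite pairwise_map.
  have : uniq (take d.+1 (enum A)) by rewrite take_uniq // enum_uniq.
  elim: (take _ _) => //= i t IH /andP[it ut]; rewrite IH // andbT.
  by apply/allP => j jt; apply: hx; apply: contraNneq it => ->.
- by apply/allP => y /mapP[i _ ->].
- by apply/allP => y /mapP[i /mem_take]; rewrite mem_enum inE => h ->.
Qed.

(** Integrates the number of sets [A i] containing a point: at most [m] on [B], zero elsewhere off
    [E], and trivially at most [#|I|] on [E]. *)
Lemma overlap_bound (R : realType) (dT : measure_display) (T : measurableType dT)
    (mu : {measure set T -> \bar R}) (I : finType) (A : I -> set T) (B E : set T) (m : nat) :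
  (forall i, measurable (A i)) -> measurable B -> measurable E ->
  (forall x, ~ E x -> B x -> (#|[pred i | x \in A i]| <= m)%N) ->
  (forall x i, ~ E x -> A i x -> B x) ->
  (\sum_i mu (A i) <= m%:R%:E * mu B + #|I|%:R%:E * mu E)%E.
Proof.
move=> mA mB mE hm hAB.
have mi (S : set T) : measurable S -> measurable_fun setT (fun x => (\1_S x)%:E : \bar R).
  by move=> mS; apply/measurable_EFinP; exact: measurable_indic.
have iS (S : set T) : measurable S -> mu S = (\int[mu]_x (\1_S x)%:E)%E.
  by move=> mS; rewrite integral_indic // setIT.
rewrite (eq_bigr (fun i => \int[mu]_x (\1_(A i) x)%:E)%E) => [|i _]; last exact: iS.
have i0 (S : set T) x : (0 <= (\1_S x)%:E :> \bar R)%E by rewrite lee_fin.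
rewrite -ge0_integral_sum //; last by move=> i; exact: mi.
rewrite (iS _ mB) (iS _ mE) -!ge0_integralZl //; last 2 first.
- exact: mi.
- exact: mi.
rewrite -ge0_integralD //; last 2 first.
- by apply: emeasurable_funM; [exact: measurable_cst|exact: mi].
- by apply: emeasurable_funM; [exact: measurable_cst|exact: mi].
apply: ge0_le_integral => //.
- by move=> x _; apply: sume_ge0.
- by apply: emeasurable_sum => i; exact: mi.
- by apply: emeasurable_funD; apply: emeasurable_funM; [exact: measurable_cst|exact: mi|exact: measurable_cst|exact: mi].
move=> x _; rewrite sumEFin -!EFinM -EFinD lee_fin.
have -> : \sum_i \1_(A i) x = #|[pred i | x \in A i]|%:R :> R.
  rewrite -sum1_card natr_sum [RHS]big_mkcond; apply: eq_bigr => i _.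
  by rewrite indicE inE; case: (x \in A i).
rewrite !indicE -!natrM -natrD ler_nat.
have [Ex|Ex] := pselect (E x).
  by rewrite (mem_set Ex) muln1; apply: leq_trans (leq_addl _ _); exact: max_card.
have [Bx|Bx] := pselect (B x).
  by rewrite (mem_set Bx) muln1; apply: leq_trans (leq_addr _ _); exact: hm.
rewrite (_ : #|_| = 0%N) //; apply: eq_card0 => i; rewrite !inE.
by apply/negbTE; apply/negP => /set_mem h; apply: Bx; exact: hAB h.
Qed.

Lemma max_separated (R : realType) (A : set R[i]) (sg : R) (d : nat) :
  (forall s : seq R[i], pairwise (fun x y => sg <= cn (x - y)) s -> (forall x, x \in s -> A x) -> (size s <= d)%N) ->
  exists s : seq R[i], (size s <= d)%N /\ forall w, A w -> exists2 x, x \in s & cn (x - w) < sg.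
Proof.
move=> hd.
pose Q k := `[< exists s : seq R[i], [/\ pairwise (fun x y => sg <= cn (x - y)) s, forall x, x \in s -> A x & size s = k] >].
have Q0 : exists k, Q k by exists 0%N; apply/asboolP; exists [::].
have Qd k : Q k -> (k <= d)%N by move=> /asboolP [s [h1 h2 <-]]; exact: hd.
case: (ex_maxnP Q0 Qd) => k /asboolP [s [h1 h2 h3]] hk.
exists s; split; first exact: hd.
move=> w Aw; apply: contrapT => hw.
have : Q k.+1.
  apply/asboolP; exists (w :: s); split; last by rewrite /= h3.
  - rewrite /= h1 andbT; apply/allP => x xs; rewrite cnB leNgt; apply/negP => h.
    by apply: hw; exists x.
  - by move=> x; rewrite inE => /orP[/eqP->|/h2].
by move/hk; rewrite ltnn.
Qed.

(** By [interp_bound] a [sg]-separated subset of the sublevel set has at most [d] points. The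
    squares of side [2 * sg] around a maximal one cover the part of the sublevel set inside
    [[-2, 2]^2], which carries all the mass. *)
Lemma u2_small (R : realType) (d : nat) (f : {poly R[i]}) (sg eta : R) k (A : set (RR R)) :
  0 < sg -> sg <= 1 -> (size f <= d.+1)%N -> (9 / sg) ^+ d * eta < cn f`_k -> measurable A ->
  (forall w, A w -> cn f.[(w.1 +i* w.2)%C] <= eta) ->
  (u2 R A <= (d%:R * sg ^+ 2)%:E)%E.
Proof.
move=> sg0 sg1 sf hk mA hA.
pose S : set (RR R) := itvR (-2) 4 `*` itvR (-2) 4.
have mS : measurable S by apply: measurableX; exact: measurable_itvR.
have S1 : u2 R S = 1%E.
  rewrite u2_square //; [|lra..].
  by congr (_%:E); field.
pose A' : set R[i] := [set z | cn f.[z] <= eta /\ cn z <= 3].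
have [s [sd hs]] : exists s : seq R[i], (size s <= d)%N /\ forall w, A' w -> exists2 x, x \in s & cn (x - w) < sg.
  apply: max_separated => s ps sA; rewrite leqNgt; apply/negP => ds.
  move: hk; rewrite ltNge => /negP; apply.
  apply: (@interp_bound _ d (take d.+1 s)) => //.
  - by rewrite size_takel.
  - by rewrite -(cat_take_drop d.+1 s) pairwise_cat in ps; case/and3P: ps.
  - by apply/allP => x /mem_take /sA [].
  - by apply/allP => x /mem_take /sA [].
pose bx (x : R[i]) : set (RR R) := itvR (complex.Re x - sg) (2 * sg) `*` itvR (complex.Im x - sg) (2 * sg).
have mbx x : measurable (bx x) by apply: measurableX; exact: measurable_itvR.
have ubx x : (u2 R (bx x) <= (sg ^+ 2)%:E)%E.
  rewrite u2_setX; [|exact: measurable_itvR|exact: measurable_itvR].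
  apply: le_trans (_ : ((2 * sg / 4)%:E * (2 * sg / 4)%:E <= _)%E).
    by apply: lee_pmul => //; apply: uR_ub; rewrite mulr_ge0 // ltW.
  rewrite -EFinM lee_fin -expr2; apply: lerXn2r; rewrite ?nnegrE; lra.
have mU : measurable (\big[setU/set0]_(x <- s) bx x) by apply: bigsetU_measurable.
have sub : A `<=` ~` S `|` \big[setU/set0]_(x <- s) bx x.
  move=> w Aw; have [Sw|Sw] := pselect (S w); last by left.
  right; have A'w : A' (w.1 +i* w.2)%C.
    split; first exact: hA.
    move: Sw => [] /=; rewrite !itvRE => h1 h2.
    rewrite -(@ler_pXn2r _ 2) ?nnegrE ?cn_ge0 // cn_sqr /=.
    have q1 : w.1 ^+ 2 <= 4 by rewrite -subr_ge0 (_ : 4 - _ = (2 - w.1) * (2 + w.1)); [apply: mulr_ge0; lra|ring].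
    have q2 : w.2 ^+ 2 <= 4 by rewrite -subr_ge0 (_ : 4 - _ = (2 - w.2) * (2 + w.2)); [apply: mulr_ge0; lra|ring].
    by move: q1 q2; rewrite (_ : 3 ^+ 2 = 9 :> R); [lra|ring].
  have [x xs hx] := hs _ A'w; rewrite -bigcup_seq; exists x => //.
  have := le_trans (cn_geRe _) (ltW hx); have := le_trans (cn_geIm _) (ltW hx).
  rewrite !raddfB /= !ler_norml => b1 b2.
  by split => /=; rewrite itvRE; lra.
apply: le_trans (le_measure _ _ _ sub) _; rewrite ?inE //.
  by apply: measurableU => //; exact: measurableC.
apply: le_trans (measureU2 _ (measurableC mS) mU) _.
have S0 : u2 R (~` S) = 0%E by rewrite (probability_setC (u2 R) mS) S1 subee.
rewrite [X in (X + _)%E]S0 add0e.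
apply: le_trans (_ : (\sum_(x <- s) u2 R (bx x) <= _)%E).
  elim: s {sd hs mU sub} => [|x s IH]; first by rewrite !big_nil measure0.
  rewrite !big_cons; apply: le_trans (measureU2 _ (mbx x) _) _; first by apply: bigsetU_measurable.
  exact: leeD2l.
apply: le_trans (_ : (\sum_(x <- s) (sg ^+ 2)%:E <= _)%E); first by apply: lee_sum => x _; exact: ubx.
rewrite sumEFin lee_fin big_const_seq count_predT iter_addr_0 -[X in X <= _]mulr_natl.
by apply: ler_wpM2r; rewrite ?sqr_ge0 // ler_nat.
Qed.

Lemma slice_bound (R : realType) (d1 d2 : measure_display) (T1 : measurableType d1) (T2 : measurableType d2)
    (m1 : probability T1 R) (m2 : probability T2 R) (S : set (T1 * T2)) (B : set T1) (c : R) :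
  measurable S -> measurable B -> 0 <= c -> (forall x, ~ B x -> (m2 (xsection S x) <= c%:E)%E) ->
  ((m1 \x m2)%E S <= m1 B + c%:E)%E.
Proof.
move=> mS mB c0 hS.
have mi : measurable_fun setT (fun x => (\1_B x)%:E : \bar R).
  by apply/measurable_EFinP; exact: measurable_indic.
have -> : (m1 B + c%:E = \int[m1]_x ((\1_B x)%:E + cst c%:E x))%E.
  rewrite ge0_integralD //.
  by rewrite integral_indic // setIT integral_cst // [X in (_ + _ * X)%E]probability_setT mule1.
rewrite /product_measure1; apply: ge0_le_integral => //.
- exact: measurable_fun_xsection.
- by apply: emeasurable_funD => //; exact: measurable_cst.
move=> x _ /=; have [Bx|Bx] := pselect (B x).
  rewrite indicE (mem_set Bx); apply: le_trans (probability_le1 _ _) _; first exact: measurable_xsection.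
  by rewrite -EFinD lee_fin lerDl.
by rewrite indicE (memNset Bx) add0e; exact: hS.
Qed.

Lemma le_avg (R : realType) (M : nat) (x : \bar R) (c : R) : (\sum_(k < M) x <= c%:E)%E ->
  (0 < M)%N -> (0 <= x)%E -> (x <= (c / M%:R)%:E)%E.
Proof.
case: M => // M; case: x => [x||] //.
  rewrite sumEFin !lee_fin sumr_const card_ord => h _ _.
  by rewrite ler_pdivlMr ?ltr0n // mulr_natr.
rewrite big_ord_recl => h _ _; move: h.
suff : (0 <= \sum_(i < M) (+oo : \bar R))%E by case: (X in (0 <= X)%E) => //.
by apply: sume_ge0.
Qed.

(* Cayley's rational parametrization of the unit circle. *)
Definition wt (R : realType) (t : R) : R[i] := (1 + 'i%C * t%:C%C) / (1 - 'i%C * t%:C%C).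

Lemma wt_den (R : realType) (t : R) : cn (1 - 'i%C * t%:C%C) ^+ 2 = 1 + t ^+ 2.
Proof. by rewrite cn_sqr /= ; ring. Qed.

Lemma wt_den0 (R : realType) (t : R) : 1 - 'i%C * t%:C%C != 0 :> R[i].
Proof.
rewrite -cn_gt0 lt_neqAle cn_ge0 andbT eq_sym -sqrf_eq0 wt_den.
by rewrite gt_eqF // ltr_pwDl // sqr_ge0.
Qed.

Lemma cn_wt (R : realType) (t : R) : cn (wt t) = 1.
Proof.
have h : cn (1 + 'i%C * t%:C%C) = cn (1 - 'i%C * t%:C%C).
  apply/eqP; rewrite -(@eqrXn2 _ 2) ?cn_ge0 // wt_den cn_sqr /=; apply/eqP; ring.
by rewrite /wt cnM cnV h mulfV // cn_eq0 wt_den0.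
Qed.

Lemma wt_neq0 (R : realType) (t : R) : wt t != 0.
Proof. by rewrite -cn_eq0 cn_wt oner_eq0. Qed.

(** The difference is [2i (s - t) / ((1 - i s) (1 - i t))], and both denominators have modulus at
    most [sqrt 2] on the unit interval. *)
Lemma wt_sep (R : realType) (s t : R) : 0 <= s <= 1 -> 0 <= t <= 1 -> `|s - t| <= cn (wt s - wt t).
Proof.
move=> /andP[s0 s1] /andP[t0 t1].
have hs := wt_den0 s; have ht := wt_den0 t.
have : (wt s - wt t) * ((1 - 'i%C * s%:C%C) * (1 - 'i%C * t%:C%C)) = 2 * 'i%C * (s - t)%:C%C.
  by rewrite /wt rmorphB /=; field; rewrite hs ht.
move/(congr1 (@cn R)); rewrite !cnM cn_real cn_nat (_ : cn 'i%C = 1); last by rewrite cn_def /= expr0n add0r expr1n sqrtr1.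
have b (x : R) : 0 <= x -> x <= 1 -> cn (1 - 'i%C * x%:C%C) <= Num.sqrt 2.
  move=> x0 x1; rewrite -(@ler_pXn2r _ 2) ?nnegrE ?cn_ge0 ?sqrtr_ge0 // wt_den sqr_sqrtr //.
  by rewrite -natr1 lerD2l; apply: exprn_ile1.
have p2 : cn (1 - 'i%C * s%:C%C) * cn (1 - 'i%C * t%:C%C) <= 2.
  apply: le_trans (ler_pM _ _ (b _ s0 s1) (b _ t0 t1)) _; rewrite ?cn_ge0 //.
  by rewrite -expr2 sqr_sqrtr.
move=> e; have := ler_wpM2l (cn_ge0 (wt s - wt t)) p2; rewrite e mulr1.
move: `|s - t| (cn _); clear; move=> a b; lra.
Qed.

(** * Averaging over unitary images of lines and vectors *)

Section tails.
Context (R : realType) (n : nat) (vol : probability (MT R n) R).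
Hypothesis vol2 : vol [set L : MT R n | ~ rank2proj L] = 0%E.
Hypothesis volU : forall U : Mat R n, unitary U ->
  forall A : set (MT R n), measurable A -> vol ((fun L : MT R n => U *m L *m adj U) @^-1` A) = vol A.

Lemma measurable_conj (U : Mat R n) (A : set (MT R n)) : measurable A ->
  measurable ((fun L : MT R n => U *m L *m adj U : MT R n) @^-1` A).
Proof.
move=> mA; have h : measurable_fun setT (fun L : MT R n => U *m L *m adj U : MT R n).
  apply: mmeasP; apply: mmeasM; last exact: mmeas_cst.
  by apply: mmeasM; [exact: mmeas_cst|exact: mmeas_id].
by have := h measurableT _ mA; rewrite setTI.
Qed.

Lemma vn_unitary (U : Mat R n) (x : Vec R n) : unitary U -> vn (U *m x) = vn x.
Proof.
move=> hU; have := unitary_ip x x hU; rewrite !ipxx => /complexI /eqP.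
by rewrite eqrXn2 ?vn_ge0 // => /eqP.
Qed.

Lemma measurable_low (a : Vec R n) (r : R) : measurable [set L : MT R n | vn (L *m a) < r].
Proof.
apply: measurable_setb; apply: measurable_fun_ltr; last exact: measurable_cst.
by apply: measurable_vn; apply: mmeasM; [exact: mmeas_id|exact: mmeas_cst].
Qed.

(** By invariance all unit vectors [a] give the same mass, so it may be averaged over [M] points
    [m k] of the moment curve. For a fixed line the trace 2 forces a diagonal entry above
    [n.+1%:R^-1]; that row of [L] applied to [m k] is a polynomial in [k / M] of degree at most [n]
    with a large coefficient, hence small for at most [n] indices. In the constant, [9 ^+ n] comes
    from interpolation, one factor [n.+1] from that entry and one from the norm of [m k]. *)
Lemma vol_low : exists2 K : R, 0 < K & forall (M : nat) (a : Vec R n), (0 < M)%N -> ip a a = 1 ->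
  (vol [set L : MT R n | (vn (L *m a) < (K * M%:R ^+ n)^-1)%R] <= (n%:R / M%:R)%:E)%E.
Proof.
have N0 : 0 < n.+1%:R :> R by rewrite ltr0n.
exists (9 ^+ n * n.+1%:R ^+ 2); first by rewrite mulr_gt0 ?exprn_gt0.
move=> M a M0 a1; set rho := _^-1.
have MR : 0 < M%:R :> R by rewrite ltr0n.
have rho0 : 0 < rho by rewrite invr_gt0 mulr_gt0 ?mulr_gt0 ?exprn_gt0.
pose m (k : 'I_M) : Vec R n := \col_j (k%:R / M%:R) ^+ j.
have m0 k : m k != 0.
  by apply/eqP => /matrixP/(_ 0 0)/eqP; rewrite !mxE expr0 oner_eq0.
have mle k : vn (m k) <= n.+1%:R.
  rewrite -(@ler_pXn2r _ 2) ?nnegrE ?vn_ge0 ?(ltW N0) // vn_sqr.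
  apply: le_trans (_ : \sum_(i < n.+1) 1 <= _).
    apply: ler_sum => i _; rewrite mxE cnX cnM cnV !cn_nat.
    apply: exprn_ile1; first by rewrite exprn_ge0 // divr_ge0.
    by apply: exprn_ile1; rewrite ?divr_ge0 // ler_pdivrMr // mul1r ler_nat ltnW.
  by rewrite sumr_const card_ord -natrX ler_nat leq_pmull.
pose E b : set (MT R n) := [set L : MT R n | vn (L *m b) < rho].
have Ea k : vol (E (nrm (m k))) = vol (E a).
  have [U [hU Ua _]] := unitary_move a1 (nrm_unit (m0 k)).
  rewrite -(volU (unitary_adj hU) (measurable_low a rho)).
  congr (vol _); rewrite /E; apply/seteqP; split=> L /=.
    by rewrite adjK -!mulmxA Ua (vn_unitary _ (unitary_adj hU)).
  by rewrite adjK -!mulmxA Ua (vn_unitary _ (unitary_adj hU)).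
have mR2 : measurable [set L : MT R n | ~ rank2proj L] by apply: measurableC; exact: measurable_rank2.
have := @overlap_bound R _ _ vol 'I_M (fun k => E (nrm (m k))) setT [set L | ~ rank2proj L] n
  (fun k => measurable_low _ _) measurableT mR2.
rewrite [X in (_ * X)%E]probability_setT [X in (_ + _ * X)%E]vol2 mule0 adde0 mule1 => h.
have {h} : (\sum_(k < M) vol (E (nrm (m k))) <= n%:R%:E)%E.
  apply: h => // L /contrapT rL _.
  have [i hi] : exists i, n.+1%:R^-1 < cn (L i i).
    apply: contrapT => hi.
    have : cn (\tr L) <= 1.
      apply: le_trans (cn_sum _ _ _) _; apply: le_trans (_ : \sum_(i < n.+1) n.+1%:R^-1 <= _).
        by apply: ler_sum => i _; rewrite leNgt; apply/negP => h; apply: hi; exists i.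
      by rewrite sumr_const card_ord -[X in X <= _]mulr_natl mulfV // gt_eqF.
    by case: rL => _ ->; rewrite cn_nat; lra.
  pose f : {poly R[i]} := \poly_(j < n.+1) L i (inord j).
  have fE (k : 'I_M) : f.[k%:R / M%:R] = (L *m m k) i 0.
    rewrite horner_poly mxE; apply: eq_bigr => j _.
    by rewrite mxE inord_val.
  apply: leq_trans (_ : #|[pred k : 'I_M | (cn f.[k%:R / M%:R] <= n.+1%:R * rho)%R]| <= _)%N.
    apply: subset_leq_card; apply/fintype.subsetP => k /set_mem h; rewrite inE; move: h; rewrite /E /= => h.
    rewrite fE; apply: le_trans (le_coord_vn _ _) _.
    have -> : m k = (vn (m k))%:C%C *: nrm (m k).
      by rewrite /nrm scalerA -rmorphM /= mulfV ?scale1r // vn_eq0.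
    rewrite -scalemxAr vnZ cn_real ger0_norm ?vn_ge0 //.
    by apply: ler_pM; rewrite ?vn_ge0 // ltW.
  apply: (@few_small R n _ _ f (M%:R^-1) _ i).
  - by rewrite invr_gt0.
  - by rewrite invf_le1 // ler1n.
  - exact: size_poly.
  - move=> k l kl; rewrite -mulrBl cnM cnV cn_nat -[X in X <= _]mul1r ler_wpM2r ?invr_ge0 ?(ltW MR) //.
    have -> : (k%:R - l%:R : R[i]) = ((k%:R - l%:R : R)%:C)%C by rewrite rmorphB /= !rmorph_nat.
    rewrite cn_real; have : (k != l :> nat) by [].
    case: ltngtP => // h _.
      by rewrite distrC -natrB ?(ltnW h) // normr_nat ler1n subn_gt0.
    by rewrite -natrB ?(ltnW h) // normr_nat ler1n subn_gt0.
  - move=> k; rewrite cnM cnV !cn_nat ler_pdivrMr //.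
    apply: le_trans (_ : M%:R <= _); first by rewrite ler_nat ltnW.
    by rewrite ler_peMl ?(ltW MR) //; lra.
  rewrite coef_poly ltn_ord inord_val; apply: le_lt_trans hi.
  apply: eq_ler; rewrite /rho invrK; move: n.+1%:R N0 => c c0.
  rewrite exprMn; field; rewrite !gt_eqF ?exprn_gt0 //.
by rewrite (eq_bigr (fun=> vol (E a))) // => /le_avg; apply.
Qed.

End tails.

Section coefficient_tails.
Context (R : realType) (n d : nat) (vol : probability (MT R n) R).
Hypothesis vol2 : vol [set L : MT R n | ~ rank2proj L] = 0%E.
Hypothesis volU : forall U : Mat R n, unitary U ->
  forall A : set (MT R n), measurable A -> vol ((fun L : MT R n => U *m L *m adj U) @^-1` A) = vol A.

Definition lowcoef (p : HPoly R n) (r : R) : set (MT R n) :=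
  [set L | [forall k : 'I_d.+1, cn (lcoef p k L) <= r]].

Lemma measurable_lowcoef p r : measurable (lowcoef p r).
Proof.
rewrite (_ : lowcoef p r = \bigcap_(k in [set: 'I_d.+1]) [set L | cn (lcoef p k L) <= r]).
  apply: fin_bigcap_measurable => // k _; apply: measurable_setb; apply: measurable_fun_ler.
    by apply: measurable_cn; exact: cmeas_lcoef.
  exact: measurable_cst.
by apply/seteqP; split=> [L /forallP h k _|L h]; [exact: h|apply/forallP => k; exact: h].
Qed.

Lemma lowcoef_sup p r (L : Mat R n) (x : Vec R n) : is_homog d p -> rank2proj L -> lowcoef p r L ->
  L *m x = x -> vn x <= 1 -> cn (pe p x) <= d.+1%:R * r.
Proof.
move=> hp rL /forallP hr Lx x1.
have [LE u1 v1 uv _] := rank2_frame rL.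
have xE : x = ip (fu L) x *: fu L + ip (fv L) x *: fv L.
  by rewrite -{1}Lx {1}LE mulmxDl !outerE.
have b (w : Vec R n) : ip w w = 1 -> cn (ip w x) <= 1.
  move=> /vn_unitP w1; apply: le_trans (CS w x) _; by rewrite w1 mul1r.
rewrite xE (pe_line _ _ _ _ hp); apply: le_trans (cn_sum _ _ _) _.
apply: le_trans (_ : \sum_(k < d.+1) r <= _); last by rewrite sumr_const card_ord mulr_natl.
apply: ler_sum => k _; rewrite !cnM !cnX -mulrA -[leRHS]mulr1.
apply: ler_pM (hr k) _; rewrite ?cn_ge0 ?mulr_ge0 ?exprn_ge0 ?cn_ge0 //.
by rewrite -[leRHS]mulr1; apply: ler_pM; rewrite ?exprn_ge0 ?cn_ge0 // exprn_ile1 ?cn_ge0 ?b.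
Qed.

Lemma restr_top (p : HPoly R n) (u v : Vec R n) : is_homog d p -> (restr p u v)`_d = pe p v.
Proof.
move=> hp; have := pe_line u v 0 1 hp; rewrite scale0r add0r scale1r => ->.
rewrite (bigD1 ord_max) //= subnn expr0 expr1n !mulr1 big1 ?addr0 // => k kd.
rewrite expr0n subn_eq0 leqNgt; have : (k < d)%N by rewrite ltn_neqAle -ltnS ltn_ord andbT.
by move=> ->; rewrite mulr0 mul0r.
Qed.

Hypothesis d_gt0 : (0 < d)%N.

(** The set is averaged over the twists about a unit vector [a] with [pe p a != 0]. Evaluated at the
    image of [L *m a], the form is a polynomial of degree at most [d] in the twist parameter, with
    top coefficient [pe p (s *: a)] where [s] is the squared norm of [L *m a]. Unless [L] is nearly
    orthogonal to [a], at most [d] of the [M] twisted lines are therefore low. The exponent is [d]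
    for the spacing of the parameters plus [2 * (n * d)] for [(rho ^+ 2) ^+ d]. *)
Lemma vol_lowcoef p : inPnd d p -> exists2 K : R, 0 < K & forall M : nat, (0 < M)%N ->
  (vol (lowcoef p (K * M%:R ^+ (d + 2 * (n * d)))^-1) <= ((d + n)%:R / M%:R)%:E)%E.
Proof.
move=> pP; have [p0 hp] := pP.
have [a a1 pa] : exists2 a : Vec R n, ip a a = 1 & pe p a != 0.
  have [x px] := pe_neq0 pP.
  have x0 : x != 0.
    apply: contraNneq px => ->; rewrite -(scale0r (0 : Vec R n)) (pe_homog _ _ hp).
    by rewrite expr0n gtn_eqF // mul0r.
  exists (nrm x); first exact: nrm_unit.
  rewrite /nrm (pe_homog _ _ hp) mulf_neq0 // expf_neq0 // -cn_eq0 cn_real normr_eq0.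
  by rewrite invr_eq0 vn_eq0.
have [K1 K10 low] := vol_low vol2 volU.
have d0 : 0 < d.+1%:R :> R by rewrite ltr0n.
have pa0 : 0 < cn (pe p a) by rewrite cn_gt0.
exists (2 * (9 ^+ d * d.+1%:R * (K1 ^+ 2) ^+ d / cn (pe p a))).
  by rewrite mulr_gt0 // divr_gt0 // !mulr_gt0 ?exprn_gt0.
move=> M M0; set kap := _^-1.
have MR : 0 < M%:R :> R by rewrite ltr0n.
set rho := (K1 * M%:R ^+ n)^-1 : R.
have rho0 : 0 < rho by rewrite invr_gt0 mulr_gt0 ?exprn_gt0.
pose t (k : 'I_M) : R := k%:R / M%:R.
have t01 k : 0 <= t k <= 1.
  by rewrite divr_ge0 // ler_pdivrMr // mul1r ler_nat ltnW.
pose U k := twist (wt (t k)) a.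
have hU k : unitary (U k) by apply: twist_unitary => //; exact: cn_wt.
pose A k := (fun L : MT R n => U k *m L *m adj (U k) : MT R n) @^-1` lowcoef p kap.
have mL := measurable_lowcoef p kap.
have mE : measurable ([set L : MT R n | ~ rank2proj L] `|` [set L : MT R n | vn (L *m a) < rho]).
  by apply: measurableU; [apply: measurableC; exact: measurable_rank2|exact: measurable_low].
have := @overlap_bound R _ _ vol 'I_M A setT _ d (fun k => measurable_conj (U k) mL) measurableT mE.
rewrite (eq_bigr (fun=> vol (lowcoef p kap))) => [|k _]; last exact: volU.
rewrite [X in (_ * X)%E]probability_setT mule1 => h.
have {h} : (\sum_(k < M) vol (lowcoef p kap) <= (d + n)%:R%:E)%E.
  apply: le_trans (h _ _) _ => //; last first.
    rewrite natrD EFinD; apply: leeD2l; rewrite card_ord.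
    apply: le_trans (_ : (M%:R%:E * (n%:R / M%:R)%:E <= _)%E); last first.
      by rewrite -EFinM mulrC mulfVK // gt_eqF.
    apply: lee_wpmul2l; first by rewrite lee_fin ltW.
    have mr2 : measurable [set L : MT R n | ~ rank2proj L] by apply: measurableC; exact: measurable_rank2.
    apply: le_trans (measureU2 _ mr2 (measurable_low _ _)) _.
    by rewrite [X in (X + _)%E]vol2 add0e; exact: low.
  move=> L hL _.
  have rL : rank2proj L by apply: contrapT => h'; apply: hL; left.
  have La : rho <= vn (L *m a) by rewrite leNgt; apply/negP => h'; apply: hL; right.
  have oL := rL.1.
  pose s := ip a (L *m a).
  have sE : s = (vn (L *m a) ^+ 2)%:C%C.
    by rewrite /s -ipxx (orth_ip _ _ oL) mulmxA oL.2.
  pose f := restr p (L *m a - s *: a) (s *: a).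
  have pU k : pe p (U k *m (L *m a)) = f.[wt (t k)].
    rewrite /f horner_restr twistE; congr (pe p _).
    by rewrite mulrBl mul1r -/s scalerBl scalerA addrA addrAC.
  have La1 : vn (L *m a) <= 1.
    have := CS a (L *m a); rewrite -/s sE cn_real ger0_norm ?exprn_ge0 ?vn_ge0 //.
    rewrite (vn_unitP a).2 // mul1r expr2 => h1.
    have v0 : 0 < vn (L *m a) by exact: lt_le_trans La.
    by rewrite -(@ler_pM2r _ (vn (L *m a))) // mul1r.
  apply: leq_trans (_ : #|[pred k : 'I_M | (cn f.[wt (t k)] <= d.+1%:R * kap)%R]| <= _)%N.
    apply: subset_leq_card; apply/fintype.subsetP => k /set_mem h'; rewrite inE -pU.
    apply: (lowcoef_sup hp _ h'); first by apply: unitary_rank2.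
      by rewrite -!mulmxA (mulmxA (adj (U k))) unitaryC // mul1mx (mulmxA L) oL.2.
    by rewrite vn_unitary.
  apply: (@few_small R d _ _ f (M%:R^-1) _ d).
  - by rewrite invr_gt0.
  - by rewrite invf_le1 // ler1n.
  - exact: size_restr.
  - move=> k l kl; apply: le_trans (wt_sep (t01 k) (t01 l)).
    rewrite /t -mulrBl normrM normfV (ger0_norm (ltW MR)) -[X in X <= _]mul1r ler_wpM2r ?invr_ge0 ?(ltW MR) //.
    have : (k != l :> nat) by [].
    case: ltngtP => // h' _.
      by rewrite distrC -natrB ?(ltnW h') // normr_nat ler1n subn_gt0.
    by rewrite -natrB ?(ltnW h') // normr_nat ler1n subn_gt0.
  - by move=> k; rewrite cn_wt; lra.
  rewrite restr_top // (pe_homog _ _ hp) cnM cnX sE cn_real ger0_norm ?exprn_ge0 ?vn_ge0 //.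
  apply: lt_le_trans (_ : (rho ^+ 2) ^+ d * cn (pe p a) <= _); last first.
    by rewrite ler_pM2r //; apply: lerXn2r; rewrite ?nnegrE ?exprn_ge0 ?vn_ge0 ?(ltW rho0) //;
      apply: lerXn2r; rewrite ?nnegrE ?vn_ge0 ?(ltW rho0).
  have -> : (9 / M%:R^-1) ^+ d * (d.+1%:R * kap) = (rho ^+ 2) ^+ d * cn (pe p a) / 2.
    rewrite /kap /rho invrK; move: (cn _) pa0 d.+1%:R d0 => c c0 e e0.
    have -> : M%:R ^+ (d + 2 * (n * d)) = M%:R ^+ d * ((M%:R ^+ n) ^+ 2) ^+ d :> R.
      by rewrite exprD -!exprM mulnCA.
    rewrite !exprMn !exprVn !exprMn; move: (exprn_gt0 d MR) (exprn_gt0 d (exprn_gt0 n MR)).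
    move: (exprn_gt0 d K10) (exprn_gt0 d (ltr0n R 9)).
    move: (K1 ^+ d) (M%:R ^+ d) ((M%:R ^+ n) ^+ d) (9 ^+ d) => x1 x2 x3 x4 h1 h2 h3 h4.
    by field; rewrite ?gt_eqF.
  rewrite ltr_pdivrMr // mulr_natr mulr2n ltrDl mulr_gt0 // exprn_gt0 // exprn_gt0 //.
by move/le_avg; apply.
Qed.


Lemma vol_lgood p : inPnd d p -> vol [set L | ~ lgood d p L] = 0%E.
Proof.
move=> pP; have [K K0 hK] := vol_lowcoef pP.
have mr2 : measurable [set L : MT R n | ~ rank2proj L] by apply: measurableC; exact: measurable_rank2.
apply/eqP; rewrite -measure_le0.
apply/lee_addgt0Pr => e e0; rewrite add0e.
pose M := (Num.truncn ((d + n)%:R / e)).+1.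
have hM : (d + n)%:R / M%:R <= e.
  by rewrite ler_pdivrMr ?ltr0n // mulrC -ler_pdivrMr //; apply: ltW; exact: truncnS_gt.
apply: le_trans (_ : (vol ([set L : MT R n | ~ rank2proj L] `|` lowcoef p (K * M%:R ^+ (d + 2 * (n * d)))^-1) <= _)%E).
  apply: le_measure; rewrite ?inE; [by apply: measurableC; exact: measurable_lgood| |].
    by apply: measurableU => //; exact: measurable_lowcoef.
  move=> L hL; have [rL|rL] := pselect (rank2proj L); [right|by left].
  apply/forallP => k; have -> : lcoef p k L = 0.
    apply/eqP; apply: contrapT => /negP h; apply: hL; split=> //.
    by exists k => //; rewrite -ltnS.
  by rewrite cn0 invr_ge0 mulr_ge0 ?exprn_ge0 // ltW.
apply: le_trans (measureU2 _ mr2 (measurable_lowcoef _ _)) _.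
rewrite [X in (X + _)%E]vol2 add0e; apply: le_trans (hK M _) _ => //.
Qed.

Lemma chart_small p (c : bool) (M : nat) (K : R) (L : MT R n) : is_homog d p -> (0 < M)%N -> 0 < K ->
  ~ lowcoef p (K * M%:R ^+ (d + 2 * (n * d)))^-1 L ->
  (u2 R (xsection (lset c (fun x => cn (pe p x) <= (K * 9 ^+ d * M%:R ^+ (2 * d + 2 * (n * d)))^-1)%R) L) <=
     (d%:R / M%:R)%:E)%E.
Proof.
move=> hp M0 K0 hL; have MR : 0 < M%:R :> R by rewrite ltr0n.
have [k hk] : exists k : 'I_d.+1, (K * M%:R ^+ (d + 2 * (n * d)))^-1 < cn (lcoef p k L).
  apply: contrapT => h; apply: hL; apply/forallP => k; rewrite leNgt; apply/negP => h'.
  by apply: h; exists k.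
set eta := (K * 9 ^+ d * _)^-1.
have etaE : (9 / M%:R^-1) ^+ d * eta = (K * M%:R ^+ (d + 2 * (n * d)))^-1.
  rewrite /eta; move: (2 * (n * d))%N => N; rewrite invrK mul2n -addnn !exprD exprMn.
  move: (exprn_gt0 d MR) (exprn_gt0 N MR) (exprn_gt0 d (ltr0n R 9)).
  move: (M%:R ^+ d) (M%:R ^+ N) (9 ^+ d) => a b c0 a0 b0 c00.
  by field; rewrite ?gt_eqF.
(* In the second chart the roles of [fu] and [fv] are exchanged, so the coefficients appear in
   reverse order. *)
have [f sf [[j fj] fE]] : exists2 f : {poly R[i]}, (size f <= d.+1)%N & (exists j, f`_j = lcoef p k L) /\
    forall w, f.[(w.1 +i* w.2)%C] = pe p (cpt c (L, w)).
  case: c => /=.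
    exists (restr p (fu L) (fv L)); first exact: size_restr.
    by split; [exists k|move=> w; rewrite horner_restr].
  exists (\poly_(i < d.+1) lcoef p (d - i) L); first exact: size_poly.
  split; first by exists (d - k)%N; rewrite coef_poly ltnS leq_subr subKn // -ltnS.
  move=> w; rewrite /cpt /= -[X in pe p (_ + X)]scale1r (pe_line _ _ _ _ hp) horner_poly.
  rewrite (reindex_inj rev_ord_inj) /=; apply: eq_bigr => i _.
  by rewrite (subSS i d) (subKn (leq_ord i)) expr1n mulr1.
apply: le_trans (u2_small (d := d) (f := f) (sg := M%:R^-1) (eta := eta) (k := j) _ _ _ _ _ _) _ => //.
- by rewrite invr_gt0.
- by rewrite invf_le1 // ler1n.
- by rewrite etaE fj.
- by apply: measurable_xsection; exact: vmeas_le_cst.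
- by move=> w; rewrite /xsection /= inE /lset /= fE.
rewrite lee_fin; apply: ler_wpM2l => //; rewrite expr2 -[leRHS]mulr1.
by apply: ler_pM; rewrite ?invr_ge0 ?(ltW MR) // invf_le1 // ler1n.
Qed.

(** The lines with only low coefficients are rare by [vol_lowcoef]; on every other line
    [chart_small] bounds the sublevel set in each chart. *)
Lemma PP_tail p : inPnd d p -> exists2 K : R, 0 < K & forall M : nat, (0 < M)%N ->
  (PP vol (fun x => cn (pe p x) <= (K * M%:R ^+ (2 * d + 2 * (n * d)))^-1)%R <= (K / M%:R)%:E)%E.
Proof.
move=> pP; have [K K0 hK] := vol_lowcoef pP.
have K2 : 0 < K * 9 ^+ d by rewrite mulr_gt0 // exprn_gt0.
pose K' := K * 9 ^+ d + 4 * (d + n)%:R.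
have K'0 : 0 < K' by rewrite ltr_wpDr // mulr_ge0.
exists K' => // M M0; have MR : 0 < M%:R :> R by rewrite ltr0n.
have hc c : (vu2 vol (lset c (fun x => cn (pe p x) <= (K' * M%:R ^+ (2 * d + 2 * (n * d)))^-1)%R) <=
    ((2 * (d + n)%:R) / M%:R)%:E)%E.
  apply: le_trans (_ : (vu2 vol (lset c (fun x => cn (pe p x) <= (K * 9 ^+ d * M%:R ^+ (2 * d + 2 * (n * d)))^-1)%R) <= _)%E).
    apply: le_measure; rewrite ?inE; [exact: vmeas_le_cst|exact: vmeas_le_cst|].
    move=> t; rewrite /lset /= => h; apply: le_trans h _.
    rewrite lef_pV2 ?posrE ?mulr_gt0 ?exprn_gt0 // ler_pM2r ?exprn_gt0 //.
    by rewrite /K' lerDl mulr_ge0.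
  have hs := @slice_bound R _ _ _ _ vol (u2 R) _ (lowcoef p (K * M%:R ^+ (d + 2 * (n * d)))^-1) (d%:R / M%:R)
    (vmeas_le_cst p _ c) (measurable_lowcoef _ _) (divr_ge0 (ler0n _ d) (ler0n _ M))
    (fun L => @chart_small p c M K L pP.2 M0 K0).
  apply: le_trans hs _.
  apply: le_trans (leeD2r _ (hK M M0)) _.
  rewrite -EFinD lee_fin -mulrDl ler_pM2r ?invr_gt0 // -natrD -natrM ler_nat.
  by rewrite mul2n -addnn leq_add // leq_addr.
apply: le_trans (leeD (hc true) (hc false)) _.
rewrite -EFinD lee_fin -mulrDl ler_pM2r ?invr_gt0 //.
by move: K2; rewrite /K'; set a := K * _; set b := _%:R; lra.
Qed.

Lemma PP_le (Phi Psi : Vec R n -> bool) : vmeas Phi -> vmeas Psi -> (forall x, Phi x -> Psi x) ->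
  (PP vol Phi <= PP vol Psi)%E.
Proof.
move=> m1 m2 h; apply: leeD; (apply: le_measure; rewrite ?inE //; move=> t; rewrite /lset /=; exact: h).
Qed.

Lemma PP_le2 (Phi : Vec R n -> bool) : vmeas Phi -> (PP vol Phi <= 2%:E)%E.
Proof.
move=> m; rewrite -[X in X%:E](_ : 1 + 1 = 2 :> R) ?EFinD; last by ring.
by apply: leeD; apply: probability_le1.
Qed.

Lemma PP_small p (e : R) : inPnd d p -> 0 < e -> exists2 eta : R, 0 < eta &
  (PP vol (fun x => cn (pe p x) <= eta)%R <= e%:E)%E.
Proof.
move=> pP e0; have [K K0 hK] := PP_tail pP.
pose M := (Num.truncn (K / e)).+1.
exists (K * M%:R ^+ (2 * d + 2 * (n * d)))^-1; first by rewrite invr_gt0 mulr_gt0 // exprn_gt0 // ltr0n.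
apply: le_trans (hK M _) _ => //; rewrite lee_fin ler_pdivrMr ?ltr0n // mulrC -ler_pdivrMr //.
by apply: ltW; exact: truncnS_gt.
Qed.

Lemma PP_tail_geom p (A : R) : inPnd d p -> 0 < A -> exists2 C : R, 0 < C & forall s : nat,
  (PP vol (fun x => cn (pe p x) <= A * (4^-1 ^+ (2 * d + 2 * (n * d))) ^+ s)%R <= (C * 4^-1 ^+ s)%:E)%E.
Proof.
move=> pP A0; have [K K0 hK] := PP_tail pP.
set e := (2 * d + 2 * (n * d))%N in hK *.
have e0 : (0 < e)%N by rewrite addn_gt0 muln_gt0 d_gt0.
pose s0 := (Num.truncn (A * K)).+1.
have hs0 : A * K <= (4 ^+ e) ^+ s0.
  apply: le_trans (ltW (truncnS_gt _)) _; rewrite -/s0 -!natrX ler_nat.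
  apply: ltnW; apply: ltn_expl; rewrite -[X in (X < _)%N](expn0 4) ltn_exp2l //.
exists ((K + 2) * 4 ^+ s0); first by rewrite mulr_gt0 ?exprn_gt0 // addr_gt0.
have p4 k : 0 < 4^-1 ^+ k :> R by rewrite exprn_gt0 // invr_gt0.
move=> s; have [ss|ss] := ltnP s s0.
  apply: le_trans (PP_le2 _) _; first exact: vmeas_le_cst.
  rewrite lee_fin -mulrA -[leLHS]mulr1; apply: ler_pM => //; first by lra.
  rewrite exprVn ler_pdivlMr ?exprn_gt0 // mul1r; apply: ler_weXn2l; [lra|exact: ltnW].
have [r sE] : exists r, s = (r + s0)%N by exists (s - s0)%N; rewrite subnK.
have q0 k : 0 < (4 ^+ e) ^+ k :> R by do 2 apply: exprn_gt0.
have E1 : (4^-1 ^+ e) ^+ s = ((4 ^+ e) ^+ r)^-1 * ((4 ^+ e) ^+ s0)^-1 :> R.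
  by rewrite sE !exprVn exprD invfM.
have E2 : (4 ^ r)%:R ^+ e = (4 ^+ e) ^+ r :> R by rewrite natrX -!exprM mulnC.
apply: le_trans (PP_le (Psi := fun x => cn (pe p x) <= (K * (4 ^ r)%:R ^+ e)^-1)%R _ _ _) _.
- exact: vmeas_le_cst.
- exact: vmeas_le_cst.
- move=> x h; apply: le_trans h _; rewrite E1 E2 invfM.
  have -> : A * (((4 ^+ e) ^+ r)^-1 * ((4 ^+ e) ^+ s0)^-1) =
      (A * K / (4 ^+ e) ^+ s0) * (K^-1 / (4 ^+ e) ^+ r).
    by move: (q0 r) (q0 s0); move: (_ ^+ r) (_ ^+ s0) => a b a0 b0; field; rewrite ?gt_eqF.
  rewrite -[leRHS]mul1r ler_pM2r; last by rewrite divr_gt0 // invr_gt0.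
  by rewrite ler_pdivrMr // mul1r.
apply: le_trans (hK _ _) _; first by rewrite expn_gt0.
rewrite lee_fin natrX sE exprD !exprVn.
have r0 : 0 < 4 ^+ r :> R by apply: exprn_gt0.
have s00 : 0 < 4 ^+ s0 :> R by apply: exprn_gt0.
have -> : (K + 2) * 4 ^+ s0 * ((4 ^+ r)^-1 * (4 ^+ s0)^-1) = (K + 2) / 4 ^+ r.
  by move: r0 s00; move: (_ ^+ r) (_ ^+ s0) => a b a0 b0; field; rewrite ?gt_eqF.
by rewrite ler_pM2r ?invr_gt0 //; lra.
Qed.

End coefficient_tails.

Lemma homog_expand (R : realType) n d (p : HPoly R n) : is_homog d p ->
  p = \sum_(m : 'X_{1..n.+1 < d.+1}) p@_m *: 'X_[m].
Proof.
move=> hp; apply: mpolywE; rewrite msizeE; apply/bigmax_leqP_seq => m mp _.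
by rewrite (homog_mdeg hp mp).
Qed.

Lemma pe_coef (R : realType) n d (p : HPoly R n) x : is_homog d p ->
  pe p x = \sum_(m : 'X_{1..n.+1 < d.+1}) p@_m * \prod_i x i 0 ^+ m i.
Proof.
move=> hp; rewrite {1}(homog_expand hp) /pe raddf_sum; apply: eq_bigr => m _.
by apply: etrans (mevalZ _ _ _) _; rewrite mevalX.
Qed.

Lemma pe_bound (R : realType) n d (p : HPoly R n) x (r B : R) : is_homog d p -> 0 <= r ->
  (forall m : 'X_{1..n.+1 < d.+1}, cn p@_m <= r) -> 1 <= B -> vn x <= B ->
  cn (pe p x) <= #|{: 'X_{1..n.+1 < d.+1}}|%:R * (r * B ^+ d).
Proof.
move=> hp r0 pr B1 xB; rewrite (pe_coef _ hp); apply: le_trans (cn_sum _ _ _) _.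
have B0 : 0 <= B by apply: le_trans B1.
rewrite mulr_natl -sumr_const; apply: ler_sum => m _; rewrite cnM; apply: ler_pM; rewrite ?cn_ge0 //.
rewrite cn_prod; apply: le_trans (_ : \prod_(i < n.+1) B ^+ m i <= _).
  apply: ler_prod => i _; rewrite cn_ge0 cnX; apply: lerXn2r; rewrite ?nnegrE ?cn_ge0 //.
  exact: le_trans (le_coord_vn _ _) xB.
rewrite prodrXr -mdegE; apply: ler_weXn2l => //.
by rewrite -ltnS bmdeg.
Qed.

Lemma pe_bounded (R : realType) n d (p : HPoly R n) (B : R) : is_homog d p -> 1 <= B -> exists2 Q : R, 0 < Q &
  forall x, vn x <= B -> cn (pe p x) <= Q.
Proof.
move=> hp B1.
pose r : R := \sum_(m : 'X_{1..n.+1 < d.+1}) cn p@_m.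
have r0 : 0 <= r by apply: sumr_ge0 => m _; exact: cn_ge0.
pose Q := #|{: 'X_{1..n.+1 < d.+1}}|%:R * (r * B ^+ d).
have Q0 : 0 <= Q by rewrite mulr_ge0 // mulr_ge0 // exprn_ge0 // (le_trans ler01).
exists (Q + 1); first by rewrite ltr_wpDl.
move=> x xB; apply: le_trans (pe_bound hp r0 _ B1 xB) _; last by rewrite lerDl.
move=> m; rewrite /r (bigD1 m) //= lerDl; apply: sumr_ge0 => k _; exact: cn_ge0.
Qed.

Lemma homogB (R : realType) n d (p q : HPoly R n) : is_homog d p -> is_homog d q -> is_homog d (p - q).
Proof. by move=> hp hq; rewrite /is_homog rpredB. Qed.

Lemma homogZ (R : realType) n d c (p : HPoly R n) : is_homog d p -> is_homog d (c *: p).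
Proof. by move=> hp; apply: dhomogZ. Qed.

Lemma restrZ (R : realType) n c (p : HPoly R n) u v : restr (c *: p) u v = c *: restr p u v.
Proof.
apply: poly_eq_horner => a _; rewrite horner_restr hornerZ horner_restr; exact: peZ.
Qed.

Lemma muPZ (R : realType) n d (vol : {measure set (MT R n) -> \bar R}) c (p : HPoly R n) : c != 0 ->
  muP d vol (c *: p) = muP d vol p.
Proof.
move=> c0; have E : mult (c *: p) = mult p; last by rewrite /muP E.
apply/funext => L; apply/funext => Z; rewrite /mult; set uv := xget _ _.
rewrite restrZ scaler_eq0 (negbTE c0) /=; case: ifP => // /andP[_ q0].
by rewrite -mul_polyC mupM ?polyC_eq0 // mupNroot // rootC.
Qed.

(** * The distance of root measures and the masses as real-valued functions *)

HB.lock Definition PPr (R : realType) n (vol : probability (MT R n) R) (Phi : Vec R n -> bool) : R :=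
  fine (PP vol Phi).

HB.lock Definition DD (R : realType) n (d : nat) (vol : probability (MT R n) R) (p q : HPoly R n) : R :=
  W2 (muP d vol p) (muP d vol q).

Lemma W2_ext (R : realType) n (mu nu mu' nu' : set (MT R n) -> \bar R) :
  (forall A, measurable A -> mu A = mu' A) -> (forall A, measurable A -> nu A = nu' A) ->
  W2 mu nu = W2 mu' nu'.
Proof. by move=> h1 h2; rewrite /W2 (W2sq_ext h1 h2). Qed.

Lemma lee_muladd (R : realType) (c : R) (a b : \bar R) : (0 <= a)%E -> (0 <= b)%E ->
  (c%:E * a + c%:E * b <= c%:E * (a + b))%E.
Proof. by move=> a0 b0; rewrite muleDr //; exact: ge0_adde_def. Qed.

Lemma lee_add4 (R : realType) (a b a1 b1 a2 b2 : \bar R) : (a <= a1 + a2 -> b <= b1 + b2 ->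
  a + b <= (a1 + b1) + (a2 + b2))%E.
Proof. by move=> h1 h2; apply: le_trans (leeD h1 h2) _; rewrite addeACA. Qed.

Lemma vu2_setX (R : realType) n (vol : probability (MT R n) R) (A : set (MT R n)) (B : set (RR R)) :
  measurable A -> measurable B -> vu2 vol (A `*` B) = (vol A * u2 R B)%E.
Proof. by move=> mA mB; exact: product_measure1E. Qed.

Section normalized_measure.
Context (R : realType) (n d : nat) (vol : probability (MT R n) R).
Hypothesis d_gt0 : (0 < d)%N.
Hypothesis vol2 : vol [set L : MT R n | ~ rank2proj L] = 0%E.
Hypothesis volU : forall U : Mat R n, unitary U ->
  forall A : set (MT R n), measurable A -> vol ((fun L : MT R n => U *m L *m adj U) @^-1` A) = vol A.
Implicit Types (p q g : HPoly R n) (Phi Psi Nul : Vec R n -> bool).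

(** [muP] is only a set function; on measurable sets it agrees with a probability carried by the
    rank-one projectors, to which the results on [W2] apply. *)
Lemma muP_prob p : inPnd d p -> exists P : probability (MT R n) R,
  r1supp P /\ forall A, measurable A -> muP d vol p A = P A.
Proof.
move=> pP; have [kap [ze hz]] := roots_exist pP.2.
have N0 := vol_lgood vol2 volU d_gt0 pP.
have mr i := measurable_rootpt i hz.
have [P [hP _]] := mixture_exists vol d_gt0 mr.
have mG : measurable [set x : MT R n | ~ rank1proj x] by apply: measurableC; exact: measurable_rank1.
exists P; split; last by move=> A mA; rewrite hP // (muPE d_gt0 hz).
rewrite /r1supp hP // big1 ?mule0 // => i _; apply/eqP; rewrite -measure_le0 -N0.
have mi := mr i measurableT _ mG; rewrite setTI in mi.
apply: le_measure; rewrite ?inE //.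
  by apply: measurableC; exact: measurable_lgood.
by move=> L /= h1 h2; apply: h1; exact: rootpt_rank1 hz h2 _.
Qed.

Local Notation DD := (DD d vol).

Lemma DD_ge0 p q : 0 <= DD p q. Proof. by rewrite DD.unlock; exact: W2_ge0. Qed.
Hint Resolve DD_ge0 : core.

Lemma DD_sym p q : DD p q = DD q p. Proof. by rewrite DD.unlock; exact: W2_sym. Qed.

Lemma DDE p q : inPnd d p -> inPnd d q -> W2sq (muP d vol p) (muP d vol q) = (DD p q ^+ 2)%:E.
Proof.
move=> pP qP; have [P [sP hP]] := muP_prob pP; have [Q [sQ hQ]] := muP_prob qP.
by rewrite DD.unlock (W2_ext hP hQ) (W2sq_ext hP hQ); exact: W2E.
Qed.

Lemma DD_refl p : inPnd d p -> DD p p = 0.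
Proof.
move=> pP; have [P [sP hP]] := muP_prob pP.
by rewrite DD.unlock (W2_ext hP hP) /W2 W2sq_refl //= sqrtr0.
Qed.

Lemma DD_triangle p q g : inPnd d p -> inPnd d q -> inPnd d g -> DD p g <= DD p q + DD q g.
Proof.
move=> pP qP gP; have [P [sP hP]] := muP_prob pP; have [Q [sQ hQ]] := muP_prob qP.
have [G [sG hG]] := muP_prob gP.
have -> : DD p g = W2 P G by rewrite DD.unlock; exact: W2_ext.
have -> : DD p q = W2 P Q by rewrite DD.unlock; exact: W2_ext.
have -> : DD q g = W2 Q G by rewrite DD.unlock; exact: W2_ext.
exact: W2_triangle.
Qed.

Lemma DD_scale p q c : c != 0 -> q = c *: p -> inPnd d p -> DD p q = 0.
Proof. by move=> c0 -> /DD_refl; rewrite DD.unlock muPZ. Qed.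

Local Notation PPr := (PPr vol).

Lemma PPrE Phi : vmeas Phi -> PP vol Phi = (PPr Phi)%:E.
Proof.
move=> m; rewrite PPr.unlock fineK // ge0_fin_numE; last by rewrite adde_ge0.
by apply: le_lt_trans (PP_le2 _ m) _; exact: ltry.
Qed.

Lemma PPr_ge0 Phi : 0 <= PPr Phi. Proof. by rewrite PPr.unlock fine_ge0 // adde_ge0. Qed.

Lemma DD_bad : exists2 K : R, 0 < K & forall p q, inPnd d p -> inPnd d q ->
  DD p q ^+ 2 <= K * PPr (fun x => cn (pe p x) <= 2 * cn (pe (p - q) x)).
Proof.
have [K K0 hK] := @W2_bad_bound R n d d_gt0; exists K => // p q pP qP.
have := hK vol p q pP.2 qP.2 (vol_lgood vol2 volU d_gt0 pP) (vol_lgood vol2 volU d_gt0 qP).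
by rewrite DDE // PPrE ?lee_fin //; exact: vmeas_le.
Qed.

Lemma vmeas_or Phi Psi : vmeas Phi -> vmeas Psi -> vmeas (fun x => Phi x || Psi x).
Proof.
move=> m1 m2 c; rewrite (_ : lset c _ = lset c Phi `|` lset c Psi); first exact: measurableU.
by apply/seteqP; split=> [t /orP|t /orP].
Qed.

Lemma vmeas_vn (B : R) : vmeas (fun x : Vec R n => ~~ (vn x <= B)).
Proof.
move=> c; rewrite (_ : lset c _ = ~` (lset c (fun x : Vec R n => vn x <= B))).
  apply: measurableC; apply: measurable_setb; apply: measurable_fun_ler; last exact: measurable_cst.
  by apply: measurable_vn; exact: mmeas_cpt.
by apply/seteqP; split=> [t /negP|t /negP].
Qed.

Lemma PPr_overlap (I : finType) (F : I -> Vec R n -> bool) Psi Nul (m : nat) :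
  (forall i, vmeas (F i)) -> vmeas Psi -> vmeas Nul -> PPr Nul = 0 ->
  (forall x, ~~ Nul x -> Psi x -> (#|[pred i | F i x]| <= m)%N) ->
  (forall x i, ~~ Nul x -> F i x -> Psi x) ->
  \sum_i PPr (F i) <= m%:R * PPr Psi.
Proof.
move=> mF mP mN N0 hm hF; rewrite -lee_fin EFinM -PPrE // -sumEFin.
have PN := PPrE mN; rewrite N0 in PN.
have nN c : vu2 vol (lset c Nul) = 0%E.
  apply/eqP; rewrite eq_le measure_ge0 andbT; apply: le_trans (_ : PP vol Nul <= _)%E; last by rewrite PN.
  by rewrite /PP; case: c; [rewrite leeDl|rewrite leeDr].
have h c := @overlap_bound R _ _ (vu2 vol) I (fun i => lset c (F i)) (lset c Psi) (lset c Nul) m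
  (fun i => mF i c) (mP c) (mN c).
have h' c : (\sum_i vu2 vol (lset c (F i)) <= m%:R%:E * vu2 vol (lset c Psi))%E.
  apply: le_trans (h c _ _) _.
  - move=> t /negP Nt Pt; apply: leq_trans (hm _ Nt Pt).
    by apply: subset_leq_card; apply/fintype.subsetP => i /set_mem.
  - by move=> t i /negP Nt; exact: hF.
  by rewrite [X in (_ + _ * X)%E]nN mule0 adde0.
rewrite (eq_bigr (fun i => vu2 vol (lset true (F i)) + vu2 vol (lset false (F i)))%E) => [|i _]; last by rewrite -PPrE.
rewrite big_split /=; apply: le_trans (leeD (h' true) (h' false)) _.
exact: lee_muladd (measure_ge0 _ _) (measure_ge0 _ _).
Qed.

Lemma PPr_le Phi Psi : vmeas Phi -> vmeas Psi -> (forall x, Phi x -> Psi x) -> PPr Phi <= PPr Psi.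
Proof. by move=> m1 m2 h; rewrite -lee_fin -(PPrE m1) -(PPrE m2); exact: PP_le. Qed.

Lemma PPr_or Phi Psi : vmeas Phi -> vmeas Psi -> PPr (fun x => Phi x || Psi x) <= PPr Phi + PPr Psi.
Proof.
move=> m1 m2; rewrite -lee_fin EFinD -(PPrE m1) -(PPrE m2) -(PPrE (vmeas_or m1 m2)).
have h c : (vu2 vol (lset c (fun x => Phi x || Psi x)) <= vu2 vol (lset c Phi) + vu2 vol (lset c Psi))%E.
  rewrite (_ : lset c _ = lset c Phi `|` lset c Psi); first exact: measureU2.
  by apply/seteqP; split=> [t /orP|t /orP].
exact: lee_add4 (h true) (h false).
Qed.

(** Almost surely a chart point is [u + w v] or [w u + v] with [u], [v] orthonormal and [w] in the
    square [[-2, 2]^2], where [cn w <= 3]. *)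
Lemma PPr_vn : PPr (fun x => ~~ (vn x <= 4)) = 0.
Proof.
pose S : set (RR R) := itvR (-2) 4 `*` itvR (-2) 4.
have mS : measurable S by apply: measurableX; exact: measurable_itvR.
have S0 : u2 R (~` S) = 0%E.
  rewrite (probability_setC (u2 R) mS) u2_square; [|lra..].
  by rewrite divff // expr1n subee.
have mr2 : measurable [set L : MT R n | ~ rank2proj L] by apply: measurableC; exact: measurable_rank2.
have h c : vu2 vol (lset c (fun x => ~~ (vn x <= 4))) = 0%E.
  apply/eqP; rewrite -measure_le0.
  have m1 : measurable ([set L : MT R n | ~ rank2proj L] `*` setT : set (MT R n * RR R)) by exact: measurableX.
  have m2 : measurable (setT `*` ~` S : set (MT R n * RR R)) by apply: measurableX => //; exact: measurableC.
  apply: le_trans (_ : (vu2 vol (([set L : MT R n | ~ rank2proj L] `*` setT) `|` (setT `*` ~` S)) <= _)%E).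
    apply: le_measure; rewrite ?inE; [exact: vmeas_vn|exact: measurableU|].
    move=> [L w]; rewrite /lset /= => /negP hv.
    have [/= rL|rL] := pselect (rank2proj L); last by left.
    right; split=> //= -[]; rewrite !itvRE => /= w1 w2; apply: hv.
    have [_ u1 v1 _ _] := rank2_frame rL.
    have wb : cn (w.1 +i* w.2)%C <= 3.
      rewrite -(@ler_pXn2r _ 2) ?nnegrE ?cn_ge0 // cn_sqr /=.
      have q1 : w.1 ^+ 2 <= 4 by rewrite -subr_ge0 (_ : 4 - _ = (2 - w.1) * (2 + w.1)); [apply: mulr_ge0; lra|ring].
      have q2 : w.2 ^+ 2 <= 4 by rewrite -subr_ge0 (_ : 4 - _ = (2 - w.2) * (2 + w.2)); [apply: mulr_ge0; lra|ring].
      by move: q1 q2; rewrite (_ : 3 ^+ 2 = 9 :> R); [lra|ring].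
    rewrite /cpt /=; case: c; apply: le_trans (vnD _ _) _; rewrite vnZ
      ((vn_unitP _).2 u1) ((vn_unitP _).2 v1) mulr1; lra.
  apply: le_trans (measureU2 _ m1 m2) _.
  have z1 : vu2 vol ([set L : MT R n | ~ rank2proj L] `*` setT) = 0%E.
    by apply: etrans (vu2_setX _ _ _) _ => //; rewrite [X in (X * _)%E]vol2 mul0e.
  have z2 : vu2 vol (setT `*` ~` S) = 0%E.
    by apply: etrans (vu2_setX _ _ (measurableC mS)) _ => //; rewrite [X in (_ * X)%E]S0 mule0.
  by rewrite [X in (X + _)%E]z1 [X in (_ + X)%E]z2 adde0.
by have := PPrE (vmeas_vn 4); rewrite /PP !h adde0 => -[].
Qed.

Lemma PPr_tail p (e : R) : inPnd d p -> 0 < e -> exists2 eta : R, 0 < eta &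
  PPr (fun x => cn (pe p x) <= eta) <= e.
Proof.
move=> pP e0; have [eta eta0 h] := PP_small vol2 volU d_gt0 pP e0; exists eta => //.
by rewrite -lee_fin -(PPrE (vmeas_le_cst _ _)).
Qed.

Lemma PPr_zero p : inPnd d p -> PPr (fun x => cn (pe p x) <= 0) = 0.
Proof.
move=> pP; apply/eqP; rewrite eq_le PPr_ge0 andbT; apply/ler_addgt0Pr => e e0; rewrite add0r.
have [eta eta0 h] := PPr_tail pP e0; apply: le_trans h.
by apply: PPr_le; [exact: vmeas_le_cst|exact: vmeas_le_cst|move=> x h; apply: le_trans h (ltW _)].
Qed.

(** For small coefficients of [p - g] the bad set of [DD_bad] lies, up to the null set of vectors of
    norm above 4, in a sublevel set of [p] alone. *)
Lemma DD_cont p (e : R) : inPnd d p -> 0 < e -> exists2 r : R, 0 < r & forall g, inPnd d g ->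
  (forall m : 'X_{1..n.+1 < d.+1}, cn (p@_m - g@_m) <= r) -> DD p g <= e.
Proof.
move=> pP e0; have [K K0 hK] := DD_bad.
have e1 : 0 < e ^+ 2 / K by rewrite divr_gt0 ?exprn_gt0.
have [eta eta0 h] := PPr_tail pP e1.
pose N := #|{: 'X_{1..n.+1 < d.+1}}|.+1.
have N0 : 0 < N%:R :> R by rewrite ltr0n.
have B0 : 0 < 4 ^+ d :> R by rewrite exprn_gt0.
have r0 : 0 < eta / (2 * N%:R * 4 ^+ d) by rewrite divr_gt0 // !mulr_gt0.
exists (eta / (2 * N%:R * 4 ^+ d)) => // g gP hg.
rewrite -(@ler_pXn2r _ 2) ?nnegrE ?DD_ge0 ?(ltW e0) //.
apply: le_trans (hK p g pP gP) _.
have -> : e ^+ 2 = K * (e ^+ 2 / K) by rewrite mulrCA mulfV ?mulr1 // gt_eqF.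
rewrite (ler_pM2l K0); apply: le_trans h.
rewrite -[leRHS]add0r -PPr_vn; apply: le_trans (PPr_or (vmeas_vn _) (vmeas_le_cst _ _)).
apply: PPr_le; [exact: vmeas_le|by apply: vmeas_or; [exact: vmeas_vn|exact: vmeas_le_cst]|].
move=> x hx; have [x4|//] := boolP (vn x <= 4) => /=.
apply: le_trans hx _.
have hpg : cn (pe (p - g) x) <= #|{: 'X_{1..n.+1 < d.+1}}|%:R * (eta / (2 * N%:R * 4 ^+ d) * 4 ^+ d).
  apply: (pe_bound (homogB pP.2 gP.2)) => //; first exact: ltW.
  - by move=> m; rewrite mcoeffB.
  - by lra.
apply: le_trans (ler_wpM2l _ hpg) _; first by lra.
have : #|{: 'X_{1..n.+1 < d.+1}}|%:R <= N%:R :> R by rewrite ler_nat.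
move: #|_|%:R => k kN.
apply: le_trans (_ : 2 * (N%:R * (eta / (2 * N%:R * 4 ^+ d) * 4 ^+ d)) <= _).
  by rewrite ler_pM2l // ler_pM2r // mulr_gt0.
by apply: eq_ler; field; rewrite !gt_eqF.
Qed.

End normalized_measure.

(** * Chains of bounded length *)

Section chains.
Context (R : realType) (T : eqType) (V : T -> Prop) (D : T -> T -> R).

Fixpoint walk (p : T) (s : seq T) : R := if s is x :: s' then D p x + walk x s' else 0.

Definition chn (e : R) (p q : T) (L : R) := exists s : seq T,
  [/\ path (fun x y => D x y <= e) p s, last p s = q, (forall x, x \in s -> V x) & walk p s <= L].

Lemma chn_nil e p L : 0 <= L -> chn e p p L.
Proof. by move=> L0; exists [::]. Qed.

Lemma chn_one e p q L : V q -> D p q <= e -> D p q <= L -> chn e p q L.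
Proof.
move=> Vq De DL; exists [:: q]; split=> //=; first by rewrite De.
  by move=> x; rewrite inE => /eqP ->.
by rewrite addr0.
Qed.

Lemma walk_cat p s s' : walk p (s ++ s') = walk p s + walk (last p s) s'.
Proof. by elim: s p => [|x s IH] p /=; rewrite ?add0r // IH addrA. Qed.

Lemma chn_cat e p q r L L' : chn e p q L -> chn e q r L' -> chn e p r (L + L').
Proof.
move=> [s [s1 s2 s3 s4]] [s' [t1 t2 t3 t4]]; exists (s ++ s'); split.
- by rewrite cat_path s1 s2 t1.
- by rewrite last_cat s2 t2.
- by move=> x; rewrite mem_cat => /orP[/s3|/t3].
- by rewrite walk_cat s2 lerD.
Qed.

Lemma chn_le e e' p q L L' : e <= e' -> L <= L' -> chn e p q L -> chn e' p q L'.
Proof.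
move=> ee LL [s [s1 s2 s3 s4]]; exists s; split=> //; last exact: le_trans LL.
by apply: sub_path s1 => x y h; exact: le_trans ee.
Qed.

Lemma chn_sym e p q L : (forall x y, D x y = D y x) -> V p -> chn e p q L -> chn e q p L.
Proof.
move=> Ds Vp [s [s1 s2 s3 s4]]; move: s1 s2 s3 s4.
elim: s p Vp L => [|x s IH] p Vp L /= s1 s2 s3 s4; first by rewrite s2; exact: chn_nil.
case/andP: s1 => s1 s1'.
have h : chn e q x (walk x s).
  by apply: IH => // [|y ys]; apply: s3; rewrite inE ?eqxx // ys orbT.
apply: chn_le (lexx e) _ (chn_cat h (chn_one Vp _ (lexx _))); last by rewrite Ds.
by rewrite addrC Ds.
Qed.

Lemma chn_iter e (y : nat -> T) (l : nat -> R) N :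
  (forall k, (k < N)%N -> [/\ V (y k.+1), D (y k) (y k.+1) <= e & D (y k) (y k.+1) <= l k]) ->
  chn e (y 0%N) (y N) (\sum_(k < N) l k).
Proof.
elim: N => [|N IH] h; first by rewrite big_ord0; exact: chn_nil.
rewrite big_ord_recr /=; apply: chn_cat (IH _) _; first by move=> k kN; apply: h; exact: ltnW.
by have [h1 h2 h3] := h N (ltnSn N); exact: chn_one.
Qed.

End chains.

(** All pairs lie in a box of sides [a.+1] and [c.+1] above the two minimal coordinates. *)
Lemma pairs_card (N a c : nat) (A : pred ('I_N * 'I_N)) :
  (forall x y, A x -> A y -> (x.1 <= y.1 + a)%N /\ (x.2 <= y.2 + c)%N) -> (#|A| <= a.+1 * c.+1)%N.
Proof.
move=> hA; have [x0 Ax0|A0] := pickP A; last by rewrite eq_card0.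
have [x1 Ax1 h1] := arg_minnP (fun x : 'I_N * 'I_N => x.1 : nat) Ax0.
have [x2 Ax2 h2] := arg_minnP (fun x : 'I_N * 'I_N => x.2 : nat) Ax0.
pose f (x : 'I_N * 'I_N) : 'I_a.+1 * 'I_c.+1 := (inord (x.1 - x1.1), inord (x.2 - x2.2)).
have fi : {in A &, injective f}.
  move=> x y Ax Ay [] /(congr1 val) /= e1 /(congr1 val) /= e2.
  have lt1 z : A z -> (z.1 - x1.1 < a.+1)%N by move=> Az; rewrite ltnS leq_subLR; case: (hA _ _ Az Ax1).
  have lt2 z : A z -> (z.2 - x2.2 < c.+1)%N by move=> Az; rewrite ltnS leq_subLR; case: (hA _ _ Az Ax2).
  rewrite !inordK ?lt1 // in e1; rewrite !inordK ?lt2 // in e2.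
  case: x y Ax Ay e1 e2 => [u u'] [v v'] Ax Ay /= e1 e2; congr (_, _); apply: val_inj.
    by rewrite /= -(subnK (h1 _ Ax)) /= e1 subnK //; exact: (h1 _ Ay).
  by rewrite /= -(subnK (h2 _ Ax)) /= e2 subnK //; exact: (h2 _ Ay).
rewrite -(card_in_image fi); apply: leq_trans (max_card _) _.
by rewrite card_prod !card_ord.
Qed.

(** Applied to [z = p / q] at a point, it limits the parameters [(r, w)] of the pencil whose bad set
    contains that point. *)
Lemma dir_close (R : realType) (z w w' : R[i]) (r r' t : R) : cn w = 1 -> cn w' = 1 -> 0 <= r -> 0 <= r' ->
  cn (z - r%:C%C * w) <= t -> cn (z - r'%:C%C * w') <= t ->
  `|r - r'| <= 2 * t /\ r * cn (w - w') <= 4 * t.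
Proof.
move=> w1 w1' r0 r0' h h'.
have h2 : cn (r%:C%C * w - r'%:C%C * w') <= 2 * t.
  apply: le_trans (cnD3 _ z _) _; rewrite (cnB _ z); move: h h'; lra.
have e1 : cn (r%:C%C * w) = r by rewrite cnM w1 mulr1 cn_real ger0_norm.
have e2 : cn (r'%:C%C * w') = r' by rewrite cnM w1' mulr1 cn_real ger0_norm.
have h3 : `|r - r'| <= 2 * t.
  have := cnDB (r%:C%C * w) (r'%:C%C * w'); have := cnDB (r'%:C%C * w') (r%:C%C * w).
  rewrite e1 e2 (cnB (r'%:C%C * w')) ler_norml; move: h2; lra.
split=> //.
have -> : r * cn (w - w') = cn (r%:C%C * (w - w')) by rewrite cnM cn_real (ger0_norm r0).
have -> : r%:C%C * (w - w') = (r%:C%C * w - r'%:C%C * w') - (r - r')%:C%C * w' :> R[i].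
  by rewrite rmorphB /=; ring.
apply: le_trans (cn_leB _ _) _; rewrite [cn (_ * w')]cnM w1' mulr1 cn_real.
by move: h2 h3; lra.
Qed.

(** Used in place of Cauchy--Schwarz: it bounds each step by terms that are linear in the mass, with
    a weight [t] free to depend on the shell. *)
Lemma le_amgm (R : realType) (D X t : R) : 0 < t -> D ^+ 2 <= X -> D <= (t^-1 + X * t) / 2.
Proof.
move=> t0 DX; have h : 0 <= t * (D - t^-1) ^+ 2 by rewrite mulr_ge0 ?sqr_ge0 // ltW.
have e : t * (D - t^-1) ^+ 2 = D ^+ 2 * t - D * 2 + t^-1 by field; rewrite gt_eqF.
by rewrite e in h; have := ler_wpM2r (ltW t0) DX; rewrite ler_pdivlMr //; lra.
Qed.

(** At [r = 1] the pencil from [p] in direction [w] and the pencil from [q] in direction [w^-1]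
    reach proportional forms. *)
Lemma swap_lin (F : fieldType) (V : lmodType F) (p q : V) (w : F) : w != 0 ->
  q - (1 * w^-1) *: p = - w^-1 *: (p - (1 * w) *: q).
Proof.
by move=> w0; rewrite !mul1r scalerBr scalerA mulNr mulVf // !scaleNr scale1r opprK addrC.
Qed.

Section chain_existence.
Context (R : realType) (n d : nat) (vol : probability (MT R n) R).
Hypothesis d_gt0 : (0 < d)%N.
Hypothesis vol2 : vol [set L : MT R n | ~ rank2proj L] = 0%E.
Hypothesis volU : forall U : Mat R n, unitary U ->
  forall A : set (MT R n), measurable A -> vol ((fun L : MT R n => U *m L *m adj U) @^-1` A) = vol A.
Local Notation PPr := (PPr vol).
Local Notation DD := (DD d vol).
Local Notation expo := (2 * d + 2 * (n * d))%N.
Local Notation b := (4^-1 ^+ expo : R).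

Lemma base_bounds : 0 < b /\ b < 1.
Proof.
split; first by rewrite exprn_gt0 // invr_gt0.
have h0 : expo != 0%N by rewrite -lt0n addn_gt0 muln_gt0 d_gt0.
have h1 : 0 <= 4^-1 :> R by lra.
by rewrite exprn_ilt1 //; lra.
Qed.

Definition pencil (p q : HPoly R n) (w : R[i]) (r : R) : HPoly R n := p - (r%:C%C * w) *: q.

(* The shell [b^(s+1) <= r <= b^s] of the pencil is cut into [N] steps of length [dlt N s];
   [bad] is where the step from [rad N s k] to [rad N s k.+1] can be expensive. *)
Definition dlt (N s : nat) : R := b ^+ s * (1 - b) / N%:R.
Definition rad (N s k : nat) : R := b ^+ s.+1 + k%:R * dlt N s.

Definition bad (p q : HPoly R n) (N s k : nat) (w : R[i]) (x : Vec R n) :=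
  cn (pe (pencil p q w (rad N s k)) x) <=
    2 * cn (pe (pencil p q w (rad N s k) - pencil p q w (rad N s k.+1)) x).

Lemma pe_pencil p q w r x : pe (pencil p q w r) x = pe p x - r%:C%C * w * pe q x.
Proof. by rewrite peB peZ. Qed.

Lemma pe_pencilB p q w r r' x :
  pe (pencil p q w r - pencil p q w r') x = (r' - r)%:C%C * w * pe q x.
Proof. by rewrite peB !pe_pencil rmorphB /=; ring. Qed.

Lemma dlt_ge0 N s : 0 <= dlt N s.
Proof. by have [b0 b1] := base_bounds; rewrite divr_ge0 // mulr_ge0 ?exprn_ge0 ?subr_ge0 ?ltW. Qed.

Lemma dlt_ub N s : dlt N s <= b ^+ s / N%:R.
Proof.
have [b0 /ltW b1] := base_bounds; apply: ler_wpM2r; rewrite ?invr_ge0 //.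
by rewrite -[leRHS]mulr1; apply: ler_wpM2l; rewrite ?exprn_ge0 ?(ltW b0) // lerBlDr lerDl ltW.
Qed.

(** Off a null set, a point is bad for [(k, j)] only if [p / q] is within [2 * dlt N s] of
    [rad N s k] times [w j]. Then [p] is at most [3 * Q * b ^+ s] there, a set of mass at most
    [C * 4^-1 ^+ s], and by [dir_close] at most [m] pairs share the point. So the sum over all
    [N * N] pairs is bounded independently of [N], and after the weight [2 ^+ s] the shells still
    form a geometric series. *)
Lemma half_bound p q : inPnd d p -> inPnd d q -> exists2 C : R, 0 < C &
  forall (N S : nat) (w : nat -> R[i]), (0 < N)%N -> (forall j, cn (w j) = 1) ->
  (forall j k : 'I_N, `|j%:R - k%:R| / N%:R <= cn (w j - w k)) ->
  \sum_(j < N) \sum_(s < S) 2 ^+ s * (\sum_(k < N) PPr (bad p q N s k (w j))) <= C.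
Proof.
move=> pP qP; have [b0 b1] := base_bounds.
have B1 : 1 <= 4 :> R by lra.
have [Q Q0 hQ] := pe_bounded qP.2 B1.
have Q30 : 0 < 3 * Q by rewrite mulr_gt0.
have [C C0 hC] := PP_tail_geom vol2 volU d_gt0 pP Q30.
(* Two pairs sharing a point have radii at most 4 steps apart, and directions at most [8 / b]
   indices apart because the radius is at least [b ^+ s.+1]. *)
pose c8 := (8 * 4 ^ expo)%N.
pose m := (5 * c8.+1)%N.
have m0 : 0 < m%:R :> R by rewrite ltr0n.
exists (2 * (m%:R * C)); first by rewrite !mulr_gt0.
move=> N S w N0 w1 wsep; have NR : 0 < N%:R :> R by rewrite ltr0n.
have hs s : \sum_(j < N) \sum_(k < N) PPr (bad p q N s k (w j)) <= m%:R * (C * 4^-1 ^+ s).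
  pose F (kj : 'I_N * 'I_N) := bad p q N s kj.1 (w kj.2).
  pose Psi (x : Vec R n) := cn (pe p x) <= 3 * Q * b ^+ s.
  (* The quotient [p / q] is considered only where [q] does not vanish and where the bound [Q] on
     [q] holds. *)
  pose Nul (x : Vec R n) := ~~ (vn x <= 4) || (cn (pe q x) <= 0).
  have mF kj : vmeas (F kj) by exact: vmeas_le.
  have mP : vmeas Psi by exact: vmeas_le_cst.
  have mN : vmeas Nul by apply: vmeas_or; [exact: vmeas_vn|exact: vmeas_le_cst].
  have N00 : PPr Nul = 0.
    apply/eqP; rewrite eq_le PPr_ge0 andbT.
    apply: le_trans (PPr_or _ (vmeas_vn _) (vmeas_le_cst _ _)) _.
    by rewrite (PPr_vn vol2) (PPr_zero d_gt0 vol2 volU qP) addr0.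
  have close x kj : ~~ Nul x -> F kj x ->
      cn (pe p x / pe q x - (rad N s kj.1)%:C%C * w kj.2) <= 2 * dlt N s /\ cn (pe q x) <= Q.
    rewrite negb_or negbK -ltNge => /andP[x4 qx] H; split; last exact: hQ.
    rewrite -(ler_pM2r qx) -cnM mulrBl divfK -?cn_gt0 //; move: H; rewrite /F /bad pe_pencilB pe_pencil.
    have -> : rad N s kj.1.+1 - rad N s kj.1 = dlt N s by rewrite /rad -natr1; ring.
    by rewrite !cnM w1 mulr1 cn_real ger0_norm ?dlt_ge0 // mulrA.
  have rad0 k : b ^+ s.+1 <= rad N s k by rewrite /rad lerDl mulr_ge0 // dlt_ge0.
  have rad_ge0 k : 0 <= rad N s k by apply: le_trans (rad0 k); rewrite exprn_ge0 // ltW.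
  have radub (k : 'I_N) : rad N s k <= b ^+ s.
    rewrite /rad; apply: le_trans (_ : b ^+ s.+1 + N%:R * dlt N s <= _).
      by rewrite lerD2l ler_wpM2r ?dlt_ge0 // ler_nat ltnW.
    by rewrite /dlt mulrCA mulfV ?gt_eqF // mulr1 exprS; lra.
  have bs0 : 0 < b ^+ s by rewrite exprn_gt0.
  have dN : dlt N s <= b ^+ s.
    apply: le_trans (dlt_ub N s) _; rewrite ler_pdivrMr // ler_peMr ?(ltW bs0) //.
    by rewrite ler1n.
  rewrite exchange_big /= pair_big /=.
  have -> : \sum_(i : 'I_N * 'I_N) PPr (bad p q N s i.1 (w i.2)) = \sum_i PPr (F i) by [].
  apply: le_trans (PPr_overlap (m := m) mF mP mN N00 _ _) _; last first.
  - rewrite (ler_pM2l m0) -lee_fin -PPrE //; exact: hC.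
  - move=> x kj Nx Fx; have [h1 h2] := close x kj Nx Fx.
    move: Nx; rewrite negb_or negbK -ltNge => /andP[x4 qx].
    have h3 : cn (pe p x / pe q x) <= 3 * b ^+ s.
      have := cnD (pe p x / pe q x - (rad N s kj.1)%:C%C * w kj.2) ((rad N s kj.1)%:C%C * w kj.2).
      rewrite subrK [cn (_ * w _)]cnM w1 mulr1 cn_real ger0_norm //.
      have := radub kj.1; move: dN h1; lra.
    rewrite /Psi -(divfK (_ : pe q x != 0) (pe p x)) -?cn_gt0 // cnM.
    have -> : 3 * Q * b ^+ s = 3 * b ^+ s * Q by ring.
    by apply: ler_pM; rewrite ?cn_ge0.
  - move=> x Nx _; apply: pairs_card => kj kj' h h'.
    have [h1 h2] := close x kj Nx h; have [h1' h2'] := close x kj' Nx h'.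
    have [e1 e2] := dir_close (w1 _) (w1 _) (rad_ge0 _) (rad_ge0 _) h1 h1'.
    have s0 : 0 < dlt N s by rewrite divr_gt0 // mulr_gt0 // subr_gt0.
    split.
      rewrite -(ler_nat R) natrD -lerBlDl; apply: le_trans (ler_norm _) _.
      rewrite -(ler_pM2r s0) -{1}(ger0_norm (ltW s0)) -normrM.
      have -> : (kj.1%:R - kj'.1%:R) * dlt N s = rad N s kj.1 - rad N s kj'.1 by rewrite /rad; ring.
      by apply: le_trans e1 _; apply: eq_ler; ring.
    rewrite -(ler_nat R) natrD -lerBlDl; apply: le_trans (ler_norm _) _.
    have h5 : b ^+ s.+1 * (`|kj.2%:R - kj'.2%:R| / N%:R) <= 8 * (b ^+ s / N%:R).
      apply: le_trans (_ : rad N s kj.1 * cn (w kj.2 - w kj'.2) <= _).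
        by apply: ler_pM => //; rewrite ?exprn_ge0 ?divr_ge0 ?(ltW b0).
      apply: le_trans e2 _; apply: le_trans (_ : 8 * dlt N s <= _); first by apply: eq_ler; ring.
      by apply: ler_wpM2l => //; exact: dlt_ub.
    have h6 : b * `|kj.2%:R - kj'.2%:R| <= 8.
      have t0 : 0 < b ^+ s / N%:R by rewrite divr_gt0.
      rewrite -(ler_pM2r t0); apply: le_trans h5; apply: eq_ler; rewrite exprS; ring.
    rewrite -(ler_pM2l b0); apply: le_trans h6 _; apply: eq_ler.
    rewrite /c8 natrM natrX exprVn; field; rewrite gt_eqF // exprn_gt0 //.
rewrite exchange_big /=.
apply: le_trans (_ : \sum_(s < S) 2^-1 ^+ s * (m%:R * C) <= _).
  apply: ler_sum => s _; rewrite -mulr_sumr.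
  apply: le_trans (ler_wpM2l _ (hs s)) _; first by rewrite exprn_ge0.
  apply: eq_ler; rewrite !exprVn; have -> : 4 ^+ s = 2 ^+ s * 2 ^+ s :> R by rewrite -exprMn; congr (_ ^+ _); ring.
  have : 2 ^+ s != 0 :> R by rewrite gt_eqF // exprn_gt0.
  by move: (2 ^+ s) => t t0; field.
rewrite -mulr_suml ler_pM2r ?mulr_gt0 //.
elim: S => [|S IH]; first by rewrite big_ord0.
rewrite big_ord_recl expr0 /=.
apply: le_trans (_ : 1 + 2^-1 * \sum_(i < S) 2^-1 ^+ i <= _); last by lra.
by rewrite lerD2l mulr_sumr; apply: ler_sum => i _; rewrite exprS.
Qed.

Lemma pencil_inPnd p q w r : inPnd d p -> inPnd d q -> (forall c, p - c *: q != 0) -> inPnd d (pencil p q w r).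
Proof. by move=> pP qP h; split; [exact: h|exact: homogB pP.2 (homogZ _ qP.2)]. Qed.

(** AM-GM with weight [2 ^+ s * N%:R]: the first terms of [l] sum to at most 2 and the second to at
    most [K * c] (before halving), so the length does not depend on [N] or [S]. A single step has
    square at most [K * (c / N%:R)], so a large [N] makes all steps short. *)
Lemma shells_chain K p q (N S : nat) (w : R[i]) (c e : R) : 0 < K -> (0 < N)%N -> 0 < e -> 0 <= c ->
  (forall p q, inPnd d p -> inPnd d q ->
     DD p q ^+ 2 <= K * PPr (fun x => cn (pe p x) <= 2 * cn (pe (p - q) x))) ->
  inPnd d p -> inPnd d q -> (forall c, p - c *: q != 0) ->
  \sum_(s < S) 2 ^+ s * (\sum_(k < N) PPr (bad p q N s k w)) <= c / N%:R ->
  K * (c / N%:R) <= e ^+ 2 ->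
  chn (inPnd d) DD e (pencil p q w (b ^+ S)) (pencil p q w 1) ((2 + K * c) / 2).
Proof.
move=> K0 N0 e0 c0 hK pP qP np hQ he.
have NR : 0 < N%:R :> R by rewrite ltr0n.
pose l s k : R := (2^-1 ^+ s / N%:R + K * PPr (bad p q N s k w) * (2 ^+ s * N%:R)) / 2.
have PY r : inPnd d (pencil p q w r) by exact: pencil_inPnd.
have p2 k : 0 < 2 ^+ k :> R by rewrite exprn_gt0.
have term0 s : 0 <= 2 ^+ s * (\sum_(k < N) PPr (bad p q N s k w)).
  by rewrite mulr_ge0 ?(ltW (p2 _)) //; apply: sumr_ge0 => k _; exact: PPr_ge0.
have step s k : (s < S)%N -> (k < N)%N ->
    DD (pencil p q w (rad N s k)) (pencil p q w (rad N s k.+1)) <= e /\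
    DD (pencil p q w (rad N s k)) (pencil p q w (rad N s k.+1)) <= l s k.
  move=> sS kN; set D := DD _ _.
  have D0 : 0 <= D by exact: DD_ge0.
  have DK : D ^+ 2 <= K * PPr (bad p q N s k w) by exact: hK.
  have P0 : 0 <= PPr (bad p q N s k w) by exact: PPr_ge0.
  split.
    rewrite -(@ler_pXn2r _ 2) ?nnegrE ?(ltW e0) //; apply: le_trans DK _; apply: le_trans he.
    rewrite ler_pM2l //; apply: le_trans hQ.
    rewrite (bigD1 (Ordinal sS) isT) (bigD1 (Ordinal kN) isT).
    apply: le_trans (_ : 2 ^+ s * PPr (bad p q N s k w) <= _).
      by rewrite ler_peMl // exprn_ege1 //; lra.
    apply: le_trans (_ : 2 ^+ s * (PPr (bad p q N s k w) + \sum_(i < N | i != Ordinal kN) PPr (bad p q N s i w)) <= _).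
      by rewrite ler_pM2l // lerDl; apply: sumr_ge0 => i _; exact: PPr_ge0.
    by rewrite lerDl; apply: sumr_ge0 => i _; exact: term0.
  rewrite /l; have t0 : 0 < 2 ^+ s * N%:R :> R by rewrite mulr_gt0.
  have -> : 2^-1 ^+ s / N%:R = (2 ^+ s * N%:R)^-1 :> R by rewrite exprVn invfM.
  exact: le_amgm.
have shell s : (s < S)%N -> chn (inPnd d) DD e (pencil p q w (b ^+ s.+1)) (pencil p q w (b ^+ s)) (\sum_(k < N) l s k).
  move=> sS.
  have := @chn_iter _ _ (inPnd d) DD e (fun k => pencil p q w (rad N s k)) (l s) N.
  have -> : rad N s 0 = b ^+ s.+1 by rewrite /rad mul0r addr0.
  have -> : rad N s N = b ^+ s.
    by rewrite /rad /dlt exprS; field; rewrite gt_eqF.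
  by apply=> k kN; have [h1 h2] := step s k sS kN.
have {shell} : forall T, (T <= S)%N ->
    chn (inPnd d) DD e (pencil p q w (b ^+ T)) (pencil p q w 1) (\sum_(s < T) \sum_(k < N) l s k).
  elim=> [|T IH] TS; first by rewrite expr0 big_ord0; exact: chn_nil.
  rewrite big_ord_recr /= addrC; apply: chn_cat (shell _ TS) (IH _); exact: ltnW.
move/(_ S (leqnn _)); apply: chn_le => //.
have -> : \sum_(s < S) \sum_(k < N) l s k =
   (\sum_(s < S) 2^-1 ^+ s + K * N%:R * \sum_(s < S) 2 ^+ s * (\sum_(k < N) PPr (bad p q N s k w))) / 2.
  rewrite mulrDl mulr_sumr !mulr_suml -big_split /=; apply: eq_bigr => s _.
  rewrite /l -mulr_suml big_split /= sumr_const card_ord -mulr_suml -mulr_sumr mulrDl; congr (_ / _ + _).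
    by rewrite -[LHS]mulr_natr divfK // gt_eqF.
  by move: (\sum_(i < N) _) => Z; ring.
rewrite ler_pM2r ?invr_gt0 //; apply: lerD.
  elim: (S) => [|S' IH]; first by rewrite big_ord0.
  rewrite big_ord_recl expr0 /=.
  apply: le_trans (_ : 1 + 2^-1 * \sum_(i < S') 2^-1 ^+ i <= _); last by lra.
  by rewrite lerD2l mulr_sumr; apply: ler_sum => i _; rewrite exprS.
rewrite -mulrA ler_pM2l // mulrC -ler_pdivlMr //.
Qed.

(** Bridges in one short step what remains between [p] and the innermost shell used. *)
Lemma first_jump K p q : 0 < K ->
  (forall p q, inPnd d p -> inPnd d q ->
     DD p q ^+ 2 <= K * PPr (fun x => cn (pe p x) <= 2 * cn (pe (p - q) x))) ->
  inPnd d p -> inPnd d q -> (forall c, p - c *: q != 0) ->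
  exists2 C : R, 0 < C & forall (S : nat) w, cn w = 1 -> DD p (pencil p q w (b ^+ S)) ^+ 2 <= C * 4^-1 ^+ S.
Proof.
move=> K0 hK pP qP np; have B1 : 1 <= 4 :> R by lra.
have [b0 _] := base_bounds.
have [Q Q0 hQ] := pe_bounded qP.2 B1.
have Q20 : 0 < 2 * Q by rewrite mulr_gt0.
have [C C0 hC] := PP_tail_geom vol2 volU d_gt0 pP Q20.
exists (K * C); first by rewrite mulr_gt0.
move=> S w w1; apply: le_trans (hK _ _ pP (pencil_inPnd _ _ pP qP np)) _.
rewrite -mulrA (ler_pM2l K0).
apply: le_trans (_ : PPr (fun x => cn (pe p x) <= 2 * Q * b ^+ S) <= _); last first.
  by rewrite -lee_fin -(PPrE vol (vmeas_le_cst _ _)); exact: hC.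
rewrite -[leRHS]add0r -(PPr_vn vol2); apply: le_trans (PPr_or vol (vmeas_vn _) (vmeas_le_cst _ _)).
apply: PPr_le; [exact: vmeas_le|by apply: vmeas_or; [exact: vmeas_vn|exact: vmeas_le_cst]|].
move=> x hx; have [x4|//] := boolP (vn x <= 4) => /=.
apply: le_trans hx _; rewrite peB pe_pencil opprB addrC subrK !cnM w1 mulr1 cn_real ger0_norm ?exprn_ge0 ?(ltW b0) //.
have -> : 2 * Q * b ^+ S = 2 * (b ^+ S * Q) by ring.
by rewrite ler_pM2l // ler_pM2l ?exprn_gt0 //; exact: hQ.
Qed.

Lemma pigeonhole_sum (N : nat) (x : 'I_N -> R) (C : R) : (0 < N)%N -> \sum_j x j <= C ->
  exists j, x j <= C / N%:R.
Proof.
move=> N0 h; apply: contrapT => hx; have NR : 0 < N%:R :> R by rewrite ltr0n.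
have : C < \sum_(j < N) x j.
  have -> : C = \sum_(j < N) C / N%:R by rewrite sumr_const card_ord -[RHS]mulr_natr divfK // gt_eqF.
  apply: ltr_sum; first by apply/hasP; exists (Ordinal N0) => //; rewrite mem_index_enum.
  by move=> j _; rewrite ltNge; apply/negP => hj; apply: hx; exists j.
by rewrite ltNge h.
Qed.

Lemma pow4_small (C e : R) : 0 < C -> 0 < e -> exists S, C * 4^-1 ^+ S <= e.
Proof.
move=> C0 e0; exists (Num.truncn (C / e)).+1; set S := _.+1.
rewrite exprVn ler_pdivrMr ?exprn_gt0 // mulrC -ler_pdivrMr //.
apply: le_trans (ltW (truncnS_gt _)) _; rewrite -/S -natrX ler_nat ltnW //; exact: ltn_expl.
Qed.

(** One index [j] must be cheap for the halves from [p] and from [q] at once, so their sums are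
    added before the pigeonhole. The second half runs in the directions [(w j)^-1], so that both end
    at the same projective point. *)
Lemma chain_exists p q : inPnd d p -> inPnd d q -> (forall c, c != 0 -> q <> c *: p) ->
  exists L : R, forall e : R, 0 < e -> chn (inPnd d) DD e p q L.
Proof.
move=> pP qP npq; have [K K0 hK] := DD_bad d_gt0 vol2 volU.
have np c : p - c *: q != 0.
  apply/eqP => /eqP; rewrite subr_eq0 => /eqP e; have c0 : c != 0.
    by apply: contraTneq pP.1 => c0; rewrite e c0 scale0r eqxx.
  by apply: (npq c^-1); rewrite ?invr_eq0 // e scalerA mulVf // scale1r.
have nq c : q - c *: p != 0.
  apply/eqP => /eqP; rewrite subr_eq0 => /eqP e; have c0 : c != 0.
    by apply: contraTneq qP.1 => c0; rewrite e c0 scale0r eqxx.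
  exact: npq e.
have [C1 C10 h1] := half_bound pP qP.
have [C2 C20 h2] := half_bound qP pP.
have [D1 D10 j1] := first_jump K0 hK pP qP np.
have [D2 D20 j2] := first_jump K0 hK qP pP nq.
pose c := C1 + C2; have c0 : 0 < c by rewrite addr_gt0.
(* First jump, shells from [p], the zero-length passage between proportional forms, shells to [q],
   last jump. Only [N] and [S] will depend on [e]. *)
exists (1 + (2 + K * c) / 2 + 0 + ((2 + K * c) / 2 + 1)) => e e0.
pose e1 := Num.min e 1; have e10 : 0 < e1 by rewrite lt_min e0 ltr01.
have e1e : e1 <= e by rewrite ge_min lexx.
have e11 : e1 <= 1 by rewrite ge_min lexx orbT.
have [S hS] := pow4_small (addr_gt0 D10 D20) (exprn_gt0 2 e10).
pose N := (Num.truncn (K * c / e ^+ 2)).+1.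
have N0 : (0 < N)%N by [].
have NR : 0 < N%:R :> R by rewrite ltr0n.
have hN : K * (c / N%:R) <= e ^+ 2.
  rewrite mulrA ler_pdivrMr // [leRHS]mulrC -ler_pdivrMr ?exprn_gt0 //.
  by apply: ltW; exact: truncnS_gt.
pose w (j : nat) : R[i] := wt (j%:R / N%:R).
have w1 j : cn (w j) = 1 by exact: cn_wt.
have w0 j : w j != 0 by exact: wt_neq0.
have wv1 j : cn (w j)^-1 = 1 by rewrite cnV w1 invr1.
have wsep (j k : 'I_N) : `|j%:R - k%:R| / N%:R <= cn (w j - w k).
  have t01 (i : 'I_N) : 0 <= (i%:R / N%:R : R) <= 1.
    by rewrite divr_ge0 // ler_pdivrMr // mul1r ler_nat ltnW.
  apply: le_trans (wt_sep (t01 j) (t01 k)).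
  by rewrite -mulrBl normrM normfV (ger0_norm (ltW NR)).
have wvsep (j k : 'I_N) : `|j%:R - k%:R| / N%:R <= cn ((w j)^-1 - (w k)^-1).
  apply: le_trans (wsep j k) _; rewrite cnB.
  have -> : (w j)^-1 - (w k)^-1 = (w k - w j) * (w j)^-1 * (w k)^-1.
    by have := w0 j; have := w0 k; move: (w j) (w k) => a b a0 b0; field; rewrite a0 b0.
  by rewrite cnM cnM !wv1 !mulr1.
have := lerD (h1 N S w N0 w1 wsep) (h2 N S (fun j => (w j)^-1) N0 wv1 wvsep).
rewrite -big_split /= => /(pigeonhole_sum N0) [j hj].
have pos p' q' w' : 0 <= \sum_(s < S) 2 ^+ s * (\sum_(k < N) PPr (bad p' q' N s k w')).
  apply: sumr_ge0 => s _; rewrite mulr_ge0 ?exprn_ge0 //.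
  by apply: sumr_ge0 => k _; exact: PPr_ge0.
have hj1 : \sum_(s < S) 2 ^+ s * (\sum_(k < N) PPr (bad p q N s k (w j))) <= c / N%:R.
  by apply: le_trans hj; rewrite lerDl; exact: pos.
have hj2 : \sum_(s < S) 2 ^+ s * (\sum_(k < N) PPr (bad q p N s k (w j)^-1)) <= c / N%:R.
  by apply: le_trans hj; rewrite lerDr; exact: pos.
have c1 := shells_chain K0 N0 e0 (ltW c0) hK pP qP np hj1 hN.
have c2 := shells_chain K0 N0 e0 (ltW c0) hK qP pP nq hj2 hN.
have P1 := pencil_inPnd (w j) (4^-1 ^+ expo ^+ S) pP qP np.
have P2 := pencil_inPnd (w j)^-1 (4^-1 ^+ expo ^+ S) qP pP nq.
have jump p' q' D' (D'0 : 0 < D') : (forall S w, cn w = 1 -> DD p' (pencil p' q' w (b ^+ S)) ^+ 2 <= D' * 4^-1 ^+ S) ->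
    D' <= D1 + D2 -> forall w', cn w' = 1 -> DD p' (pencil p' q' w' (b ^+ S)) <= e1.
  move=> hj' hD w' w'1; rewrite -(@ler_pXn2r _ 2) ?nnegrE ?(ltW e10) //; last exact: DD_ge0.
  apply: le_trans (hj' S w' w'1) _; apply: le_trans hS; exact: ler_wpM2r.
have J1 : DD p (pencil p q (w j) (b ^+ S)) <= e1 by apply: jump j1 _ _ (w1 j) => //; rewrite lerDl ltW.
have J2 : DD q (pencil q p (w j)^-1 (b ^+ S)) <= e1 by apply: jump j2 _ _ (wv1 j) => //; rewrite lerDr ltW.
have mid : DD (pencil p q (w j) 1) (pencil q p (w j)^-1 1) = 0.
  apply: (DD_scale d_gt0 vol2 volU (c := - (w j)^-1)).
  - by rewrite oppr_eq0 invr_eq0.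
  - exact: swap_lin.
  - exact: pencil_inPnd.
have half1 : chn (inPnd d) DD e p (pencil p q (w j) 1) (1 + (2 + K * c) / 2).
  by apply: chn_cat (chn_one P1 _ _) c1; apply: le_trans J1 _.
have half2 : chn (inPnd d) DD e (pencil q p (w j)^-1 1) q ((2 + K * c) / 2 + 1).
  rewrite addrC; apply: (chn_sym (@DD_sym _ _ _ _) qP).
  by apply: chn_cat (chn_one P2 _ _) c2; apply: le_trans J2 _.
apply: chn_cat half2; apply: chn_cat half1 (chn_one _ _ _).
- exact: pencil_inPnd.
- by rewrite mid ltW.
- by rewrite mid.
Qed.

End chain_existence.

(** * Roots of one-variable polynomials *)

Lemma prod_split_ub (R : realType) (T : eqType) (f : T -> R) (P : pred T) (x M : R) (s : seq T) :
  0 <= x -> 1 <= M -> (forall a, a \in s -> 0 <= f a) -> (forall a, a \in s -> P a -> f a <= x) ->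
  (forall a, a \in s -> ~~ P a -> f a <= M) -> \prod_(a <- s) f a <= x ^+ count P s * M ^+ size s.
Proof.
move=> x0 M1; have M0 : 0 <= M by apply: le_trans M1.
elim: s => [|a s IH] h0 hx hM; first by rewrite big_nil !expr0 mulr1.
rewrite big_cons /=; have {}IH : \prod_(j <- s) f j <= x ^+ count P s * M ^+ size s.
  by apply: IH => b bs; [apply: h0|apply: hx|apply: hM]; rewrite inE bs orbT.
have fa := h0 a (mem_head _ _).
have p0 : 0 <= \prod_(j <- s) f j.
  by rewrite big_seq; apply: prodr_ge0 => b bs; apply: h0; rewrite inE bs orbT.
case: (boolP (P a)) => Pa.
  have -> : x ^+ (true + count P s) * M ^+ (size s).+1 = (x * M) * (x ^+ count P s * M ^+ size s).
    by rewrite !exprS; ring.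
  apply: ler_pM => //; apply: le_trans (hx a (mem_head _ _) Pa) _.
  by rewrite ler_peMr.
have -> : x ^+ (false + count P s) * M ^+ (size s).+1 = M * (x ^+ count P s * M ^+ size s).
  by rewrite add0n exprS; ring.
by apply: ler_pM => //; apply: hM; rewrite ?mem_head.
Qed.

Lemma prod_split_lb (R : realType) (T : eqType) (f : T -> R) (P : pred T) (x y : R) (s : seq T) :
  0 <= x -> 0 <= y -> y <= 1 -> (forall a, a \in s -> P a -> x <= f a) ->
  (forall a, a \in s -> ~~ P a -> y <= f a) -> x ^+ count P s * y ^+ size s <= \prod_(a <- s) f a.
Proof.
move=> x0 y0 y1; elim: s => [|a s IH] hx hy; first by rewrite big_nil !expr0 mulr1.
rewrite big_cons /=; have {}IH : x ^+ count P s * y ^+ size s <= \prod_(j <- s) f j.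
  by apply: IH => b bs; [apply: hx|apply: hy]; rewrite inE bs orbT.
have p0 : 0 <= x ^+ count P s * y ^+ size s by rewrite mulr_ge0 ?exprn_ge0.
case: (boolP (P a)) => Pa.
  have -> : x ^+ (true + count P s) * y ^+ (size s).+1 = (x * y) * (x ^+ count P s * y ^+ size s).
    by rewrite !exprS; ring.
  apply: ler_pM => //; first exact: mulr_ge0.
  by apply: le_trans (hx a (mem_head _ _) Pa); rewrite ler_piMr.
have -> : x ^+ (false + count P s) * y ^+ (size s).+1 = y * (x ^+ count P s * y ^+ size s).
  by rewrite add0n exprS; ring.
by apply: ler_pM => //; apply: hy; rewrite ?mem_head.
Qed.

(** Each entry of [s] satisfies exactly one of the predicates indexed by [r]. *)
Lemma sum_count (T I : eqType) (s : seq T) (r : seq I) (P : I -> pred T) : uniq r ->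
  (forall a, a \in s -> exists2 t, t \in r & forall t', t' \in r -> P t' a = (t' == t)) ->
  (\sum_(t <- r) count (P t) s = size s)%N.
Proof.
move=> ur; elim: s => [|a s IH] h; first by rewrite big1.
rewrite /= big_split /= IH => [|b bs]; last by apply: h; rewrite inE bs orbT.
rewrite -add1n; congr (_ + _)%N.
have [t tr ht] := h a (mem_head _ _).
rewrite -(_ : count_mem t r = 1%N); last by rewrite count_uniq_mem // tr.
rewrite -sum1_count [RHS]big_mkcond big_seq [RHS]big_seq; apply: eq_bigr => t' /ht ->.
by rewrite /=; case: (t' == t).
Qed.

Lemma list_lb (R : realType) (s : seq R) : (forall x, x \in s -> 0 < x) ->
  exists2 sg : R, 0 < sg <= 1 & forall x, x \in s -> sg <= x.
Proof.
elim: s => [|a s IH] h; first by exists 1; rewrite ?ltr01 ?lexx.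
have [|sg /andP[s0 s1] hs] := IH; first by move=> x xs; apply: h; rewrite inE xs orbT.
exists (Num.min sg a).
  by rewrite lt_min s0 h ?mem_head //= ge_min s1.
by move=> x; rewrite inE => /orP[/eqP ->|/hs]; rewrite ge_min ?lexx ?orbT // => ->.
Qed.

Lemma separation (R : realType) (T : seq R[i]) : exists2 sg : R, 0 < sg <= 1 &
  forall t t', t \in T -> t' \in T -> t != t' -> sg <= cn (t - t').
Proof.
have [|sg s0 h] := @list_lb R [seq x <- [seq cn (t - t') | t <- T, t' <- T] | 0 < x].
  by move=> x; rewrite mem_filter => /andP[].
exists sg => // t t' tT tT' tt; apply: h.
by rewrite mem_filter cn_gt0 subr_eq0 tt; apply/allpairsP; exists (t, t').
Qed.

Lemma cluster_prod (R : realType) (s : seq R[i]) (t tau : R[i]) (rho sg M : R) :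
  0 < sg -> sg <= 1 -> 1 <= M ->
  (forall a, a \in s -> cn (t - a) <= rho -> a = tau) ->
  (forall a, a \in s -> ~~ (cn (t - a) <= rho) -> sg <= cn (t - a)) ->
  (forall a, a \in s -> cn (t - a) <= M) ->
  cn (t - tau) ^+ (count (fun a => cn (t - a) <= rho) s) * sg ^+ size s <= \prod_(a <- s) cn (t - a) <=
    cn (t - tau) ^+ (count (fun a => cn (t - a) <= rho) s) * M ^+ size s.
Proof.
move=> s0 s1 M1 h1 h2 h3; apply/andP; split.
  apply: prod_split_lb => //; [exact: ltW|].
  by move=> a aS /(h1 a aS) ->.
apply: prod_split_ub => //.
- by move=> a aS /(h1 a aS) ->.
- by move=> a aS _; exact: h3.
Qed.

(** Both families of counts add up to the same degree, so [<=] at every [t] is enough. With more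
    than [m] roots of [s] within [rho] of [t], the product for [s] at [t + 2 * rho] would be of
    order [rho ^+ m.+1], whereas the product for [s0] is at least [(2 * rho) ^+ m * K]; [rho0] makes
    the former at most a quarter of the latter. *)
Lemma count_semi (R : realType) (s0 T : seq R[i]) : uniq T -> {subset s0 <= T} ->
  exists2 rho0 : R, 0 < rho0 & forall rho, 0 < rho -> rho <= rho0 -> exists2 eta : R, 0 < eta &
  forall s : seq R[i], size s = size s0 ->
  (forall a, a \in s -> exists2 t, t \in T & cn (t - a) <= rho) ->
  (forall t, t \in T -> cn (\prod_(a <- s) (t + (2 * rho)%:C%C - a) - \prod_(a <- s0) (t + (2 * rho)%:C%C - a)) <= eta) ->
  forall t, t \in T -> count (fun a => cn (t - a) <= rho) s = count_mem t s0.
Proof.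
move=> uT sT; have [sg /andP[sg0 sg1] hsg] := separation T.
pose B : R := \sum_(t <- T) \sum_(t' <- T) cn (t - t').
have hB t t' : t \in T -> t' \in T -> cn (t - t') <= B.
  have pos (r : seq R[i]) t1 : 0 <= \sum_(t' <- r) cn (t1 - t') by apply: sumr_ge0 => *; exact: cn_ge0.
  move=> tT tT'; rewrite /B (big_rem t) //= (big_rem t') //=.
  rewrite -addrA lerDl addr_ge0 //.
  by apply: sumr_ge0 => *; exact: pos.
have B0 : 0 <= B by apply: sumr_ge0 => *; apply: sumr_ge0 => *; exact: cn_ge0.
pose M := B + 1; have M1 : 1 <= M by rewrite /M lerDr.
have M0 : 0 < M by apply: lt_le_trans M1.
pose d := size s0; pose K := (sg / 2) ^+ d.
have K0 : 0 < K by rewrite exprn_gt0 // divr_gt0.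
have MD0 : 0 < 2 ^+ d * M ^+ d by rewrite mulr_gt0 // exprn_gt0.
pose rho0 := Num.min (sg / 12) (K / (12 * (2 ^+ d * M ^+ d))).
have rho00 : 0 < rho0 by rewrite lt_min !divr_gt0 // mulr_gt0.
exists rho0 => // rho r0 rr.
have r1 : rho <= sg / 12 by apply: le_trans rr _; rewrite ge_min lexx.
have r2 : rho * (12 * (2 ^+ d * M ^+ d)) <= K.
  have D0 : 0 < 12 * (2 ^+ d * M ^+ d) by rewrite mulr_gt0.
  by rewrite -(ler_pdivlMr _ _ D0); apply: le_trans rr _; rewrite ge_min lexx orbT.
have rp m : 0 < (2 * rho) ^+ m by rewrite exprn_gt0 // mulr_gt0.
exists ((2 * rho) ^+ d * K / 2); first by rewrite divr_gt0 // mulr_gt0.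
move=> s ss hs hp.
have uniqT a t t' : t \in T -> t' \in T -> cn (t - a) <= rho -> cn (t' - a) <= rho -> t' = t.
  move=> tT tT' h h'; apply/eqP; apply: contraT => tt; have := hsg _ _ tT' tT tt.
  have := cnD3 t' a t; rewrite (cnB a); move: r1 h h' sg0; lra.
have h1 : (\sum_(t <- T) count (fun a => (cn (t - a) <= rho)%R) s = size s)%N.
  apply: sum_count => // a /hs [t tT ta]; exists t => // t' tT'.
  by apply/idP/eqP => [h|-> //]; exact: uniqT ta h.
have h2 : (\sum_(t <- T) count_mem t s0 = size s0)%N.
  apply: sum_count => // a /sT aT; exists a => // t' _; exact: eq_sym.
suff hle t : t \in T -> (count (fun a => (cn (t - a) <= rho)%R) s <= count_mem t s0)%N.
  move: h1 h2; rewrite ss => <-; elim: (T) hle => [|t0 r IH] hle h t //.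
  have h0 := hle t0 (mem_head _ _).
  have hr : (\sum_(t <- r) count (fun a => (cn (t - a) <= rho)%R) s <= \sum_(t <- r) count_mem t s0)%N.
    by rewrite big_seq [leqRHS]big_seq; apply: leq_sum => t' tr; apply: hle; rewrite inE tr orbT.
  rewrite !big_cons in h.
  have e0 : count (fun a => cn (t0 - a) <= rho) s = count_mem t0 s0.
    by apply/eqP; rewrite eqn_leq h0 -(leq_add2r (\sum_(t <- r) count_mem t s0)) h leq_add2l.
  rewrite inE => /orP[/eqP -> //|tr]; apply: IH => //.
    by move=> t' tr'; apply: hle; rewrite inE tr' orbT.
  by apply/eqP; rewrite -(eqn_add2l (count_mem t0 s0)) h e0.
move=> tT; rewrite leqNgt; apply/negP => hc.
set m := count_mem t s0 in hc; set c := count _ s in hc.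
have md : (m <= d)%N by exact: count_size.
(* At distance [2 * rho] from [t] the test point stays away from the roots inside the ball and from
   all other clusters. *)
pose x : R[i] := t + (2 * rho)%:C%C.
have c2 : cn ((2 * rho)%:C%C : R[i]) = 2 * rho by rewrite cn_real ger0_norm // mulr_ge0 // ltW.
have U : \prod_(a <- s) cn (x - a) <= (3 * rho) ^+ m.+1 * M ^+ d.
  apply: le_trans (prod_split_ub (P := fun a => cn (t - a) <= rho) (x := 3 * rho) (M := M) _ M1 _ _ _) _ => //.
  - by rewrite mulr_ge0 // ltW.
  - move=> a _ h; rewrite /x addrAC; apply: le_trans (cnD _ _) _; rewrite c2; move: h; lra.
  - move=> a aS _; have [t' tT' ta] := hs a aS; rewrite /x addrAC; apply: le_trans (cnD _ _) _; rewrite c2.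
    have := cnD3 t t' a; have := hB t t' tT tT'; rewrite /M; move: r1 sg1 ta; lra.
  rewrite ss ler_pM2r ?exprn_gt0 //; apply: ler_wiXn2l => //.
    by rewrite mulr_ge0 // ltW.
  by move: r1 sg1; lra.
have L : (2 * rho) ^+ m * K <= \prod_(a <- s0) cn (x - a).
  apply: (prod_split_lb (P := pred1 t)).
  - by rewrite mulr_ge0 // ltW.
  - by rewrite divr_ge0 // ltW.
  - by move: sg1; lra.
  - by move=> a _ /eqP ->; rewrite /x addrAC subrr add0r c2.
  - move=> a /sT aT at'; have := hsg _ _ tT aT (_ : t != a); rewrite eq_sym at' => /(_ isT).
    have := cnDB (t - a) (x - a); have -> : t - a - (x - a) = - (2 * rho)%:C%C by rewrite /x; ring.
    by rewrite cnN c2; move: r1; lra.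
have := hp t tT; rewrite cnB => h.
have := le_trans (cnDB _ _) h; rewrite !cn_prod -/x => {}h.
have e3 : (3 * rho) ^+ m.+1 <= 3 * rho * 2 ^+ d * (2 * rho) ^+ m.
  rewrite exprS -[leRHS]mulrA; apply: ler_wpM2l; first by rewrite mulr_ge0 // ltW.
  apply: le_trans (_ : 2 ^+ m * (2 * rho) ^+ m <= _).
    rewrite -exprMn; apply: lerXn2r; rewrite ?nnegrE; move: (r0); lra.
  by rewrite ler_pM2r //; apply: ler_weXn2l => //; lra.
have e4 : (3 * rho) ^+ m.+1 * M ^+ d <= (2 * rho) ^+ m * (K / 4).
  apply: le_trans (ler_wpM2r _ e3) _; first by rewrite exprn_ge0 // ltW.
  have -> : 3 * rho * 2 ^+ d * (2 * rho) ^+ m * M ^+ d = (2 * rho) ^+ m * (rho * (12 * (2 ^+ d * M ^+ d)) / 4) by field.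
  by rewrite ler_pM2l // ler_pM2r.
have e5 : (2 * rho) ^+ d * K <= (2 * rho) ^+ m * K.
  rewrite ler_pM2r //; apply: ler_wiXn2l => //; first by rewrite mulr_ge0 // ltW.
  by move: r1 sg1; lra.
have := mulr_gt0 (rp m) K0.
move: U L h e4 e5; rewrite [_ * (K / 4)]mulrA.
move: (\prod_(a <- s) _) (\prod_(a <- s0) _) ((2 * rho) ^+ m * K) ((2 * rho) ^+ d * K) ((3 * rho) ^+ m.+1 * M ^+ d).
clear; move=> a b u v w; lra.
Qed.

Lemma mup_split (R : realType) (f : {poly R[i]}) : f != 0 ->
  exists2 g : {poly R[i]}, g.[0] != 0 & f = g * 'X^(mup 0 f).
Proof.
move=> f0; have [m [g gr fE]] := multiplicity_XsubC f 0.
rewrite f0 /= in gr; rewrite subr0 in fE; exists g => //.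
suff -> : mup 0 f = m by [].
by rewrite fE mupMr // -['X]subr0 mup_XsubCX eqxx.
Qed.

(** Compares the orders of vanishing of both sides as [s] tends to 0: a positive surplus on the
    right would push the positive constant [A ^+ m'] below a multiple of [s]. *)
Lemma mup_compare (R : realType) (f g : {poly R[i]}) (c e : R) (m m' : nat) : f != 0 -> g != 0 -> 0 < e -> 0 <= c ->
  (forall s : R, 0 < s -> s < e -> cn f.[s%:C%C] ^+ m' <= c * cn g.[s%:C%C] ^+ m) ->
  (m * mup 0 g <= m' * mup 0 f)%N.
Proof.
move=> f0 g0 e0 c0 h.
have [f1 f10 fE] := mup_split f0; have [g1 g10 gE] := mup_split g0.
set a := mup 0 f in fE *; set b := mup 0 g in gE *.
have A0 : 0 < cn f1.[0] / 2 by rewrite divr_gt0 // cn_gt0.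
have rt : root (f1 - (f1.[0])%:P) 0 by rewrite rootE !hornerE subrr.
have [dl dl0 hdl] := root_approx rt A0.
pose B := \sum_(k < size g1) cn g1`_k * 1 ^+ k.
have B0 : 0 <= B by apply: sumr_ge0 => k _; rewrite mulr_ge0 // exprn_ge0.
rewrite leqNgt; apply/negP => hlt.
set A := cn f1.[0] / 2 in A0 hdl.
have hs s : 0 < s -> s < e -> s < dl -> s <= 1 -> A ^+ m' <= c * B ^+ m * s.
  move=> s0 se sd s1; have cs : cn (s%:C%C : R[i]) = s by rewrite cn_real ger0_norm // ltW.
  have b1 : A <= cn f1.[s%:C%C].
    have := hdl s%:C%C; rewrite subr0 cs => /(_ sd); rewrite !hornerE => h1.
    have := cnDB f1.[0] f1.[s%:C%C]; rewrite cnB; move: h1; rewrite /A; lra.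
  have b2 : cn g1.[s%:C%C] <= B by apply: horner_bound => //; rewrite cs.
  have h1 := h s s0 se; rewrite fE gE !hornerE !cnM !cnX cs !exprMn -!exprM in h1.
  have sp k : 0 < s ^+ k by rewrite exprn_gt0.
  have : A ^+ m' * s ^+ (a * m') <= c * (B ^+ m * s ^+ (b * m)).
    apply: le_trans (le_trans _ h1) _.
      by rewrite ler_pM2r //; apply: lerXn2r; rewrite ?nnegrE // ltW.
    by apply: ler_wpM2l => //; rewrite ler_pM2r //; apply: lerXn2r; rewrite ?nnegrE.
  have [k kE] : exists k, (b * m = a * m' + k.+1)%N.
    by exists (b * m - (a * m').+1)%N; rewrite addnS -addSn subnKC // mulnC (mulnC b).
  rewrite kE exprD => h2.
  have : A ^+ m' * s ^+ (a * m') <= c * B ^+ m * s ^+ k.+1 * s ^+ (a * m').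
    apply: le_trans h2 _; apply: eq_ler.
    by move: (s ^+ (a * m')) (s ^+ k.+1) (B ^+ m) => x y z; ring.
  rewrite ler_pM2r // => h3; apply: le_trans h3 _.
  apply: ler_wpM2l; first by rewrite mulr_ge0 // exprn_ge0.
  by rewrite exprS ler_piMr ?(ltW s0) // exprn_ile1 // ltW.
pose D := c * B ^+ m + 1.
have D0 : 0 < D by rewrite ltr_wpDl // mulr_ge0 // exprn_ge0.
have AM : 0 < A ^+ m' by rewrite exprn_gt0.
pose s := Num.min (Num.min (e / 2) (dl / 2)) (Num.min 1 (A ^+ m' / (2 * D))).
have s0 : 0 < s by rewrite !lt_min ltr01 !divr_gt0 // mulr_gt0.
have s1 : s <= e / 2 by rewrite /s !ge_min lexx.
have s2 : s <= dl / 2 by rewrite /s !ge_min lexx !orbT.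
have s3 : s <= 1 by rewrite /s !ge_min lexx !orbT.
have s4 : s <= A ^+ m' / (2 * D) by rewrite /s !ge_min lexx !orbT.
have se : s < e by move: s1 e0; lra.
have sdl : s < dl by move: s2 dl0; lra.
have := hs s s0 se sdl s3; rewrite leNgt => /negP; apply.
apply: le_lt_trans (_ : D * s < _); first by rewrite ler_pM2r // lerDl.
apply: le_lt_trans (_ : D * (A ^+ m' / (2 * D)) < _); first by rewrite ler_pM2l.
have -> : D * (A ^+ m' / (2 * D)) = A ^+ m' / 2 by field; rewrite gt_eqF.
by move: AM; lra.
Qed.

(** * Zeros of a form carry positive mass *)

Definition ctn (R : realType) n (F : Vec R n -> R[i]) (x : Vec R n) :=
  forall e : R, 0 < e -> exists2 r : R, 0 < r & forall y, vn (y - x) <= r -> cn (F y - F x) <= e.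

Lemma ctn_cst (R : realType) n c (x : Vec R n) : ctn (fun _ => c) x.
Proof. by move=> e e0; exists 1 => // y _; rewrite subrr cn0 ltW. Qed.

Lemma ctn_coord (R : realType) n i (x : Vec R n) : ctn (fun y => y i 0) x.
Proof.
move=> e e0; exists e => // y; apply: le_trans.
have -> : y i 0 - x i 0 = (y - x) i 0 by rewrite !mxE.
exact: le_coord_vn.
Qed.

Lemma ctnD (R : realType) n (F G : Vec R n -> R[i]) x : ctn F x -> ctn G x -> ctn (fun y => F y + G y) x.
Proof.
move=> hF hG e e0; have e2 : 0 < e / 2 by rewrite divr_gt0.
have [r r0 h] := hF _ e2; have [r' r0' h'] := hG _ e2.
exists (Num.min r r'); first by rewrite lt_min r0.
move=> y; rewrite le_min => /andP[/h y1 /h' y2].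
have -> : F y + G y - (F x + G x) = (F y - F x) + (G y - G x) by ring.
by apply: le_trans (cnD _ _) _; move: y1 y2; lra.
Qed.

Lemma ctnM (R : realType) n (F G : Vec R n -> R[i]) x : ctn F x -> ctn G x -> ctn (fun y => F y * G y) x.
Proof.
move=> hF hG e e0.
pose B := 1 + cn (F x) + cn (G x).
have Fx := cn_ge0 (F x); have Gx := cn_ge0 (G x).
have B0 : 0 < B by rewrite /B; lra.
pose e1 := Num.min 1 (e / (2 * B)).
have e10 : 0 < e1 by rewrite lt_min ltr01 divr_gt0 // mulr_gt0.
have e11 : e1 <= 1 by rewrite ge_min lexx.
have e12 : e1 * B <= e / 2.
  apply: le_trans (_ : e / (2 * B) * B <= _); first by rewrite ler_pM2r // ge_min lexx orbT.
  by apply: eq_ler; field; rewrite gt_eqF.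
have [r r0 h] := hF _ e10; have [r' r0' h'] := hG _ e10.
exists (Num.min r r'); first by rewrite lt_min r0.
move=> y; rewrite le_min => /andP[/h y1 /h' y2].
have -> : F y * G y - F x * G x = (F y - F x) * G y + F x * (G y - G x) by ring.
apply: le_trans (cnD _ _) _; rewrite !cnM.
have g : cn (G y) <= B by have := cnDB (G y) (G x); move: y2 e11; rewrite /B; lra.
apply: le_trans (lerD (ler_pM (cn_ge0 _) (cn_ge0 _) y1 g) (ler_pM (cn_ge0 _) (cn_ge0 _) (_ : _ <= B) y2)) _.
  by rewrite /B; lra.
by move: e12; rewrite mulrC; lra.
Qed.

Lemma ctn_pe (R : realType) n (p : HPoly R n) x : ctn (pe p) x.
Proof.
have E : pe p = fun y => \sum_(m <- msupp p) p@_m * \prod_i y i 0 ^+ m i by apply/funext => y; rewrite /pe mevalE.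
rewrite E.
have hX i k : ctn (fun y : Vec R n => y i 0 ^+ k) x.
  elim: k => [|k IH]; first exact: ctn_cst.
  rewrite (_ : (fun _ => _) = fun y : Vec R n => y i 0 * y i 0 ^+ k); last by apply/funext => y; rewrite exprS.
  by apply: ctnM IH; exact: ctn_coord.
elim: (msupp p) => [|m s IH].
  rewrite (_ : (fun _ => _) = fun _ => 0); last by apply/funext => y; rewrite big_nil.
  exact: ctn_cst.
rewrite (_ : (fun _ => _) = fun y : Vec R n => p@_m * \prod_i y i 0 ^+ m i +
   \sum_(m <- s) p@_m * \prod_i y i 0 ^+ m i); last by apply/funext => y; rewrite big_cons.
apply: ctnD IH; apply: ctnM; first exact: ctn_cst.
elim: (index_enum _) => [|i l IH].
  rewrite (_ : (fun _ => _) = fun _ => 1); last by apply/funext => y; rewrite big_nil.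
  exact: ctn_cst.
rewrite (_ : (fun _ => _) = fun y : Vec R n => y i 0 ^+ m i * \prod_(j <- l) y j 0 ^+ m j).
  exact: ctnM.
by apply/funext => y; rewrite big_cons.
Qed.

Lemma dFS_pj (R : realType) n (x y : Vec R n) : x != 0 -> y != 0 ->
  dFS (pj x) (pj y) = acos (cn (ip x y) / (vn x * vn y)) /\ 0 <= cn (ip x y) / (vn x * vn y) <= 1.
Proof.
move=> x0 y0.
have e : cn (ip x y) / (vn x * vn y) = cn (ip (nrm x) (nrm y)).
  rewrite /nrm ipZr ipZl conjc_real !cnM !cn_real !ger0_norm ?invr_ge0 ?vn_ge0 // invfM; ring.
rewrite e; split; first exact: dFS_unit.
by apply: cn_ip_le1; exact: nrm_unit.
Qed.

Lemma pj_near (R : realType) n (z : Vec R n) (r : R) : z != 0 -> 0 < r -> exists2 e : R, 0 < e &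
  forall x, vn (x - z) <= e -> x != 0 /\ dFS (pj x) (pj z) <= r.
Proof.
move=> z0 r0; have vz : 0 < vn z by rewrite vn_gt0.
exists (Num.min (vn z / 2) (r * vn z / 4)); first by rewrite lt_min !divr_gt0 // mulr_gt0.
move=> x; rewrite le_min => /andP[h1 h2].
have xz : vn z / 2 <= vn x.
  have : vn z <= vn (x - z) + vn x.
    have -> : z = - (x - z) + x by rewrite opprB subrK.
    by apply: le_trans (vnD _ _) _; rewrite vnN opprB subrK.
  by move: h1; lra.
have vx : 0 < vn x by apply: lt_le_trans xz; rewrite divr_gt0.
have x0 : x != 0 by rewrite -vn_gt0.
split=> //; have [-> cb] := dFS_pj x0 z0.
rewrite -(@ler_pXn2r _ 2) ?nnegrE ?(ltW r0) //; last by have /andP[] := acos_bounds (cn (ip x z) / (vn x * vn z)).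
apply: le_trans (acos_sqr_ub cb) _; set c := _ / _ in cb *.
have cE : cn (ip x z) = c * (vn x * vn z) by rewrite /c divfK // gt_eqF // mulr_gt0.
have hRe : complex.Re (ip x z) <= c * (vn x * vn z).
  by rewrite -cE; apply: le_trans (cn_geRe _); exact: ler_norm.
have hsq : vn (x - z) ^+ 2 <= (r * vn z / 4) ^+ 2.
  by apply: lerXn2r => //; rewrite ?nnegrE ?vn_ge0 // divr_ge0 // mulr_ge0 // ltW.
have h3 : 2 * (vn x * vn z) * (1 - c) <= vn (x - z) ^+ 2.
  rewrite vnB_sqr; have := sqr_ge0 (vn x - vn z); rewrite sqrrB; move: hRe; rewrite -[vn x * vn z *+ 2]mulr_natl; lra.
have h4 : vn z ^+ 2 * (1 - c) <= (r * vn z / 4) ^+ 2.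
  apply: le_trans hsq; apply: le_trans h3; case/andP: cb => c0 c1.
  apply: ler_wpM2r; first by rewrite subr_ge0.
  rewrite expr2 mulrA ler_pM2r //; move: xz; lra.
have h5 : 1 - c <= r ^+ 2 / 16.
  have vz2 : 0 < vn z ^+ 2 by rewrite exprn_gt0.
  by rewrite -(ler_pM2l vz2); apply: le_trans h4 _; apply: eq_ler; field.
have h6 : 1 - c ^+ 2 <= 2 * (1 - c).
  have := sqr_ge0 (1 - c); rewrite sqrrB expr1n mul1r -[c *+ 2]mulr_natl; lra.
by move: h5 h6; lra.
Qed.

(** The representative is [ip u z *: u], the orthogonal projection of [z]; its squared distance from
    [z] is [vn z ^+ 2] times the squared sine of the angle. *)
Lemma rep_near (R : realType) n (z : Vec R n) (e : R) : z != 0 -> 0 < e -> exists2 r : R, 0 < r &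
  forall u, ip u u = 1 -> dFS (u *m adj u) (pj z) <= r -> exists2 l, l != 0 & vn (l *: u - z) <= e.
Proof.
move=> z0 e0; have vz : 0 < vn z by rewrite vn_gt0.
pose t := Num.min 2^-1 (e ^+ 2 / (2 * vn z ^+ 2)).
have t0 : 0 < t by rewrite lt_min invr_gt0 ltr0n divr_gt0 ?mulr_gt0 ?exprn_gt0.
have t1 : t <= 2^-1 by rewrite ge_min lexx.
have t2 : t <= e ^+ 2 / (2 * vn z ^+ 2) by rewrite ge_min lexx orbT.
have tb : -1 <= 1 - t <= 1 by move: t0 t1; lra.
exists (acos (1 - t)).
  rewrite lt_neqAle (acos_ge0 tb) andbT eq_sym; apply/eqP => a0.
  have := acosK (_ : 1 - t \in `[-1, 1]); rewrite in_itv /= tb => /(_ isT); rewrite a0 cos0; move: t0; lra.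
move=> u u1; have u0 : u != 0.
  by apply/eqP => uE; move/eqP: u1; rewrite uE ip0r eq_sym oner_eq0.
have vu : vn u = 1 by apply/vn_unitP.
rewrite -(pj_unit u1); have [-> /andP[c0 c1]] := dFS_pj u0 z0; rewrite vu mul1r in c0 c1 *.
rewrite acos_le; last 2 first.
- by move: c0 c1; set c := _ / _; lra.
- by rewrite acos_ge0 // acos_lepi.
rewrite (acosK (_ : 1 - t \in `[-1, 1])) ?in_itv //= => hc.
have cE : cn (ip u z) = cn (ip u z) / vn z * vn z by rewrite divfK // gt_eqF.
exists (ip u z).
  rewrite -cn_gt0 cE mulr_gt0 //; apply: lt_le_trans hc; move: t1; lra.
rewrite -(@ler_pXn2r _ 2) ?nnegrE ?vn_ge0 ?(ltW e0) // vnB_sqr vnZ vu mulr1 ipZl.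
have -> : (ip u z)^*%C * ip u z = (cn (ip u z) ^+ 2)%:C%C by rewrite mulrC mulcJ.
rewrite /= {1 2}cE; set c := _ / vn z in c0 c1 hc *.
have h6 : 1 - c ^+ 2 <= 2 * t.
  have : (1 - c) * (1 + c) <= t * 2 by apply: ler_pM; move: c0 c1 hc; lra.
  by rewrite mulrC [t * 2]mulrC; have -> : (1 + c) * (1 - c) = 1 - c ^+ 2 by ring.
have vz2 : 0 < vn z ^+ 2 by rewrite exprn_gt0.
apply: le_trans (_ : vn z ^+ 2 * (2 * t) <= _).
  by apply: le_trans (_ : vn z ^+ 2 * (1 - c ^+ 2) <= _); [apply: eq_ler; ring|rewrite ler_pM2l].
apply: le_trans (_ : vn z ^+ 2 * (2 * (e ^+ 2 / (2 * vn z ^+ 2))) <= _).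
  by rewrite ler_pM2l // ler_pM2l.
by apply: eq_ler; field; rewrite gt_eqF.
Qed.

Lemma vn_small (R : realType) n (M : Mat R n) (x : Vec R n) (r : R) : 0 <= r -> (forall i j, cn (M i j) <= r) ->
  vn (M *m x) <= n.+1%:R ^+ 2 * r * vn x.
Proof.
move=> r0 hM; have N1 : 1 <= n.+1%:R :> R by rewrite ler1n.
have N0 : 0 <= n.+1%:R :> R by [].
rewrite -(@ler_pXn2r _ 2) ?nnegrE ?vn_ge0 ?mulr_ge0 ?vn_ge0 ?exprn_ge0 // vn_sqr.
apply: le_trans (_ : \sum_(i < n.+1) (n.+1%:R * r * vn x) ^+ 2 <= _).
  apply: ler_sum => i _; apply: lerXn2r; rewrite ?nnegrE ?mulr_ge0 ?vn_ge0 //.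
  rewrite mxE; apply: le_trans (cn_sum _ _ _) _.
  apply: le_trans (_ : \sum_(j < n.+1) r * vn x <= _).
    by apply: ler_sum => j _; rewrite cnM; apply: ler_pM => //; exact: le_coord_vn.
  by rewrite sumr_const card_ord -mulrA -[X in X <= _]mulr_natl.
rewrite sumr_const card_ord -[X in X <= _]mulr_natl.
have -> : (n.+1%:R ^+ 2 * r * vn x) ^+ 2 = n.+1%:R ^+ 2 * (n.+1%:R * r * vn x) ^+ 2 :> R by ring.
by apply: ler_wpM2r; rewrite ?sqr_ge0 // expr2 ler_peMl.
Qed.

Lemma unitary_entry (R : realType) n (U : Mat R n) i j : unitary U -> cn (U i j) <= 1.
Proof.
move=> hU; have := congr1 (fun M : Mat R n => M i i) hU; rewrite !mxE eqxx.
under eq_bigr do rewrite adjE mulcJ.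
rewrite -(rmorph_sum (real_complex R)) => /complexI h.
rewrite -(@expr_le1 _ 2) ?cn_ge0 //; have : \sum_k cn (U i k) ^+ 2 = 1 by [].
rewrite (bigD1 j) //= => <-; rewrite lerDl; apply: sumr_ge0 => k _; exact: sqr_ge0.
Qed.

Lemma bigU_le (R : realType) (dT : measure_display) (T : measurableType dT) (mu : {measure set T -> \bar R})
    (F : nat -> set T) N : (forall k, measurable (F k)) ->
  (mu (\big[setU/set0]_(k < N) F k) <= \sum_(k < N) mu (F k))%E.
Proof.
move=> mF; elim: N => [|N IH]; first by rewrite !big_ord0 measure0.
rewrite !big_ord_recr /=; apply: le_trans (measureU2 _ _ (mF N)) _; first by apply: bigsetU_measurable.
exact: leeD2r.
Qed.

Lemma mxsubE (R : zmodType) m k (A B : 'M[R]_(m, k)) i j : (A - B) i j = A i j - B i j.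
Proof. by rewrite !mxE. Qed.

Section positivity.
Context (R : realType) (n d : nat) (vol : probability (MT R n) R).
Hypothesis d_gt0 : (0 < d)%N.
Hypothesis vol2 : vol [set L : MT R n | ~ rank2proj L] = 0%E.
Hypothesis volU : forall U : Mat R n, unitary U ->
  forall A : set (MT R n), measurable A -> vol ((fun L : MT R n => U *m L *m adj U) @^-1` A) = vol A.

Definition ebox (L0 : Mat R n) (r : R) : set (MT R n) := [set L | forall i j, cn (L i j - L0 i j) <= r].

Lemma measurable_ebox L0 r : measurable (ebox L0 r).
Proof.
rewrite (_ : ebox L0 r = \bigcap_(ij in [set: 'I_n.+1 * 'I_n.+1]) [set L : MT R n | cn (L ij.1 ij.2 - L0 ij.1 ij.2) <= r]).
  apply: fin_bigcap_measurable => // ij _; apply: measurable_setb; apply: measurable_fun_ler.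
    by apply: measurable_cn; apply: cmeasB; [exact: mmeas_id|exact: cmeas_cst].
  exact: measurable_cst.
by apply/seteqP; split=> [L h ij _|L h i j]; [exact: h|exact: (h (i, j))].
Qed.

(** If the box were null, invariance and transitivity would make the boxes around all points of a
    finite net null, but these cover almost every line. The factor [n.+1%:R ^+ 2] accounts for the
    distortion of a box under conjugation by a unitary matrix. *)
Lemma vol_ebox L0 r : rank2proj L0 -> 0 < r -> (0 < vol (ebox L0 r))%E.
Proof.
move=> rL0 r0; have N1 : 0 < n.+1%:R :> R by rewrite ltr0n.
have r1 : 0 < r / n.+1%:R ^+ 2 by rewrite divr_gt0 // exprn_gt0.
have [||N [y [N0 hy hP]]] := @finite_net R n [set P | rank2proj P] _ r1.
- by exists L0.
- move=> P [oP tP] i j; rewrite -(@ler_pXn2r _ 2) ?nnegrE ?cn_ge0 //.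
  have : \sum_i \sum_j cn (P i j) ^+ 2 = 2%:R.
    by have := tr_proj oP; rewrite tP -(rmorph_nat (real_complex R)) => /complexI ->.
  have pos : forall i', 0 <= \sum_j cn (P i' j) ^+ 2 by move=> i'; apply: sumr_ge0 => k _; exact: sqr_ge0.
  rewrite (bigD1 i) //= (bigD1 j) //= => h.
  have : cn (P i j) ^+ 2 <= 2.
    rewrite -h -addrA lerDl addr_ge0 //; first by apply: sumr_ge0 => k _; exact: sqr_ge0.
    by apply: sumr_ge0 => k _; exact: pos.
  by move=> h'; apply: le_trans h' _; rewrite expr2; lra.
rewrite lt0e measure_ge0 andbT; apply/eqP => v0.
have hk k : vol (ebox (y k) (r / n.+1%:R ^+ 2)) = 0%E.
  have [U hU yE] := unitary_move2 rL0 (hy k).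
  apply/eqP; rewrite -measure_le0 -v0.
  rewrite -(volU (unitary_adj hU) (measurable_ebox L0 r)); apply: le_measure; rewrite ?inE.
  - exact: measurable_ebox.
  - by apply: measurable_conj; exact: measurable_ebox.
  move=> L hL; rewrite /ebox /= adjK => i j.
  have -> : (adj U *m L *m U) i j - L0 i j = (adj U *m (L - y k) *m U) i j.
    by rewrite mulmxBr mulmxBl yE !mulmxA (unitaryC hU) mul1mx -(mulmxA L0) (unitaryC hU) mulmx1 !mxE.
  rewrite mxE; apply: le_trans (cn_sum _ _ _) _.
  apply: le_trans (_ : \sum_(l < n.+1) n.+1%:R * (r / n.+1%:R ^+ 2) <= _); last first.
    rewrite sumr_const card_ord -[X in X <= _]mulr_natl; apply: eq_ler.
    by move: N1; move: n.+1%:R => c c0; field; rewrite gt_eqF.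
  apply: ler_sum => l _; rewrite cnM -[leRHS]mulr1; apply: ler_pM; rewrite ?cn_ge0 ?(unitary_entry _ _ hU) //.
  rewrite mxE; apply: le_trans (cn_sum _ _ _) _.
  apply: le_trans (_ : \sum_(m < n.+1) (r / n.+1%:R ^+ 2) <= _); last by rewrite sumr_const card_ord mulr_natl.
  apply: ler_sum => m _; rewrite cnM -[leRHS]mul1r; apply: ler_pM; rewrite ?cn_ge0 //.
    by apply: unitary_entry; exact: unitary_adj.
  by rewrite !mxE; exact: hL.
have mB : measurable (\big[setU/set0]_(k < N) ebox (y k) (r / n.+1%:R ^+ 2)).
  by apply: bigsetU_measurable => k _; exact: measurable_ebox.
have mr2 : measurable [set L : MT R n | ~ rank2proj L] by apply: measurableC; exact: measurable_rank2.
have : (vol setT <= 0)%E.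
  apply: le_trans (_ : (vol ([set L : MT R n | ~ rank2proj L] `|` \big[setU/set0]_(k < N) ebox (y k) (r / n.+1%:R ^+ 2)) <= _)%E).
    apply: le_measure; rewrite ?inE //; first exact: measurableU.
    move=> L _; have [rL|] := pselect (rank2proj L); last by left.
    right; have [k hk'] := hP L rL.
    have : (\bigcup_(k in [set k | (k < N)%N]) ebox (y k) (r / n.+1%:R ^+ 2)) L.
      by exists k => //=; exact: ltn_ord.
    by rewrite bigcup_mkord.
  apply: le_trans (measureU2 _ mr2 mB) _; rewrite [X in (X + _)%E]vol2 add0e.
  apply: le_trans (bigU_le vol N (fun k => measurable_ebox (y k) (r / n.+1%:R ^+ 2))) _.
  by rewrite big1 // => k _; exact: hk.
by rewrite [X in (X <= _)%E]probability_setT lee_fin ler10.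
Qed.

(** [cn (pe p x)] is [cn (pe p y)] times the product of the moduli of the [d] roots in [a], so one
    root has modulus below [rho]. *)
Lemma root_near (p : HPoly R n) (x y : Vec R n) (rho : R) : is_homog d p -> 0 < rho -> pe p y != 0 ->
  cn (pe p x) < cn (pe p y) * rho ^+ d -> exists2 a, cn a < rho & pe p (x + a *: y) = 0.
Proof.
move=> hp r0 py h; pose f := restr p x y.
have fd : f`_d = pe p y by exact: restr_top.
have f0 : f != 0 by apply: contraNneq py => fE; rewrite -fd fE coef0.
have sf : size f = d.+1.
  apply/eqP; rewrite eqn_leq size_restr // ltnNge; apply/negP => sz.
  by move: py; rewrite -fd nth_default ?eqxx.
have ss : size (clroots f) = d by apply: succn_inj; rewrite -clroots_size.
have [a ar ha] : exists2 a, a \in clroots f & cn a < rho.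
  apply: contrapT => hno.
  have : cn (pe p y) * rho ^+ d <= cn (pe p x).
    have -> : pe p x = f.[0] by rewrite horner_restr scale0r addr0.
    rewrite [in leRHS](clrootsE f) hornerZ cnM lead_coefE sf fd ler_pM2l ?cn_gt0 // horner_prod cn_prod -ss.
    apply: prodr_ge_exp => [|z zr]; first exact: ltW.
    by rewrite hornerXsubC sub0r cnN leNgt; apply/negP => h'; apply: hno; exists z.
  by rewrite leNgt h.
exists a => //; rewrite -horner_restr; apply/eqP; by rewrite -/f -rootE -clroots_root.
Qed.

(** [L0] joins [z] to a point [y] with [pe p y != 0]. On a line [L] near [L0], the form is small at
    [L *m z] and bounded below at [L *m y], so by [root_near] it has a zero on [L] close to [z];
    such lines have positive mass by [vol_ebox]. *)
Lemma muP_pos (p : HPoly R n) (z : Vec R n) (r : R) : inPnd d p -> pe p z = 0 -> z != 0 -> 0 < r ->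
  (0 < muP d vol p [set Z : MT R n | (dFS Z (pj z) <= r)%R])%E.
Proof.
move=> pP pz z0 r0; have hp := pP.2; have [y py] := pe_neq0 pP.
have [u [u1 zu uE]] : exists u, [/\ ip u u = 1, z = (vn z)%:C%C *: u & u = ((vn z)^-1)%:C%C *: z].
  exists (nrm z); split=> //; first exact: nrm_unit.
  by rewrite /nrm scalerA -rmorphM /= mulfV ?scale1r // vn_eq0.
pose y' := y - ip u y *: u.
have y'0 : y' != 0.
  apply: contraNneq py => /eqP; rewrite subr_eq0 => /eqP ->.
  by rewrite [X in _ *: X]uE scalerA (pe_homog _ _ hp) pz mulr0.
have [v [v1 uv yE]] : exists v, [/\ ip v v = 1, ip u v = 0 & y = ip u y *: u + (vn y')%:C%C *: v].
  exists (nrm y'); split; first exact: nrm_unit.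
    by rewrite /nrm ipZr /y' ipBr ipZr u1 mulr1 subrr mulr0.
  by rewrite /nrm scalerA -rmorphM /= mulfV ?scale1r ?vn_eq0 // /y' addrC subrK.
pose L0 : Mat R n := u *m adj u + v *m adj v.
have rL0 : rank2proj L0 by exact: rank2_outer.
have L0z : L0 *m z = z.
  have vu : ip v u = 0 by rewrite ipJ uv conjc0.
  by rewrite {1}zu -scalemxAr mulmxDl !outerE u1 scale1r vu scale0r addr0 -zu.
have L0y : L0 *m y = y.
  have vy : ip v y = (vn y')%:C%C.
    by rewrite {1}yE ipDr !ipZr v1 mulr1 [ip v u]ipJ uv conjc0 mulr0 add0r.
  by rewrite mulmxDl !outerE vy -yE.
have [e e0 he] := pj_near z0 r0.
have py0 : 0 < cn (pe p y) by rewrite cn_gt0.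
pose rho := e / (2 * (vn y + 1)).
have vy0 := vn_ge0 y.
have rho0 : 0 < rho by rewrite divr_gt0 // mulr_gt0 //; lra.
have t0 : 0 < cn (pe p y) / 2 * rho ^+ d / 2 by rewrite divr_gt0 // mulr_gt0 ?exprn_gt0 // divr_gt0.
have [r1 r10 h1] := @ctn_pe R n p z _ t0.
have py2 : 0 < cn (pe p y) / 2 by rewrite divr_gt0.
have [r2 r20 h2] := @ctn_pe R n p y _ py2.
pose m := Num.min (Num.min r1 r2) (Num.min 1 (e / 2)).
have m0 : 0 < m by rewrite !lt_min r10 r20 ltr01 divr_gt0.
have N1 : 0 < n.+1%:R :> R by rewrite ltr0n.
pose dl := m / (n.+1%:R ^+ 2 * (vn z + vn y + 1)).
have vz0 := vn_ge0 z.
have s0 : 0 < vn z + vn y + 1 by lra.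
have dl0 : 0 < dl by rewrite divr_gt0 // mulr_gt0 // exprn_gt0.
have near (L : Mat R n) x : ebox L0 dl L -> L0 *m x = x -> vn x <= vn z + vn y + 1 -> vn (L *m x - x) <= m.
  move=> hL Lx xb; have -> : L *m x - x = (L - L0) *m x by rewrite mulmxBl Lx.
  apply: le_trans (vn_small x (ltW dl0) _) _; first by move=> i j; rewrite mxsubE; exact: hL.
  apply: le_trans (_ : n.+1%:R ^+ 2 * dl * (vn z + vn y + 1) <= _).
    by rewrite ler_pM2l // mulr_gt0 // exprn_gt0.
  by rewrite /dl; apply: eq_ler; move: N1 s0; move: n.+1%:R (vn z + vn y + 1) => c a c0 a0; field; rewrite !gt_eqF.
have key (L : Mat R n) : ebox L0 dl L -> rank2proj L -> exists x : Vec R n,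
    [/\ x != 0, L *m x = x, pe p x = 0 & dFS (pj x) (pj z) <= r].
  move=> hL rL; have nz := near L z hL L0z (_ : _ <= _); have ny := near L y hL L0y (_ : _ <= _).
  have {}nz : vn (L *m z - z) <= m by apply: nz; lra.
  have {}ny : vn (L *m y - y) <= m by apply: ny; lra.
  have mr1 : m <= r1 by rewrite /m !ge_min lexx.
  have mr2 : m <= r2 by rewrite /m !ge_min lexx orbT.
  have m1 : m <= 1 by rewrite /m !ge_min lexx !orbT.
  have me : m <= e / 2 by rewrite /m !ge_min lexx !orbT.
  have g1 := h1 _ (le_trans nz mr1); rewrite pz subr0 in g1.
  have g2 := h2 _ (le_trans ny mr2).
  have g3 : cn (pe p y) / 2 <= cn (pe p (L *m y)).
    by rewrite cnB in g2; move: (le_trans (cnDB _ _) g2); move: (cn _) (cn _) => a b; lra.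
  have [||a ar pa] := @root_near p (L *m z) (L *m y) rho hp rho0.
  - by rewrite -cn_gt0; apply: lt_le_trans g3.
  - apply: le_lt_trans g1 _; apply: lt_le_trans (_ : cn (pe p y) / 2 * rho ^+ d <= _).
      have : 0 < cn (pe p y) / 2 * rho ^+ d by rewrite mulr_gt0 // exprn_gt0.
      lra.
    by rewrite ler_pM2r // exprn_gt0.
  have Ly : vn (L *m y) <= vn y + 1.
    have -> : L *m y = (L *m y - y) + y by rewrite subrK.
    by apply: le_trans (vnD _ _) _; rewrite addrC lerD2l; exact: le_trans ny m1.
  have xz : vn (L *m z + a *: (L *m y) - z) <= e.
    rewrite addrAC; apply: le_trans (vnD _ _) _; rewrite vnZ.
    have : cn a * vn (L *m y) <= rho * (vn y + 1) by apply: ler_pM; rewrite ?cn_ge0 ?vn_ge0 // ltW.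
    have -> : rho * (vn y + 1) = e / 2 by rewrite /rho; field; rewrite gt_eqF //; lra.
    by move=> hx; rewrite [leRHS](splitr e); apply: lerD => //; exact: le_trans nz me.
  have [x0 dx] := he _ xz; exists (L *m z + a *: (L *m y)); split=> //.
  by rewrite mulmxDr -scalemxAr !mulmxA rL.1.2.
have [kap [ze hz]] := roots_exist hp.
have N0 := vol_lgood vol2 volU d_gt0 pP.
have mball : measurable [set Z : MT R n | dFS Z (pj z) <= r].
  apply: measurable_setb; apply: measurable_fun_ler; last exact: measurable_cst.
  by apply: measurable_dFS => //; exact: measurable_cst.
rewrite (muPE d_gt0 hz) //.
have dR : 0 < d%:R :> R by rewrite ltr0n.
apply: mule_gt0; first by rewrite lte_fin invr_gt0.
pose F i := rootpt ze i @^-1` [set Z : MT R n | dFS Z (pj z) <= r].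
have mF i : measurable (F i).
  by have := measurable_rootpt i hz measurableT mball; rewrite setTI.
apply: lt_le_trans (vol_ebox rL0 dl0) _.
have mg : measurable [set L : MT R n | ~ lgood d p L] by apply: measurableC; exact: measurable_lgood.
have mU : measurable (\big[setU/set0]_(k < d) F k) by apply: bigsetU_measurable.
apply: le_trans (_ : (vol ([set L | ~ lgood d p L] `|` \big[setU/set0]_(k < d) F k) <= _)%E).
  apply: le_measure; rewrite ?inE; [exact: measurable_ebox|exact: measurableU|].
  move=> L hL; have [gL|] := pselect (lgood d p L); last by left.
  right; suff : (\bigcup_(k in [set k | (k < d)%N]) F k) L by rewrite bigcup_mkord.
  have [x [x0 Lx px dx]] := key L hL gL.1.
  have [LE fu1 fv1 fuv _] := rank2_frame gL.1.
  have [_ _ hzL] := hz; have [k0 zn pE] := hzL L gL.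
  pose zt := (ip (fu L) x, ip (fv L) x).
  have xE : x = onln (fu L) (fv L) zt.
    by rewrite /onln /= -{1}Lx {1}LE mulmxDl !outerE.
  have zt0 : zt != 0.
    by apply: contraNneq x0 => e1; rewrite xE /onln e1 !scale0r addr0.
  have : pe p (zt.1 *: fu L + zt.2 *: fv L) = 0 by rewrite -[X in pe p X]/(onln _ _ zt) -xE.
  rewrite pE => /eqP; rewrite mulf_eq0 (negbTE k0) /= => /prodf_eq0 [i _ /eqP bi].
  exists i; first exact: ltn_ord.
  have [c c0 cE] := br0_par (zn i (ltn_ord i)) zt0 bi.
  rewrite /F /= /rootpt; have -> : onln (fu L) (fv L) (ze i L) = c *: x.
    by rewrite cE xE /onln /= scalerDr !scalerA.
  by rewrite pjZ.
apply: le_trans (measureU2 _ mg mU) _; rewrite [X in (X + _)%E]N0 add0e.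
exact: bigU_le.
Qed.

End positivity.

(** * The zero measure determines the form *)

Lemma count_mul (T : eqType) (s s' : seq T) (a : pred T) (m m' : nat) :
  (forall z, a z -> z \in s -> (m * count_mem z s <= m' * count_mem z s')%N) -> (m * count a s <= m' * count a s')%N.
Proof.
move=> h; pose r := undup [seq z <- s ++ s' | a z].
have E (l : seq T) : {subset l <= s ++ s'} -> count a l = (\sum_(t <- r) count_mem t l)%N.
  move=> sl; rewrite -size_filter -(@sum_count _ _ [seq z <- l | a z] r (fun t => pred1 t)).
  - rewrite big_seq [RHS]big_seq; apply: eq_bigr => t tr; rewrite count_filter; apply: eq_count => y /=.
    by move: tr; rewrite mem_undup mem_filter => /andP[at_ _]; case: eqP => // ->.
  - exact: undup_uniq.
  - move=> y; rewrite mem_filter => /andP[ay yl]; exists y; last by move=> t' _; exact: eq_sym.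
    by rewrite mem_undup mem_filter ay sl.
rewrite !E; [|by move=> y; rewrite mem_cat orbC => ->|by move=> y; rewrite mem_cat => ->].
rewrite !big_distrr /= big_seq [leqRHS]big_seq; apply: leq_sum => t.
rewrite mem_undup mem_filter => /andP[at_ _]; case: (boolP (t \in s)) => [|ts]; first exact: h.
by rewrite (count_memPn ts) muln0.
Qed.

Lemma sum_measure_le (R : realType) (dT : measure_display) (T : measurableType dT)
    (mu : {measure set T -> \bar R}) (I J : finType) (A : I -> set T) (B : J -> set T) (E : set T) :
  (forall i, measurable (A i)) -> (forall j, measurable (B j)) -> measurable E -> mu E = 0%E ->
  (forall x, ~ E x -> (#|[pred i | x \in A i]| <= #|[pred j | x \in B j]|)%N) ->
  (\sum_i mu (A i) <= \sum_j mu (B j))%E.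
Proof.
move=> mA mB mE E0 h.
have mi (S : set T) : measurable S -> measurable_fun setT (fun x => (\1_S x)%:E : \bar R).
  by move=> mS; apply/measurable_EFinP; exact: measurable_indic.
have iS (S : set T) : measurable S -> mu S = (\int[mu]_x (\1_S x)%:E)%E.
  by move=> mS; rewrite integral_indic // setIT.
have i0 (S : set T) x : (0 <= (\1_S x)%:E :> \bar R)%E by rewrite lee_fin.
rewrite (eq_bigr (fun i => \int[mu]_x (\1_(A i) x)%:E)%E) => [|i _]; last exact: iS.
rewrite [leRHS](eq_bigr (fun i => \int[mu]_x (\1_(B i) x)%:E)%E) => [|i _]; last exact: iS.
rewrite -!ge0_integral_sum //; [|by move=> i; exact: mi|by move=> i; exact: mi].
apply: (le_integral_offnull mE E0) => [x|x|x Ex]; [exact: sume_ge0|exact: sume_ge0|].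
have cnt (K : finType) (F : K -> set T) : (\sum_k (\1_(F k) x)%:E = (#|[pred k | x \in F k]|%:R : R)%:E)%E.
  rewrite sumEFin; congr (_%:E); rewrite -sum1_card natr_sum [RHS]big_mkcond; apply: eq_bigr => i _.
  by rewrite indicE inE; case: (x \in F i).
by rewrite !cnt lee_fin ler_nat; exact: h.
Qed.

Section decay.
Context (R : realType) (n d : nat) (vol : probability (MT R n) R).
Hypothesis d_gt0 : (0 < d)%N.
Hypothesis vol2 : vol [set L : MT R n | ~ rank2proj L] = 0%E.
Hypothesis volU : forall U : Mat R n, unitary U ->
  forall A : set (MT R n), measurable A -> vol ((fun L : MT R n => U *m L *m adj U) @^-1` A) = vol A.
Implicit Types p q : HPoly R n.

(** [lgood] refers to the frame [fu], [fv]; vanishing in any other frame means that [p] vanishes on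
    the whole line. *)
Lemma restr_neq0 p (L : Mat R n) u v : is_homog d p -> lgood d p L -> L = u *m adj u + v *m adj v -> restr p u v != 0.
Proof.
move=> hp [rL [k kd kc]] LE; move: kc; apply: contraNneq => f0.
have [_ _ _ _ [Lu Lv]] := rank2_frame rL.
have p0 x : L *m x = x -> pe p x = 0.
  move=> <-; rewrite LE mulmxDl !outerE (pe_line _ _ _ _ hp) f0.
  by rewrite big1 // => i _; rewrite coef0 !mul0r.
rewrite /lcoef; suff -> : restr p (fu L) (fv L) = 0 by rewrite coef0.
apply: poly_eq_horner => a _; rewrite horner_restr horner0; apply: p0.
by rewrite mulmxDr -scalemxAr Lu Lv.
Qed.

Lemma mup_if_le (f g : {poly R[i]}) (m m' : nat) : f != 0 -> (g != 0 -> (m * mup 0 g <= m' * mup 0 f)%N) ->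
  (m * (if true && (g != 0%R) then mup 0 g else 0) <= m' * (if true && (f != 0%R) then mup 0 f else 0))%N.
Proof. by move=> -> h; case: (boolP (g != 0)) => [/h|_]; rewrite ?muln0. Qed.

(** [mult] reads both multiplicities in the same frame [(u, v)]. The multiple [l *: u] from
    [rep_near] is close to [z], so the hypothesis applies along [l *: (u + s *: v)] for small [s],
    and homogeneity turns it into the input of [mup_compare]. *)
Lemma mult_compare p q z (c e : R) (m m' : nat) : is_homog d p -> is_homog d q -> z != 0 -> 0 < e -> 0 <= c ->
  (forall x, vn (x - z) <= e -> cn (pe p x) ^+ m' <= c * cn (pe q x) ^+ m) ->
  exists2 r : R, 0 < r & forall L Z, lgood d p L -> rank1proj Z -> dFS Z (pj z) <= r ->
    (m * mult q L Z <= m' * mult p L Z)%N.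
Proof.
move=> hp hq z0 e0 c0 hpq; have e2 : 0 < e / 2 by rewrite divr_gt0.
have [r r0 hr] := rep_near z0 e2; exists r; first exact: r0.
move=> L Z gL rZ dZ.
rewrite /mult; move: (xget _ _) => [u v] /=.
case: (boolP `[< Z = u *m adj u /\ L = Z + v *m adj v >]) => [/asboolP [ZE LE]|_]; last by rewrite !muln0.
have f0 : restr p u v != 0 by apply: restr_neq0 hp gL _; rewrite -ZE.
apply: (mup_if_le f0) => q0.
have u1 : ip u u = 1 by rewrite -tr_outer -ZE; case: rZ.
have dZ' : dFS (u *m adj u) (pj z) <= r by rewrite -ZE.
have [l l0 hl] := hr _ u1 dZ'.
have l1 : 0 < cn l by rewrite cn_gt0.
have lp k : 0 < cn l ^+ k by rewrite exprn_gt0.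
pose e1 := e / 2 / (cn l * (vn v + 1)).
have v0 := vn_ge0 v.
have B0 : 0 < cn l * (vn v + 1) by rewrite mulr_gt0 // ltr_wpDl.
have e10 : 0 < e1 by rewrite divr_gt0.
apply: (@mup_compare R (restr p u v) (restr q u v) (c * cn l ^+ (d * m) / cn l ^+ (d * m')) e1 m m' f0 q0 e10).
- by rewrite divr_ge0 ?mulr_ge0 ?(ltW (lp _)).
move=> s s0 se; generalize (horner_restr p u v s%:C%C) (horner_restr q u v s%:C%C).
generalize (restr p u v) (restr q u v) => f g -> ->.
have cs : cn (s%:C%C : R[i]) = s by rewrite cn_real ger0_norm // ltW.
have near : vn (l *: (u + s%:C%C *: v) - z) <= e.
  rewrite scalerDr addrAC; apply: le_trans (vnD _ _) _; rewrite !vnZ cs.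
  have : cn l * (s * vn v) <= e / 2.
    apply: le_trans (_ : cn l * (s * (vn v + 1)) <= _).
      by rewrite ler_pM2l // ler_pM2l // lerDl.
    have -> : cn l * (s * (vn v + 1)) = s * (cn l * (vn v + 1)) by ring.
    by rewrite -ler_pdivlMr // ltW.
  by move: hl; lra.
have := hpq _ near; rewrite !(pe_homog _ _ hp) !(pe_homog _ _ hq) !cnM !cnX !exprMn -!exprM => h.
rewrite -(ler_pM2l (lp (d * m')%N)); apply: le_trans h _; apply: eq_ler.
have := lp (d * m')%N; move: (cn l ^+ (d * m')) (cn l ^+ (d * m)) => a b a0.
by field; rewrite gt_eqF.
Qed.

Lemma multE_roots p kap ze (L : MT R n) (Z : Mat R n) : is_roots d p kap ze -> lgood d p L -> rank1proj Z ->
  mult p L Z = count_mem Z [seq (rootpt ze i L : Mat R n) | i : 'I_d].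
Proof.
move=> hz gL rZ; have [_ _ hL] := hz; have [k0 zn pE] := hL L gL.
have [LE u1 v1 uv _] := rank2_frame gL.1.
rewrite (multE u1 v1 uv LE k0 zn pE rZ) count_map -sum1_count [RHS]big_mkcond /=.
rewrite [RHS]big_enum /=; apply: eq_bigr => i _.
by rewrite /= /rootpt eq_sym; case: eqP.
Qed.

Lemma muP_compare p q (A : set (MT R n)) (m m' : nat) : inPnd d p -> inPnd d q -> measurable A ->
  (forall L Z, lgood d p L -> rank1proj Z -> A Z -> (m * mult q L Z <= m' * mult p L Z)%N) ->
  (m%:R%:E * muP d vol q A <= m'%:R%:E * muP d vol p A)%E.
Proof.
move=> pP qP mA hm.
have [kap [ze hz]] := roots_exist pP.2; have [kap' [ze' hz']] := roots_exist qP.2.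
have Np := vol_lgood vol2 volU d_gt0 pP; have Nq := vol_lgood vol2 volU d_gt0 qP.
rewrite (muPE d_gt0 hz Np mA) (muPE d_gt0 hz' Nq mA) muleCA [leRHS]muleCA.
apply: lee_wpmul2l; first by rewrite lee_fin invr_ge0.
pose F i := rootpt ze i @^-1` A; pose G i := rootpt ze' i @^-1` A.
have mF i : measurable (F i) by have := measurable_rootpt i hz measurableT mA; rewrite setTI.
have mG i : measurable (G i) by have := measurable_rootpt i hz' measurableT mA; rewrite setTI.
have mp : measurable [set L : MT R n | ~ lgood d p L] by apply: measurableC; exact: measurable_lgood.
have mq : measurable [set L : MT R n | ~ lgood d q L] by apply: measurableC; exact: measurable_lgood.
have mE := measurableU _ _ mp mq.
have E0 : vol ([set L : MT R n | ~ lgood d p L] `|` [set L | ~ lgood d q L]) = 0%E.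
  apply/eqP; rewrite -measure_le0; apply: le_trans (measureU2 _ mp mq) _.
  by rewrite [X in (X + _)%E]Np [X in (_ + X)%E]Nq adde0.
(* An integer multiple of a sum of masses becomes a sum over ['I_k * 'I_d], so that [sum_measure_le]
   only has to compare cardinals on each line. *)
have expand (k : nat) (H : nat -> set (MT R n)) :
    (k%:R%:E * \sum_(i < d) vol (H i) = \sum_(x : 'I_k * 'I_d) vol (H x.2))%E.
  rewrite -(pair_big xpredT xpredT (fun (_ : 'I_k) (i : 'I_d) => vol (H i))) /= sumr_const card_ord.
  by rewrite mule_natl.
rewrite (expand m (fun i => rootpt ze' i @^-1` A)) (expand m' (fun i => rootpt ze i @^-1` A)).
apply: (@sum_measure_le R _ _ vol _ _ (fun x : 'I_m * 'I_d => rootpt ze' x.2 @^-1` A)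
  (fun x : 'I_m' * 'I_d => rootpt ze x.2 @^-1` A) _ (fun x => mG x.2) (fun x => mF x.2) mE E0).
move=> L hL.
have gp : lgood d p L by apply: contrapT => h; apply: hL; left.
have gq : lgood d q L by apply: contrapT => h; apply: hL; right.
have cnt (k : nat) (H : nat -> Mat R n) : #|[pred x : 'I_k * 'I_d | `[< A (H x.2) >]]| =
    (k * count (fun Z : Mat R n => `[< A Z >]) [seq H i | i : 'I_d])%N.
  rewrite -sum1_card (eq_bigl (fun x : 'I_k * 'I_d => xpredT x.1 && `[< A (H x.2) >])) //.
  rewrite -(pair_big xpredT (fun i : 'I_d => `[< A (H i) >]) (fun _ _ => 1%N)) /= sum_nat_const card_ord.
  by rewrite count_map -sum1_count /= [in RHS]big_enum_cond.
have conv (k : nat) (z : nat -> MT R n -> MT R n) :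
    #|[pred x : 'I_k * 'I_d | L \in z x.2 @^-1` A]| = #|[pred x : 'I_k * 'I_d | `[< A (z x.2 L) >]]|.
  by apply: eq_card => x; rewrite !inE.
rewrite !conv (cnt m (fun i => rootpt ze' i L)) (cnt m' (fun i => rootpt ze i L)).
apply: count_mul => Z /asboolP AZ /mapP [i _ ZE].
have rZ : rank1proj Z by rewrite ZE; exact: rootpt_rank1 hz' gq (ltn_ord i).
have E1 := multE_roots hz gp rZ; have E2 := multE_roots hz' gq rZ; have h := hm L Z gp rZ AZ.
by rewrite E1 E2 in h.
Qed.

(* If [m' < m], the mass of a ball around [z] would grow by a fixed amount under each of
   arbitrarily many enlargements between the radii [r / 2] and [r]. *)
Lemma decay_contra p q z (c e : R) (m m' : nat) : inPnd d p -> inPnd d q -> DD d vol p q = 0 ->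
  z != 0 -> pe p z = 0 -> 0 < e -> 0 <= c ->
  (forall x, vn (x - z) <= e -> cn (pe p x) ^+ m' <= c * cn (pe q x) ^+ m) -> (m <= m')%N.
Proof.
move=> pP qP Dpq z0 pz e0 c0 hpq; rewrite leqNgt; apply/negP => mm.
have [r r0 hr] := mult_compare pP.2 qP.2 z0 e0 c0 hpq.
have [P [sP hP]] := muP_prob d_gt0 vol2 volU pP; have [Q [sQ hQ]] := muP_prob d_gt0 vol2 volU qP.
have PQ0 : W2sq P Q = 0%E.
  by rewrite -(W2sq_ext hP hQ) (DDE d_gt0 vol2 volU pP qP) Dpq expr0n.
have rZ0 : rank1proj (pj z) by exact: pj_rank1.
pose B (s : R) : set (MT R n) := [set Z | dFS Z (pj z) <= s].
have mB s : measurable (B s).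
  apply: measurable_setb; apply: measurable_fun_ler; last exact: measurable_cst.
  by apply: measurable_dFS => //; exact: measurable_cst.
pose a s := fine (P (B s)).
have aE s : P (B s) = (a s)%:E by rewrite fineK // fin_num_measure.
have a1 s : a s <= 1 by rewrite -lee_fin -aE probability_le1.
have a_pos : 0 < a (r / 2).
  rewrite -lte_fin -aE -hP //; apply: muP_pos => //; by rewrite divr_gt0.
have a_mono s t : s <= t -> a s <= a t.
  move=> st; rewrite -lee_fin -!aE; apply: le_measure; rewrite ?inE //.
  by move=> Z /= h; exact: le_trans st.
(* The ball of radius [s] has no more [P]-mass than the larger ball has [Q]-mass, as [P] and [Q] are
   at distance 0; multiplicities then pass from [q] back to [p]. *)
have step s t : s < t -> t <= r -> m%:R * a s <= m'%:R * a t.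
  move=> st tr; rewrite -lee_fin !EFinM -!aE.
  apply: le_trans (_ : (m%:R%:E * Q (B t) <= _)%E).
    apply: lee_wpmul2l; first by rewrite lee_fin.
    apply: (W2sq0_nbhd sP sQ PQ0 (mB s) (mB t) (_ : 0 < t - s)); first by rewrite subr_gt0.
    move=> x y; rewrite /B /= => xs rx ry xy.
    by apply: le_trans (dFS_triangle ry rx rZ0) _; rewrite dFSC; move: xs xy; lra.
  rewrite -(hP _ (mB t)) -(hQ _ (mB t)); apply: (muP_compare pP qP (mB t)).
  by move=> L Z gL rZ BZ; exact: hr gL rZ (le_trans BZ tr).
have m0 : 0 < m%:R :> R by rewrite ltr0n (leq_ltn_trans _ mm).
(* Each enlargement gains at least [a (r / 2) / m], so [N] of them push the mass of a ball above
   1. *)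
pose N := (Num.truncn (m%:R / a (r / 2))).+1.
have NR : 0 < N%:R :> R by rewrite ltr0n.
pose rr k : R := r / 2 + r / 2 * (k%:R / N%:R).
have rN : rr N = r by rewrite /rr divff ?gt_eqF //; field.
have rmono k l : (k < l)%N -> rr k < rr l.
  by move=> kl; rewrite /rr ltrD2l ltr_pM2l ?divr_gt0 // ltr_pM2r ?invr_gt0 // ltr_nat.
have lb k : (k <= N)%N -> a (r / 2) + k%:R * (a (r / 2) / m%:R) <= a (rr k).
  elim: k => [|k IH] kN; first by rewrite /rr !mul0r mulr0 !addr0.
  have h1 := IH (ltnW kN).
  have h2 := step _ _ (rmono _ _ (ltnSn k)) (_ : rr k.+1 <= r).
  have {}h2 : m%:R * a (rr k) <= m'%:R * a (rr k.+1).
    apply: h2; rewrite -rN; move: kN; rewrite leq_eqVlt => /orP[/eqP -> //|h]; exact: ltW (rmono _ _ h).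
  have h3 : a (r / 2) <= a (rr k.+1).
    by apply: a_mono; rewrite /rr lerDl mulr_ge0 ?divr_ge0 // ltW.
  have h4 : m'%:R * a (rr k.+1) <= (m%:R - 1) * a (rr k.+1).
    apply: ler_wpM2r; first by apply: le_trans h3; exact: ltW.
    by rewrite lerBrDr natr1 ler_nat.
  have h5 : a (r / 2) / m%:R <= a (rr k.+1) - a (rr k).
    by rewrite ler_pdivrMr //; move: h2 h4 h3; rewrite mulrBl mul1r mulrBl; lra.
  have kE : k.+1%:R = k%:R + 1 :> R by rewrite natr1.
  by rewrite kE mulrDl mul1r; move: h1 h5; lra.
have := lb N (leqnn _); have := a1 (rr N).
have : 1 <= N%:R * (a (r / 2) / m%:R).
  rewrite mulrA ler_pdivlMr // mul1r -ler_pdivrMr //; apply: ltW; exact: truncnS_gt.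
by move: a_pos; lra.
Qed.

End decay.

HB.lock Definition rts (R : realType) n (p : HPoly R n) (v x : Vec R n) : seq R[i] := clroots (restr p x v).

Lemma sep_absurd (R : realFieldType) (s r x y z : R) :
  s <= z -> z <= x + y -> x <= r -> y <= 2 * r -> r <= s / 4 -> 0 < s -> false.
Proof. by lra. Qed.

Lemma sep_far (R : realFieldType) (s r x y z : R) :
  s <= z -> z <= x + y -> y <= r -> r <= s / 4 -> 0 < s -> s / 2 <= x.
Proof. by lra. Qed.

(** * Equal root measures force proportional forms *)

Section injectivity.
Context (R : realType) (n d : nat) (vol : probability (MT R n) R).
Hypothesis n_gt0 : (0 < n)%N.
Hypothesis d_gt0 : (0 < d)%N.
Hypothesis vol2 : vol [set L : MT R n | ~ rank2proj L] = 0%E.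
Hypothesis volU : forall U : Mat R n, unitary U ->
  forall A : set (MT R n), measurable A -> vol ((fun L : MT R n => U *m L *m adj U) @^-1` A) = vol A.
Implicit Types p q : HPoly R n.

Lemma ctn_shift p (x v : Vec R n) t : ctn (fun y => pe p (y + t *: v)) x.
Proof.
move=> e e0; have [r r0 h] := @ctn_pe R n p (x + t *: v) e e0; exists r => // y hy.
by apply: h; rewrite opprD addrACA subrr addr0.
Qed.

Lemma ctn_list (T : seq R[i]) (F : R[i] -> Vec R n -> R[i]) x e : (forall t, ctn (F t) x) -> 0 < e ->
  exists2 r : R, 0 < r & forall t y, t \in T -> vn (y - x) <= r -> cn (F t y - F t x) <= e.
Proof.
move=> hF e0; elim: T => [|t T [r r0 IH]]; first by exists 1.
have [r' r0' h] := hF t e e0; exists (Num.min r r'); first by rewrite lt_min r0.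
move=> t' y; rewrite inE le_min => /orP[/eqP ->|tT] /andP[h1 h2]; [exact: h|exact: IH].
Qed.

Local Notation rts := (@rts R n).

Lemma rts_spec p v x : is_homog d p -> pe p v != 0 ->
  size (rts p v x) = d /\ forall t, pe p (x + t *: v) = pe p v * \prod_(a <- rts p v x) (t - a).
Proof.
move=> hp pv; pose f := restr p x v.
have fd : f`_d = pe p v by exact: restr_top.
have f0 : f != 0 by apply: contraNneq pv => fE; rewrite -fd fE coef0.
have sf : size f = d.+1.
  apply/eqP; rewrite eqn_leq size_restr // ltnNge; apply/negP => sz.
  by move: pv; rewrite -fd nth_default ?eqxx.
rewrite rts.unlock; split; first by apply: succn_inj; rewrite -clroots_size.
move=> t; rewrite -horner_restr -/f {1}(clrootsE f) hornerZ lead_coefE sf fd horner_prod.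
by congr (_ * _); apply: eq_bigr => a _; rewrite hornerXsubC.
Qed.

(** On the line through [x] parallel to [v], the roots of [p] lie in the balls of radius [rho]
    around [T]; inside the ball of [t] they all coincide with the single point [a t], with the same
    total multiplicity as at [x0]. The same [a] will serve for [p] and [q]. *)
Definition clustered p (v x0 : Vec R n) (T : seq R[i]) (rho sg M : R) (x : Vec R n) (a : R[i] -> R[i]) :=
  [/\ forall t, t \in T -> count (fun b => cn (t - b) <= rho) (rts p v x) = count_mem t (rts p v x0),
      forall b, b \in rts p v x -> exists2 t, t \in T & cn (t - b) <= rho,
      forall b t, b \in rts p v x -> t \in T -> cn (t - b) <= rho -> b = a t,
      forall b t, b \in rts p v x -> t \in T -> ~~ (cn (t - b) <= rho) -> sg <= cn (t - b) &
      forall b t, b \in rts p v x -> t \in T -> cn (t - b) <= M].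

(** By hypothesis [x0] locally maximizes the number of distinct roots of [p] and [q] together.
    Continuity gives, for [x] close to [x0], at least one root near every [t] in [T]; by maximality
    there is no room for a second one. The multiplicities are then controlled by [count_semi]. *)
Lemma local_clusters p q v x0 (r0 : R) (T : seq R[i]) : is_homog d p -> is_homog d q -> pe p v != 0 -> pe q v != 0 ->
  uniq T -> (forall b, (b \in T) = (b \in rts p v x0) || (b \in rts q v x0)) -> 0 < r0 ->
  (forall x, vn (x - x0) <= r0 -> (size (undup (rts p v x ++ rts q v x)) <= size T)%N) ->
  exists dl rho sg M : R, [/\ 0 < dl, 0 < sg <= 1, 1 <= M &
    forall x, vn (x - x0) <= dl -> exists a, clustered p v x0 T rho sg M x a /\ clustered q v x0 T rho sg M x a].
Proof.
move=> hp hq pv qv uT memT r00 hmax.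
have spT : {subset rts p v x0 <= T} by move=> b bp; rewrite memT bp.
have sqT : {subset rts q v x0 <= T} by move=> b bq; rewrite memT bq orbT.
have [sg /andP[sg0 sg1] hsg] := separation T.
have [rp rp0 hrp] := count_semi uT spT; have [rq rq0 hrq] := count_semi uT sqT.
pose rho := Num.min (Num.min rp rq) (sg / 4).
have rho0 : 0 < rho by rewrite !lt_min rp0 rq0 divr_gt0.
have rhop : rho <= rp by rewrite !ge_min lexx.
have rhoq : rho <= rq by rewrite !ge_min lexx orbT.
have rhos : rho <= sg / 4 by rewrite !ge_min lexx orbT.
have [ep ep0 hep] := hrp rho rho0 rhop; have [eq eq0 heq] := hrq rho rho0 rhoq.
have pv0 : 0 < cn (pe p v) by rewrite cn_gt0.
have qv0 : 0 < cn (pe q v) by rewrite cn_gt0.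
have e1 : 0 < cn (pe p v) * ep by rewrite mulr_gt0.
have e2 : 0 < cn (pe q v) * eq by rewrite mulr_gt0.
have e3 : 0 < cn (pe p v) * cn (pe q v) * (rho ^+ d * rho ^+ d) / 2.
  by rewrite divr_gt0 // !mulr_gt0 // exprn_gt0.
have [d1 d10 h1] := ctn_list T (fun t => ctn_shift p x0 v (t + (2 * rho)%:C%C)) e1.
have [d2 d20 h2] := ctn_list T (fun t => ctn_shift q x0 v (t + (2 * rho)%:C%C)) e2.
have [d3 d30 h3] := ctn_list T (fun t => ctnM (ctn_shift p x0 v t) (ctn_shift q x0 v t)) e3.
pose B : R := \sum_(t <- T) \sum_(t' <- T) cn (t - t').
have hB t t' : t \in T -> t' \in T -> cn (t - t') <= B.
  have pos (r : seq R[i]) t1 : 0 <= \sum_(t' <- r) cn (t1 - t') by apply: sumr_ge0 => *; exact: cn_ge0.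
  move=> tT tT'; rewrite /B (big_rem t) //= (big_rem t') //=.
  rewrite -addrA lerDl addr_ge0 //.
  by apply: sumr_ge0 => *; exact: pos.
have B0 : 0 <= B by apply: sumr_ge0 => *; apply: sumr_ge0 => *; exact: cn_ge0.
exists (Num.min (Num.min d1 d2) (Num.min d3 r0)), rho, (sg / 2), (B + 1); split.
- by rewrite !lt_min d10 d20 d30.
- rewrite divr_gt0 //= ler_pdivrMr //; apply: le_trans sg1 _.
  by rewrite mul1r ler1n.
- by rewrite lerDr.
move=> x; rewrite !le_min => /andP[/andP[x1 x2] /andP[x3 x4]].
have [spx Ep] := rts_spec x hp pv; have [sqx Eq] := rts_spec x hq qv.
have [sp0 Ep0] := rts_spec x0 hp pv; have [sq0 Eq0] := rts_spec x0 hq qv.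
(* Without a root near [t] the product of both forms at [x + t *: v] would stay of order
   [rho ^+ d * rho ^+ d], although it vanishes at [x0 + t *: v]. *)
have /choice [a ha] : forall t, exists b, t \in T -> b \in rts p v x ++ rts q v x /\ cn (t - b) <= rho.
  move=> t; case: (boolP (t \in T)) => tT; last by exists 0.
  apply: contrapT => hno.
  have hb b : b \in rts p v x ++ rts q v x -> rho <= cn (t - b).
    move=> bin; rewrite leNgt; apply/negP => h; apply: hno; exists b => _; split=> //; exact: ltW.
  have z0 : pe p (x0 + t *: v) * pe q (x0 + t *: v) = 0.
    have zr (s : seq R[i]) : t \in s -> \prod_(a <- s) (t - a) = 0.
      by move=> ts; rewrite (big_rem t) //= subrr mul0r.
    rewrite Ep0 Eq0; move: tT; rewrite memT => /orP[/zr ->|/zr ->].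
      by rewrite mulr0 mul0r.
    by rewrite mulr0 mulr0.
  have := h3 t x tT x3; rewrite z0 subr0 Ep Eq !cnM !cn_prod leNgt => /negP; apply.
  have lp : rho ^+ d <= \prod_(b <- rts p v x) cn (t - b).
    rewrite -{1}spx; apply: prodr_ge_exp => [|b br]; first exact: ltW.
    by apply: hb; rewrite mem_cat br.
  have lq : rho ^+ d <= \prod_(b <- rts q v x) cn (t - b).
    rewrite -{1}sqx; apply: prodr_ge_exp => [|b br]; first exact: ltW.
    by apply: hb; rewrite mem_cat br orbT.
  have rd : 0 < rho ^+ d by rewrite exprn_gt0.
  apply: lt_le_trans (_ : cn (pe p v) * cn (pe q v) * (rho ^+ d * rho ^+ d) <= _).
    by rewrite ltr_pdivrMr // ltr_pMr ?ltr1n // !mulr_gt0.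
  rewrite mulrACA; apply: ler_pM; rewrite ?mulr_ge0 ?(ltW rd) ?cn_ge0 //; last first.
    by apply: ler_pM => //; rewrite ?cn_ge0 // ltW.
  by apply: ler_pM => //; rewrite ?cn_ge0 // ltW.
have sepT t t' b : t \in T -> t' \in T -> cn (t - b) <= rho -> cn (t' - b) <= 2 * rho -> t = t'.
  move=> tT tT' h h'; apply/eqP; apply: contraT => tt; have tri := cnD3 t b t'; rewrite (cnB b) in tri.
  exact: sep_absurd (hsg _ _ tT tT' tt) tri h h' rhos sg0.
have ia : {in T &, injective a}.
  move=> t t' tT tT' e; have [_ t1] := ha t tT; have [_ t2] := ha t' tT'.
  by apply: (sepT t t' (a t)) => //; rewrite e; apply: le_trans t2 _; rewrite ler_peMl ?(ltW rho0) // ler1n.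
(* An injective map into a set with no more elements than [T] is onto: every root is some [a t]. *)
have Ueq : map a T =i undup (rts p v x ++ rts q v x).
  apply: (uniq_min_size _ _ _).2.
  - by rewrite map_inj_in_uniq.
  - by move=> b /mapP[t tT ->]; rewrite mem_undup; case: (ha t tT).
  - by rewrite size_map hmax.
have near b : b \in rts p v x ++ rts q v x -> exists2 t, t \in T & b = a t /\ cn (t - b) <= rho.
  rewrite -mem_undup -Ueq => /mapP[t tT bE]; exists t => //; split=> //.
  by rewrite bE; case: (ha t tT).
have uniq_near b t : b \in rts p v x ++ rts q v x -> t \in T -> cn (t - b) <= rho -> b = a t.
  move=> /near [t' tT' [bE h']] tT h; suff -> : t = t' by [].
  by apply: (sepT t t' b) => //; apply: le_trans h' _; rewrite ler_peMl ?(ltW rho0) // ler1n.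
have far b t : b \in rts p v x ++ rts q v x -> t \in T -> ~~ (cn (t - b) <= rho) -> sg / 2 <= cn (t - b).
  move=> /near [t' tT' [bE h']] tT h.
  have tt : t != t' by apply: contraNneq h => ->.
  have tri := cnD3 t b t'; rewrite (cnB b) in tri; exact: sep_far (hsg _ _ tT tT' tt) tri h' rhos sg0.
have ub b t : b \in rts p v x ++ rts q v x -> t \in T -> cn (t - b) <= B + 1.
  move=> /near [t' tT' [bE h']] tT; apply: le_trans (cnD3 t t' b) _.
  apply: lerD; first exact: hB.
  apply: le_trans h' (le_trans rhos _); rewrite ler_pdivrMr //; apply: le_trans sg1 _.
  by rewrite mul1r ler1n.
have inp b : b \in rts p v x -> b \in rts p v x ++ rts q v x by rewrite mem_cat => ->.
have inq b : b \in rts q v x -> b \in rts p v x ++ rts q v x by rewrite mem_cat orbC => ->.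
exists a; split; split.
- apply: hep; first by rewrite spx sp0.
    by move=> b /inp /near [t tT [_ h]]; exists t.
  move=> t tT; have := h1 t x tT x1; rewrite Ep Ep0 -mulrBr cnM ler_pM2l //.
- by move=> b /inp /near [t tT [_ h]]; exists t.
- by move=> b t /inp; exact: uniq_near.
- by move=> b t /inp; exact: far.
- by move=> b t /inp; exact: ub.
- apply: heq; first by rewrite sqx sq0.
    by move=> b /inq /near [t tT [_ h]]; exists t.
  move=> t tT; have := h2 t x tT x2; rewrite Eq Eq0 -mulrBr cnM ler_pM2l //.
- by move=> b /inq /near [t tT [_ h]]; exists t.
- by move=> b t /inq; exact: uniq_near.
- by move=> b t /inq; exact: far.
- by move=> b t /inq; exact: ub.
Qed.

Lemma cluster_bounds p v x0 T rho sg M x a t : is_homog d p -> pe p v != 0 -> 0 < sg -> sg <= 1 -> 1 <= M ->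
  clustered p v x0 T rho sg M x a -> t \in T ->
  cn (pe p v) * (cn (t - a t) ^+ (count_mem t (rts p v x0)) * sg ^+ d) <= cn (pe p (x + t *: v)) <=
    cn (pe p v) * (cn (t - a t) ^+ (count_mem t (rts p v x0)) * M ^+ d).
Proof.
move=> hp pv s0 s1 M1 [c1 c2 c3 c4 c5] tT.
have [sx Ex] := rts_spec x hp pv.
have pv0 : 0 < cn (pe p v) by rewrite cn_gt0.
rewrite Ex cnM cn_prod !ler_pM2l // -(c1 t tT) -sx.
by apply: cluster_prod => // b br; [exact: c3|exact: c4|exact: c5].
Qed.

(** With [u] the distance to the common root [a t], [p] is at most [A * u ^+ m] and [q] at least
    [B * u ^+ m']; hence [p] to the power [m'] is bounded by a multiple of [q] to the power [m], and
    [decay_contra] applies. *)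
Lemma cluster_mult_le p q v x0 T (dl rho sg M : R) t : inPnd d p -> inPnd d q -> pe p v != 0 -> pe q v != 0 ->
  DD d vol p q = 0 -> 0 < dl -> 0 < sg -> sg <= 1 -> 1 <= M ->
  (forall x, vn (x - x0) <= dl -> exists a, clustered p v x0 T rho sg M x a /\ clustered q v x0 T rho sg M x a) ->
  t \in T -> x0 + t *: v != 0 -> (count_mem t (rts p v x0) <= count_mem t (rts q v x0))%N.
Proof.
move=> pP qP pv qv Dpq dl0 s0 s1 M1 hcl tT z0.
have [m0|m0] := posnP (count_mem t (rts p v x0)); first by rewrite m0.
set m := count_mem t (rts p v x0) in m0 *; set m' := count_mem t (rts q v x0).
have pv0 : 0 < cn (pe p v) by rewrite cn_gt0.
have qv0 : 0 < cn (pe q v) by rewrite cn_gt0.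
have M0 : 0 < M by apply: lt_le_trans M1.
pose A := cn (pe p v) * M ^+ d; pose B := cn (pe q v) * sg ^+ d.
have A0 : 0 < A by rewrite mulr_gt0 // exprn_gt0.
have B0 : 0 < B by rewrite mulr_gt0 // exprn_gt0.
have BM : 0 < B ^+ m by rewrite exprn_gt0.
have c0 : 0 <= A ^+ m' / B ^+ m by rewrite divr_ge0 ?exprn_ge0 // ltW.
apply: (decay_contra d_gt0 vol2 volU pP qP Dpq z0 _ dl0 c0).
  have [_ ->] := rts_spec x0 pP.2 pv.
  have tr : t \in rts p v x0 by rewrite -has_pred1 has_count.
  by rewrite (big_rem t) //= subrr mul0r mulr0.
move=> y hy; have hx : vn (y - t *: v - x0) <= dl.
  by rewrite -addrA -opprD [t *: v + x0]addrC.
have [a [cp cq]] := hcl _ hx.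
have := cluster_bounds pP.2 pv s0 s1 M1 cp tT; have := cluster_bounds qP.2 qv s0 s1 M1 cq tT.
rewrite subrK => /andP[q1 _] /andP[_ p1].
set u := cn (t - a t) in q1 p1; have u0 : 0 <= u by exact: cn_ge0.
have h1 : cn (pe p y) ^+ m' <= (A * u ^+ m) ^+ m'.
  apply: lerXn2r; rewrite ?nnegrE ?cn_ge0 ?mulr_ge0 ?exprn_ge0 ?(ltW A0) ?(ltW M0) //.
  by apply: le_trans p1 _; apply: eq_ler; rewrite /A; ring.
have h2 : (B * u ^+ m') ^+ m <= cn (pe q y) ^+ m.
  apply: lerXn2r; rewrite ?nnegrE ?cn_ge0 ?mulr_ge0 ?exprn_ge0 ?(ltW B0) ?(ltW s0) //.
  by apply: le_trans q1; apply: eq_ler; rewrite /B; ring.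
apply: le_trans h1 _; apply: le_trans (ler_wpM2l c0 h2).
rewrite [(A * _) ^+ m']exprMn [(B * _) ^+ m]exprMn -[(u ^+ m) ^+ m']exprM -[(u ^+ m') ^+ m]exprM (mulnC m' m).
apply: eq_ler.
by move: BM; move: (A ^+ m') (B ^+ m) (u ^+ _) => e f g f0; field; rewrite gt_eqF.
Qed.

Lemma DD_inj p q : inPnd d p -> inPnd d q -> DD d vol p q = 0 -> proj_eq p q.
Proof.
move=> pP qP Dpq; have hp := pP.2; have hq := qP.2.
have Dqp : DD d vol q p = 0 by rewrite DD_sym.
have [v pqv] : exists v, pe p v * pe q v != 0.
  have pqP : inPnd (d + d) (p * q) by split; [rewrite mulf_neq0 ?pP.1 ?qP.1|exact: dhomogM].
  have [v hv] := pe_neq0 pqP; exists v; rewrite /pe -mevalM; exact: hv.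
move: pqv; rewrite mulf_eq0 negb_or => /andP[pv qv].
have v0 : v != 0.
  apply: contraNneq pv => ->; rewrite -(scale0r (0 : Vec R n)) (pe_homog _ _ hp).
  by rewrite expr0n gtn_eqF // mul0r.
have [i vi] : exists i, v i 0 != 0.
  apply: contrapT => h; move/eqP: v0; apply; apply/colP => i; rewrite mxE.
  by apply/eqP; apply: contrapT => /negP h'; apply: h; exists i.
have [j ji] : exists j : 'I_n.+1, j != i.
  have [i0|i0] := eqVneq i ord0; last by exists ord0; rewrite eq_sym.
  by exists ord_max; rewrite i0 -(inj_eq val_inj) /= -lt0n.
(* [phi x != 0] is an open condition, unchanged along [v], which keeps the line [x + t *: v] away
   from the origin, so that its points are projective points. *)
pose phi (x : Vec R n) : R[i] := v j 0 * x i 0 - v i 0 * x j 0.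
have phiv x t : phi (x + t *: v) = phi x by rewrite /phi !mxE; ring.
have phi0 : phi 0 = 0 by rewrite /phi !mxE !mulr0 subrr.
have phic x : ctn phi x.
  have E : phi = fun x => v j 0 * x i 0 + (- v i 0) * x j 0 by apply/funext => y; rewrite /phi mulNr.
  by rewrite E; apply: ctnD; (apply: ctnM; [exact: ctn_cst|exact: ctn_coord]).
(* The base point [x0] maximizes the number of distinct roots of the two forms, which is at most
   [d + d]. *)
pose N (x : Vec R n) := size (undup (rts p v x ++ rts q v x)).
pose good k := `[< exists2 x, phi x != 0 & N x = k >].
have good0 : exists k, good k.
  exists (N (delta_mx j 0)); apply/asboolP; exists (delta_mx j 0) => //.
  by rewrite /phi !mxE !eqxx (negbTE (_ : i != j)) ?(eq_sym i) //= mulr0 mulr1 sub0r oppr_eq0.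
have goodub k : good k -> (k <= d + d)%N.
  move=> /asboolP [x _ <-]; apply: leq_trans (size_undup _) _.
  by rewrite size_cat (rts_spec x hp pv).1 (rts_spec x hq qv).1.
case: (ex_maxnP good0 goodub) => k /asboolP [x0 phix0 Nx0] kmax.
have [r0 r00 hr0] : exists2 r0 : R, 0 < r0 & forall x, vn (x - x0) <= r0 -> phi x != 0.
  have e0 : 0 < cn (phi x0) / 2 by rewrite divr_gt0 // cn_gt0.
  have [r r0 h] := phic x0 _ e0; exists r => // x /h hx.
  rewrite -cn_gt0; have := cnDB (phi x0) (phi x); rewrite cnB; move: hx e0; lra.
pose T := undup (rts p v x0 ++ rts q v x0).
have uT : uniq T by exact: undup_uniq.
have memT b : (b \in T) = (b \in rts p v x0) || (b \in rts q v x0) by rewrite mem_undup mem_cat.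
have hmax x : vn (x - x0) <= r0 -> (size (undup (rts p v x ++ rts q v x)) <= size T)%N.
  by move=> /hr0 px; rewrite -/(N x) -/(N x0) Nx0; apply: kmax; apply/asboolP; exists x.
have [dl [rho [sg [M [dl0 /andP[sg0 sg1] M1 hcl]]]]] := local_clusters hp hq pv qv uT memT r00 hmax.
have hcl' x : vn (x - x0) <= dl -> exists a, clustered q v x0 T rho sg M x a /\ clustered p v x0 T rho sg M x a.
  by move=> /hcl [a [h1 h2]]; exists a.
have mE t : t \in T -> count_mem t (rts p v x0) = count_mem t (rts q v x0).
  move=> tT; have z0 : x0 + t *: v != 0 by apply: contraNneq phix0 => z0; rewrite -(phiv x0 t) z0 phi0.
  apply/eqP; rewrite eqn_leq; apply/andP; split.
    exact: cluster_mult_le pP qP pv qv Dpq dl0 sg0 sg1 M1 hcl tT z0.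
  exact: cluster_mult_le qP pP qv pv Dqp dl0 sg0 sg1 M1 hcl' tT z0.
(* Near [x0] both forms have the same roots in direction [v], so [pe p x / pe p v] and
   [pe q x / pe q v] are the same product; [g] vanishes there. *)
pose g : HPoly R n := pe q v *: p - pe p v *: q.
have hg : is_homog d g by apply: homogB; exact: homogZ.
have gE x : pe g x = pe q v * pe p x - pe p v * pe q x by rewrite peB !peZ.
have g_near x : vn (x - x0) <= dl -> pe g x = 0.
  move=> hx; have [a [[c1 c2 c3 _ _] [c1' c2' c3' _ _]]] := hcl x hx.
  have pq : perm_eq (rts p v x) (rts q v x).
    have cnt r : (forall t, t \in T -> count (fun b => cn (t - b) <= rho) (rts r v x) = count_mem t (rts r v x0)) ->
        (forall b t, b \in rts r v x -> t \in T -> cn (t - b) <= rho -> b = a t) ->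
        forall b t, b = a t -> t \in T -> cn (t - b) <= rho -> count_mem b (rts r v x) = count_mem t (rts r v x0).
      move=> h1 h3 b t bE tT tb; rewrite -h1 //; apply: eq_in_count => b' br /=.
      by apply/eqP/idP => [-> //|h]; rewrite bE; exact: h3.
    have key b : b \in rts p v x ++ rts q v x -> exists2 t, t \in T & b = a t /\ cn (t - b) <= rho.
      rewrite mem_cat => /orP[br|br]; [have [t tT h] := c2 b br|have [t tT h] := c2' b br]; exists t => //.
        by split=> //; exact: c3.
      by split=> //; exact: c3'.
    apply/allP => b /key [t tT [bE h]] /=.
    by rewrite (cnt p c1 c3 b t bE tT h) (cnt q c1' c3' b t bE tT h) mE.
  have [_ /(_ 0) Ep] := rts_spec x hp pv; have [_ /(_ 0) Eq] := rts_spec x hq qv.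
  rewrite scale0r addr0 in Ep Eq; rewrite gE Ep Eq (perm_big _ pq) /=; ring.
have g0 : g = 0.
  apply/eqP; apply: contrapT => /negP gn; have [y gy] := pe_neq0 (conj gn hg).
  pose f := restr g x0 y.
  have f0 : f != 0 by apply: contraNneq gy => fE; rewrite -(restr_top x0 y hg) -/f fE coef0.
  have vy : 0 < vn y + 1 by rewrite ltr_wpDl // vn_ge0.
  have [e e0 eE] : exists2 e, 0 < e & e * (vn y + 1) = dl.
    by exists (dl / (vn y + 1)); [rewrite divr_gt0|rewrite divfK // gt_eqF].
  (* [d.+1] distinct parameters for which [x0 + t *: y] is still within [dl] of [x0]: more roots
     than the degree of [g] on this line allows. *)
  pose rs : seq R[i] := [seq (e / k.+1%:R)%:C%C | k <- iota 0 d.+1].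
  have := max_poly_roots f0 (rs := rs); rewrite size_map size_iota ltnNge size_restr //.
  move=> h; suff : false by []; apply: h.
    apply/allP => z /mapP [k1 _ ->]; rewrite rootE horner_restr; apply/eqP; apply: g_near.
    rewrite addrC addKr vnZ cn_real ger0_norm ?divr_ge0 ?(ltW e0) //.
    rewrite -eE.
    apply: ler_pM; rewrite ?divr_ge0 ?vn_ge0 ?(ltW e0) //; last by rewrite lerDl.
    by rewrite ler_pdivrMr ?ltr0n // ler_peMr ?(ltW e0) // ler1n.
  rewrite map_inj_uniq ?iota_uniq // => k1 l /complexI /(mulfI (lt0r_neq0 e0)) /invr_inj /eqP.
  by rewrite eqr_nat eqSS => /eqP.
exists (pe q v / pe p v); split; first by rewrite mulf_neq0 ?invr_eq0.
move/eqP: g0; rewrite subr_eq0 => /eqP g0.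
by rewrite mulrC -scalerA g0 scalerA mulVf // scale1r.
Qed.

End injectivity.

(** * Compactness of the space of polynomials *)

Lemma ultra_real (R : realType) (U : set_system nat) (a : nat -> R) (B : R) : UltraFilter U ->
  (forall k, `|a k| <= B) -> exists l : R, forall e, 0 < e -> U [set k | (`|a k - l| <= e)%R].
Proof.
move=> UU aB; have PU := @ultra_proper _ _ UU.
have [l [_ hl]] : `[- B, B]%classic `&` cluster (a @ U) !=set0.
  apply: (@segment_compact R (- B) B (a @ U)).
  suff h k : `[- B, B]%classic (a k) by apply: (@filterS _ U _ setT) filterT => k _; exact: h.
  by rewrite /= in_itv /= -ler_norml.
exists l => e e0; have [//|h] := in_ultra_setVsetC [set k | (`|a k - l| <= e)%R] UU.
have [y [/= y1 y2]] := hl (~` [set y | (`|y - l| <= e)%R]) _ h (nbhsx_ballx l e e0).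
by case: y1; rewrite distrC ltW.
Qed.

Lemma ultra_complex (R : realType) (U : set_system nat) (a : nat -> R[i]) (B : R) : UltraFilter U ->
  (forall k, cn (a k) <= B) -> exists l : R[i], forall e, 0 < e -> U [set k | (cn (a k - l) <= e)%R].
Proof.
move=> UU aB.
have [x hx] := ultra_real UU (fun k => le_trans (cn_geRe (a k)) (aB k)).
have [y hy] := ultra_real UU (fun k => le_trans (cn_geIm (a k)) (aB k)).
exists (x +i* y)%C => e e0; have e2 : 0 < e / 2 by lra.
apply: filterS2 (hx _ e2) (hy _ e2) => k /= h1 h2.
by apply: le_trans (cn_leD _) _; rewrite !raddfB /=; lra.
Qed.

Section compactness.
Context (R : realType) (n d : nat) (vol : probability (MT R n) R).
Hypothesis d_gt0 : (0 < d)%N.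
Hypothesis vol2 : vol [set L : MT R n | ~ rank2proj L] = 0%E.
Hypothesis volU : forall U : Mat R n, unitary U ->
  forall A : set (MT R n), measurable A -> vol ((fun L : MT R n => U *m L *m adj U) @^-1` A) = vol A.
Local Notation DD := (DD d vol).

Lemma normalize p : inPnd d p -> exists q : HPoly R n, [/\ inPnd d q, DD q p = 0,
  forall m, cn q@_m <= 1 & \sum_(m : 'X_{1..n.+1 < d.+1}) cn q@_m = 1].
Proof.
move=> [p0 hp]; pose N : R := \sum_(m : 'X_{1..n.+1 < d.+1}) cn p@_m.
have le_N (m : 'X_{1..n.+1 < d.+1}) : cn p@_m <= N.
  by rewrite /N (bigD1 m) //= lerDl; apply: sumr_ge0 => k _; exact: cn_ge0.
have N0 : 0 < N.
  rewrite lt_neqAle eq_sym sumr_ge0 ?andbT => [|m _]; last exact: cn_ge0.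
  apply: contra_neq p0 => N0; rewrite (homog_expand hp) big1 // => m _.
  have : cn p@_m <= 0 by rewrite -N0.
  by rewrite le_eqVlt ltNge cn_ge0 orbF cn_eq0 => /eqP ->; rewrite scale0r.
have c0 : (N^-1)%:C%C != 0 :> R[i] by rewrite -cn_gt0 cn_real gtr0_norm invr_gt0.
have qP : inPnd d ((N^-1)%:C%C *: p) by split; [rewrite scaler_eq0 negb_or c0|exact: homogZ].
have qE m : cn ((N^-1)%:C%C *: p)@_m = N^-1 * cn p@_m.
  by rewrite mcoeffZ cnM cn_real gtr0_norm // invr_gt0.
exists ((N^-1)%:C%C *: p); split=> //.
- by rewrite DD_sym; exact: (DD_scale d_gt0 vol2 volU c0).
- move=> m; rewrite qE mulrC ler_pdivrMr // mul1r.
  have [md|md] := eqVneq (mdeg m) d; last by rewrite (dhomog_nemf_coeff hp md) cn0 ltW.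
  have mb : (mdeg m < d.+1)%N by rewrite md.
  exact: (le_N (BMultinom mb)).
- by rewrite (eq_bigr (fun m : 'X_{1..n.+1 < d.+1} => N^-1 * cn p@_m)) // -mulr_sumr mulVf // gt_eqF.
Qed.

(** Representatives with coefficient moduli of sum 1 converge coefficientwise along [U]; the
    normalization keeps the limit nonzero, and [DD_cont] turns this into convergence for [DD]. *)
Lemma DD_compact (U : set_system nat) (x : nat -> HPoly R n) : UltraFilter U ->
  (forall k, inPnd d (x k)) -> exists2 p, inPnd d p & forall e : R, 0 < e -> U [set k | (DD (x k) p <= e)%R].
Proof.
move=> UU xV; have PU := @ultra_proper _ _ UU.
have [y hy] := choice (fun k => normalize (xV k)).
have yb m k : cn (y k)@_m <= 1 by case: (hy k).
have [c hc] := choice (fun m => ultra_complex UU (yb m)).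
pose p : HPoly R n := \sum_(m : 'X_{1..n.+1 < d.+1}) c m *: 'X_[m].
have pE (m : 'X_{1..n.+1 < d.+1}) : p@_m = c m by rewrite mcoeff_mpoly // bmdeg.
have near_p (e : R) : 0 < e -> U [set k | forall m : 'X_{1..n.+1 < d.+1}, (cn ((y k)@_m - p@_m) <= e)%R].
  move=> e0; apply: filter_forall => m; rewrite pE; exact: hc.
have p_homog : is_homog d p.
  rewrite /is_homog; apply: rpred_sum => m _.
  have [md|md] := eqVneq (mdeg m) d; first by apply: dhomogZ; rewrite dhomogX; apply/eqP.
  suff -> : c m = 0 by rewrite scale0r rpred0.
  apply/eqP; rewrite -cn_eq0 eq_le cn_ge0 andbT; apply/ler_addgt0Pr => e e0; rewrite add0r.
  have [k /=] := filter_ex (hc m _ e0); have [[_ yh] _ _ _] := hy k.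
  by rewrite (dhomog_nemf_coeff yh md) sub0r cnN.
have p_neq0 : p != 0.
  apply/eqP => p0; pose K : R := #|{: 'X_{1..n.+1 < d.+1}}|%:R + 1.
  have K0 : 0 < K by rewrite ltr_wpDl.
  have K1 : 0 < (2 * K)^-1 by rewrite invr_gt0 mulr_gt0.
  have [k /= h] := filter_ex (near_p _ K1).
  have [_ _ _ s1] := hy k.
  have : 1 <= #|{: 'X_{1..n.+1 < d.+1}}|%:R * (2 * K)^-1.
    rewrite -{1}s1; apply: le_trans (_ : \sum_(m : 'X_{1..n.+1 < d.+1}) (2 * K)^-1 <= _).
      by apply: ler_sum => m _; have := h m; rewrite p0 mcoeff0 subr0.
    by rewrite sumr_const -[leLHS]mulr_natl.
  rewrite ler_pdivlMr ?mulr_gt0 // mul1r /K; have : 0 <= #|{: 'X_{1..n.+1 < d.+1}}|%:R :> R by [].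
  by move: (#|_|%:R : R) => t; lra.
have pP : inPnd d p by [].
exists p => // e e0; have [r r0 hr] := DD_cont d_gt0 vol2 volU pP e0.
apply: filterS (near_p r r0) => k /= h; have [yP yx _ _] := hy k.
rewrite DD_sym; apply: le_trans (DD_triangle d_gt0 vol2 volU pP yP (xV k)) _; rewrite yx addr0.
by apply: hr => // m; rewrite cnB.
Qed.

End compactness.

(** * Length of chains and Lipschitz curves *)

Section length_metric.
Context (R : realType) (T : eqType) (V : T -> Prop) (D : T -> T -> R).
Hypothesis D_ge0 : forall x y, 0 <= D x y.
Hypothesis D_sym : forall x y, D x y = D y x.
Hypothesis D_refl : forall x, V x -> D x x = 0.
Hypothesis D_tri : forall x y z, V x -> V y -> V z -> D x z <= D x y + D y z.
Hypothesis D_compact : forall (U : set_system nat) (x : nat -> T), UltraFilter U ->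
  (forall k, V (x k)) -> exists2 p, V p & forall e : R, 0 < e -> U [set k | (D (x k) p <= e)%R].
Hypothesis D_chain : forall p q, V p -> V q -> exists L : R, forall e : R, 0 < e -> chn V D e p q L.
Implicit Types (p q : T) (s : seq T) (t L e : R).

(* The position at time [t] on a walk along the chain at unit speed, waiting at the vertices. *)
Fixpoint at_time p s t : T :=
  if s is x :: s' then if D p x <= t then at_time x s' (t - D p x) else p else p.

Lemma at_time_V p s t : V p -> (forall x, x \in s -> V x) -> V (at_time p s t).
Proof.
elim: s p t => [|x s IH] p t //= Vp Vs; case: ifP => // _.
by apply: IH => [|y ys]; apply: Vs; rewrite inE ?eqxx // ys orbT.
Qed.

Lemma at_time_dist p s t : V p -> (forall x, x \in s -> V x) -> 0 <= t -> D p (at_time p s t) <= t.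
Proof.
elim: s p t => [|x s IH] p t /= Vp Vs t0; first by rewrite D_refl.
case: ifP => [h|_]; last by rewrite D_refl.
have Vx : V x by apply: Vs; rewrite inE eqxx.
have Vs' y : y \in s -> V y by move=> ys; apply: Vs; rewrite inE ys orbT.
apply: le_trans (D_tri Vp Vx (at_time_V _ Vx Vs')) _.
by rewrite -lerBrDl; apply: IH => //; rewrite subr_ge0.
Qed.

(** Waiting at a vertex delays the position by less than one step, whence the additive [e]. *)
Lemma at_time_lip e p s t t' : 0 <= e -> V p -> (forall x, x \in s -> V x) -> path (fun x y => D x y <= e) p s ->
  0 <= t -> t <= t' -> D (at_time p s t) (at_time p s t') <= t' - t + e.
Proof.
move=> e0; elim: s p t t' => [|x s IH] p t t' /= Vp Vs hs t0 tt'; first by rewrite D_refl //; lra.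
have Vx : V x by apply: Vs; rewrite inE eqxx.
have Vs' y : y \in s -> V y by move=> ys; apply: Vs; rewrite inE ys orbT.
case/andP: hs => hx hs.
case: ifP => h1; case: ifP => h2.
- have -> : t' - t = (t' - D p x) - (t - D p x) by ring.
  by apply: IH => //; lra.
- by move: h1 h2; lra.
- have h3 : 0 <= t' - D p x by rewrite subr_ge0.
  have := at_time_dist Vx Vs' h3; have := D_tri Vp Vx (at_time_V (t' - D p x) Vx Vs').
  by move: h1 hx; lra.
- by rewrite D_refl //; lra.
Qed.

Lemma at_time_last p s t : walk D p s <= t -> at_time p s t = last p s.
Proof.
elim: s p t => [|x s IH] p t //= h.
have h0 : 0 <= walk D x s by elim: (s) (x) => //= y s' IH' z; rewrite addr_ge0.
by rewrite ifT; [apply: IH; lra|lra].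
Qed.

(** Chains of mesh and excess length [k.+1%:R^-1] are traversed at constant speed on the unit
    interval, and at each time the limit is taken along one ultrafilter finer than the filter at
    infinity. The additive errors of [at_time_lip] disappear in the limit. *)
Lemma chn_curve p q L : V p -> V q -> 0 <= L -> (forall e, 0 < e -> chn V D e p q (L + e)) ->
  exists g : R -> T, [/\ forall t, V (g t), D p (g 0) = 0, D q (g 1) = 0 &
    forall s t : R, 0 <= s -> s <= t -> D (g s) (g t) <= L * (t - s)].
Proof.
move=> Vp Vq L0 hc.
have e_gt0 k : 0 < k.+1%:R^-1 :> R by [].
have [s hs] := choice (fun k => hc _ (e_gt0 k)).
have [U [UU hU]] := ultraFilterLemma (eventually_filter); have PU := @ultra_proper _ _ UU.
have Ue e : 0 < e -> U [set k | (k.+1%:R^-1 <= e)%R].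
  move=> e0; apply: hU; apply: filterS (near_infty_natSinv_lt (PosNum e0)) => k /=; exact: ltW.
pose y (t : R) k := at_time p (s k) (t * (L + k.+1%:R^-1)).
have Vy t k : V (y t k) by have [_ _ h _] := hs k; exact: at_time_V.
have [g hg] := choice (fun t => let: ex_intro2 x a b := D_compact UU (Vy t) in ex_intro _ x (conj a b)).
have Vg t : V (g t) by case: (hg t).
have gy t e : 0 < e -> U [set k | (D (y t k) (g t) <= e)%R] by case: (hg t) => _; apply.
have zero x t : V x -> (forall k, D x (y t k) <= 0) -> D x (g t) = 0.
  move=> Vx h; apply/eqP; rewrite eq_le D_ge0 andbT; apply/ler_addgt0Pr => e e0.
  by have [k /= hk] := filter_ex (gy t e e0); apply: le_trans (D_tri Vx (Vy t k) (Vg t)) _; exact: lerD.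
exists g; split=> //.
- by apply: zero => // k; rewrite /y mul0r; have [s1 s2 s3 s4] := hs k; exact: at_time_dist.
- by apply: zero => // k; rewrite /y mul1r; have [_ s2 _ s4] := hs k; rewrite at_time_last // s2 D_refl.
move=> a b a0 ab; have b0 : 0 <= b by exact: le_trans ab.
apply/ler_addgt0Pr => e e0; have e1 : 0 < e / (b + 4) by rewrite divr_gt0 //; lra.
have [k /= [[h1 h2] h3]] := filter_ex (filterI (filterI (gy a _ e1) (gy b _ e1)) (Ue _ e1)).
have [s1 s2 s3 s4] := hs k; have ek := e_gt0 k.
have h4 : D (y a k) (y b k) <= (b - a) * (L + k.+1%:R^-1) + k.+1%:R^-1.
  have Lk : 0 <= L + k.+1%:R^-1 by rewrite addr_ge0 // ltW.
  rewrite mulrBl; exact: at_time_lip (ltW ek) Vp s3 s1 (mulr_ge0 a0 Lk) (ler_wpM2r Lk ab).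
have h5 := D_tri (Vg a) (Vy a k) (Vg b); have h6 := D_tri (Vy a k) (Vy b k) (Vg b).
rewrite (D_sym (g a) (y a k)) in h5.
have h7 : (b - a) * k.+1%:R^-1 <= b * (e / (b + 4)).
  by apply: ler_pM; [rewrite subr_ge0|exact: ltW|rewrite lerBlDr lerDl|].
have h8 : e = b * (e / (b + 4)) + 4 * (e / (b + 4)) by field; rewrite gt_eqF //; lra.
rewrite mulrDr in h4; apply: le_trans h5 _; apply: le_trans (lerD h1 h6) _.
apply: le_trans (lerD (lexx _) (lerD h4 h2)) _.
rewrite {3}h8; apply: le_trans (_ : L * (b - a) + (e / (b + 4) + (b - a) * k.+1%:R^-1 + k.+1%:R^-1 + e / (b + 4)) <= _).
  by apply: eq_ler; ring.
rewrite lerD2l; move: h3 h7 e1; move: (e / _) k.+1%:R^-1 => u w; move: (_ * w) (b * u) => v z; lra.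
Qed.

Lemma lip_chn (g : R -> T) L a b e : (forall t, 0 <= t <= 1 -> V (g t)) -> 0 <= L ->
  (forall s t : R, 0 <= s -> s <= t -> t <= 1 -> D (g s) (g t) <= L * (t - s)) ->
  0 <= a -> a <= b -> b <= 1 -> 0 < e -> chn V D e (g a) (g b) (L * (b - a)).
Proof.
move=> Vg L0 hg a0 ab b1 e0.
pose N := (Num.truncn (L / e)).+1.
have NR : 0 < N%:R :> R by [].
have LN : L / N%:R <= e.
  by rewrite ler_pdivrMr // mulrC -ler_pdivrMr // ltW // truncnS_gt.
pose t k := a + (b - a) * (k%:R / N%:R).
have tS k : t k.+1 - t k = (b - a) / N%:R.
  by rewrite /t -[k.+1]addn1 natrD; field; rewrite gt_eqF.
have kN k : (k <= N)%N -> 0 <= (k%:R / N%:R : R) <= 1.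
  by move=> h; rewrite divr_ge0 //= ler_pdivrMr // mul1r ler_nat.
have t01 k : (k <= N)%N -> 0 <= t k <= 1.
  move=> /kN /andP[h0 h1]; have ba : 0 <= b - a by rewrite subr_ge0.
  have := mulr_ge0 ba h0; have := ler_wpM2l ba h1; rewrite mulr1 /t; lra.
have st k : (k < N)%N -> D (g (t k)) (g (t k.+1)) <= L * ((b - a) / N%:R).
  move=> h; have /andP[u0 u1] := t01 _ (ltnW h); have /andP[v0 v1] := t01 _ h.
  by rewrite -(tS k); apply: hg => //; rewrite -subr_ge0 tS divr_ge0 // subr_ge0.
have E : chn V D e (g (t 0%N)) (g (t N)) (\sum_(k < N) L * ((b - a) / N%:R)).
  apply: (chn_iter (y := g \o t) (l := fun=> _)) => k h; split; [exact/Vg/t01|..|exact: st].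
  apply: le_trans (st k h) _; apply: le_trans LN.
  rewrite mulrA ler_pM2r ?invr_gt0 // ler_piMr //; lra.
have e0E : t 0%N = a by rewrite /t mul0r mulr0 addr0.
have e1E : t N = b by rewrite /t mulfV ?gt_eqF // mulr1; ring.
rewrite e0E e1E in E; apply: chn_le (lexx e) _ E.
rewrite sumr_const card_ord -mulr_natr; by apply: eq_ler; field; rewrite gt_eqF.
Qed.

(** The mesh condition is essential: without it the triangle inequality would reduce the infimum
    [ell] to [D] itself. *)
Definition lens p q : set R := [set L | 0 <= L /\ forall e, 0 < e -> chn V D e p q (L + e)].
Definition ell p q : R := inf (lens p q).

Lemma ell_le p q L : 0 <= L -> (forall e, 0 < e -> chn V D e p q (L + e)) -> ell p q <= L.
Proof. by move=> L0 h; apply: ge_inf; [exists 0 => x []|split]. Qed.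

Lemma lens_neq0 p q : V p -> V q -> lens p q !=set0.
Proof.
move=> Vp Vq; have [L hL] := D_chain Vp Vq; exists `|L|; split=> // e e0.
by apply: chn_le (lexx e) _ (hL e e0); have := ler_norm L; lra.
Qed.

Lemma ell_ge0 p q : V p -> V q -> 0 <= ell p q.
Proof. by move=> Vp Vq; apply: lb_le_inf; [exact: lens_neq0|move=> x []]. Qed.

Lemma ell_chn p q e : V p -> V q -> 0 < e -> chn V D e p q (ell p q + e).
Proof.
move=> Vp Vq e0; have e2 : 0 < e / 2 by lra.
have hi : has_inf (lens p q) by split; [exact: lens_neq0|exists 0 => x []].
have [L [L0 hL] Le] := inf_adherent e2 hi.
by apply: chn_le (hL _ e2); rewrite /ell; lra.
Qed.

Lemma ell_sym_le p q : V p -> V q -> ell q p <= ell p q.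
Proof.
move=> Vp Vq; apply: ell_le; first exact: ell_ge0.
by move=> e e0; apply: chn_sym => //; exact: ell_chn.
Qed.

Lemma ell_sym p q : V p -> V q -> ell p q = ell q p.
Proof. by move=> Vp Vq; apply/le_anti; rewrite !ell_sym_le. Qed.

Lemma ell_tri p q r : V p -> V q -> V r -> ell p r <= ell p q + ell q r.
Proof.
move=> Vp Vq Vr; apply: ell_le; first by rewrite addr_ge0 // ell_ge0.
move=> e e0; have e2 : 0 < e / 2 by lra.
by apply: chn_le (chn_cat (ell_chn Vp Vq e2) (ell_chn Vq Vr e2)); lra.
Qed.

Lemma ell_eq0 p q : V p -> V q -> D p q = 0 -> ell p q = 0.
Proof.
move=> Vp Vq h; apply/eqP; rewrite eq_le ell_ge0 // andbT; apply: ell_le => // e e0.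
by apply: chn_one => //; rewrite h ?add0r ltW.
Qed.

Lemma D_le_ell p q : V p -> V q -> D p q <= ell p q.
Proof.
move=> Vp Vq; apply/ler_addgt0Pr => e e0; have [s [_ <- s3 s4]] := ell_chn Vp Vq e0.
apply: le_trans s4; elim: s p Vp s3 {Vq} => [|x s IH] p Vp Vs /=; first by rewrite D_refl.
have Vx : V x by apply: Vs; rewrite inE eqxx.
have Vs' y : y \in s -> V y by move=> ys; apply: Vs; rewrite inE ys orbT.
have Vl : V (last x s).
  by elim: (s) (x) Vx Vs' => //= y s' IH' z Vz h; apply: IH' => [|w ws]; apply: h; rewrite inE ?eqxx // ws orbT.
by apply: le_trans (D_tri Vp Vx Vl) _; rewrite lerD2l; exact: IH.
Qed.

(** The Lipschitz bound gives [<=] for the length of every piece; the three pieces [[0, s]],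
    [[s, t]], [[t, 1]] add up to at least [ell p q], so each is an equality. *)
Lemma ell_geodesic p q : V p -> V q -> exists g : R -> T, [/\ forall t, V (g t), D p (g 0) = 0, D q (g 1) = 0,
  forall s t : R, 0 <= s -> s <= t -> D (g s) (g t) <= ell p q * (t - s) &
  forall s t : R, 0 <= s -> s <= t -> t <= 1 -> ell (g s) (g t) = ell p q * (t - s)].
Proof.
move=> Vp Vq; have l0 := ell_ge0 Vp Vq.
have [g [Vg g0 g1 hg]] := chn_curve Vp Vq l0 (fun e => ell_chn Vp Vq).
exists g; split=> //.
have ub (s t : R) : 0 <= s -> s <= t -> t <= 1 -> ell (g s) (g t) <= ell p q * (t - s).
  move=> s0 st t1; apply: ell_le; first by rewrite mulr_ge0 // subr_ge0.
  move=> e e0; have := @lip_chn g (ell p q) s t e (fun t _ => Vg t) l0 (fun a b x y _ => hg a b x y) s0 st t1 e0.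
  by apply: chn_le => //; rewrite lerDl ltW.
move=> s t s0 st t1; apply/eqP; rewrite eq_le ub //=.
have h1 := ell_tri Vp (Vg 0) Vq; have h2 := ell_tri (Vg 0) (Vg s) Vq; have h3 := ell_tri (Vg s) (Vg t) Vq.
have h4 := ell_tri (Vg t) (Vg 1) Vq; rewrite (ell_eq0 Vp (Vg 0) g0) in h1.
rewrite (ell_sym (Vg 1) Vq) (ell_eq0 Vq (Vg 1) g1) in h4.
have h5 := ub 0 s (lexx 0) s0 (le_trans st t1); have h6 := ub t 1 (le_trans s0 st) t1 (lexx 1).
by move: h1 h2 h3 h4 h5 h6; rewrite !mulrBr; lra.
Qed.

(** A chain from [x k] to a remote [x l] is continued by one step to the limit [p]; a chain asks of
    this step only that it be short in [D]. *)
Lemma ell_complete (x : nat -> T) : (forall k, V (x k)) ->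
  (forall e, 0 < e -> exists N, forall k l, (N <= k)%N -> (N <= l)%N -> ell (x k) (x l) < e) ->
  exists2 p, V p & forall e, 0 < e -> exists N, forall k, (N <= k)%N -> ell (x k) p <= e.
Proof.
move=> Vx hx; have [U [UU hU]] := ultraFilterLemma (eventually_filter); have PU := @ultra_proper _ _ UU.
have [p Vp hp] := D_compact UU Vx; exists p => // e e0.
have [N hN] := hx e e0; exists N => k kN; apply: ell_le; first exact: ltW.
move=> a a0; have a2 : 0 < a / 2 by lra.
have UN : U [set l | (N <= l)%N] by apply: hU; exists N.
have [l /= [Nl h]] := filter_ex (filterI UN (hp _ a2)).
have c1 := chn_one Vp h (lexx _); have := chn_cat (ell_chn (Vx k) (Vx l) a2) c1.
by apply: chn_le; move: h (hN k l kN Nl); lra.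
Qed.

End length_metric.

(** * Absolutely continuous functions *)

Section primitives.
Context (R : realType).
Local Notation mu := (@lebesgue_measure R).
Local Notation itg f := (mu.-integrable [set: R] (EFin \o f)).
Implicit Types (f g h : R -> R) (s t x e : R).

Definition prim f t : R := \int[mu]_(x in `]-oo, t]) f x.

Lemma itg_sub f (A : set R) : measurable A -> itg f -> mu.-integrable A (EFin \o f).
Proof. by move=> mA; exact: integrableS. Qed.

Lemma primE f s t : itg f -> s <= t -> prim f t - prim f s = \int[mu]_(x in `]s, t]) f x.
Proof.
by move=> fi st; rewrite /prim Rintegral_itvB ?bnd_simp //; exact: itg_sub.
Qed.

Lemma prim_le f g s t : itg f -> itg g -> (forall x, f x <= g x) -> s <= t ->
  prim f t - prim f s <= prim g t - prim g s.
Proof. by move=> fi gi fg st; rewrite !primE //; apply: le_Rintegral => //; exact: itg_sub. Qed.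

Lemma prim_mono f s t : itg f -> (forall x, 0 <= f x) -> s <= t -> prim f s <= prim f t.
Proof. by move=> fi f0 st; rewrite -subr_ge0 primE //; apply: Rintegral_ge0. Qed.

Lemma mu_oc s t : s <= t -> mu `]s, t] = (t - s)%:E.
Proof.
move=> st; rewrite lebesgue_measure_itv /= lte_fin; case: ltP => [//|ts].
by have -> : t = s by [apply/le_anti; rewrite ts st]; rewrite subrr.
Qed.

Lemma prim_small f e : itg f -> (forall x, 0 <= f x) -> 0 < e -> exists2 a : R, 0 < a &
  forall s t, s <= t -> t - s < a -> prim f t - prim f s < e.
Proof.
move=> fi f0 e0; have [a [a0 ha]] := integral_normr_continuous fi e0.
exists a => // s t st ta; rewrite primE //.
have hm : (mu `]s, t] < a%:E)%E by rewrite mu_oc.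
apply: le_lt_trans (ha _ (measurable_itv _) hm); apply: eq_ler.
by apply: eq_Rintegral => x _; rewrite ger0_norm.
Qed.

(** Lebesgue's differentiation theorem, in epsilon form. *)
Lemma prim_deriv f : itg f -> {ae mu, forall x, forall e, 0 < e -> exists2 a : R, 0 < a &
  forall h : R, h != 0 -> `|h| < a -> `|(prim f (x + h) - prim f x) / h - f x| <= e}.
Proof.
move=> fi; have fl := integrable_locally measurableT fi; rewrite patch_setT in fl.
have := FTC1Ny (fun y => itg_sub (measurable_itv _) fi) fl; rewrite /= -/prim.
apply: filterS; first exact: (ae_filter_ringOfSetsType mu).
move=> x [dF Fx] e e0; move: dF; rewrite /derivable => /cvg_ex [l hl].
have lE : l = f x by rewrite -Fx derive1E /derive; apply/esym/cvg_lim.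
move/cvgrPdist_le: hl => /(_ e e0); rewrite lE => -[a /= a0 ha].
exists a => // h h0 hax; have := ha h; rewrite /ball_ /= sub0r normrN => /(_ hax h0).
have -> : h%:A = h :> R by rewrite /GRing.scale /= mulr1.
by rewrite distrC (addrC h) -/(prim f (x + h)) -/(prim f x) /GRing.scale /= mulrC.
Qed.

Lemma cumulative_of (F : R -> R) : nondecreasing F ->
  (forall e, 0 < e -> exists2 a : R, 0 < a & forall s t, s <= t -> t - s < a -> F t - F s < e) ->
  exists G : cumulative R R, (G : R -> R) = F.
Proof.
move=> nF cF; have rF : forall x, F y @[y --> x^'+] --> F x.
  move=> x; apply/cvgrPdist_lt => e e0; have [a a0 ha] := cF e e0.
  near=> y; have xy : x <= y by near: y; exact: nbhs_right_ge.
  rewrite distrC ger0_norm ?subr_ge0 ?nF //; apply: ha => //.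
  by rewrite ltrBlDl; near: y; apply: nbhs_right_lt; rewrite ltrDl.
by exists (HB.pack_for (cumulative R R) F (isCumulative.Build R _ R F nF rF)).
Unshelve. all: by end_near. Qed.

Lemma LS_itv (F : cumulative R R) (A : set R) : ocitv A -> lebesgue_stieltjes_measure F A = wlength F A.
Proof. by move=> mA; rewrite /lebesgue_stieltjes_measure /measure_extension measurable_mu_extE. Qed.

Lemma wlength_oc (F : R -> R) s t : s <= t -> wlength F `]s, t]%classic = (F t - F s)%:E.
Proof. by move=> st; rewrite wlength_itv_bnd. Qed.

(** Compares the two outer measures cover by cover. *)
Lemma LS_le (F K : cumulative R R) (A : set R) : (forall s t, s <= t -> F t - F s <= K t - K s) ->
  (lebesgue_stieltjes_measure F A <= lebesgue_stieltjes_measure K A)%E.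
Proof.
move=> FK; rewrite /lebesgue_stieltjes_measure /measure_extension.
apply: le_ereal_inf_tmp => _ [C [mC AC] <-].
apply: ge_ereal_inf; exists (\sum_(0 <= k <oo) wlength F (C k))%E; first by exists C.
apply: lee_nneseries => [k _ _|k _]; first exact: wlength_ge0.
have [->|[[a b] /= ab ->]] := (ocitvP _).1 (mC k); first by rewrite !wlength0.
by rewrite !wlength_oc ?lee_fin ?FK // ltW.
Qed.

(** Both sides are measures that agree on half-open intervals. *)
Lemma LS_prim (K : cumulative R R) g (A : set (measurableTypeR R)) : itg g -> (forall x, 0 <= g x) ->
  (K : R -> R) = prim g -> measurable A ->
  lebesgue_stieltjes_measure K A = (\int[mu]_(x in A) (g x)%:E)%E.
Proof.
move=> gi g0 KE mA.
pose nu (B : set (measurableTypeR R)) : \bar R := (\int[mu]_(x in B) (EFin \o g) x)%E.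
have nu0 : nu set0 = 0%E by rewrite /nu integral_set0.
have nu_ge0 B : (0 <= nu B)%E by apply: integral_ge0 => x _; rewrite lee_fin.
have nu_sig : semi_sigma_additive nu.
  apply: semi_sigma_additive_nng_induced; first exact: measurable_int gi.
  by move=> x; rewrite lee_fin.
pose Nu : {measure set (measurableTypeR R) -> \bar R} := HB.pack nu (isMeasure.Build _ _ _ nu nu0 nu_ge0 nu_sig).
apply: (@lebesgue_stieltjes_measure_unique _ K Nu) => // X mX; rewrite LS_itv //.
have [->|[[a b] /= /ltW ab ->]] := (ocitvP _).1 mX; first by rewrite wlength0 [RHS]nu0.
rewrite wlength_oc // KE primE // /Rintegral fineK //.
by apply: integrable_fin_num => //; exact: itg_sub.
Qed.

(* The Lebesgue--Stieltjes measure of [prim g + f] is dominated by [2 g] times the Lebesgue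
   measure, hence has a density. *)
Lemma ac_deriv f g : itg g -> (forall x, 0 <= g x) ->
  (forall s t, s <= t -> `|f t - f s| <= prim g t - prim g s) ->
  exists p : R -> R, [/\ itg p, forall x, `|p x| <= g x &
    forall s t, s <= t -> f t - f s = prim p t - prim p s].
Proof.
move=> gi g0 fg.
pose F t := prim g t + f t; pose h x := g x + g x.
have hi : itg h by apply: (integrableD measurableT gi gi).
have h0 x : 0 <= h x by rewrite addr_ge0.
have primD s t : s <= t -> prim h t - prim h s = (prim g t - prim g s) + (prim g t - prim g s).
  by move=> st; rewrite (primE hi st) (primE gi st) RintegralD //; exact: itg_sub.
have fgb s t : s <= t -> - (prim g t - prim g s) <= f t - f s <= prim g t - prim g s.
  by move=> st; rewrite -ler_norml fg.
have nF : nondecreasing F by move=> s t st; have := fgb _ _ st; rewrite /F; lra.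
have Fh s t : s <= t -> F t - F s <= prim h t - prim h s.
  by move=> st; rewrite primD //; have := fgb _ _ st; rewrite /F; lra.
have [FC FCE] : exists G : cumulative R R, (G : R -> R) = F.
  apply: cumulative_of => // e e0; have [a a0 ha] := prim_small hi h0 e0.
  by exists a => // s t st ta; apply: le_lt_trans (Fh _ _ st) _; exact: ha.
have [HC HCE] : exists G : cumulative R R, (G : R -> R) = prim h.
  by apply: cumulative_of => [s t st|e e0]; [exact: prim_mono|exact: prim_small].
have nub (A : set (measurableTypeR R)) : measurable A ->
    (lebesgue_stieltjes_measure FC A <= \int[mu]_(x in A) (h x)%:E)%E.
  move=> mA; rewrite -(LS_prim hi h0 HCE mA); apply: LS_le => s t st.
  by rewrite FCE HCE; exact: Fh.
have fin_nu : fin_num_fun (lebesgue_stieltjes_measure FC).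
  move=> A mA; rewrite ge0_fin_numE ?measure_ge0 //; apply: le_lt_trans (nub A mA) _.
  rewrite ltey_eq integrable_fin_num //; exact: itg_sub.
pose nu : {finite_measure set (measurableTypeR R) -> \bar R} :=
  HB.pack (lebesgue_stieltjes_measure FC) (Measure_isFinite.Build _ _ _ (lebesgue_stieltjes_measure FC) fin_nu).
have nuE A : nu A = lebesgue_stieltjes_measure FC A by [].
have mh : measurable_fun [set: R] h by move/measurable_int: hi => /measurable_EFinP.
have dom : nu `<< mu.
  apply/null_content_dominatesP => A mA A0; apply/eqP; rewrite eq_le measure_ge0 andbT.
  rewrite nuE; apply: le_trans (nub A mA) _; rewrite null_set_integral //.
  by apply/measurable_EFinP; exact: measurable_funTS mh.
have [q [q0 qf qi qE]] := radon_nikodym_sigma_finite dom.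
(* Truncating the density at [h] makes the bound by [2 * g] hold at every point, and leaves the
   integrals unchanged because [nu] is dominated by [h] times the Lebesgue measure. *)
pose r x := Num.min (fine (q x)) (h x).
have mq : measurable_fun [set: R] (fine \o q) by apply: measurableT_comp => //; exact: measurable_int qi.
have r0 x : 0 <= r x by rewrite le_min h0 andbT fine_ge0.
have mr : measurable_fun [set: R] r by exact: measurable_minr.
have ri : itg r.
  apply: (le_integrable measurableT _ _ hi); first exact/measurable_EFinP.
  by move=> x _; rewrite /= lee_fin !ger0_norm // ge_min lexx orbT.
have rE (A : set (measurableTypeR R)) : measurable A -> (nu A = \int[mu]_(x in A) (r x)%:E)%E.
  move=> mA; pose B := [set x | (fine (q x) <= h x)%R].
  have mB : measurable B by rewrite -[B]setTI; exact: measurable_fun_ler.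
  have sp (X : set (measurableTypeR R)) (k : R -> R) : measurable_fun [set: R] k -> (forall x, 0 <= k x) -> measurable X ->
      (\int[mu]_(x in X) (k x)%:E = \int[mu]_(x in X `&` B) (k x)%:E + \int[mu]_(x in X `&` ~` B) (k x)%:E)%E.
    move=> mk k0 mX; rewrite -ge0_integral_setU.
    + by rewrite -setIUr setUv setIT.
    + exact: measurableI.
    + by apply: measurableI => //; exact: measurableC.
    + by apply/measurable_EFinP; exact: measurable_funTS.
    + by move=> x _; rewrite lee_fin.
    + by apply/disj_setPS => x [[_ ?] [_ ?]].
  have qE' X : measurable X -> (nu X = \int[mu]_(x in X) (fine (q x))%:E)%E.
    by move=> mX; rewrite qE //; apply: eq_integral => x _; rewrite fineK.
  rewrite qE' // sp // => [|x]; last exact: fine_ge0.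
  rewrite [RHS]sp //; congr (_ + _)%E.
    by apply: eq_integral => x /set_mem [_ xB]; rewrite /r min_l.
  have mX : measurable (A `&` ~` B) by apply: measurableI => //; exact: measurableC.
  have rh : (\int[mu]_(x in A `&` ~` B) (r x)%:E = \int[mu]_(x in A `&` ~` B) (h x)%:E)%E.
    apply: eq_integral => x /set_mem [_ xB]; rewrite /r min_r // ltW // ltNge; exact/negP.
  apply/eqP; rewrite eq_le; apply/andP; split; first by rewrite rh -qE'; [exact: nub|].
  apply: ge0_le_integral => //.
  + by move=> x _; rewrite lee_fin.
  + by apply/measurable_EFinP; exact: measurable_funTS.
  + by apply/measurable_EFinP; exact: measurable_funTS.
  + by move=> x _; rewrite lee_fin ge_min lexx.
exists (fun x => r x - g x); split; first exact: (integrableB measurableT ri gi).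
  move=> x; rewrite ler_norml; have := r0 x; have : r x <= h x by rewrite ge_min lexx orbT.
  by rewrite /h; move: (r x) (g x) => a b; lra.
move=> s t st; rewrite primE //; last exact: (integrableB measurableT ri gi).
rewrite RintegralB //; [|exact: itg_sub..].
have -> : f t - f s = (F t - F s) - (prim g t - prim g s) by rewrite /F; ring.
rewrite (primE gi st); congr (_ - _).
have : nu `]s, t]%classic = (F t - F s)%:E.
  by rewrite nuE LS_itv ?wlength_oc ?FCE //; exact: is_ocitv.
by rewrite rE // /Rintegral => ->.
Qed.

End primitives.

(** * Metric derivative of an absolutely continuous curve *)

Section metric_derivative.
Context (R : realType) (T : Type) (V : T -> Prop) (D : T -> T -> R).
Hypothesis D_sym : forall x y, D x y = D y x.
Hypothesis D_tri : forall x y z, V x -> V y -> V z -> D x z <= D x y + D y z.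
Local Notation mu := (@lebesgue_measure R).
Local Notation itg f := (mu.-integrable [set: R] (EFin \o f)).

(* [M] is the supremum over the rationals [r] of the absolute values of the densities of
   [fun t => D (c t) (c r)]. *)
Lemma metric_deriv (c : R -> T) (m : R -> R) : (forall t, V (c t)) -> itg m -> (forall x, 0 <= m x) ->
  (forall s t, s <= t -> D (c s) (c t) <= prim m t - prim m s) ->
  exists M : R -> R, [/\ itg M, forall x, 0 <= M x,
    forall s t, s <= t -> D (c s) (c t) <= prim M t - prim M s &
    {ae mu, forall x, forall e : R, 0 < e -> exists2 a : R, 0 < a &
      forall h : R, h != 0 -> `|h| < a -> `|D (c (x + h)) (c x) / `|h| - M x| <= e}].
Proof.
move=> Vc mi m0 hm.
pose r (k : nat) : R := if unpickle k is Some q then ratr (q : rat) else 0.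
have fle s t k : `|D (c t) (c (r k)) - D (c s) (c (r k))| <= D (c s) (c t).
  have := D_tri (Vc t) (Vc s) (Vc (r k)); have := D_tri (Vc s) (Vc t) (Vc (r k)).
  by rewrite (D_sym (c t) (c s)) ler_norml; lra.
have hac k := ac_deriv mi m0 (fun s t st => le_trans (fle s t k) (hm s t st)).
have [p hp] := choice hac.
have p_itg k : itg (p k) by case: (hp k).
have p_le k x : `|p k x| <= m x by case: (hp k).
have pE k s t : D (c t) (c (r k)) - D (c s) (c (r k)) = prim (p k) t - prim (p k) s.
  case: (hp k) => _ _ h; have [st|/ltW ts] := leP s t; first exact: h.
  by apply: oppr_inj; rewrite !opprB; exact: h.
pose M x := sups (fun k => `|p k x|) 0%N.
have ub x : has_ubound (range (fun k => `|p k x|)) by exists (m x) => _ [k _ <-].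
have supE x : M x = sup (range (fun k => `|p k x|)).
  by rewrite /M /sups /sdrop; congr sup; apply/seteqP; split=> y [k _ <-]; exists k.
have p_le_M k x : `|p k x| <= M x by rewrite supE; apply: ub_le_sup => //; exists k.
have M_le x : M x <= m x.
  by rewrite supE; apply: ge_sup; [exists `|p 0%N x|; exists 0%N|move=> _ [k _ <-]].
have M0 x : 0 <= M x by apply: le_trans (p_le_M 0%N x).
have mM : measurable_fun [set: R] M.
  apply: measurable_fun_sups => // k; apply: measurableT_comp => //.
  by move/measurable_int: (p_itg k) => /measurable_EFinP.
have Mi : itg M.
  apply: (le_integrable measurableT _ _ mi); first exact/measurable_EFinP.
  by move=> x _; rewrite /= lee_fin !ger0_norm.
(* For a rational [q] just after [s], [D (c s) (c t)] is up to [e] the increment of the distance to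
   [c q] between [s] and [t], which is the integral of a density at most [M]. *)
have D_le s t : s <= t -> D (c s) (c t) <= prim M t - prim M s.
  move=> st; apply/ler_addgt0Pr => e e0; have e2 : 0 < e / 2 by lra.
  have [a a0 ha] := prim_small mi m0 e2.
  have [q] : exists q : rat, ratr q \in `]s, s + a[ by apply: rat_in_itvoo; rewrite ltrDl.
  rewrite in_itv /= => /andP[sq qs].
  have rq : r (pickle q) = ratr q by rewrite /r pickleK.
  have h1 : D (c s) (c (ratr q)) <= e / 2.
    by apply: le_trans (hm _ _ (ltW sq)) (ltW (ha _ _ (ltW sq) _)); rewrite ltrBlDl.
  have h2 := D_tri (Vc s) (Vc (ratr q)) (Vc t).
  have h3 := pE (pickle q) s t; rewrite rq (D_sym (c t)) in h3.
  have h4 : prim (p (pickle q)) t - prim (p (pickle q)) s <= prim M t - prim M s.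
    by apply: prim_le => // x; apply: le_trans (ler_norm _) (p_le_M _ _).
  by move: h1 h2 h3 h4; lra.
have D_abs s t : D (c s) (c t) <= `|prim M s - prim M t|.
  have [st|/ltW ts] := leP s t.
    by apply: le_trans (D_le _ _ st) _; rewrite distrC; exact: ler_norm.
  by rewrite D_sym; apply: le_trans (D_le _ _ ts) _; exact: ler_norm.
exists M; split=> //.
have pd : {ae mu, forall x, forall k, forall e : R, 0 < e -> exists2 a : R, 0 < a &
    forall h : R, h != 0 -> `|h| < a -> `|(prim (p k) (x + h) - prim (p k) x) / h - p k x| <= e}.
  by apply: ae_foralln => k; exact: prim_deriv (p_itg k).
have aeF := ae_filter_ringOfSetsType mu.
apply: filterS2 pd (prim_deriv Mi) => x pd Md e e0; have e2 : 0 < e / 2 by lra.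
(* The density of one rational centre, nearly attaining [M x], bounds the difference quotient from
   below; the primitive of [M] bounds it from above. *)
have [_ [k _ <-] hk] := sup_adherent e2 (conj (ex_intro _ `|p 0%N x| (ex_intro2 _ _ 0%N I erefl)) (ub x)).
rewrite -supE in hk.
have [a a0 ha] := pd k _ e2; have [b b0 hb] := Md _ e0.
exists (Num.min a b); first by rewrite lt_min a0.
move=> h h0; rewrite lt_min => /andP[ka kb]; have := ha h h0 ka; have := hb h h0 kb.
have nh : 0 < `|h| by rewrite normr_gt0.
have u1 : D (c (x + h)) (c x) / `|h| <= `|(prim M (x + h) - prim M x) / h|.
  by rewrite normrM normrV ?unitfE // ler_pM2r ?invr_gt0 //; exact: D_abs.
have u2 : `|(prim (p k) (x + h) - prim (p k) x) / h| <= D (c (x + h)) (c x) / `|h|.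
  by rewrite normrM normrV ?unitfE // ler_pM2r ?invr_gt0 // -pE (D_sym (c (x + h)) (c x)); exact: fle.
move: u1 u2; move: (_ / h) (_ / h) (_ / `|h|) => u v w u1 u2 hu hv.
have h1 := ler_distD (M x) v 0; have h2 := ler_distD u (p k x) 0.
rewrite !subr0 (ger0_norm (M0 x)) in h1; rewrite !subr0 distrC in h2.
by rewrite ler_norml; move: hk; lra.
Qed.

End metric_derivative.

(** * The intrinsic distance is the chain length *)

Lemma le_integral_offnullD (dT : measure_display) (T : measurableType dT) (R : realType)
    (mu : {measure set T -> \bar R}) (N A : set T) (f g : T -> \bar R) :
  measurable N -> mu N = 0%E -> (forall x, 0 <= f x)%E -> (forall x, 0 <= g x)%E ->
  (forall x, A x -> ~ N x -> (f x <= g x)%E) -> (\int[mu]_(x in A) f x <= \int[mu]_(x in A) g x)%E.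
Proof.
move=> mN N0 f0 g0 fg; rewrite integral_mkcond [leRHS]integral_mkcond.
have pos (k : T -> \bar R) x : (forall x, 0 <= k x)%E -> (0 <= (k \_ A) x)%E.
  by move=> k0; rewrite patchE; case: ifP.
apply: (le_integral_offnull mN N0) => [x|x|x Nx]; [exact: pos|exact: pos|].
by rewrite !patchE; case: ifPn => // /set_mem Ax; exact: fg.
Qed.

(* When [f] diverges, its [lim] is the default value [0]. *)
Lemma lim_bounded (R : realType) (f : R -> R) (L : R) : 0 <= L ->
  (\forall h \near 0^', 0 <= f h <= L) -> 0 <= lim (f h @[h --> 0^']) <= L.
Proof.
move=> L0 hf; have [cf|df] := pselect (cvg (f h @[h --> 0^'])); last by rewrite dvgP //= lexx.
apply/andP; split; first by apply: limr_ge => //; apply: filterS hf => h /andP[].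
by apply: limr_le => //; apply: filterS hf => h /andP[].
Qed.

Section unit_interval.
Context (R : realType).
Local Notation mu := (@lebesgue_measure R).
Local Notation itg f := (mu.-integrable [set: R] (EFin \o f)).
Local Notation I01 := (`[0%R, 1%R]%classic : set R).

Lemma int_cst (s t L : R) : s <= t -> (\int[mu]_(x in `[s, t]) L%:E = (L * (t - s))%:E)%E.
Proof.
move=> st; apply: etrans (integral_cst mu (measurable_itv _) L%:E) _.
suff h : mu `[s, t] = (t - s)%:E by rewrite EFinM; congr (_ * _)%E.
rewrite lebesgue_measure_itv /= lte_fin; case: ltP => [//|ts].
by have -> : t = s by [apply/le_anti; rewrite ts st]; rewrite subrr.
Qed.

Lemma mu_ends : mu ([set 0] `|` [set 1] : set R) = 0%E.
Proof.
have h (a : R) : mu [set a] = 0%E by rewrite lebesgue_measure_set1.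
apply/eqP; rewrite eq_le measure_ge0 andbT.
apply: le_trans (measureU2 mu (measurable_set1 0) (measurable_set1 1)) _.
by rewrite [X in (X + _)%E](h 0) [X in (_ + X)%E](h 1) adde0.
Qed.

Lemma ends_open (t : R) : I01 t -> ~ ([set 0] `|` [set 1]) t -> 0 < t < 1.
Proof.
rewrite /= in_itv /= => /andP[t0 t1] nt; rewrite !lt_neqAle t0 t1 !andbT.
by apply/andP; split; apply/eqP => e; apply: nt; [left|right].
Qed.

Lemma sq_integrable (m : R -> R) : measurable_fun I01 m ->
  (\int[mu]_(t in I01) ((m t) ^+ 2)%:E < +oo)%E -> mu.-integrable I01 (EFin \o m).
Proof.
move=> mm m2; have mI : @measurable _ (measurableTypeR R) I01 by exact: measurable_itv.
have i1 : mu.-integrable I01 (EFin \o cst 1).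
  apply/integrableP; split; first exact/measurable_EFinP/measurable_cst.
  rewrite (eq_integral (fun=> 1%:E)) => [|y _]; last by rewrite /= normr1.
  by have := int_cst 1 (@ler01 R) => /= ->; exact: ltry.
have i2 : mu.-integrable I01 (EFin \o (fun t => m t ^+ 2)).
  apply/integrableP; split; first by apply/measurable_EFinP; exact: measurable_funX.
  by move: m2; congr (_ < _)%E; apply: eq_integral => y _; rewrite /= ger0_norm // sqr_ge0.
apply: (le_integrable mI _ _ (integrableD mI i1 i2)); first exact/measurable_EFinP.
move=> y _; rewrite /= lee_fin [leRHS]ger0_norm ?addr_ge0 ?sqr_ge0 //.
have h1 := sqr_ge0 (`|m y| - 1); have h2 := normr_ge0 (m y).
by rewrite sqrrB1 -normrX ger0_norm ?sqr_ge0 // in h1; move: h1 h2; rewrite mulr2n; lra.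
Qed.

(** Cauchy--Schwarz on the unit interval, through Young's inequality with weight [x + e], which
    stays positive when [x = 0]. *)
Lemma prim_le_sqrt (M : R -> R) (x : R) : itg M -> (forall t, 0 <= M t) -> 0 <= x ->
  (\int[mu]_(t in I01) (M t ^+ 2)%:E <= (x ^+ 2)%:E)%E -> prim M 1 - prim M 0 <= x.
Proof.
move=> Mi M0 x0 hM; have mI : @measurable _ (measurableTypeR R) I01 by exact: measurable_itv.
rewrite primE ?ler01 // Rintegral_itv_obnd_cbnd; last exact: itg_sub.
have mM : measurable_fun [set: R] M by move/measurable_int: Mi => /measurable_EFinP.
apply/ler_addgt0Pr => e e0; have l0 : 0 < x + e by rewrite ltr_wpDl.
rewrite -lee_fin fineK; last by apply: integrable_fin_num => //; exact: itg_sub.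
have a0 : 0 <= (2 * (x + e))^-1 by rewrite invr_ge0 mulr_ge0 // ltW.
have b0 : 0 <= (x + e) / 2 by rewrite divr_ge0 // ltW.
apply: (@le_trans _ _ (\int[mu]_(t in I01) ((2 * (x + e))^-1%:E * (M t ^+ 2)%:E + ((x + e) / 2)%:E))%E).
  apply: ge0_le_integral => //.
  - by move=> t _; rewrite lee_fin.
  - by apply/measurable_EFinP; exact: measurable_funTS.
  - by apply/measurable_EFinP; apply: measurable_funTS; apply: measurable_funD => //;
      apply: measurable_funM => //; exact: measurable_funX.
  move=> t _; rewrite -EFinM -EFinD lee_fin -subr_ge0.
  have -> : (2 * (x + e))^-1 * M t ^+ 2 + (x + e) / 2 - M t = (2 * (x + e))^-1 * (M t - (x + e)) ^+ 2.
    by field; rewrite gt_eqF.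
  by rewrite mulr_ge0 // sqr_ge0.
have mM2 : measurable_fun I01 (fun t => (M t ^+ 2)%:E).
  by apply/measurable_EFinP; apply: measurable_funTS; exact: measurable_funX.
rewrite ge0_integralD //; last 2 first.
- by move=> t _; rewrite -EFinM lee_fin mulr_ge0 // sqr_ge0.
- exact: measurable_funeM.
rewrite ge0_integralZl_EFin //; last by move=> t _; rewrite lee_fin sqr_ge0.
rewrite (int_cst _ ler01); apply: le_trans (leeD (lee_wpmul2l _ hM) (lexx _)) _; first by rewrite lee_fin.
rewrite -EFinM -EFinD lee_fin subr0 mulr1.
have h : (2 * (x + e))^-1 * x ^+ 2 <= (2 * (x + e))^-1 * (x + e) ^+ 2.
  apply: ler_wpM2l => //; apply: lerXn2r; rewrite ?nnegrE //; first exact: ltW.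
  by rewrite lerDl ltW.
apply: le_trans (lerD h (lexx _)) _; apply: eq_ler; field; rewrite gt_eqF //.
Qed.

End unit_interval.

Section intrinsic.
Context (R : realType) (n d : nat) (vol : probability (MT R n) R).
Hypothesis n_gt0 : (0 < n)%N.
Hypothesis d_gt0 : (0 < d)%N.
Hypothesis vol2 : vol [set L : MT R n | ~ rank2proj L] = 0%E.
Hypothesis volU : forall U : Mat R n, unitary U ->
  forall A : set (MT R n), measurable A -> vol ((fun L : MT R n => U *m L *m adj U) @^-1` A) = vol A.
Local Notation DD := (DD d vol).
Local Notation V := (@inPnd R n d).
Local Notation mu := (@lebesgue_measure R).
Local Notation itg f := (mu.-integrable [set: R] (EFin \o f)).
Local Notation ell := (ell V DD).
Implicit Types (p q r : HPoly R n) (g : R -> HPoly R n).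

Lemma chain_all p q : V p -> V q -> exists L : R, forall e : R, 0 < e -> chn V DD e p q L.
Proof.
move=> pV qV; have [[c [c0 qE]]|h] := pselect (proj_eq p q).
  exists 0 => e e0; have D0 := DD_scale d_gt0 vol2 volU c0 qE pV.
  by apply: chn_one => //; rewrite D0 // ltW.
by apply: (chain_exists d_gt0 vol2 volU pV qV) => c c0 qE; apply: h; exists c.
Qed.

Let D0 := @DD_ge0 R n d vol.
Let Ds := @DD_sym R n d vol.
Let Dr := DD_refl d_gt0 vol2 volU.
Let Dt := DD_triangle d_gt0 vol2 volU.
Let Dc := DD_compact d_gt0 vol2 volU.

Lemma W2_DD p q : W2 (muP d vol p) (muP d vol q) = DD p q.
Proof. by rewrite DD.unlock. Qed.

(** At interior times the speed lies between 0 and [L], also where its defining limit fails to exist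
    ([lim_bounded]); the two endpoints form a null set. *)
Lemma lip_admissible g (L : R) : (forall t, V (g t)) -> 0 <= L ->
  (forall s t, 0 <= s -> s <= t -> DD (g s) (g t) <= L * (t - s)) ->
  admissible d vol g /\ (curve_energy d vol g <= (L ^+ 2)%:E)%E.
Proof.
move=> gV L0 hg.
split.
  split=> [t _ //|]; exists (cst L); split; first exact: measurable_cst.
  split; first by rewrite (int_cst (L ^+ 2) ler01) ltry.
  by move=> s t s0 st t1; rewrite W2_DD (int_cst L st) lee_fin hg.
rewrite /curve_energy /energy.
apply: le_trans (_ : \int[mu]_(t in `[0%R, 1%R]) (L ^+ 2)%:E <= _)%E; last first.
  by rewrite (int_cst (L ^+ 2) ler01) subr0 mulr1.
have m01 : @measurable _ (measurableTypeR R) ([set 0] `|` [set 1]) by apply: measurableU; exact: measurable_set1.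
apply: (le_integral_offnullD m01 (mu_ends R)) => [x|x|t It nt].
- by rewrite lee_fin sqr_ge0.
- by rewrite lee_fin sqr_ge0.
have /andP[t0 t1] := ends_open It nt.
suff /andP[s0 s1] : 0 <= speed (fun t => muP d vol (g t)) t <= L by rewrite lee_fin; apply: lerXn2r.
apply: lim_bounded => //.
have t2 : 0 < Num.min t (1 - t) by rewrite lt_min t0 subr_gt0.
apply: filterS2 (nbhs_dnbhs_neq (0 : R)) (@dnbhs0_lt _ R _ t2) => h h0; rewrite lt_min => /andP[h1 h2].
have hp : 0 < `|h| by rewrite normr_gt0.
rewrite W2_DD divr_ge0 //= ler_pdivrMr //.
move: h1 h2; rewrite !ltr_norml => /andP[h1 h2] /andP[h3 h4].
have [hh|hh] := leP 0 h.
  rewrite (ger0_norm hh) (Ds (g (t + h))); have e : t + h - t = h by ring.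
  by have := hg t (t + h) (ltW t0); rewrite e lerDl; apply.
rewrite (ltr0_norm hh); have e : t - (t + h) = - h by ring.
by have := hg (t + h) t; rewrite e; apply; lra.
Qed.

(** [metric_deriv] gives a density [M] that equals the speed almost everywhere, so its square
    integrates to at most [x ^+ 2] and [M] itself to at most [x]. A fine subdivision of the unit
    interval is then a chain of short steps. *)
Lemma chn_of_energy g (x e : R) : admissible d vol g -> 0 <= x -> (curve_energy d vol g <= (x ^+ 2)%:E)%E ->
  0 < e -> chn V DD e (g 0) (g 1) (x + e).
Proof.
move=> [gV [m [mm [m2 hm]]]] x0 gx e0.
pose I01 : set R := `[0, 1]%classic.
have mI : @measurable _ (measurableTypeR R) I01 by exact: measurable_itv.
pose m' := (fun x => `|m x|) \_ I01.
have m'0 t : 0 <= m' t by rewrite /m' patchE; case: ifP.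
have ml := sq_integrable mm m2.
have m'i : itg m'.
  have := (@integrable_mkcond _ _ _ mu I01 (EFin \o (fun x => `|m x|)) mI).1 (integrable_norm ml).
  by apply: eq_integrable => // y _; rewrite /m' /= !patchE; case: ifP.
(* The curve is frozen outside the unit interval, since [metric_deriv] concerns curves on the whole
   line. *)
pose cl (t : R) := Num.max 0 (Num.min t 1).
have cl01 t : 0 <= cl t <= 1.
  by rewrite /cl le_max lexx /= ge_max ler01 ge_min lexx orbT.
have clE t : 0 <= t <= 1 -> cl t = t.
  by move=> /andP[t0 t1]; rewrite /cl min_l // max_r.
pose c t := g (cl t).
have cV t : V (c t) by exact: gV.
have hc01 s t : 0 <= s -> s <= t -> t <= 1 -> DD (g s) (g t) <= prim m' t - prim m' s.
  move=> s0 st t1; rewrite primE // -lee_fin.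
  have si : mu.-integrable `[s, t] (EFin \o m').
    by exact: itg_sub.
  rewrite Rintegral_itv_obnd_cbnd; last exact: itg_sub.
  rewrite fineK; last exact: integrable_fin_num.
  rewrite -W2_DD; apply: le_trans (hm s t s0 st t1) _.
  apply: le_integral => //.
    by apply: integrableS ml => // y /=; rewrite !in_itv /= => /andP[h1 h2]; rewrite (le_trans s0 h1) (le_trans h2 t1).
  move=> y; rewrite inE /= in_itv /= => /andP[h1 h2]; rewrite lee_fin /m' patchE ifT ?ler_norm //.
  by rewrite inE /I01 /= in_itv /= (le_trans s0 h1) (le_trans h2 t1).
have hc s t : s <= t -> DD (c s) (c t) <= prim m' t - prim m' s.
  move=> st; have pm : prim m' s <= prim m' t by exact: prim_mono.
  have [s1|s1] := leP 1 s.
    have -> : c s = c t by rewrite /c /cl !min_r // (le_trans s1 st).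
    by rewrite Dr // subr_ge0.
  have [t0|t0] := leP t 0.
    have st0 := le_trans st t0.
    have -> : c s = c t by rewrite /c /cl !(@max_l _ _ 0) // ge_min ?t0 ?st0.
    by rewrite Dr // subr_ge0.
  have ss : s <= cl s by rewrite /cl le_max le_min lexx (ltW s1) orbT.
  have tt : cl t <= t by rewrite /cl ge_max (ltW t0) ge_min lexx.
  have cst : cl s <= cl t.
    rewrite /cl ge_max le_max lexx /= le_max; apply/orP; right.
    by rewrite le_min ge_min st /= ge_min lexx orbT.
  have /andP[h1 _] := cl01 s; have /andP[_ h2] := cl01 t.
  have := hc01 _ _ h1 cst h2; have := prim_mono m'i m'0 ss; have := prim_mono m'i m'0 tt.
  by rewrite -/(c s) -/(c t); lra.
have [M [Mi M0 MD Mae]] := metric_deriv Ds Dt cV m'i m'0 hc.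
have [N [mN N0 hN]] := Mae.
have m01 : @measurable _ (measurableTypeR R) ([set 0] `|` [set 1]) by apply: measurableU; exact: measurable_set1.
have mN1 : measurable (N `|` ([set 0] `|` [set 1])) by exact: measurableU.
have N01 : mu (N `|` ([set 0] `|` [set 1])) = 0%E.
  apply/eqP; rewrite eq_le measure_ge0 andbT; apply: le_trans (measureU2 mu mN m01) _.
  by rewrite [X in (X + _)%E]N0 [X in (_ + X)%E](mu_ends R) adde0.
have en : (\int[mu]_(t in I01) (M t ^+ 2)%:E <= (x ^+ 2)%:E)%E.
  apply: le_trans gx; apply: (le_integral_offnullD mN1 N01) => [y|y|t It nt].
  - by rewrite lee_fin sqr_ge0.
  - by rewrite lee_fin sqr_ge0.
  have /andP[t0 t1] := ends_open It (fun h => nt (or_intror h)).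
  suff -> : speed (fun t => muP d vol (g t)) t = M t by [].
  have Nt : ~ ~ (forall e, 0 < e -> exists2 a : R, 0 < a &
      forall h : R, h != 0 -> `|h| < a -> `|DD (c (t + h)) (c t) / `|h| - M t| <= e).
    by move=> h; apply: nt; left; exact: hN.
  apply/cvg_lim => //; apply/cvgrPdist_le => e' e'0.
  have [a a0 ha] := (contrapT Nt) e' e'0.
  have t2 : 0 < Num.min a (Num.min t (1 - t)) by rewrite !lt_min a0 t0 subr_gt0.
  apply: filterS2 (nbhs_dnbhs_neq (0 : R)) (@dnbhs0_lt _ R _ t2) => h h0; rewrite !lt_min => /and3P[h1 h2 h3].
  have := ha h h0 h1; rewrite distrC W2_DD /c !clE ?t0 //.
  by move: h2 h3; rewrite !ltr_norml; lra.
have Mx := prim_le_sqrt Mi M0 x0 en.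
have [a a0 ha] := prim_small Mi M0 e0.
have c0 : c 0 = g 0 by rewrite /c clE // lexx ler01.
have c1 : c 1 = g 1 by rewrite /c clE // lexx ler01.
pose K := (Num.truncn a^-1).+1; have K0 : 0 < K%:R :> R by [].
have Ka : K%:R^-1 < a by rewrite invf_plt ?posrE // truncnS_gt.
pose y k : R := k%:R / K%:R.
have yS k : y k.+1 - y k = K%:R^-1 by rewrite /y -[k.+1]addn1 natrD; field; rewrite gt_eqF.
have yle k : y k <= y k.+1 by rewrite -subr_ge0 yS invr_ge0.
have h := @chn_iter R _ V DD e (c \o y) (fun k => prim M (y k.+1) - prim M (y k)) K.
have y0 : y 0%N = 0 by rewrite /y mul0r.
have y1 : y K = 1 by rewrite /y divff // gt_eqF.
rewrite -(big_mkord predT (fun k => prim M (y k.+1) - prim M (y k))) (telescope_sumr (fun k => prim M (y k))) //= in h.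
rewrite y0 y1 c0 c1 in h.
apply: chn_le (lexx e) _ (h _); first by rewrite (le_trans Mx) // lerDl ltW.
move=> k _; split=> //; last exact: MD.
by apply: le_trans (MD _ _ (yle k)) (ltW (ha _ _ (yle k) _)); rewrite yS.
Qed.

Lemma proj_eq_V p q : V p -> proj_eq p q -> DD p q = 0.
Proof. by move=> pV [c [c0 qE]]; exact: (DD_scale d_gt0 vol2 volU c0 qE pV). Qed.

(** Upper bound: the curve of [ell_geodesic] has Lipschitz constant [ell p q]. Lower bound:
    [chn_of_energy] with the square root of the energy as [x]. A competing curve meets [p] and [q]
    only up to proportionality, which costs no length. *)
Lemma W2in_sqE p q : V p -> V q -> W2in_sq d vol p q = (ell p q ^+ 2)%:E.
Proof.
move=> pV qV; have l0 := ell_ge0 chain_all pV qV.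
apply/eqP; rewrite eq_le; apply/andP; split.
  have [g [gV g0 g1 hg _]] := ell_geodesic D0 Ds Dr Dt Dc chain_all pV qV.
  have [ga ge] := lip_admissible gV l0 hg.
  apply: ge_ereal_inf; exists (curve_energy d vol g) => //.
  by exists g; split=> //; split; [exact: (DD_inj n_gt0 d_gt0 vol2 volU)|split=> //; exact: (DD_inj n_gt0 d_gt0 vol2 volU)].
apply: le_ereal_inf_tmp => _ [g [ga [pg [qg ->]]]].
have gV t : 0 <= t <= 1 -> V (g t) by case: ga => + _; apply.
have g0V : V (g 0) by apply: gV; rewrite lexx ler01.
have g1V : V (g 1) by apply: gV; rewrite lexx ler01.
have E0 : (0 <= curve_energy d vol g)%E by apply: integral_ge0 => t _; rewrite lee_fin sqr_ge0.
have [Efin|] := ltP (curve_energy d vol g) +oo%E; last by move=> h; apply: le_trans h; rewrite leey.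
have Ef : curve_energy d vol g \is a fin_num by rewrite ge0_fin_numE.
have E1 : 0 <= fine (curve_energy d vol g) by exact: fine_ge0.
have E2 : (curve_energy d vol g <= (Num.sqrt (fine (curve_energy d vol g)) ^+ 2)%:E)%E.
  by rewrite sqr_sqrtr // fineK.
have h := ell_le (sqrtr_ge0 _) (fun e => chn_of_energy ga (sqrtr_ge0 _) E2).
have p0 := ell_eq0 chain_all pV g0V (proj_eq_V pV pg); have q0 := ell_eq0 chain_all qV g1V (proj_eq_V qV qg).
have t1 := ell_tri chain_all pV g0V qV; have t2 := ell_tri chain_all g0V g1V qV.
rewrite (ell_sym Ds chain_all g1V qV) q0 addr0 in t2; rewrite p0 add0r in t1.
rewrite -(fineK Ef) lee_fin -(sqr_sqrtr E1); apply: lerXn2r; rewrite ?nnegrE ?sqrtr_ge0 //.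
exact: le_trans t1 (le_trans t2 h).
Qed.

Lemma W2inE p q : V p -> V q -> W2in d vol p q = ell p q.
Proof.
move=> pV qV; rewrite /W2in W2in_sqE //= sqrtr_sqr ger0_norm //.
exact: (ell_ge0 chain_all pV qV).
Qed.

End intrinsic.


Unset Implicit Arguments.

Theorem mainTheorem13 (R : realType) (n d : nat) (vol : probability (MT R n) R) :
  (0 < n)%N -> (0 < d)%N ->
  (* vol is the U(n+1)-invariant probability measure on G(1,n),
     modelled on the rank-two orthogonal projectors *)
  vol [set L : MT R n | ~ rank2proj L] = 0%E ->
  (forall U : Mat R n, unitary U ->
     forall A : set (MT R n), measurable A ->
       vol ((fun L : MT R n => U *m L *m adj U) @^-1` A) = vol A) ->
  (* W2^in is a (finite) distance on P_{n,d} *)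
  (forall p q : HPoly R n, inPnd d p -> inPnd d q ->
         (W2in_sq d vol p q < +oo)%E) /\
  [/\ (forall p q : HPoly R n, inPnd d p -> inPnd d q ->
         (W2in d vol p q = 0 <-> proj_eq p q)),
      (forall p q : HPoly R n, inPnd d p -> inPnd d q ->
         W2in d vol p q = W2in d vol q p),
      (forall p q r : HPoly R n, inPnd d p -> inPnd d q -> inPnd d r ->
         W2in d vol p r <= W2in d vol p q + W2in d vol q r),
      (* completeness *)
      (forall x : nat -> HPoly R n, (forall k, inPnd d (x k)) ->
         (forall e : R, 0 < e -> exists N : nat, forall k l : nat,
             (N <= k)%N -> (N <= l)%N -> W2in d vol (x k) (x l) < e) ->
         exists p : HPoly R n, inPnd d p /\
           (fun k => W2in d vol (x k) p) @ \oo --> (0 : R))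
    & (* geodesic *)
      (forall p0 p1 : HPoly R n, inPnd d p0 -> inPnd d p1 ->
         exists g : R -> HPoly R n,
           [/\ admissible d vol g, proj_eq p0 (g 0), proj_eq p1 (g 1) &
               forall s t : R, 0 <= s <= 1 -> 0 <= t <= 1 ->
                 W2in d vol (g s) (g t) = `|t - s| * W2in d vol p0 p1])].
Proof.
move=> n0 d0 vol2 volU.
pose D0 := @DD_ge0 R n d vol; pose Ds := @DD_sym R n d vol; pose Dr := DD_refl d0 vol2 volU.
pose Dt := DD_triangle d0 vol2 volU; pose Dc := DD_compact d0 vol2 volU; pose ch := chain_all d0 vol2 volU.
have W p q : inPnd d p -> inPnd d q -> W2in d vol p q = ell (@inPnd R n d) (DD d vol) p q.
  exact: (W2inE n0 d0 vol2 volU).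
split; first by move=> p q pV qV; rewrite (W2in_sqE n0 d0 vol2 volU pV qV) ltry.
split.
- move=> p q pV qV; rewrite W //; split=> [h|pq].
    apply: (DD_inj n0 d0 vol2 volU) => //; apply/eqP; rewrite eq_le D0 andbT -h.
    exact: (D_le_ell Dr Dt ch).
  exact: (ell_eq0 ch pV qV (proj_eq_V d0 vol2 volU pV pq)).
- by move=> p q pV qV; rewrite !W //; exact: (ell_sym Ds ch).
- by move=> p q r pV qV rV; rewrite !W //; exact: (ell_tri ch).
- move=> x xV xC.
  have [e e0|p pV hp] := ell_complete Dc ch xV.
    by have [N hN] := xC e e0; exists N => k l kN lN; rewrite -W //; exact: hN.
  exists p; split=> //; apply/cvgrPdist_le => e e0; have [N hN] := hp e e0.
  exists N => // k /= kN; rewrite W // sub0r normrN ger0_norm; last exact: (ell_ge0 ch).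
  exact: hN.
move=> p q pV qV; have [g [gV g0 g1 hg hl]] := ell_geodesic D0 Ds Dr Dt Dc ch pV qV.
have [ga _] := lip_admissible gV (ell_ge0 ch pV qV) hg.
(* The limit curve reaches its ends only in the sense of [DD]; [DD_inj] makes this
   proportionality. *)
exists g; split=> //; [exact: (DD_inj n0 d0 vol2 volU)|exact: (DD_inj n0 d0 vol2 volU)|].
move=> s t /andP[s0 s1] /andP[t0 t1]; rewrite !W // mulrC.
have [st|/ltW ts] := leP s t; first by rewrite ger0_norm ?subr_ge0 // hl.
by rewrite (ell_sym Ds ch) // distrC ger0_norm ?subr_ge0 // hl.
Qed.
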